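(* Let $s\in[0,\infty)$ and let $\omega=\{\omega(k)\}_{k\in\mathbb{N}}$ be a positive sequence such that $k^{s}\ll\omega(k)\ll k^{1+s}$, i.e. there are constants $c_1,c_2>0$ with $c_1k^{s}\le\omega(k)\le c_2k^{1+s}$ for all $k\in\mathbb{N}$. Let $\gamma$ be the map $q\mapsto\{\gamma_q(n)\}_{n\in\mathbb{N}}$ defined on $L^2(\mathbb{T},\mathbb{R})$. Then (i) $\gamma\big(H^{\omega}(\mathbb{T},\mathbb{R})\big)=h^{\omega}_{+}(\mathbb{N})$, and (ii) $\gamma^{-1}\big(h^{\omega}_{+}(\mathbb{N})\big)=H^{\omega}(\mathbb{T},\mathbb{R})$, where $\gamma^{-1}$ denotes the preimage in $L^2(\mathbb{T},\mathbb{R})$.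
   Context: $\mathbb{T}=\mathbb{R}/\mathbb{Z}$. $L^2(\mathbb{T},\mathbb{R})$ is the space of real-valued 1-periodic functions $q(x)=\sum_{k\in\mathbb{Z}}\widehat q(k)e^{ik2\pi x}$ with $\sum_k|\widehat q(k)|^2<\infty$ and $\widehat q(k)=\overline{\widehat q(-k)}$. For such $q$, the Hill–Schrödinger operator $S(q)u=-u''+q(x)u$ on $L^2(\mathbb{R})$ is self-adjoint with band spectrum whose gap endpoints satisfy $-\infty<\lambda_0(q)<\lambda_1^-(q)\le\lambda_1^+(q)<\lambda_2^-(q)\le\lambda_2^+(q)<\cdots$; for even/odd $n$, $\lambda_0(q),\lambda_n^{\pm}(q)$ are the eigenvalues of $-u''+qu=\lambda u$ on $[0,1]$ with periodic/antiperiodic boundary conditions $u^{(j)}(0)=\pm u^{(j)}(1)$, $j=0,1$. The lengths of the spectral gaps are $\gamma_q(n)=\lambda_n^+(q)-\lambda_n^-(q)$, $n\in\mathbb{N}$. For a positive sequence $\omega$: $H^{\omega}(\mathbb{T},\mathbb{R})=\{f\in L^2(\mathbb{T},\mathbb{R}):\sum_{k\in\mathbb{N}}\omega^2(k)|\widehat f(k)|^2<\infty\}$; $h^{\omega}(\mathbb{N})=\{a=\{a(k)\}_{k\in\mathbb{N}}:\sum_{k\in\mathbb{N}}\omega^2(k)|a(k)|^2<\infty\}$; $h^{\omega}_{+}(\mathbb{N})=\{a\in h^{\omega}(\mathbb{N}): a(k)\ge0\ \forall k\}$. *)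

(* Defs.v *)
From HB Require Import structures.
From mathcomp Require Import all_boot all_order all_algebra.
From mathcomp Require Import all_classical all_reals all_analysis.
Set Implicit Arguments. Unset Strict Implicit. Unset Printing Implicit Defensive.
Import Order.TTheory GRing.Theory Num.Theory.
Import numFieldNormedType.Exports.
Local Open Scope classical_set_scope.
Local Open Scope ring_scope.

Section Hill.
Variable R : realType.
Notation mu := (@lebesgue_measure R).

Definition L2T (q : R -> R) : Prop :=
  measurable_fun setT q /\ (forall x, q (x + 1) = q x) /\
  (\int[mu]_(x in `[0%R, 1%R]) ((q x) ^+ 2)%:E < +oo)%E.

Definition fourier_sq (q : R -> R) (k : nat) : R :=
  (Rintegral mu `[0%R, 1%R] (fun x => q x * cos (2 * pi * k%:R * x))) ^+ 2 +
  (Rintegral mu `[0%R, 1%R] (fun x => q x * sin (2 * pi * k%:R * x))) ^+ 2.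

(* Sequences indexed by N = {1,2,...} are represented as nat -> R,
   index k standing for k+1. *)

Definition Hw (w : nat -> R) (q : R -> R) : Prop :=
  L2T q /\
  (\sum_(0 <= k <oo) ((w k) ^+ 2 * fourier_sq q k.+1)%:E < +oo)%E.

Definition hw (w : nat -> R) (a : nat -> R) : Prop :=
  (\sum_(0 <= k <oo) ((w k) ^+ 2 * (a k) ^+ 2)%:E < +oo)%E.

Definition hw_plus (w : nat -> R) : set (nat -> R) :=
  [set a | hw w a /\ forall k, 0 <= a k].

(* (u, v = u') is a (Caratheodory) solution of -u'' + q u = lam u on [0,1],
   written in integral form. *)
Definition hill_solution (q : R -> R) (lam : R) (u v : R -> R) : Prop :=
  {within `[0%R, 1%R], continuous u} /\ {within `[0%R, 1%R], continuous v} /\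
  forall x, x \in `[0%R, 1%R] ->
    u x = u 0 + Rintegral mu `[0%R, x] v /\
    v x = v 0 + Rintegral mu `[0%R, x] (fun t => (q t - lam) * u t).

(* u is in the eigenspace (possibly zero) for lam, with boundary condition
   u^{(j)}(1) = sgn * u^{(j)}(0), sgn = 1 periodic, sgn = -1 antiperiodic *)
Definition in_eigenspace (q : R -> R) (sgn lam : R) (u : R -> R) : Prop :=
  exists v, hill_solution q lam u v /\ u 1 = sgn * u 0 /\ v 1 = sgn * v 0.

Definition lin_indep (m : nat) (us : 'I_m -> R -> R) : Prop :=
  forall c : 'I_m -> R,
    (forall x, x \in `[0%R, 1%R] -> \sum_(i < m) c i * us i x = 0) ->
    forall i, c i = 0.

(* e lists the eigenvalues of the boundary value problem in nondecreasing
   order, each repeated according to its multiplicity (dimension of its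
   eigenspace). *)
Definition eigen_enum (q : R -> R) (sgn : R) (e : nat -> R) : Prop :=
  (forall i j : nat, (i <= j)%N -> e i <= e j) /\
  forall (lam : R) (m : nat),
    (exists us : 'I_m -> R -> R,
        (forall i, in_eigenspace q sgn lam (us i)) /\ lin_indep us) <->
    (exists ks : 'I_m -> nat, injective ks /\ forall i, e (ks i) = lam).

Definition per_eig (q : R -> R) : nat -> R := xget (fun _ => 0) (eigen_enum q 1).
Definition anti_eig (q : R -> R) : nat -> R := xget (fun _ => 0) (eigen_enum q (-1)).

(* gamma q k = gamma_q(n) with n = k+1 = lambda_n^+ - lambda_n^-:
   for n even, lambda_n^- , lambda_n^+ are the periodic eigenvalues with
   indices n-1, n (lambda_0 has index 0); for n odd they are the
   antiperiodic eigenvalues with indices n-1, n. *)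
Definition gap (q : R -> R) (k : nat) : R :=
  let e := if odd k.+1 then anti_eig q else per_eig q in e k.+1 - e k.

End Hill.

(* Main.v *)
(** The operator is treated as an infinite matrix: in a trigonometric basis adapted to the boundary
conditions it is D + b, with D diagonal of quadratic growth and b a symmetric matrix whose rows have
l^2 norm at most K = 2 |q|_2. The eigenvalues are obtained by successive minimisation of the
quadratic form and compared by min-max and Ky Fan trace inequalities.

Gap lengths versus Fourier coefficients. Let J be the conjugation that exchanges the cosine and the
sine of each frequency (up to sign). The matrix elements between J u and w of the eigenvalue equations
for the two eigenvectors u, w of the n-th gap express the gap length through twice the n-th Fourier
coefficient, up to sums over the components of u and w away from the frequency n. Estimating these
components with weights gives: if q is in H^t then the sequence gamma_q(n) - 2 |qhat(n)| lies in
h^(1+t). This yields gamma(H^w) in h^w_+ at once, and the converse by bootstrapping from t to t + 1.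

Surjectivity. For even q the periodic and antiperiodic problems split into Dirichlet and Neumann type
problems on the half period; let sigma_n be the signed difference of the two eigenvalues near
pi^2 n^2. Then gamma_n <= |sigma_n|, with equality when all sigma_n are nonnegative, so it suffices to
solve sigma = a for a nonnegative l^2 sequence a. For trigonometric polynomials this is a finite system,
solved by the Poincare-Miranda theorem; the required a priori bound is that sigma(q) = (|q|/B) a has no
solution with 0 < |q| <= B when B is large. Indeed the Dirichlet eigenvalues of every translate of q lie
in the gaps, and their trace gives, up to small errors, the oscillation of the low modes of q in terms of
the sum of the first gap lengths, while the high modes are controlled by perturbation theory. The
solutions for increasing degrees converge weakly along an ultrafilter, and the eigenvalues are weakly
continuous. *)
Require Import Defs.
From HB Require Import structures.
From mathcomp Require Import all_boot all_order all_algebra.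
From mathcomp Require Import all_classical all_reals all_analysis measurable_realfun.
From mathcomp Require Import ring lra zify.
Set Implicit Arguments. Unset Strict Implicit. Unset Printing Implicit Defensive.
Import Order.TTheory GRing.Theory Num.Theory.
Import numFieldNormedType.Exports.
Local Open Scope classical_set_scope.
Local Open Scope ring_scope.

(** * Summable sequences and the quadratic form *)

(** Since q is only in L^2, multiplication by q need not be bounded on L^2; in coordinates it sends
    l^2 to bounded sequences, and no more is used. This is enough because the diagonal grows
    quadratically: the form domain embeds in l^1, and all work is done with quadratic forms. The
    conjugation J is antisymmetric and commutes with D. When eigenvalue equations are paired through
    it, D drops out, and in the symmetrised matrix of q the coefficients at frequency differences
    cancel, so that only those at frequency sums survive. The obstacle to surjectivity is that the
    data are large: perturbation theory controls q only beyond a frequency M of order |q|^2. Two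
    facts reach the modes below: the trace of M Dirichlet levels has an error of order |q|^2 / sqrt
    M, and the first M terms of an l^2 sequence sum to o(sqrt M). With sqrt M = 256 B both
    contributions are at most |q| / 8, which leaves the low modes too little mass for a nonzero
    solution of the scaled equation. *)

Section Summation.
Variable R : realType.
Implicit Types (f g x y : nat -> R) (C a : R).

(** Absolute summability as a bound on partial sums. The sum [sm] is meaningful only together with
    it, since [limn] has a default value on divergent sequences. *)
Definition asm f := exists C, forall n, \sum_(k < n) `|f k| <= C.
Definition sm f : R := limn (fun n => \sum_(k < n) f k).

Lemma psum_mono f m n : (forall k, 0 <= f k) -> (m <= n)%N ->
  \sum_(k < m) f k <= \sum_(k < n) f k.
Proof.
move=> f0 mn; rewrite -(subnKC mn) big_split_ord /= lerDl.
by apply: sumr_ge0.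
Qed.

Lemma series_ordE f : series f = (fun n => \sum_(k < n) f k).
Proof. by apply/funext => n; rewrite /series/= big_mkord. Qed.

Lemma asm_cvg f : asm f -> cvgn (fun n => \sum_(k < n) f k).
Proof.
case=> C H; rewrite -series_ordE; apply: (@normed_cvg _ R^o).
have -> : [normed series f] = (fun n => \sum_(k < n) `|f k|).
  by apply/funext => n /=; rewrite /series/= big_mkord.
apply: nondecreasing_is_cvgn.
  by move=> m n mn; apply: (@psum_mono (fun k => `|f k|)).
by exists C => _ [n _ <-].
Qed.

Lemma sm_cvg f : asm f -> (fun n => \sum_(k < n) f k) @ \oo --> sm f.
Proof. by move/asm_cvg. Qed.

Lemma sm_unique f a : (fun n => \sum_(k < n) f k) @ \oo --> a -> sm f = a.
Proof. by move=> h; apply: cvg_lim. Qed.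

Lemma eq_sm f g : f =1 g -> sm f = sm g.
Proof. by move/funext => ->. Qed.

Lemma eq_asm f g : f =1 g -> asm f -> asm g.
Proof. by move/funext => ->. Qed.

Lemma asm_le f g : (forall k, `|f k| <= `|g k|) -> asm g -> asm f.
Proof.
move=> h [C H]; exists C => n; apply: le_trans (H n).
by apply: ler_sum => i _.
Qed.

Lemma asm_abs f : asm f -> asm (fun k => `|f k|).
Proof. by apply: asm_le => k; rewrite normr_id. Qed.

Lemma asm0 : asm (fun=> 0).
Proof. by exists 0 => n; rewrite big1// => i _; rewrite normr0. Qed.

Lemma asmD f g : asm f -> asm g -> asm (fun k => f k + g k).
Proof.
move=> [C H] [C' H']; exists (C + C') => n.
apply: (@le_trans _ _ (\sum_(k < n) (`|f k| + `|g k|))).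
  by apply: ler_sum => i _; apply: ler_normD.
by rewrite big_split/=; apply: lerD; [exact: H|exact: H'].
Qed.

Lemma asmZ a f : asm f -> asm (fun k => a * f k).
Proof.
move=> [C H]; exists (`|a| * C) => n.
under eq_bigr do rewrite normrM.
by rewrite -mulr_sumr ler_wpM2l.
Qed.

Lemma asmN f : asm f -> asm (fun k => - f k).
Proof. by move/(asmZ (-1)); apply: eq_asm => k; rewrite mulN1r. Qed.

Lemma asmB f g : asm f -> asm g -> asm (fun k => f k - g k).
Proof. by move=> hf /asmN; apply: asmD. Qed.

Lemma asm_sum (I : Type) (r : seq I) (F : I -> nat -> R) :
  (forall i, asm (F i)) -> asm (fun k => \sum_(i <- r) F i k).
Proof.
move=> h; elim: r => [|i r ih].
  by apply: eq_asm asm0 => k; rewrite big_nil.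
by apply: eq_asm (asmD (h i) ih) => k; rewrite big_cons.
Qed.

Lemma sm0 : sm (fun=> 0) = 0.
Proof.
apply: sm_unique; rewrite (_ : (fun n => _) = fun=> 0); first exact: cvg_cst.
by apply/funext => n; rewrite big1.
Qed.

Lemma smD f g : asm f -> asm g -> sm (fun k => f k + g k) = sm f + sm g.
Proof.
move=> hf hg; apply: sm_unique.
under eq_fun do rewrite big_split/=.
by apply: cvgD; apply: sm_cvg.
Qed.

Lemma smZ a f : asm f -> sm (fun k => a * f k) = a * sm f.
Proof.
move=> hf; apply: sm_unique.
under eq_fun do rewrite -mulr_sumr.
by apply: cvgMr; apply: sm_cvg.
Qed.

Lemma smN f : asm f -> sm (fun k => - f k) = - sm f.
Proof.
move=> hf; rewrite -[RHS]mulN1r -smZ//.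
by apply: eq_sm => k; rewrite mulN1r.
Qed.

Lemma smB f g : asm f -> asm g -> sm (fun k => f k - g k) = sm f - sm g.
Proof. by move=> hf hg; rewrite smD ?smN//; apply: asmN. Qed.

Lemma sm_sum (I : Type) (r : seq I) (F : I -> nat -> R) :
  (forall i, asm (F i)) ->
  sm (fun k => \sum_(i <- r) F i k) = \sum_(i <- r) sm (F i).
Proof.
move=> h; elim: r => [|i r ih].
  by rewrite big_nil -[RHS]sm0; apply: eq_sm => k; rewrite big_nil.
rewrite big_cons -ih -smD//; last exact: asm_sum.
by apply: eq_sm => k; rewrite big_cons.
Qed.

Lemma ler_sm f g : asm f -> asm g -> (forall k, f k <= g k) -> sm f <= sm g.
Proof.
move=> hf hg h; apply: ler_lim; [exact: asm_cvg|exact: asm_cvg|].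
by near=> n; apply: ler_sum => i _.
Unshelve. all: by end_near. Qed.

Lemma sm_ge0 f : asm f -> (forall k, 0 <= f k) -> 0 <= sm f.
Proof. by move=> hf h; rewrite -sm0; apply: ler_sm => //; apply: asm0. Qed.

Lemma psum_le_sm f n : asm f -> (forall k, 0 <= f k) ->
  \sum_(k < n) f k <= sm f.
Proof.
move=> hf h; apply: limr_ge; first exact: asm_cvg.
by near=> m; apply: psum_mono => //; near: m; exists n.
Unshelve. all: by end_near. Qed.

Lemma sm_le_bound f C : asm f -> (forall n, \sum_(k < n) f k <= C) -> sm f <= C.
Proof.
by move=> hf h; apply: limr_le; [exact: asm_cvg|near=> n].
Unshelve. all: by end_near. Qed.

Lemma sm_abs f : asm f -> `|sm f| <= sm (fun k => `|f k|).
Proof.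
move=> hf; rewrite ler_norml -smN; last exact: asm_abs.
apply/andP; split; apply: ler_sm => //; do ?[exact/asmN/asm_abs|exact: asm_abs].
- by move=> k; rewrite lerNl -normrN ler_norm.
- by move=> k; rewrite ler_norm.
Qed.

Lemma asm_fin f n : (forall k, (n <= k)%N -> f k = 0) -> asm f.
Proof.
move=> h; exists (\sum_(k < n) `|f k|) => m.
have [mn|/ltnW nm] := leqP m n; first by apply: (@psum_mono (fun k => `|f k|)).
rewrite -(subnKC nm) big_split_ord/= gerDl big1// => i _.
by rewrite h ?normr0// leq_addr.
Qed.

Lemma sm_fin f n : (forall k, (n <= k)%N -> f k = 0) -> sm f = \sum_(k < n) f k.
Proof.
move=> h; apply: sm_unique; apply: cvg_near_cst; near=> m.
have nm : (n <= m)%N by near: m; exists n.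
rewrite -(subnKC nm) big_split_ord/= [X in _ + X]big1 ?addr0// => i _.
by rewrite h// leq_addr.
Unshelve. all: by end_near. Qed.

Lemma asm_tail f n : asm f -> asm (fun k => f (n + k)%N).
Proof.
move=> [C H]; exists C => m; apply: le_trans (H (n + m)%N).
by rewrite big_split_ord/= lerDr sumr_ge0.
Qed.

Lemma sm_tail f n : asm f -> sm f = \sum_(k < n) f k + sm (fun k => f (n + k)%N).
Proof.
move=> hf; apply: sm_unique; rewrite -(cvg_shiftn n)/=.
have : (fun m => \sum_(k < n) f k + \sum_(k < m) f (n + k)%N) @ \oo -->
  \sum_(k < n) f k + sm (fun k => f (n + k)%N).
  by apply: cvgD; [exact: cvg_cst|apply/sm_cvg/asm_tail].
by apply: cvg_trans; apply: near_eq_cvg; near=> m; rewrite addnC big_split_ord.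
Unshelve. all: by end_near. Qed.

Lemma tail_cvg0 f : asm f -> (fun n => sm (fun k => f (n + k)%N)) @ \oo --> 0.
Proof.
move=> hf; rewrite [X in X @ _ --> _](_ : _ = fun n => sm f - \sum_(k < n) f k).
  by rewrite -[X in _ --> X](subrr (sm f)); apply: cvgB; [exact: cvg_cst|exact: sm_cvg].
by apply/funext => n; rewrite (sm_tail n hf) addrC addKr.
Qed.

Lemma tail_small f (e : R) : asm f -> 0 < e ->
  exists N, forall n, (N <= n)%N -> sm (fun k => `|f (n + k)%N|) <= e.
Proof.
move=> /asm_abs /tail_cvg0 h e0.
have /cvgr0Pnorm_le /(_ _ e0)[N _ HN] := h.
exists N => n Nn; have := HN n Nn.
by apply: le_trans; rewrite ler_norm.
Qed.

Lemma asm_cvg0 f : asm f -> f @ \oo --> 0.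
Proof.
by move=> /asm_cvg; rewrite -series_ordE => /cvg_series_cvg_0.
Qed.

Lemma asm_term f k : asm f -> `|f k| <= sm (fun k => `|f k|).
Proof.
move=> hf; apply: le_trans (psum_le_sm k.+1 (asm_abs hf) _) => //.
by rewrite big_ord_recr/= lerDr sumr_ge0.
Qed.

Lemma asm_bound f C : (forall k, 0 <= f k) -> (forall n, \sum_(k < n) f k <= C) -> asm f.
Proof.
move=> f0 h; exists C => n; apply: le_trans (h n).
by apply: ler_sum => i _; rewrite ger0_norm.
Qed.

Lemma sm_eq0 f : asm f -> (forall k, 0 <= f k) -> sm f = 0 -> forall k, f k = 0.
Proof.
move=> hf f0 sf k; apply/eqP; rewrite eq_le f0 andbT -sf.
apply: le_trans (psum_le_sm k.+1 hf f0).
by rewrite big_ord_recr/= lerDr sumr_ge0.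
Qed.

Implicit Types (e : R).

Lemma sqr_normr a : `|a| ^+ 2 = a ^+ 2.
Proof. by rewrite real_normK ?num_real. Qed.

Definition l2 x := asm (fun k => x k * x k).
Definition dot x y : R := sm (fun k => x k * y k).
Definition delta (i k : nat) : R := (k == i)%:R.

Lemma l2_dot x y : l2 x -> l2 y -> asm (fun k => x k * y k).
Proof.
move=> hx hy; apply: asm_le (asmD hx hy) => k.
have nn a : a * a = `|a| * `|a| by rewrite -!expr2 sqr_normr.
rewrite normrM [leRHS]ger0_norm; last by rewrite addr_ge0// -expr2 sqr_ge0.
rewrite (nn (x k)) (nn (y k)); have := sqr_ge0 (`|x k| - `|y k|).
have := mulr_ge0 (normr_ge0 (x k)) (normr_ge0 (y k)).
by move=> ? ?; nra.
Qed.

Lemma dotC x y : dot x y = dot y x.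
Proof. by apply: eq_sm => k; rewrite mulrC. Qed.

Lemma l2D x y : l2 x -> l2 y -> l2 (fun k => x k + y k).
Proof.
move=> hx hy.
have h := asmD (asmD hx hy) (asmZ 2 (l2_dot hx hy)).
by apply: eq_asm h => k; ring.
Qed.

Lemma l2Z a x : l2 x -> l2 (fun k => a * x k).
Proof. by move=> /(asmZ (a * a)); apply: eq_asm => k; ring. Qed.

Lemma l2N x : l2 x -> l2 (fun k => - x k).
Proof. by apply: eq_asm => k; ring. Qed.

Lemma l2B x y : l2 x -> l2 y -> l2 (fun k => x k - y k).
Proof. by move=> hx /l2N; apply: l2D. Qed.

Lemma l20 : l2 (fun=> 0).
Proof. by apply: eq_asm asm0 => k; rewrite mulr0. Qed.

Lemma l2_sum (I : Type) (r : seq I) (F : I -> nat -> R) :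
  (forall i, l2 (F i)) -> l2 (fun k => \sum_(i <- r) F i k).
Proof.
move=> h; elim: r => [|i r ih].
  by apply: eq_asm l20 => k; rewrite big_nil.
by apply: eq_asm (l2D (h i) ih) => k; rewrite big_cons.
Qed.

Lemma l2_fin x n : (forall k, (n <= k)%N -> x k = 0) -> l2 x.
Proof. by move=> h; apply: (@asm_fin _ n) => k /h ->; rewrite mulr0. Qed.

Lemma l2_delta i : l2 (delta i).
Proof. by apply: (@l2_fin _ i.+1) => k ik; rewrite /delta gtn_eqF. Qed.

Lemma l2_abs x : l2 x -> l2 (fun k => `|x k|).
Proof. by apply: eq_asm => k; rewrite -!expr2 sqr_normr. Qed.

Lemma dot_ge0 x : l2 x -> 0 <= dot x x.
Proof. by move=> h; apply: sm_ge0 => // k; rewrite -expr2 sqr_ge0. Qed.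

Lemma dotDl x y z : l2 x -> l2 y -> l2 z ->
  dot (fun k => x k + y k) z = dot x z + dot y z.
Proof.
move=> hx hy hz; rewrite -smD; [|exact: l2_dot|exact: l2_dot].
by apply: eq_sm => k; rewrite mulrDl.
Qed.

Lemma dotZl a x z : l2 x -> l2 z -> dot (fun k => a * x k) z = a * dot x z.
Proof.
move=> hx hz; rewrite -smZ; last exact: l2_dot.
by apply: eq_sm => k; rewrite mulrA.
Qed.

Lemma dotBl x y z : l2 x -> l2 y -> l2 z ->
  dot (fun k => x k - y k) z = dot x z - dot y z.
Proof.
move=> hx hy hz; rewrite -smB; [|exact: l2_dot|exact: l2_dot].
by apply: eq_sm => k; rewrite mulrBl.
Qed.

Lemma dot_suml (I : Type) (r : seq I) (F : I -> nat -> R) z :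
  (forall i, l2 (F i)) -> l2 z ->
  dot (fun k => \sum_(i <- r) F i k) z = \sum_(i <- r) dot (F i) z.
Proof.
move=> h hz; rewrite -sm_sum; last by move=> i; apply: l2_dot.
by apply: eq_sm => k; rewrite mulr_suml.
Qed.

Lemma dotDr x y z : l2 x -> l2 y -> l2 z ->
  dot z (fun k => x k + y k) = dot z x + dot z y.
Proof. by move=> hx hy hz; rewrite dotC dotDl// (dotC x) (dotC y). Qed.

Lemma dotZr a x z : l2 x -> l2 z -> dot z (fun k => a * x k) = a * dot z x.
Proof. by move=> hx hz; rewrite dotC dotZl// (dotC x). Qed.

Lemma dotBr x y z : l2 x -> l2 y -> l2 z ->
  dot z (fun k => x k - y k) = dot z x - dot z y.
Proof. by move=> hx hy hz; rewrite dotC dotBl// (dotC x) (dotC y). Qed.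

Lemma dot_sumr (I : Type) (r : seq I) (F : I -> nat -> R) z :
  (forall i, l2 (F i)) -> l2 z ->
  dot z (fun k => \sum_(i <- r) F i k) = \sum_(i <- r) dot z (F i).
Proof.
by move=> h hz; rewrite dotC dot_suml//; apply: eq_bigr => i _; rewrite dotC.
Qed.

Lemma dot_delta x i : dot (delta i) x = x i.
Proof.
rewrite /dot (@sm_fin _ i.+1); last first.
  by move=> k ik; rewrite /delta gtn_eqF// mul0r.
rewrite big_ord_recr/= big1 ?add0r ?/delta ?eqxx ?mul1r// => k _.
by rewrite ltn_eqF ?mul0r.
Qed.

Lemma cauchy_schwarz x y : l2 x -> l2 y -> dot x y ^+ 2 <= dot x x * dot y y.
Proof.
move=> hx hy.
have h t : 0 <= dot x x - 2 * t * dot x y + t ^+ 2 * dot y y.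
  have h1 := l2Z t hy.
  have := dot_ge0 (l2B hx h1).
  rewrite dotBl ?dotBr ?dotZl ?dotZr ?(dotC y x)//; last exact: l2B.
  by congr (_ <= _); ring.
have := dot_ge0 hy; rewrite le_eqVlt => /predU1P[y0|y0].
  rewrite -y0 mulr0 in h *.
  have [->|xy] := eqVneq (dot x y) 0; first by rewrite expr0n.
  (* When [dot y y = 0] the quadratic in [t] is affine, and this [t] gives it the value -1. *)
  have := h ((dot x x + 1) / (2 * dot x y)).
  rewrite mulr0 (_ : 2 * _ * _ = dot x x + 1); first by move=> ?; lra.
  by field.
have := h (dot x y / dot y y).
rewrite -(ler_pM2r y0) mul0r (_ : (_ - _ + _) * _ = dot x x * dot y y - dot x y ^+ 2).
  by rewrite subr_ge0.
by field; rewrite gt_eqF.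
Qed.

Lemma cauchy_schwarz_abs x y : l2 x -> l2 y ->
  sm (fun k => `|x k * y k|) ^+ 2 <= dot x x * dot y y.
Proof.
move=> hx hy.
rewrite (_ : sm _ = dot (fun k => `|x k|) (fun k => `|y k|)); last first.
  by apply: eq_sm => k; rewrite normrM.
apply: le_trans (cauchy_schwarz (l2_abs hx) (l2_abs hy)) _.
have nn z : dot (fun k => `|z k|) (fun k => `|z k|) = dot z z.
  by apply: eq_sm => k; rewrite -!expr2 sqr_normr.
by rewrite !nn.
Qed.

Definition nrm x : R := Num.sqrt (dot x x).

Lemma nrm_ge0 x : 0 <= nrm x. Proof. exact: sqrtr_ge0. Qed.

Lemma nrm_sqr x : l2 x -> nrm x ^+ 2 = dot x x.
Proof. by move=> h; rewrite sqr_sqrtr// dot_ge0. Qed.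

Lemma dot_nrm x y : l2 x -> l2 y -> `|dot x y| <= nrm x * nrm y.
Proof.
move=> hx hy; rewrite -(@ler_pXn2r _ 2)// ?nnegrE ?mulr_ge0 ?nrm_ge0//.
by rewrite exprMn !nrm_sqr// real_normK ?num_real//; apply: cauchy_schwarz.
Qed.

Lemma dot_nrm_abs x y : l2 x -> l2 y -> sm (fun k => `|x k * y k|) <= nrm x * nrm y.
Proof.
move=> hx hy; rewrite -(@ler_pXn2r _ 2)// ?nnegrE ?mulr_ge0 ?nrm_ge0//; last first.
  by apply: sm_ge0 => //; apply/asm_abs/l2_dot.
by rewrite exprMn !nrm_sqr//; apply: cauchy_schwarz_abs.
Qed.

Lemma nrmD x y : l2 x -> l2 y -> nrm (fun k => x k + y k) <= nrm x + nrm y.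
Proof.
move=> hx hy; rewrite -(@ler_pXn2r _ 2)// ?nnegrE ?addr_ge0 ?nrm_ge0//.
have hxy := l2D hx hy.
rewrite nrm_sqr// dotDl// !dotDr// (dotC y x).
have := dot_nrm hx hy; have := nrm_sqr hx; have := nrm_sqr hy.
move=> <- <- h; have := le_trans (ler_norm _) h => h2; rewrite sqrrD; lra.
Qed.

Lemma nrmZ a x : l2 x -> nrm (fun k => a * x k) = `|a| * nrm x.
Proof.
move=> hx; rewrite /nrm dotZl//; last exact: l2Z.
rewrite dotZr// mulrA -expr2 sqrtrM ?sqr_ge0// sqrtr_sqr.
by [].
Qed.

Lemma nrm_eq0 x : l2 x -> dot x x = 0 -> forall k, x k = 0.
Proof.
move=> hx h k; apply/eqP; rewrite -[_ == 0]orbb -mulf_eq0; apply/eqP.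
by apply: (@sm_eq0 (fun k => x k * x k)) => // i; rewrite -expr2 sqr_ge0.
Qed.

Lemma nrm_coord x k : l2 x -> `|x k| <= nrm x.
Proof.
move=> hx; rewrite -(@ler_pXn2r _ 2)// ?nnegrE ?nrm_ge0//.
rewrite nrm_sqr// real_normK ?num_real//.
have := asm_term k hx; rewrite -expr2 ger0_norm ?sqr_ge0// => /le_trans; apply.
rewrite le_eqVlt; apply/orP; left; apply/eqP.
by apply: eq_sm => i; rewrite ger0_norm// -expr2 sqr_ge0.
Qed.

Lemma dot_sqr_le x y : l2 y -> (forall k, `|x k| <= `|y k|) -> dot x x <= dot y y.
Proof.
move=> hy h.
have h' k : x k * x k <= y k * y k.
  rewrite -!expr2 -(sqr_normr (x k)) -(sqr_normr (y k)).
  by rewrite ler_pXn2r ?nnegrE.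
have hx : l2 x.
  apply: asm_le hy => k; rewrite !ger0_norm -?expr2 ?sqr_ge0//.
  by rewrite !expr2 h'.
by apply: ler_sm.
Qed.

Lemma l2_le x y : l2 y -> (forall k, `|x k| <= `|y k|) -> l2 x.
Proof.
move=> hy h; apply: asm_le hy => k.
by rewrite !normrM ler_pM.
Qed.

Lemma bessel (I : finType) (F : I -> nat -> R) x :
  (forall i, l2 (F i)) -> l2 x ->
  (forall i j, dot (F i) (F j) = (i == j)%:R) ->
  \sum_i dot x (F i) ^+ 2 <= dot x x.
Proof.
move=> hF hx ho; pose c i := dot x (F i).
pose p k := \sum_i c i * F i k.
have hp : l2 p by apply: l2_sum => i; apply: l2Z.
have xp : dot p x = \sum_i c i ^+ 2.
  rewrite dot_suml//; last by move=> i; apply: l2Z.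
  by apply: eq_bigr => i _; rewrite dotZl// dotC expr2.
have pp : dot p p = \sum_i c i ^+ 2.
  rewrite dot_suml//; last by move=> i; apply: l2Z.
  apply: eq_bigr => i _; rewrite dotZl// dot_sumr//; last by move=> j; apply: l2Z.
  rewrite (bigD1 i)//= big1 ?addr0; last first.
    by move=> j ji; rewrite dotZr// ho eq_sym (negPf ji) mulr0.
  by rewrite dotZr// ho eqxx mulr1 expr2.
have := dot_ge0 (l2B hx hp); rewrite dotBl//; last exact: l2B.
rewrite !dotBr// (dotC x p) xp pp.
by rewrite subrr subr0 subr_ge0.
Qed.

End Summation.

(** Ultrafilters replace the extraction of subsequences: all coordinates of a bounded sequence of
    vectors converge along the same [U], without a diagonal argument. *)
Lemma ultra_limit (R : realType) (U : set_system nat) (f : nat -> R) (C : R) :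
  UltraFilter U -> (forall n, `|f n| <= C) -> exists l : R, f @ U --> l.
Proof.
move=> UU hf.
have [l [_ cl]] : (`[- C, C]%classic : set R) `&` cluster (f @ U) !=set0.
  apply: segment_compact; apply: (@filterS _ U _ setT) => [n _|]; last exact: filterT.
  by rewrite /= in_itv/= -ler_norml.
exists l => V Vl.
have [//|h] := in_ultra_setVsetC (f @^-1` V) UU.
have [n [/= n1 n2]] := cl (~` V) V h Vl; case: (n1 n2).
Qed.

Lemma ultra_oo : exists U : set_system nat, UltraFilter U /\ \oo `<=` U.
Proof. by have [U [? ?]] := ultraFilterLemma eventually_filter; exists U. Qed.

(** * Admissible infinite matrices [D + b] and their forms *)

Section QuadraticForm.
Variable R : realType.
Variables (D : nat -> R) (b : nat -> nat -> R) (K : R).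
Implicit Types (x y z : nat -> R).

(** The rows of [b] are uniformly bounded in l^2, so [b] maps l^2 to bounded sequences. Summability
    of [1 / (1 + D)] puts the form domain in l^1, and the pairing of [b x] with [y] then converges
    although [b] need not be bounded on l^2. *)
Definition adm := [/\ forall k, 0 <= D k, asm (fun k => (1 + D k)^-1),
  (forall k l, b k l = b l k) & 0 <= K /\ (forall k, l2 (b k) /\ dot (b k) (b k) <= K ^+ 2)].
Hypothesis H : adm.

Let D0 k : 0 <= D k. Proof. by case: H. Qed.
Let DV : asm (fun k => (1 + D k)^-1). Proof. by case: H. Qed.
Let bsym k l : b k l = b l k. Proof. by case: H. Qed.
Let K0 : 0 <= K. Proof. by case: H => _ _ _ []. Qed.
Let bl2 k : l2 (b k). Proof. by case: H => _ _ _ [_ /(_ k)[]]. Qed.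
Let bK k : dot (b k) (b k) <= K ^+ 2. Proof. by case: H => _ _ _ [_ /(_ k)[]]. Qed.

Definition h1 x := asm (fun k => (1 + D k) * (x k * x k)).
Definition hn x : R := sm (fun k => (1 + D k) * (x k * x k)).
Definition bx x k : R := dot (b k) x.
Definition QQ x y : R := sm (fun k => D k * (x k * y k)) + sm (fun k => bx x k * y k).

Let W0 k : 0 < 1 + D k. Proof. by rewrite ltr_pwDl. Qed.
Let xx0 x k : 0 <= x k * x k :> R. Proof. by rewrite -expr2 sqr_ge0. Qed.

Let wsq (u v : R) k : Num.sqrt (1 + D k) * u * (Num.sqrt (1 + D k) * v) = (1 + D k) * (u * v).
Proof. by rewrite mulrACA -expr2 sqr_sqrtr// addr_ge0. Qed.

Lemma h1_l2 x : h1 x -> l2 x.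
Proof.
apply: asm_le => k; rewrite (ger0_norm (xx0 x k)) ger0_norm.
  by rewrite ler_peMl// lerDl.
by rewrite mulr_ge0 ?addr_ge0.
Qed.

Lemma hn_ge0 x : h1 x -> 0 <= hn x.
Proof. by move=> h; apply: sm_ge0 => // k; rewrite mulr_ge0 ?addr_ge0. Qed.

Lemma h1_sqrt x : h1 x <-> l2 (fun k => Num.sqrt (1 + D k) * x k).
Proof.
rewrite /h1 /l2 (_ : (fun k => _ * x k * _) = fun k => (1 + D k) * (x k * x k))//.
by apply/funext => k; rewrite wsq.
Qed.

Lemma hn_sqrt x : hn x = dot (fun k => Num.sqrt (1 + D k) * x k) (fun k => Num.sqrt (1 + D k) * x k).
Proof.
by apply: eq_sm => k; rewrite wsq.
Qed.

Lemma h1D x y : h1 x -> h1 y -> h1 (fun k => x k + y k).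
Proof.
move=> /h1_sqrt hx /h1_sqrt hy; apply/h1_sqrt.
by have := l2D hx hy; apply: eq_asm => k; ring.
Qed.

Lemma h1Z a x : h1 x -> h1 (fun k => a * x k).
Proof.
by move=> /h1_sqrt/(l2Z a) hx; apply/h1_sqrt; apply: eq_asm hx => k; ring.
Qed.

Lemma h10 : h1 (fun=> 0).
Proof. by apply: eq_asm (asm0 _) => k; rewrite !mulr0. Qed.

Lemma h1_sum (I : Type) (r : seq I) (F : I -> nat -> R) :
  (forall i, h1 (F i)) -> h1 (fun k => \sum_(i <- r) F i k).
Proof.
move=> h; elim: r => [|i r ih].
  by apply: eq_asm h10 => k; rewrite big_nil.
by apply: eq_asm (h1D (h i) ih) => k; rewrite big_cons.
Qed.

Lemma h1B x y : h1 x -> h1 y -> h1 (fun k => x k - y k).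
Proof.
by move=> hx /(h1Z (-1)) hy; apply: eq_asm (h1D hx hy) => k; rewrite mulN1r.
Qed.

Lemma h1_fin x n : (forall k, (n <= k)%N -> x k = 0) -> h1 x.
Proof. by move=> h; apply: (@asm_fin _ _ n) => k /h ->; rewrite !mulr0. Qed.

Lemma h1_delta i : h1 (delta R i).
Proof. by apply: (@h1_fin _ i.+1) => k ik; rewrite /delta gtn_eqF. Qed.

Let th : nat -> R := fun k => (Num.sqrt (1 + D k))^-1.
Let th_l2 : l2 th.
Proof.
apply: eq_asm DV => k; rewrite -invfM -expr2 sqr_sqrtr// addr_ge0//.
Qed.

Let ths x k : x k = (Num.sqrt (1 + D k) * x k) * th k.
Proof. by rewrite mulrAC mulfV ?mul1r// gt_eqF// sqrtr_gt0. Qed.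

Definition theta : R := sm (fun k => (1 + D k)^-1).

Lemma theta_ge0 : 0 <= theta.
Proof. by apply: sm_ge0 => // k; rewrite invr_ge0 addr_ge0. Qed.

(** Cauchy-Schwarz against the square root of [1 / (1 + D)], which is in l^2 by admissibility. *)
Lemma h1_l1 x : h1 x -> asm x.
Proof.
by move=> /h1_sqrt hx; apply: eq_asm (l2_dot hx th_l2) => k; rewrite -ths.
Qed.

Lemma l1_sqr x : h1 x -> sm (fun k => `|x k|) ^+ 2 <= hn x * theta.
Proof.
move=> hx; have /h1_sqrt hx' := hx.
have := cauchy_schwarz_abs hx' th_l2; rewrite -hn_sqrt.
rewrite (_ : dot th th = theta); last first.
  by apply: eq_sm => k; rewrite -invfM -expr2 sqr_sqrtr// addr_ge0.
by under eq_sm do rewrite -ths.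
Qed.

Lemma h1_dotD x y : h1 x -> h1 y -> asm (fun k => D k * (x k * y k)).
Proof.
move=> /h1_sqrt hx /h1_sqrt hy; apply: asm_le (l2_dot hx hy) => k.
rewrite wsq normrM [leRHS]normrM.
by rewrite ler_wpM2r// !ger0_norm ?addr_ge0// lerDr.
Qed.

Lemma bx_bound x k : l2 x -> `|bx x k| <= K * nrm x.
Proof.
move=> hx; apply: le_trans (dot_nrm (bl2 k) hx) _.
rewrite ler_wpM2r ?nrm_ge0// -(@ler_pXn2r _ 2)// ?nnegrE ?nrm_ge0//.
by rewrite nrm_sqr.
Qed.

Lemma bl_asm x y : l2 x -> asm y -> asm (fun k => bx x k * y k).
Proof.
move=> hx hy; apply: asm_le (asmZ (K * nrm x) hy) => k.
rewrite !normrM ler_wpM2r//; apply: le_trans (bx_bound k hx) _.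
by rewrite -normrM ler_norm.
Qed.

Lemma bl_bound x y : l2 x -> asm y ->
  `|sm (fun k => bx x k * y k)| <= K * nrm x * sm (fun k => `|y k|).
Proof.
move=> hx hy; apply: le_trans (sm_abs (bl_asm hx hy)) _.
rewrite -smZ; last exact: asm_abs.
apply: ler_sm; [exact/asm_abs/bl_asm|exact/asmZ/asm_abs|move=> k].
by rewrite normrM ler_wpM2r// bx_bound.
Qed.

(** The first vector is truncated at [L], where one of the two sums is finite and the exchange is
    immediate. Both sides then pass to the limit, one as a series and the other by [bl_bound]
    applied to the discarded tail. *)
Lemma bl_sym x y : l2 x -> asm x -> l2 y -> asm y ->
  sm (fun k => bx x k * y k) = sm (fun k => bx y k * x k).
Proof.
move=> x2 x1 y2 y1.
pose tr L k := if (k < L)%N then x k else 0.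
have tr2 L : l2 (tr L).
  by apply: (@l2_fin _ _ L) => k; rewrite /tr ltnNge => ->.
have e1 L : sm (fun k => bx (tr L) k * y k) = \sum_(l < L) bx y l * x l.
  have eb k : bx (tr L) k = \sum_(l < L) b k l * x l.
    rewrite /bx /dot (@sm_fin _ _ L); last first.
      by move=> l Ll; rewrite /tr ltnNge Ll mulr0.
    by apply: eq_bigr => l _; rewrite /tr ltn_ord.
  transitivity (sm (fun k => \sum_(l < L) (x l * (b l k * y k)))).
    apply: eq_sm => k; rewrite eb mulr_suml; apply: eq_bigr => l _.
    by rewrite (bsym k l); ring.
  rewrite sm_sum; last by move=> l; apply/asmZ/l2_dot.
  apply: eq_bigr => l _; rewrite smZ; last exact: l2_dot.
  by rewrite mulrC.
have c1 : (fun L => sm (fun k => bx (tr L) k * y k)) @ \oo --> sm (fun k => bx y k * x k).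
  by under eq_fun do rewrite e1; apply: sm_cvg; apply: bl_asm.
have c2 : (fun L => sm (fun k => bx (tr L) k * y k)) @ \oo --> sm (fun k => bx x k * y k).
  have bnd L : `|sm (fun k => bx (tr L) k * y k) - sm (fun k => bx x k * y k)| ^+ 2 <=
     (K * sm (fun k => `|y k|)) ^+ 2 * sm (fun k => x (L + k)%N * x (L + k)%N).
    rewrite -smB; [|exact: bl_asm|exact: bl_asm].
    pose z k := tr L k - x k.
    have z2 : l2 z by apply: l2B.
    rewrite (_ : sm _ = sm (fun k => bx z k * y k)); last first.
      by apply: eq_sm => k; rewrite -mulrBl /bx -dotBr.
    apply: (@le_trans _ _ ((K * nrm z * sm (fun k => `|y k|)) ^+ 2)).
      rewrite ler_pXn2r ?nnegrE ?bl_bound// !mulr_ge0 ?nrm_ge0//.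
      by apply: sm_ge0 => //; apply: asm_abs.
    rewrite mulrAC exprMn nrm_sqr// le_eqVlt; apply/orP; left; apply/eqP; congr (_ * _).
    rewrite /dot (sm_tail L z2) big1 ?add0r; last first.
      by move=> k _; rewrite /z /tr ltn_ord subrr mulr0.
    by apply: eq_sm => k; rewrite /z /tr ltnNge leq_addr /= sub0r mulrNN.
  have t0 : (fun L => (K * sm (fun k => `|y k|)) ^+ 2 * sm (fun k => x (L + k)%N * x (L + k)%N)) @ \oo --> 0.
    rewrite -[X in _ --> X](mulr0 ((K * sm (fun k => `|y k|)) ^+ 2)).
    by apply: cvgMr; apply: (tail_cvg0 x2).
  apply/cvgrPdist_le => e e0.
  have e20 : 0 < e ^+ 2 by rewrite exprn_gt0.
  have /cvgr0Pnorm_le /(_ _ e20) := t0.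
  apply: filterS => L hL; rewrite distrC -(@ler_pXn2r _ 2)// ?nnegrE ?(ltW e0)//.
  by apply: le_trans (bnd L) _; apply: le_trans hL; rewrite ler_norm.
exact: cvg_unique c2 c1.
Qed.

Lemma QQ_sym x y : h1 x -> h1 y -> QQ x y = QQ y x.
Proof.
move=> hx hy; rewrite /QQ; congr (_ + _).
  by apply: eq_sm => k; rewrite (mulrC (x k)).
by apply: bl_sym; do ?[exact: h1_l1|exact: h1_l2].
Qed.

Lemma QQDl x y z : h1 x -> h1 y -> h1 z ->
  QQ (fun k => x k + y k) z = QQ x z + QQ y z.
Proof.
move=> hx hy hz; rewrite /QQ addrACA; congr (_ + _).
  rewrite -smD; do ?exact: h1_dotD.
  by apply: eq_sm => k; ring.
rewrite -smD; do ?by [apply: bl_asm; [exact: h1_l2|exact: h1_l1]].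
by apply: eq_sm => k; rewrite /bx dotDr ?mulrDl//; exact: h1_l2.
Qed.

Lemma QQZl a x z : h1 x -> h1 z -> QQ (fun k => a * x k) z = a * QQ x z.
Proof.
move=> hx hz; rewrite /QQ mulrDr; congr (_ + _).
  rewrite -smZ; do ?exact: h1_dotD.
  by apply: eq_sm => k; ring.
rewrite -smZ; last by [apply: bl_asm; [exact: h1_l2|exact: h1_l1]].
by apply: eq_sm => k; rewrite /bx dotZr ?mulrA//; exact: h1_l2.
Qed.

Lemma QQDr x y z : h1 x -> h1 y -> h1 z ->
  QQ z (fun k => x k + y k) = QQ z x + QQ z y.
Proof.
move=> hx hy hz; rewrite QQ_sym ?QQDl//; last exact: h1D.
by rewrite (QQ_sym hx)// (QQ_sym hy).
Qed.

Lemma QQZr a x z : h1 x -> h1 z -> QQ z (fun k => a * x k) = a * QQ z x.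
Proof.
by move=> hx hz; rewrite QQ_sym ?QQZl//; [rewrite (QQ_sym hx)|exact: h1Z].
Qed.

Lemma QQ_suml (I : Type) (r : seq I) (F : I -> nat -> R) z :
  (forall i, h1 (F i)) -> h1 z ->
  QQ (fun k => \sum_(i <- r) F i k) z = \sum_(i <- r) QQ (F i) z.
Proof.
move=> h hz; elim: r => [|i r ih].
  rewrite big_nil (_ : (fun k => _) = fun k => 0 * 0); last first.
    by apply/funext => k; rewrite big_nil mulr0.
  by rewrite (QQZl 0 h10) ?mul0r.
rewrite big_cons -ih -QQDl//; last exact: h1_sum.
by congr QQ; apply/funext => k; rewrite big_cons.
Qed.

Lemma QQ_delta x i : h1 x -> QQ x (delta R i) = D i * x i + bx x i.
Proof.
move=> hx; rewrite /QQ; congr (_ + _).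
  rewrite -(dot_delta (fun k => D k * x k) i).
  by apply: eq_sm => k; ring.
rewrite -(dot_delta (bx x) i).
by apply: eq_sm => k; ring.
Qed.

(** The constant of the Garding inequality [QQ_lower]. The 1 compensates the shift in the weight
    [1 + D]; the rest comes from absorbing [K |x| |x|_1], where [|x|_1 ^ 2 <= theta * hn x], into
    half of the form norm. *)
Definition Qlow : R := 1 + K ^+ 2 * theta / 2.

Lemma QQ_lower x : h1 x -> hn x / 2 - Qlow * dot x x <= QQ x x.
Proof.
move=> hx; have x2 := h1_l2 hx.
have e : sm (fun k => D k * (x k * x k)) = hn x - dot x x.
  rewrite -smB//; apply: eq_sm => k; ring.
rewrite /QQ e; have := bl_bound x2 (h1_l1 hx).
set s1 := sm (fun k => `|x k|); set bl := sm _ => hbl.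
have s10 : 0 <= s1 by apply: sm_ge0 => //; apply/asm_abs/h1_l1.
have hl := l1_sqr hx; rewrite -/s1 in hl.
have n2 := nrm_sqr x2; have n0 := nrm_ge0 x; have t0 := theta_ge0.
have hn0 := hn_ge0 hx.
rewrite /Qlow -n2.
have h2 : 2 * (K * nrm x * s1) <= hn x + K ^+ 2 * theta * nrm x ^+ 2.
  rewrite -(@ler_pXn2r _ 2)// ?nnegrE; [|by rewrite !mulr_ge0|]; last first.
    by rewrite addr_ge0 ?mulr_ge0 ?sqr_ge0.
  have := sqr_ge0 (hn x - K ^+ 2 * theta * nrm x ^+ 2).
  have := ler_wpM2l (sqr_ge0 (K * nrm x)) hl.
  set A := hn x; set B := theta => h3 h4.
  have -> : (2 * (K * nrm x * s1)) ^+ 2 = 4 * ((K * nrm x) ^+ 2 * s1 ^+ 2) by ring.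
  have -> : (A + K ^+ 2 * B * nrm x ^+ 2) ^+ 2 =
     (A - K ^+ 2 * B * nrm x ^+ 2) ^+ 2 + 4 * ((K * nrm x) ^+ 2 * (A * B)) by ring.
  lra.
have := le_trans (ler_norm (- bl)) _; rewrite normrN => /(_ _ hbl) hb.
rewrite mulrDl mul1r.
have -> : K ^+ 2 * theta / 2 * nrm x ^+ 2 = (K ^+ 2 * theta * nrm x ^+ 2) / 2 by ring.
lra.
Qed.

End QuadraticForm.

(** * Spectral theorem and variational principles *)

Lemma lin_dep (R : fieldType) (m n : nat) (f : 'I_n -> 'I_m -> R) : (m < n)%N ->
  exists c : 'I_n -> R, (exists i, c i != 0) /\ forall j, \sum_i c i * f i j = 0.
Proof.
move=> mn; pose A := \matrix_(i < n, j < m) f i j.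
have : kermx A != 0.
  rewrite -mxrank_eq0 mxrank_ker subn_eq0 -ltnNge.
  exact: leq_ltn_trans (rank_leq_col A) mn.
case/rowV0Pn => v /sub_kermxP vA v0.
exists (fun i => v 0 i); split.
  apply/existsP; apply: contraNT v0; rewrite negb_exists => /forallP h.
  apply/eqP/rowP => i; rewrite mxE; apply/eqP; move: (h i).
  by rewrite negbK.
move=> j; have /rowP/(_ j) := vA; rewrite !mxE => h; rewrite -[RHS]h.
by apply: eq_bigr => i _; rewrite mxE.
Qed.

(** The first variation: it turns minimality into the Euler-Lagrange equation in [spec_exists]. *)
Lemma quad_lin_eq0 (R : realFieldType) (a c : R) :
  (forall t, 0 <= 2 * t * a + t ^+ 2 * c) -> a = 0.
Proof.
move=> h; apply/eqP/negP => /negP a0.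
have d0 : 0 < `|c| + 1 by rewrite ltr_wpDl.
have := h (- a / (`|c| + 1)).
have a20 : 0 < a ^+ 2 by rewrite lt_def sqr_ge0 expf_eq0/= a0.
rewrite -(pmulr_lge0 _ (mulr_gt0 d0 d0)).
have -> : (2 * (- a / (`|c| + 1)) * a + (- a / (`|c| + 1)) ^+ 2 * c) * ((`|c| + 1) * (`|c| + 1))
  = a ^+ 2 * (c - 2 * (`|c| + 1)) by field; rewrite gt_eqF.
rewrite pmulr_rge0//.
have := ler_norm c => ? ?; lra.
Qed.

Lemma ulim_unique (R : realType) (U : set_system nat) (f : nat -> R) (l l' : R) :
  ProperFilter U -> f @ U --> l -> f @ U --> l' -> l = l'.
Proof. by move=> UU h h'; exact: cvg_unique h h'. Qed.

Section Compactness.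
Variable R : realType.
Variables (D : nat -> R) (b : nat -> nat -> R) (K : R).
Hypothesis H : adm D b K.
Implicit Types (x y z : nat -> R).

Let D0 k : 0 <= D k. Proof. by case: H. Qed.
Let DV : asm (fun k => (1 + D k)^-1). Proof. by case: H. Qed.
Let K0 : 0 <= K. Proof. by case: H => _ _ _ []. Qed.
Let W0 k : 0 < 1 + D k. Proof. by rewrite ltr_pwDl. Qed.

Let wge0 (u : R) k : 0 <= (1 + D k) * (u * u).
Proof. by rewrite mulr_ge0 ?(ltW (W0 k))// -expr2 sqr_ge0. Qed.

Lemma dot_le_hn x : h1 D x -> dot x x <= hn D x.
Proof.
move=> hx; apply: ler_sm => //; first exact: (h1_l2 H).
by move=> k; rewrite ler_peMl// ?lerDl// -expr2 sqr_ge0.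
Qed.

Lemma hnB x y : h1 D x -> h1 D y -> hn D (fun k => x k - y k) <= 2 * hn D x + 2 * hn D y.
Proof.
move=> hx hy; rewrite -!smZ// -smD; [|exact: asmZ|exact: asmZ].
apply: ler_sm; [exact: (h1B H)|by apply: asmD; apply: asmZ|move=> k].
have := sqr_ge0 (x k + y k); rewrite !mulrA -(pmulr_rge0 _ (W0 k)) => h.
rewrite -subr_ge0; apply: le_trans h _; rewrite le_eqVlt; apply/orP; left; apply/eqP.
by ring.
Qed.

Lemma cvg_sum_ord (F : set_system nat) {FF : Filter F} N (f : nat -> nat -> R) (l : nat -> R) :
  (forall k, (fun n => f n k) @ F --> l k) ->
  (fun n => \sum_(k < N) f n k) @ F --> \sum_(k < N) l k.
Proof.
move=> h; elim: N => [|N ih].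
  by rewrite big_ord0; under eq_fun do rewrite big_ord0; apply: cvg_cst.
rewrite big_ord_recr/=; under eq_fun do rewrite big_ord_recr/=.
by apply: cvgD.
Qed.

(** Rellich compactness. Coordinates converge along the ultrafilter, and the tails are uniformly
    small in l^2 because [1 / (1 + D k)] tends to 0 while the form norm is bounded; hence the
    convergence is strong in l^2. *)
Lemma ultra_h1 (U : set_system nat) (UU : UltraFilter U) (X : nat -> nat -> R) (C : R) :
  (forall n, h1 D (X n) /\ hn D (X n) <= C) ->
  exists x, [/\ h1 D x, hn D x <= C, (forall k, (fun n => X n k) @ U --> x k) &
    (fun n => nrm (fun k => X n k - x k)) @ U --> (0 : R)].
Proof.
move=> HX.
have C0 : 0 <= C by have [h ?] := HX 0%N; apply: le_trans (hn_ge0 H h) _.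
have bd k n : `|X n k| <= Num.sqrt C.
  have [hX hC] := HX n; apply: le_trans (nrm_coord k (h1_l2 H hX)) _.
  by rewrite ler_sqrt//; apply: le_trans (dot_le_hn hX) _.
have /choice[x xl] : forall k, exists l : R, (fun n => X n k) @ U --> l.
  by move=> k; apply: ultra_limit (bd k).
have pb N : \sum_(k < N) (1 + D k) * (x k * x k) <= C.
  have h : (fun n => \sum_(k < N) (1 + D k) * (X n k * X n k)) @ U -->
      \sum_(k < N) (1 + D k) * (x k * x k).
    apply: (@cvg_sum_ord _ _ N (fun n k => (1 + D k) * (X n k * X n k))
      (fun k => (1 + D k) * (x k * x k))) => k.
    by apply: cvgMr; apply: cvgM.
  apply: (cvgr_to_le h); apply: nearW => n; have [hX hC] := HX n; apply: le_trans hC.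
  by apply: psum_le_sm => // k; exact: wge0.
have hx : h1 D x.
  by apply: asm_bound pb => k; exact: wge0.
have hxC : hn D x <= C by apply: sm_le_bound.
exists x; split=> //.
apply/cvgr0Pnorm_le => e e0.
have e20 : 0 < e ^+ 2 / 2 by rewrite divr_gt0// exprn_gt0.
(* The differences have form norm at most [4 * C], so beyond [N] their squared l^2 mass is at most
   [e ^+ 2 / 2]; the added 1 covers [C = 0]. *)
have e30 : 0 < e ^+ 2 / 2 / (4 * C + 1) by rewrite divr_gt0// ltr_wpDl// mulr_ge0.
have /cvgr0Pnorm_le /(_ _ e30)[N _ HN] := asm_cvg0 DV.
have fin : (fun n => \sum_(k < N) (X n k - x k) * (X n k - x k)) @ U --> (0 : R).
  have hk k : (fun n => (X n k - x k) * (X n k - x k)) @ U --> (0 : R).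
    have h0 : (fun n => X n k - x k) @ U --> (0 : R).
      rewrite -[X in _ --> X](subrr (x k)).
      by apply: cvgB; [exact: xl|exact: cvg_cst].
    by rewrite -[X in _ --> X](mulr0 (0 : R)); apply: cvgM.
  have z0 : \sum_(k < N) (0 : R) = 0 by rewrite big1.
  rewrite -[X in _ --> X]z0; exact: (@cvg_sum_ord U _ N _ (fun=> 0) hk).
have /cvgr0Pnorm_le /(_ _ e20) := fin; apply: filterS => n hn1.
have [hX hC] := HX n.
have z2 : h1 D (fun k => X n k - x k) by apply: (h1B H).
rewrite ger0_norm ?nrm_ge0// -(@ler_pXn2r _ 2)// ?nnegrE ?nrm_ge0 ?(ltW e0)//.
have z22 := h1_l2 H z2; rewrite nrm_sqr// /dot (sm_tail N)//.
rewrite [leRHS]splitr lerD//; first by apply: le_trans hn1; rewrite ler_norm.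
have hz : hn D (fun k => X n k - x k) <= 4 * C.
  by apply: le_trans (hnB hX hx) _; lra.
apply: (@le_trans _ _ (e ^+ 2 / 2 / (4 * C + 1) * (4 * C))); last first.
  rewrite -mulrA ler_piMr ?(ltW e20)// mulrC ler_pdivrMr ?mul1r ?lerDl//.
  by rewrite ltr_wpDl// mulr_ge0.
apply: le_trans (ler_wpM2l (ltW e30) hz).
rewrite /hn (sm_tail N z2) mulrDr -[leLHS]add0r lerD//.
  by apply: mulr_ge0 (ltW e30) _; apply: sumr_ge0 => k _; exact: wge0.
rewrite -smZ; last exact: (asm_tail N z2).
apply: ler_sm; [exact: (asm_tail N (h1_l2 H z2))|exact/asmZ/(asm_tail N z2)|move=> k].
rewrite mulrA ler_peMl -?expr2 ?sqr_ge0//.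
have := HN (N + k)%N (leq_addr _ _); rewrite /= ger0_norm ?invr_ge0 ?(ltW (W0 _))//.
by move=> h; have := ler_wpM2r (ltW (W0 (N + k)%N)) h; rewrite mulVf// gt_eqF.
Qed.

Section Convergence.
Context (U : set_system nat) {UU : Filter U} (X : nat -> nat -> R) (x : nat -> R) (C : R).
Hypothesis hX : forall n, h1 D (X n) /\ hn D (X n) <= C.
Hypothesis hx : h1 D x.
Hypothesis cX : (fun n => nrm (fun k => X n k - x k)) @ U --> (0 : R).

Lemma cvg_squeeze0 (f g : nat -> R) (l : R) : (forall n, `|f n - l| <= g n) ->
  g @ U --> (0 : R) -> f @ U --> l.
Proof.
move=> fg /cvgr0Pnorm_le h; apply/cvgrPdist_le => e e0.
apply: filterS (h _ e0) => n; apply: le_trans.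
by rewrite distrC; apply: le_trans (fg n) _; rewrite ler_norm.
Qed.

Lemma cvg_dotl y : l2 y -> (fun n => dot (X n) y) @ U --> dot x y.
Proof.
move=> hy.
apply: (@cvg_squeeze0 _ (fun n => nrm (fun k => X n k - x k) * nrm y)); last first.
  by rewrite -[X in _ --> X](mul0r (nrm y)); apply: cvgMl.
move=> n; have [hn1 _] := hX n.
have n2 := h1_l2 H hn1; have x2 := h1_l2 H hx.
by rewrite -dotBl//; apply: dot_nrm => //; apply: l2B.
Qed.

Lemma cvg_nrm : (fun n => nrm (X n)) @ U --> nrm x.
Proof.
apply: cvg_squeeze0 cX => n /=; have [/(h1_l2 H) hn _] := hX n.
have hx2 := h1_l2 H hx.
rewrite ler_norml; apply/andP; split.
  have := nrmD (l2Z (-1) (l2B hn hx2)) hn; rewrite nrmZ ?normrN1 ?mul1r; last exact: l2B.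
  rewrite (_ : (fun k => _ + X n k) = x); first lra.
  by apply/funext => k; ring.
have := nrmD (l2B hn hx2) hx2.
rewrite (_ : (fun k => _ + x k) = X n); first lra.
by apply/funext => k; ring.
Qed.

Lemma cvg_dotxx : (fun n => dot (X n) (X n)) @ U --> dot x x.
Proof.
rewrite -(nrm_sqr (h1_l2 H hx)).
rewrite (_ : (fun n => _) = fun n => nrm (X n) ^+ 2); last first.
  by apply/funext => n; rewrite nrm_sqr//; apply: (h1_l2 H); case: (hX n).
by rewrite expr2; under eq_fun do rewrite expr2; apply: cvgM; exact: cvg_nrm.
Qed.

(** With [z = X n - x], symmetry gives [b(X, X) - b(x, x) = b(z, X) + b(z, x)], and each term is at
    most [K |z|] times a bounded l^1 norm. *)
Lemma cvg_bl : (fun n => sm (fun k => bx b (X n) k * X n k)) @ U --> sm (fun k => bx b x k * x k).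
Proof.
pose T := Num.sqrt (C * theta D) + sm (fun k => `|x k|).
apply: (@cvg_squeeze0 _ (fun n => K * nrm (fun k => X n k - x k) * T)); last first.
  rewrite -[X in _ --> X](mul0r T); apply: cvgMl.
  by rewrite -[X in _ --> X](mulr0 K); apply: cvgMr.
move=> n /=; have [hn hC] := hX n.
have z1 : h1 D (fun k => X n k - x k) by apply: (h1B H).
have z2 := h1_l2 H z1; have x2 := h1_l2 H hx; have n2 := h1_l2 H hn.
have x1 := h1_l1 H hx; have n1 := h1_l1 H hn; have zz := h1_l1 H z1.
have -> : sm (fun k => bx b (X n) k * X n k) - sm (fun k => bx b x k * x k) =
  sm (fun k => bx b (fun k => X n k - x k) k * X n k) + sm (fun k => bx b (fun k => X n k - x k) k * x k).
  rewrite (bl_sym H z2 zz x2 x1) -smD; [|exact: (bl_asm H)|exact: (bl_asm H)].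
  rewrite -smB; [|exact: (bl_asm H)|exact: (bl_asm H)].
  apply: eq_sm => k; rewrite /bx dotBr//; last by case: H => _ _ _ [_ /(_ k)[]].
  by ring.
apply: le_trans (ler_normD _ _) _; rewrite /T mulrDr lerD//; last exact: (bl_bound H).
apply: le_trans (bl_bound H z2 n1) _; rewrite ler_wpM2l ?mulr_ge0 ?nrm_ge0//.
rewrite -[leLHS]ger0_norm; last by apply: sm_ge0 => //; exact: asm_abs.
rewrite -sqrtr_sqr ler_sqrt.
  by apply: le_trans (l1_sqr H hn) _; rewrite ler_wpM2r ?(theta_ge0 H).
by rewrite mulr_ge0 ?(theta_ge0 H)//; apply: le_trans hC; apply: (hn_ge0 H hn).
Qed.

End Convergence.

Notation Q := (QQ D b).

Lemma QQ_quad x y t : h1 D x -> h1 D y ->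
  Q (fun k => x k + t * y k) (fun k => x k + t * y k) =
  Q x x + 2 * t * Q x y + t ^+ 2 * Q y y.
Proof.
move=> hx hy; have ty := h1Z H t hy; have xty := h1D H hx ty.
rewrite (QQDl H)// !(QQDr H)// !(QQZl H)// !(QQZr H)// (QQ_sym H hy hx).
by ring.
Qed.

Lemma dot_quad x y t : l2 x -> l2 y ->
  dot (fun k => x k + t * y k) (fun k => x k + t * y k) =
  dot x x + 2 * t * dot x y + t ^+ 2 * dot y y.
Proof.
move=> hx hy; have ty := l2Z t hy; have xty := l2D hx ty.
rewrite dotDl// !dotDr// !dotZl// !dotZr// (dotC y x).
by ring.
Qed.

Lemma QQ0 x : (forall k, x k = 0) -> Q x x = 0.
Proof.
move=> /funext ->; rewrite -[RHS](mul0r (Q (fun=> 0) (fun=> 0))) -(QQZl H 0 (h10 D) (h10 D)).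
by congr QQ; apply/funext => k; rewrite mulr0.
Qed.

Definition ortho (c : nat -> nat -> R) m y := forall i, (i < m)%N -> dot y (c i) = 0.

Lemma ortho_fin (c : nat -> nat -> R) m : (forall i, (i < m)%N -> l2 (c i)) ->
  exists y, [/\ h1 D y, dot y y = 1 & ortho c m y].
Proof.
move=> hc.
have [a [[i0 ai0] ha]] := @lin_dep R m m.+1 (fun i j => c j i) (ltnSn m).
pose y k := \sum_(i < m.+1) a i * delta R i k.
have yE (i : 'I_m.+1) : y i = a i.
  rewrite /y (bigD1 i)//= /delta eqxx mulr1 big1 ?addr0// => j ji.
  by rewrite (_ : (i == j :> nat) = false) ?mulr0//; apply/negbTE; rewrite eq_sym.
have hy : h1 D y by apply: (h1_sum H) => i; apply/(h1Z H)/(h1_delta D).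
have y2 := h1_l2 H hy.
have yy : 0 < dot y y.
  rewrite lt_neqAle dot_ge0// andbT; apply/eqP => /esym y0.
  by have := nrm_eq0 y2 y0 i0; rewrite yE => a0; rewrite a0 eqxx in ai0.
have oy : ortho c m y.
  move=> j jm; rewrite dot_suml; [|by move=> i; apply/l2Z/l2_delta|exact: hc].
  rewrite -[RHS](ha (Ordinal jm)); apply: eq_bigr => i _ /=.
  by rewrite dotZl ?dot_delta//; [exact: l2_delta|exact: hc].
exists (fun k => (nrm y)^-1 * y k); split; first exact: (h1Z H).
  rewrite dotZl ?dotZr//; last exact: l2Z.
  by rewrite mulrA -invfM -expr2 nrm_sqr// mulVf// gt_eqF.
by move=> i im; rewrite dotZl ?oy ?mulr0//; exact: hc.
Qed.

(** The direct method. [QQ_lower] bounds a minimising sequence in the form norm, and the strong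
    limit from [ultra_h1] keeps both the normalisation and the orthogonality constraints. *)
Lemma min_exists (c : nat -> nat -> R) m : (forall i, (i < m)%N -> l2 (c i)) ->
  exists x, [/\ h1 D x, dot x x = 1, ortho c m x &
    forall y, h1 D y -> ortho c m y -> Q x x * dot y y <= Q y y].
Proof.
move=> hc.
pose S : set R := [set r | exists y, [/\ h1 D y, dot y y = 1, ortho c m y & Q y y = r]].
have low y : h1 D y -> dot y y = 1 -> hn D y / 2 - Qlow D K <= Q y y.
  by move=> hy y1; have := QQ_lower H hy; rewrite y1 mulr1.
have Sinf : has_inf S.
  split; first by have [y [? ? ?]] := ortho_fin hc; exists (Q y y); exists y.
  exists (- Qlow D K) => _ [y [hy y1 _ <-]].
  by apply: le_trans (low _ hy y1); have := hn_ge0 H hy; lra.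
pose mu := inf S.
have /choice[X HX] : forall n, exists y, [/\ h1 D y, dot y y = 1, ortho c m y & Q y y <= mu + n.+1%:R^-1].
  move=> n; have n0 : 0 < n.+1%:R^-1 :> R by rewrite invr_gt0.
  have [_ [y [hy y1 oy <-]] lt] := inf_adherent n0 Sinf.
  by exists y; split=> //; apply: ltW.
pose C : R := 2 * (mu + 1 + Qlow D K).
have hX n : h1 D (X n) /\ hn D (X n) <= C.
  have [h1 h2 _ h4] := HX n; split=> //.
  have t1 : n.+1%:R^-1 <= 1 :> R by rewrite invf_le1 ?ler1n.
  move: (low _ h1 h2) h4 t1; set t := n.+1%:R^-1; rewrite /C => ? ? ?; lra.
have [U [UU oU]] := ultra_oo; have UF : Filter U by typeclasses eauto.
have [x [hx hxC cx sx]] := ultra_h1 UU hX.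
have x1 : dot x x = 1.
  have /(_ UF) h := cvg_dotxx hX hx sx.
  apply: (ulim_unique _ h); rewrite (_ : (fun n => _) = fun=> 1); first exact: cvg_cst.
  by apply/funext => n; case: (HX n).
have ox : ortho c m x.
  move=> i im; have /(_ UF) h := cvg_dotl hX hx sx (hc i im).
  apply: (ulim_unique _ h); rewrite (_ : (fun n => _) = fun=> 0); first exact: cvg_cst.
  by apply/funext => n; case: (HX n) => _ _ /(_ i im).
(* The perturbation converges, but the diagonal part is only lower semicontinuous: each of its
   partial sums passes to the limit, which suffices for the inequality. *)
have xmu : Q x x <= mu.
  rewrite /QQ -lerBrDr; apply: sm_le_bound; first exact: (h1_dotD H).
  move=> N.
  have c1 : (fun n => \sum_(k < N) D k * (X n k * X n k)) @ U --> \sum_(k < N) D k * (x k * x k).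
    apply: (@cvg_sum_ord _ _ N (fun n k => D k * (X n k * X n k)) (fun k => D k * (x k * x k))) => k.
    by apply: cvgMr; apply: cvgM.
  have c2 : (fun n => mu + n.+1%:R^-1 - sm (fun k => bx b (X n) k * X n k)) @ U -->
     mu + 0 - sm (fun k => bx b x k * x k).
    apply: cvgB; last exact: (cvg_bl hX hx sx).
    apply: cvgD; first exact: cvg_cst.
    by apply: cvg_trans cvg_harmonic; exact: cvg_app.
  rewrite addr0 in c2; apply: (ler_cvg_to c1 c2); apply: nearW => n.
  have [h1 h2 _ h4] := HX n; rewrite lerBrDr; apply: le_trans h4.
  rewrite /QQ lerD2r; apply: psum_le_sm; first exact: (h1_dotD H).
  by move=> k; rewrite mulr_ge0// -expr2 sqr_ge0.
exists x; split=> // y hy oy; have y2 := h1_l2 H hy.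
have [y0|y0] := eqVneq (dot y y) 0.
  by rewrite y0 mulr0 QQ0//; apply: nrm_eq0.
have yy : 0 < dot y y by rewrite lt_def y0 dot_ge0.
rewrite -ler_pdivlMr//; apply: le_trans xmu _; apply: ge_inf.
  by case: Sinf.
exists (fun k => (nrm y)^-1 * y k); split; first exact: (h1Z H).
- rewrite dotZl ?dotZr//; last exact: l2Z.
  by rewrite mulrA -invfM -expr2 nrm_sqr// mulVf.
- by move=> i im; rewrite dotZl ?oy ?mulr0//; exact: hc.
- rewrite (QQZl H) ?(QQZr H)//; last exact: (h1Z H).
  by rewrite mulrA -invfM -expr2 nrm_sqr// mulrC.
Qed.

(** The eigenvalue equation in weak form, together with the two properties from which everything
    else is drawn: minimality on the complement of the earlier eigenvectors, and [E j] tending to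
    infinity. Completeness is derived from them in [spec_total]. *)
Definition spec (E : nat -> R) (e : nat -> nat -> R) :=
  [/\ forall i, h1 D (e i), forall i j, dot (e i) (e j) = (i == j)%:R,
     forall i y, h1 D y -> Q (e i) y = E i * dot (e i) y,
     forall i j, (i <= j)%N -> E i <= E j &
     (forall j y, h1 D y -> ortho e j y -> E j * dot y y <= Q y y) /\
     (forall a, exists J, forall j, (J <= j)%N -> a < E j)].

Definition is_min (e : nat -> nat -> R) j :=
  [/\ h1 D (e j), dot (e j) (e j) = 1, ortho e j (e j) &
    forall y, h1 D y -> ortho e j y -> Q (e j) (e j) * dot y y <= Q y y].

Lemma min_seq : exists e : nat -> nat -> R, forall j, is_min e j.
Proof.
pose P m (c : nat -> nat -> R) := [set x | [/\ h1 D x, dot x x = 1, ortho c m x &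
    forall y, h1 D y -> ortho c m y -> Q x x * dot y y <= Q y y]].
pose pick m c := xget (fun=> 0) (P m c).
(* Each choice depends on all earlier ones, so the recursion produces finite prefixes; [build m] and
   [build i.+1] agree at every [i < m]. *)
pose build := fix build n : nat -> nat -> R :=
  if n is m.+1 then fun i => if i == m then pick m (build m) else build m i
  else fun _ _ => 0.
have bS m i : (i < m)%N -> build m.+1 i = build m i.
  by move=> im; rewrite /= ltn_eqF.
have bE m i : (i < m)%N -> build m i = build i.+1 i.
  elim: m => // m ih; rewrite ltnS leq_eqVlt => /predU1P[->//|im].
  by rewrite bS// ih.
pose e i := build i.+1 i.
have eP j : is_min e j.
  elim/ltn_ind: j => j ih.
  have ob y : ortho (build j) j y <-> ortho e j y.
    by split=> h i ij; have := h i ij; rewrite bE.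
  have : P j (build j) (e j).
    rewrite /e /= eqxx /pick; case: xgetP => [x _ //|] /(_ _)/= no.
    have [|x hx] := @min_exists (build j) j; last by case: (no x).
    by move=> i ij; rewrite bE//; have [h _ _ _] := ih i ij; exact: (h1_l2 H).
  case=> h1 h2 /ob h3 h4; split=> // y hy /ob; exact: h4.
by exists e.
Qed.

Lemma spec_exists : exists E e, spec E e.
Proof.
have [e He] := min_seq; exists (fun j => Q (e j) (e j)), e.
have eh j : h1 D (e j) by case: (He j).
have e2 j : l2 (e j) by apply: (h1_l2 H).
have e1 j : dot (e j) (e j) = 1 by case: (He j).
have eo i j : (i < j)%N -> dot (e j) (e i) = 0 by case: (He j) => _ _ h _; exact: h.
have emin j y : h1 D y -> ortho e j y -> Q (e j) (e j) * dot y y <= Q y y.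
  by case: (He j) => _ _ _; apply.
have eij i j : dot (e i) (e j) = (i == j)%:R.
  case: (ltngtP i j) => [ij|ij|->]; rewrite ?e1//; last by rewrite eo.
  by rewrite dotC eo.
have emono i j : (i <= j)%N -> Q (e i) (e i) <= Q (e j) (e j).
  move=> ij; have := emin i (e j) (eh j); rewrite e1 mulr1; apply=> k ki.
  by apply: eo; apply: leq_trans ij.
(* Minimality yields the equation only for test vectors orthogonal to the earlier eigenvectors. [EL]
   removes the restriction by induction: the component of [y] along the earlier ones contributes
   zero by symmetry. *)
have EL0 j y : h1 D y -> ortho e j y -> Q (e j) y = Q (e j) (e j) * dot (e j) y.
  move=> hy oy; apply/eqP; rewrite -subr_eq0; apply/eqP.
  apply: (@quad_lin_eq0 _ _ (Q y y - Q (e j) (e j) * dot y y)) => t.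
  have hty := h1D H (eh j) (h1Z H t hy).
  have y2 := h1_l2 H hy; have := emin j _ hty; rewrite QQ_quad// dot_quad// e1.
  have oo : ortho e j (fun k => e j k + t * y k).
    move=> i ij; have ty := l2Z t y2.
    by rewrite dotDl// dotZl ?oy ?eo ?mulr0 ?addr0.
  move=> /(_ oo) h; lra.
have EL j y : h1 D y -> Q (e j) y = Q (e j) (e j) * dot (e j) y.
  elim/ltn_ind: j y => j ih y hy.
  pose p k := \sum_(i < j) dot y (e i) * e i k.
  have hp : h1 D p by apply: (h1_sum H) => i; apply: (h1Z H).
  have hyp : h1 D (fun k => y k - p k) by apply: (h1B H).
  have dp (i : 'I_j) : dot p (e i) = dot y (e i).
    rewrite dot_suml//; last by move=> k; apply: l2Z.
    rewrite (bigD1 i)//= dotZl// e1 mulr1 big1 ?addr0// => k ki.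
    by rewrite dotZl// eij (_ : (k == i :> nat) = false) ?mulr0//; apply/negbTE.
  have oyp : ortho e j (fun k => y k - p k).
    have y2 := h1_l2 H hy; have p2 := h1_l2 H hp; move=> i ij; rewrite dotBl//.
    by rewrite (dp (Ordinal ij)) subrr.
  have h1' := EL0 j _ hyp oyp.
  have Qp : Q (e j) p = 0.
    rewrite (QQ_sym H)// (QQ_suml H)//; last by move=> i; apply: (h1Z H).
    rewrite big1// => i _; rewrite (QQZl H)// (ih i)//.
    by rewrite (dotC (e i) (e j)) (eo i j)// !mulr0.
  have dj : dot (e j) p = 0.
    rewrite dot_sumr//; last by move=> i; apply: l2Z.
    by rewrite big1// => i _; rewrite dotZr// eo// mulr0.
  have yE : y = (fun k => (y k - p k) + p k) by apply/funext => k; rewrite subrK.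
  have p2 := h1_l2 H hp; have yp2 := h1_l2 H hyp.
  have dE : dot (e j) y = dot (e j) (fun k => y k - p k).
    by rewrite [in LHS]yE dotDr// dj addr0.
  have QE : Q (e j) y = Q (e j) (fun k => y k - p k).
    by rewrite [in LHS]yE (QQDr H)// Qp addr0.
  by rewrite QE h1' dE.
split=> //; split=> // a.
(* If the eigenvalues were bounded, the orthonormal sequence would be bounded in the form norm and
   converge strongly along an ultrafilter. Its limit would be orthogonal to all of them, hence to
   itself, and yet have norm 1. *)
apply: contrapT => /forallNP no.
have bd j : Q (e j) (e j) <= a.
  have /existsNP[k /not_implyP[jk /negP]] := no j.
  by rewrite -leNgt => h; apply: le_trans (emono _ _ jk) h.
pose C : R := 2 * (a + Qlow D K).
have hX n : h1 D (e n) /\ hn D (e n) <= C.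
  split=> //; have := QQ_lower H (eh n); rewrite e1 mulr1 /C.
  by have := bd n => ? ?; lra.
have [U [UU oU]] := ultra_oo; have UF : Filter U by typeclasses eauto.
have [x [hx hxC cx sx]] := ultra_h1 UU hX.
have x2 := h1_l2 H hx.
have xi i : dot x (e i) = 0.
  have /(_ UF) h := cvg_dotl hX hx sx (e2 i).
  apply: (ulim_unique _ h); apply: cvg_near_cst; apply: oU; exists i.+1 => // n /= ni.
  by rewrite eo.
have x0 : dot x x = 0.
  have /(_ UF) h := cvg_dotl hX hx sx x2.
  apply: (ulim_unique _ h); rewrite (_ : (fun n => _) = fun=> 0); first exact: cvg_cst.
  by apply/funext => n; rewrite dotC xi.
have /(_ UF) h := cvg_dotxx hX hx sx.
have : dot x x = 1.
  apply: (ulim_unique _ h); rewrite (_ : (fun n => _) = fun=> 1); first exact: cvg_cst.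
  by apply/funext => n; rewrite e1.
by rewrite x0 => /esym/eqP; rewrite oner_eq0.
Qed.

End Compactness.

(** * Min-max, trace inequalities and perturbation of eigenvalues *)

Section SpectralConsequences.
Variable R : realType.
Variables (D : nat -> R) (b : nat -> nat -> R) (K : R).
Hypothesis H : adm D b K.
Variables (E : nat -> R) (e : nat -> nat -> R).
Hypothesis S : spec D b E e.
Implicit Types (x y z : nat -> R).
Notation Q := (QQ D b).

Let D0 k : 0 <= D k. Proof. by case: H. Qed.
Let K0 : 0 <= K. Proof. by case: H => _ _ _ []. Qed.
Let b2 k : l2 (b k). Proof. by case: H => _ _ _ [_ /(_ k)[]]. Qed.
Let bK k : dot (b k) (b k) <= K ^+ 2. Proof. by case: H => _ _ _ [_ /(_ k)[]]. Qed.
Let bsym k l : b k l = b l k. Proof. by case: H. Qed.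
Let eh i : h1 D (e i). Proof. by case: S. Qed.
Let e2 i : l2 (e i). Proof. exact: (h1_l2 H). Qed.
Let eij i j : dot (e i) (e j) = (i == j)%:R. Proof. by case: S. Qed.
Let eE i y : h1 D y -> Q (e i) y = E i * dot (e i) y. Proof. by case: S => _ _ h _ _; exact: h. Qed.
Let Em i j : (i <= j)%N -> E i <= E j. Proof. by case: S => _ _ _ h _; exact: h. Qed.
Let Emin j y : h1 D y -> ortho e j y -> E j * dot y y <= Q y y.
Proof. by case: S => _ _ _ _ [h _]; exact: h. Qed.
Let Einf a : exists J, forall j, (J <= j)%N -> a < E j.
Proof. by case: S => _ _ _ _ [_ h]; exact: h. Qed.

Lemma eig_coord i k : D k * e i k + bx b (e i) k = E i * e i k.
Proof.
rewrite -(QQ_delta b k (eh i)) eE; last exact: h1_delta.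
by rewrite dotC dot_delta.
Qed.

Lemma eigE i : Q (e i) (e i) = E i.
Proof. by rewrite eE// eij eqxx mulr1. Qed.

(** A nonzero vector orthogonal to all eigenvectors would have a Rayleigh quotient above every
    [E j]. *)
Lemma spec_total x : h1 D x -> (forall j, dot x (e j) = 0) -> forall k, x k = 0.
Proof.
move=> hx o; have x2 := h1_l2 H hx; apply: nrm_eq0 => //.
apply/eqP; rewrite eq_le dot_ge0// andbT leNgt; apply/negP => xx.
have [J /(_ J (leqnn J))] := Einf (Q x x / dot x x).
rewrite ltr_pdivrMr// ltNge => /negP; apply.
by apply: Emin => // i _.
Qed.

Lemma eigvec_ortho x lam j : h1 D x -> (forall y, h1 D y -> Q x y = lam * dot x y) ->
  E j != lam -> dot x (e j) = 0.
Proof.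
move=> hx hl jl; have h1 := hl _ (eh j); rewrite (QQ_sym H)// eE// dotC in h1.
by apply/eqP; move/eqP: h1; rewrite -subr_eq0 -mulrBl mulf_eq0 subr_eq0 (negPf jl).
Qed.

Lemma span_dot n (c : nat -> R) :
  dot (fun k => \sum_(i < n) c i * e i k) (fun k => \sum_(i < n) c i * e i k) = \sum_(i < n) c i ^+ 2.
Proof.
rewrite dot_suml; [|by move=> i; exact: l2Z|by apply: l2_sum => i; exact: l2Z].
apply: eq_bigr => i _; rewrite dotZl//; last by apply: l2_sum => ?; exact: l2Z.
rewrite dot_sumr//; last by move=> ?; exact: l2Z.
rewrite (bigD1 i)//= dotZr// eij eqxx mulr1 big1 ?addr0// => j ji.
by rewrite dotZr// eij (_ : (i == j :> nat) = false) ?mulr0//; apply/negbTE; rewrite eq_sym.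
Qed.

Lemma span_dotl n (c : nat -> R) y : l2 y ->
  dot (fun k => \sum_(i < n) c i * e i k) y = \sum_(i < n) c i * dot (e i) y.
Proof.
move=> y2; rewrite dot_suml//; last by move=> i; exact: l2Z.
by apply: eq_bigr => i _; rewrite dotZl.
Qed.

Lemma span_h1 n (c : nat -> R) : h1 D (fun k => \sum_(i < n) c i * e i k).
Proof. by apply: (h1_sum H) => i; apply: (h1Z H). Qed.

Lemma span_Ql n (c : nat -> R) y : h1 D y ->
  Q (fun k => \sum_(i < n) c i * e i k) y = \sum_(i < n) c i * (E i * dot (e i) y).
Proof.
move=> hy; rewrite (QQ_suml H)//; last by move=> i; exact: (h1Z H).
by apply: eq_bigr => i _; rewrite (QQZl H)// eE.
Qed.

Lemma span_Q n (c : nat -> R) :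
  Q (fun k => \sum_(i < n) c i * e i k) (fun k => \sum_(i < n) c i * e i k) =
  \sum_(i < n) E i * c i ^+ 2.
Proof.
rewrite span_Ql; last exact: span_h1.
apply: eq_bigr => i _; rewrite dotC span_dotl// (bigD1 i)//= eij eqxx mulr1 big1 ?addr0.
  by ring.
move=> j ji; rewrite eij (_ : (j == i :> nat) = false) ?mulr0//; exact/negbTE.
Qed.

Lemma span_upper n (c : nat -> R) x : x = (fun k => \sum_(i < n.+1) c i * e i k) ->
  Q x x <= E n * dot x x.
Proof.
move=> ->; rewrite span_Q span_dot mulr_sumr; apply: ler_sum => i _.
by rewrite ler_wpM2r ?sqr_ge0// Em// -ltnS.
Qed.

(** The [m] extra functionals [l] serve trial families whose combinations are admissible only after
    [m] linear conditions, such as boundary values; the dimension count then asks for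
    [m + j < n]. *)
Lemma minmax_up n m j (f : 'I_n -> nat -> R) (l : 'I_m -> 'I_n -> R) (M : R) :
  (m + j < n)%N -> (forall i, l2 (f i)) ->
  (forall c : 'I_n -> R, (exists i, c i != 0) -> (forall s, \sum_i c i * l s i = 0) ->
    let x := fun k => \sum_i c i * f i k in
    [/\ h1 D x, 0 < dot x x & Q x x <= M * dot x x]) ->
  E j <= M.
Proof.
move=> mjn f2 h.
pose L (i : 'I_n) (t : 'I_(m + j)) : R :=
  match fintype.split t with inl s => l s i | inr s => dot (f i) (e s) end.
have [c [c0 hc]] := @lin_dep R (m + j) n L mjn.
have hs s : \sum_i c i * l s i = 0.
  rewrite -[RHS](hc (lshift j s)); apply: eq_bigr => i _; rewrite /L.
  by rewrite (unsplitK (inl s)).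
have he (s : 'I_j) : \sum_i c i * dot (f i) (e s) = 0.
  rewrite -[RHS](hc (rshift m s)); apply: eq_bigr => i _; rewrite /L.
  by rewrite (unsplitK (inr s)).
have /= [hx x0 Qx] := h c c0 hs.
rewrite -(ler_pM2r x0); apply: le_trans Qx; apply: Emin => //.
move=> i ij; rewrite dot_suml//; last by move=> k; exact: l2Z.
by rewrite -[RHS](he (Ordinal ij)); apply: eq_bigr => k _; rewrite dotZl.
Qed.

(** Some combination of the first [j + 1] eigenvectors is orthogonal to the [j] test vectors, and
    its Rayleigh quotient is at most [E j]. *)
Lemma maxmin_low j (g : nat -> nat -> R) (M : R) :
  (forall i, (i < j)%N -> l2 (g i)) ->
  (forall x, h1 D x -> ortho g j x -> M * dot x x <= Q x x) -> M <= E j.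
Proof.
move=> g2 h.
have [c [[i0 ci0] hc]] := @lin_dep R j j.+1 (fun i s => dot (e i) (g s)) (ltnSn j).
pose c' i := if (i < j.+1)%N then c (inord i) else 0.
have cc (i : 'I_j.+1) : c' i = c i by rewrite /c' ltn_ord inord_val.
pose x k := \sum_(i < j.+1) c' i * e i k.
have hx : h1 D x by exact: span_h1.
have x0 : 0 < dot x x.
  rewrite span_dot; under eq_bigr do rewrite cc.
  rewrite lt_def sumr_ge0 ?andbT; last by move=> i _; exact: sqr_ge0.
  rewrite psumr_neq0; last by move=> i _; exact: sqr_ge0.
  apply/hasP; exists i0; first exact: mem_index_enum.
  by rewrite /= lt_def sqr_ge0 expf_eq0 /= ci0.
rewrite -(ler_pM2r x0); apply: le_trans (@span_upper j c' x erefl).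
apply: h => // i ij; rewrite span_dotl; last exact: g2.
by rewrite -[RHS](hc (Ordinal ij)); apply: eq_bigr => s _; rewrite cc.
Qed.

Lemma dot_pyth x y : l2 x -> l2 y -> dot x y = 0 ->
  dot (fun k => x k + y k) (fun k => x k + y k) = dot x x + dot y y.
Proof.
move=> hx hy xy; have s2 := l2D hx hy.
by rewrite dotDl// !dotDr// xy addr0 (dotC y) xy add0r.
Qed.

Lemma QQ_pyth x y : h1 D x -> h1 D y -> Q x y = 0 ->
  Q (fun k => x k + y k) (fun k => x k + y k) = Q x x + Q y y.
Proof.
move=> hx hy xy; have s2 := h1D H hx hy.
by rewrite (QQDl H)// !(QQDr H)// xy addr0 (QQ_sym H hy)// xy add0r.
Qed.

Lemma spec_lower N y : h1 D y ->
  \sum_(j < N) E j * dot y (e j) ^+ 2 +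
  E N * (dot y y - \sum_(j < N) dot y (e j) ^+ 2) <= Q y y.
Proof.
move=> hy; have y2 := h1_l2 H hy.
pose c i := dot y (e i).
pose p k := \sum_(i < N) c i * e i k.
have hp : h1 D p by exact: span_h1.
have p2 := h1_l2 H hp.
have hz : h1 D (fun k => y k - p k) by exact: (h1B H).
have z2 := h1_l2 H hz.
have pe (i : nat) : (i < N)%N -> dot p (e i) = c i.
  move=> iN; rewrite span_dotl// (bigD1 (Ordinal iN))//= eij eqxx mulr1 big1 ?addr0//.
  by move=> j ji; rewrite eij (_ : (j == i :> nat) = false) ?mulr0//; apply/negbTE.
have oz : ortho e N (fun k => y k - p k).
  by move=> i iN; rewrite dotBl// pe// subrr.
have pz : dot p (fun k => y k - p k) = 0.
  rewrite span_dotl// big1// => i _.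
  by rewrite dotC oz ?mulr0.
have Qpz : Q p (fun k => y k - p k) = 0.
  rewrite span_Ql// big1// => i _.
  by rewrite dotC oz ?mulr0.
have yE : y = (fun k => p k + (y k - p k)) by apply/funext => k; rewrite addrC subrK.
have yy : dot y y = dot p p + dot (fun k => y k - p k) (fun k => y k - p k).
  have -> : dot y y = dot (fun k => p k + (y k - p k)) (fun k => p k + (y k - p k)).
    by rewrite -yE.
  exact: dot_pyth.
have QQy : Q y y = Q p p + Q (fun k => y k - p k) (fun k => y k - p k).
  have -> : Q y y = Q (fun k => p k + (y k - p k)) (fun k => p k + (y k - p k)).
    by rewrite -yE.
  exact: QQ_pyth.
have pp : dot p p = \sum_(j < N) c j ^+ 2 by exact: span_dot.
have Qp : Q p p = \sum_(j < N) E j * c j ^+ 2 by exact: span_Q.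
rewrite (_ : dot y y - _ = dot (fun k => y k - p k) (fun k => y k - p k)); last first.
  by rewrite yy pp addrAC subrr add0r.
by rewrite QQy Qp lerD2l; exact: Emin.
Qed.

(** The weight [p j], the total squared component of the family along [e j], is at most 1 by Bessel.
    Mass missing at levels below [N] sits at levels no lower than [E N], so the trace cannot drop
    below the sum of the first eigenvalues. *)
Lemma kyfan_upper N (f : 'I_N -> nat -> R) : (forall i, h1 D (f i)) ->
  (forall i j, dot (f i) (f j) = (i == j)%:R) ->
  \sum_(i < N) E i <= \sum_i Q (f i) (f i).
Proof.
move=> fh fo; have f2 i : l2 (f i) by exact: (h1_l2 H).
pose p (j : 'I_N) := \sum_i dot (f i) (e j) ^+ 2.
have p1 j : p j <= 1.
  rewrite -[leRHS](_ : dot (e j) (e j) = 1); last by rewrite eij eqxx.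
  apply: le_trans (bessel f2 (e2 j) fo); apply: ler_sum => i _.
  by rewrite dotC.
apply: (@le_trans _ _ (\sum_(j < N) (E j * p j + E N * (1 - p j)))).
  apply: ler_sum => j _.
  have h : E j <= E N by apply: Em; exact: ltnW.
  have := ler_wpM2r (_ : 0 <= 1 - p j) h; rewrite subr_ge0 => /(_ (p1 j)); lra.
apply: (@le_trans _ _ (\sum_i (\sum_(j < N) E j * dot (f i) (e j) ^+ 2 +
    E N * (dot (f i) (f i) - \sum_(j < N) dot (f i) (e j) ^+ 2)))); last first.
  by apply: ler_sum => i _; apply: spec_lower.
rewrite !big_split/= lerD//.
  rewrite le_eqVlt; apply/orP; left; apply/eqP; rewrite exchange_big/=.
  by apply: eq_bigr => j _; rewrite /p mulr_sumr.
rewrite -!mulr_sumr le_eqVlt; apply/orP; left; apply/eqP; congr (_ * _).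
rewrite !sumrB; congr (_ - _).
  by apply: eq_bigr => i _; rewrite fo eqxx.
by rewrite exchange_big.
Qed.

(** On the span of the first [j + 1] basis vectors the l^1 norm is at most [sqrt (j + 1)] times the
    l^2 norm, which is the only quantity in [bl_bound] that has to be controlled. *)
Lemma eig_upper j : (forall i k, (i <= k)%N -> D i <= D k) ->
  E j <= D j + K * Num.sqrt j.+1%:R.
Proof.
move=> Dm; pose l (s : 'I_0) (i : 'I_j.+1) : R := 0.
apply: (@minmax_up j.+1 0 j (fun i => delta R i) l) => //.
  by move=> i; exact: l2_delta.
move=> c [i0 ci0] _ /=; set x := fun k => _.
have xE (i : 'I_j.+1) : x i = c i.
  rewrite /x (bigD1 i)//= /delta eqxx mulr1 big1 ?addr0// => k ki.
  by rewrite (_ : (i == k :> nat) = false) ?mulr0//; apply/negbTE; rewrite eq_sym.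
have x0 k : (j.+1 <= k)%N -> x k = 0.
  move=> jk; rewrite /x big1// => i _; rewrite /delta gtn_eqF ?mulr0//.
  exact: leq_trans (ltn_ord i) jk.
have hx : h1 D x by exact: (h1_fin D x0).
have x2 := h1_l2 H hx.
have xx : 0 < dot x x.
  rewrite lt_def dot_ge0// andbT; apply/eqP => /(nrm_eq0 x2)/(_ i0).
  by rewrite xE => h; rewrite h eqxx in ci0.
split=> //; rewrite mulrDl /QQ lerD//.
  rewrite -smZ//; apply: ler_sm; [exact: (h1_dotD H)|exact: asmZ|move=> k].
  have [jk|kj] := ltnP j k; first by rewrite x0// !mulr0.
  by rewrite ler_wpM2r ?Dm// -expr2 sqr_ge0.
have s1 : sm (fun k => `|x k|) <= Num.sqrt j.+1%:R * nrm x.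
  pose o k : R := if (k < j.+1)%N then 1 else 0.
  have o2 : l2 o by apply: (@l2_fin _ _ j.+1) => k jk; rewrite /o ltnNge jk.
  have := dot_nrm_abs o2 x2.
  rewrite (_ : sm _ = sm (fun k => `|x k|)); last first.
    apply: eq_sm => k; rewrite /o; have [kj|kj] := ltnP k j.+1; first by rewrite mul1r.
    by rewrite x0// mulr0.
  rewrite (_ : nrm o = Num.sqrt j.+1%:R)// /nrm; congr Num.sqrt.
  rewrite /dot (@sm_fin _ _ j.+1); last by move=> k jk; rewrite /o ltnNge jk mulr0.
  rewrite (eq_bigr (fun=> 1)); last by move=> k _; rewrite /o ltn_ord mulr1.
  by rewrite sumr_const card_ord.
apply: le_trans (ler_norm _) _; apply: le_trans (bl_bound H x2 (h1_l1 H hx)) _.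
rewrite -(nrm_sqr x2) expr2 -!mulrA ler_wpM2l//.
by rewrite [leRHS](_ : _ = nrm x * (Num.sqrt j.+1%:R * nrm x)) ?ler_wpM2l ?nrm_ge0//; ring.
Qed.

(* only the tail beyond j of 1/D enters, which makes the error O(sqrt j) *)
Lemma eig_lower j (T : R) : (forall i k, (i <= k)%N -> D i <= D k) -> 0 < D j -> 0 <= T ->
  (forall n, \sum_(k < n) (D (j + k)%N)^-1 <= T ^+ 2) ->
  K * T <= 2 * Num.sqrt (D j) ->
  D j - K * T * Num.sqrt (D j) <= E j.
Proof.
move=> Dm Dj T0 hT KT.
apply: (@maxmin_low j (fun i => delta R i)); first by move=> i _; exact: l2_delta.
move=> x hx ox; have x2 := h1_l2 H hx.
have xk k : (k < j)%N -> x k = 0 by move=> /ox; rewrite dotC dot_delta.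
pose hh := sm (fun k => D k * (x k * x k)).
have hD := h1_dotD H hx hx.
have hh0 : 0 <= hh by apply: sm_ge0 => // k; rewrite mulr_ge0// -expr2 sqr_ge0.
have Djk k : 0 < D (j + k)%N by apply: lt_le_trans Dj (Dm _ _ (leq_addr _ _)).
have l1 : sm (fun k => `|x k|) <= T * Num.sqrt hh.
  pose a k := (Num.sqrt (D (j + k)%N))^-1.
  pose c k := Num.sqrt (D (j + k)%N) * x (j + k)%N.
  have aa k : a k * a k = (D (j + k)%N)^-1 by rewrite /a -invfM -expr2 sqr_sqrtr// ltW.
  have a2 : l2 a.
    apply: (@asm_bound _ _ (T ^+ 2)) => [k|n]; first by rewrite -expr2 sqr_ge0.
    by under eq_bigr do rewrite aa.
  have ccE k : c k * c k = D (j + k)%N * (x (j + k)%N * x (j + k)%N).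
    by rewrite /c mulrACA -expr2 sqr_sqrtr// ltW.
  have c2 : l2 c by apply: eq_asm (asm_tail j hD) => k; rewrite ccE.
  have aT : nrm a <= T.
    rewrite -(@ler_pXn2r _ 2)// ?nnegrE ?nrm_ge0// nrm_sqr//.
    by apply: sm_le_bound => // n; under eq_bigr do rewrite aa.
  have ch : nrm c = Num.sqrt hh.
    rewrite /nrm; congr Num.sqrt; rewrite /hh (sm_tail j hD) big1 ?add0r.
      by apply: eq_sm => k; rewrite ccE.
    by move=> k _; rewrite xk// !mulr0.
  rewrite (sm_tail j (asm_abs (h1_l1 H hx))) big1 ?add0r; last first.
    by move=> k _; rewrite xk// normr0.
  have := dot_nrm_abs a2 c2; rewrite ch => h.
  apply: le_trans (ler_wpM2r (sqrtr_ge0 _) aT); apply: le_trans h.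
  rewrite le_eqVlt; apply/orP; left; apply/eqP; apply: eq_sm => k.
  by rewrite /a /c mulrA mulVf ?mul1r// gt_eqF// sqrtr_gt0.
have sh : Num.sqrt (D j) * nrm x <= Num.sqrt hh.
  rewrite -sqrtrM ?(ltW Dj)// ler_sqrt// -smZ//; apply: ler_sm => //; first exact: asmZ.
  move=> k; have [kj|jk] := ltnP k j; first by rewrite xk// !mulr0.
  by rewrite ler_wpM2r ?Dm// -expr2 sqr_ge0.
have := bl_bound H x2 (h1_l1 H hx).
rewrite /QQ -/hh; set bb := sm _ => hb.
have {}hb : - bb <= K * nrm x * (T * Num.sqrt hh).
  apply: le_trans (ler_norm _) _; rewrite normrN; apply: le_trans hb _.
  by rewrite ler_wpM2l ?mulr_ge0 ?nrm_ge0.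
rewrite -(nrm_sqr x2); set n := nrm x in sh hb *; set h := Num.sqrt hh in sh hb.
have hE : hh = h ^+ 2 by rewrite sqr_sqrtr.
set s := Num.sqrt (D j) in KT sh *.
have sE : D j = s ^+ 2 by rewrite sqr_sqrtr ?ltW.
have n0 : 0 <= n by exact: nrm_ge0.
have s0 : 0 <= s by exact: sqrtr_ge0.
rewrite hE sE.
(* The quadratic [h ^+ 2 - K * T * n * h] increases for [h >= s * n], because [K * T <= 2 * s]; this
   product is its increment from [s * n] to [h]. *)
have h2 : 0 <= (h - s * n) * (h + s * n - K * T * n).
  apply: mulr_ge0; first by rewrite subr_ge0.
  have := ler_wpM2r n0 KT; lra.
have -> : (s ^+ 2 - K * T * s) * n ^+ 2 = h ^+ 2 - K * n * (T * h) - (h - s * n) * (h + s * n - K * T * n).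
  by ring.
lra.
Qed.

(** Away from [j] the eigenvalue equation bounds [e j k] by [K / g k]. The condition
    [K ^+ 2 * G <= 3 / 4] leaves a quarter of the mass at [j], so the [j]-th equation, whose
    right-hand side pairs [b j] with the small part, can be divided by [e j j]. *)
Lemma scalar_pert j (g : nat -> R) (G : R) :
  (forall k, k != j -> 0 < g k /\ g k <= `|E j - D k|) ->
  (forall n, \sum_(k < n | k != j :> nat) (g k ^+ 2)^-1 <= G) ->
  K ^+ 2 * G <= 3 / 4 ->
  `|E j - D j - b j j| <= 2 * K ^+ 2 * Num.sqrt G.
Proof.
move=> hg hG KG.
have G0 : 0 <= G by apply: le_trans (hG 0%N); rewrite big_ord0.
pose z k := if k == j then 0 else e j k.
have nb k : `|E j - D k| * `|e j k| <= K.
  rewrite -normrM mulrBl -eig_coord addrC addKr.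
  by have := bx_bound H k (e2 j); rewrite /nrm eij eqxx sqrtr1 mulr1.
have zb k : k != j -> z k * z k <= K ^+ 2 * (g k ^+ 2)^-1.
  move=> kj; rewrite /z (negPf kj) -expr2 -sqr_normr ler_pdivlMr; last first.
    by rewrite exprn_gt0//; case: (hg k kj).
  rewrite -exprMn ler_pXn2r ?nnegrE// ?mulr_ge0//; last by case: (hg k kj) => /ltW.
  by apply: le_trans (nb k); rewrite mulrC ler_wpM2r//; case: (hg k kj).
have zs n : \sum_(k < n) z k * z k <= K ^+ 2 * G.
  apply: le_trans (ler_wpM2l (sqr_ge0 K) (hG n)).
  rewrite mulr_sumr big_mkcond [leRHS]big_mkcond/=; apply: ler_sum => k _.
  by case: ifPn => [kj|]; [exact: zb|rewrite negbK /z => ->; rewrite mul0r].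
have z2 : l2 z by apply: asm_bound zs => k; rewrite -expr2 sqr_ge0.
have zz : dot z z <= K ^+ 2 * G by exact: sm_le_bound.
have eE1 : e j = (fun k => z k + e j j * delta R j k).
  apply/funext => k; rewrite /z /delta; case: eqVneq => [->|]; rewrite ?add0r ?mulr1//.
  by rewrite mulr0 addr0.
have d2 : l2 (fun k => e j j * delta R j k) by exact/l2Z/l2_delta.
have zd : dot z (delta R j) = 0 by rewrite dotC dot_delta /z eqxx.
have ejj : 1 / 4 <= e j j ^+ 2.
  have : dot (e j) (e j) = dot z z + e j j ^+ 2.
    rewrite {1 2}eE1 dotDl// ?dotDr//; do ?exact: l2D.
    have dl := l2_delta R j.
    have h1' : dot z (fun k => e j j * delta R j k) = 0 by rewrite dotZr// zd mulr0.
    have h2' : dot (fun k => e j j * delta R j k) (fun k => e j j * delta R j k) = e j j ^+ 2.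
      by rewrite dotZl// dotZr// dot_delta /delta eqxx mulr1 expr2.
    by rewrite h1' (dotC _ z) h1' h2' addr0 add0r.
  rewrite eij eqxx /= => h; have h3 := le_trans zz KG; lra.
have ej : 1 / 2 <= `|e j j|.
  rewrite -(@ler_pXn2r _ 2)// ?nnegrE// sqr_normr; apply: le_trans ejj.
  by rewrite expr2; lra.
have main : (E j - D j - b j j) * e j j = dot (b j) z.
  have := eig_coord j j; rewrite /bx {2}eE1 dotDr//.
  rewrite (dotZr _ (l2_delta R j))// (dotC _ (delta R j)) dot_delta => h.
  by rewrite !mulrBl -h; ring.
have m2 : `|E j - D j - b j j| * (1 / 2) <= K * (K * Num.sqrt G).
  apply: le_trans (ler_wpM2l (normr_ge0 _) ej) _; rewrite -normrM main.
  apply: le_trans (dot_nrm (b2 j) z2) _.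
  have Kn : nrm (b j) <= K.
    by rewrite -(@ler_pXn2r _ 2)// ?nnegrE ?nrm_ge0// nrm_sqr.
  apply: ler_pM => //; rewrite ?nrm_ge0//.
  rewrite -[K]ger0_norm// -sqrtr_sqr -sqrtrM ?sqr_ge0// ler_sqrt//.
  by rewrite mulr_ge0 ?sqr_ge0.
have := m2; rewrite mulrA -expr2; lra.
Qed.

End SpectralConsequences.

Section Perturbation.
Variable R : realType.
Variables (D : nat -> R).

(** The perturbation is measured by the form norm, and on the span of the first eigenvectors
    [QQ_lower] bounds [hn] by [2 * (E j + Qlow)] times the squared l^2 norm. *)
Lemma eig_stable (b b' : nat -> nat -> R) (K K' eta : R) E E' e e' j :
  adm D b K -> adm D b' K' -> spec D b E e -> spec D b' E' e' -> 0 <= eta ->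
  (forall x, h1 D x -> QQ D b' x x <= QQ D b x x + eta * hn D x) ->
  E' j <= E j + 2 * eta * (E j + Qlow D K).
Proof.
move=> H H' S S' eta0 h.
have eh i : h1 D (e i) by case: S.
have e2 i : l2 (e i) by exact: (h1_l2 H).
pose l (s : 'I_0) (i : 'I_j.+1) : R := 0.
apply: (@minmax_up _ _ _ _ H' _ _ S' j.+1 0 j (fun i => e i) l) => //.
move=> c [i0 ci0] _ /=.
pose c' i := if (i < j.+1)%N then c (inord i) else 0.
have cc (i : 'I_j.+1) : c' i = c i by rewrite /c' ltn_ord inord_val.
have -> : (fun k => \sum_(i < j.+1) c i * e i k) = (fun k => \sum_(i < j.+1) c' i * e i k).
  by apply/funext => k; apply: eq_bigr => i _; rewrite cc.
set x := fun k => _.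
have hx : h1 D x by exact: (span_h1 H S).
have xx : 0 < dot x x.
  rewrite (span_dot H S); under eq_bigr do rewrite cc.
  rewrite lt_def sumr_ge0 ?andbT; last by move=> i _; exact: sqr_ge0.
  rewrite psumr_neq0; last by move=> i _; exact: sqr_ge0.
  apply/hasP; exists i0; first exact: mem_index_enum.
  by rewrite /= lt_def sqr_ge0 expf_eq0 /= ci0.
split=> //.
have Qx : QQ D b x x <= E j * dot x x by exact: (span_upper H S (c := c')).
have hl := QQ_lower H hx.
have h2 : hn D x <= 2 * (E j + Qlow D K) * dot x x by lra.
apply: le_trans (h x hx) _; have := ler_wpM2l eta0 h2; lra.
Qed.

Section KyFanLower.
Variables (b : nat -> nat -> R) (K : R).
Hypothesis H : adm D b K.
Variables (E : nat -> R) (e : nat -> nat -> R).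
Hypothesis S : spec D b E e.
Notation Q := (QQ D b).
Let D0 k : 0 <= D k. Proof. by case: H. Qed.
Let K0 : 0 <= K. Proof. by case: H => _ _ _ []. Qed.
Let b2 k : l2 (b k). Proof. by case: H => _ _ _ [_ /(_ k)[]]. Qed.
Let bK k : dot (b k) (b k) <= K ^+ 2. Proof. by case: H => _ _ _ [_ /(_ k)[]]. Qed.
Let bsym k l : b k l = b l k. Proof. by case: H. Qed.
Let eh i : h1 D (e i). Proof. by case: S. Qed.
Let e2 i : l2 (e i). Proof. exact: (h1_l2 H). Qed.
Let eij i j : dot (e i) (e j) = (i == j)%:R. Proof. by case: S. Qed.

Variables (N : nat) (c g T : R).
Hypothesis lowD : forall k, (k < N)%N -> D k + K * Num.sqrt N%:R <= c.
Hypothesis g0 : 0 < g.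
Hypothesis highD : forall l, g <= D (N + l)%N - c.
Hypothesis hT : forall n, \sum_(l < n) (D (N + l)%N - c)^-1 <= T.
Hypothesis KT : 16 * K ^+ 2 * T <= g.

Let y i k := if (k < N)%N then e i k else 0.
Let z i k := if (k < N)%N then 0 else e i k.
Let t l := D (N + l)%N - c.
Let t0 l : 0 < t l. Proof. by apply: lt_le_trans g0 (highD l). Qed.
Let T0 : 0 <= T. Proof. by apply: le_trans (hT 0); rewrite big_ord0. Qed.
Let yh i : h1 D (y i).
Proof. by apply: (@h1_fin _ _ _ N) => k Nk; rewrite /y ltnNge Nk. Qed.
Let yzE i : e i = (fun k => y i k + z i k).
Proof. by apply/funext => k; rewrite /y /z; case: ifP; rewrite ?addr0 ?add0r. Qed.
Let zh i : h1 D (z i).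
Proof.
have := h1B H (eh i) (yh i); apply: eq_asm => k.
by rewrite /y /z; case: ifP; rewrite ?subrr ?subr0.
Qed.
Let y2 i : l2 (y i). Proof. exact: (h1_l2 H). Qed.
Let z2 i : l2 (z i). Proof. exact: (h1_l2 H). Qed.
Let zN i l : z i (N + l)%N = e i (N + l)%N.
Proof. by rewrite /z ltnNge leq_addr. Qed.
Let zlow i k : (k < N)%N -> z i k = 0. Proof. by rewrite /z => ->. Qed.
Let sm_z i (f : nat -> R) : asm (fun k => f k * z i k) ->
  sm (fun k => f k * z i k) = sm (fun l => f (N + l)%N * e i (N + l)%N).
Proof.
move=> hf; rewrite (sm_tail N hf) big1 ?add0r; last by move=> k _; rewrite zlow// mulr0.
by apply: eq_sm => l; rewrite zN.
Qed.
Let W i := sm (fun l => t l * (e i (N + l)%N * e i (N + l)%N)).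
Let Wasm i : asm (fun l => t l * (e i (N + l)%N * e i (N + l)%N)).
Proof.
have h1 := asm_tail N (h1_dotD H (eh i) (eh i)).
have h2 := asmZ c (asm_tail N (e2 i)).
by apply: eq_asm (asmB h1 h2) => l; rewrite /t mulrBl.
Qed.
Let zz i : dot (z i) (z i) = sm (fun l => e i (N + l)%N * e i (N + l)%N).
Proof.
rewrite /dot (@sm_z i (z i)); last exact: z2.
by apply: eq_sm => l; rewrite zN.
Qed.
Let W0 i : 0 <= W i.
Proof. by apply: sm_ge0 => // l; rewrite mulr_ge0 ?(ltW (t0 l))// -expr2 sqr_ge0. Qed.
Let tV : asm (fun l => (t l)^-1).
Proof. by apply: asm_bound hT => l; rewrite invr_ge0 ltW. Qed.

(** The hypothesis [16 * K ^+ 2 * T <= g] is what bounds the perturbation on the high part by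
    [W i / 4]. *)
Let Qz i : c * dot (z i) (z i) + 3 / 4 * W i <= Q (z i) (z i).
Proof.
have e1 : sm (fun k => D k * (z i k * z i k)) = c * dot (z i) (z i) + W i.
  rewrite zz -smZ; last exact: asm_tail (e2 i).
  rewrite /W -smD; [|exact/asmZ/(asm_tail N (e2 i))|exact: Wasm].
  have h := h1_dotD H (zh i) (zh i).
  rewrite (_ : (fun k => _) = (fun k => D k * z i k * z i k)) in h *; last first.
    by apply/funext => k; rewrite mulrA.
  rewrite sm_z//; apply: eq_sm => l; rewrite zN /t; ring.
have n2 : nrm (z i) ^+ 2 <= W i / g.
  rewrite nrm_sqr// zz ler_pdivlMr// mulrC -smZ; last exact: asm_tail (e2 i).
  apply: ler_sm; [exact/asmZ/(asm_tail N (e2 i))|exact: Wasm|move=> l].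
  by rewrite ler_wpM2r ?highD// -expr2 sqr_ge0.
have n1 : sm (fun k => `|z i k|) ^+ 2 <= T * W i.
  pose a l := (Num.sqrt (t l))^-1; pose d l := Num.sqrt (t l) * e i (N + l)%N.
  have aa l : a l * a l = (t l)^-1 by rewrite /a -invfM -expr2 sqr_sqrtr// ltW.
  have dd l : d l * d l = t l * (e i (N + l)%N * e i (N + l)%N).
    by rewrite /d mulrACA -expr2 sqr_sqrtr// ltW.
  have a2 : l2 a by apply: eq_asm tV => l; rewrite aa.
  have d2 : l2 d by apply: eq_asm (Wasm i) => l; rewrite dd.
  have := cauchy_schwarz_abs a2 d2.
  rewrite (_ : sm _ = sm (fun k => `|z i k|)); last first.
    rewrite [RHS](sm_tail N); last exact/asm_abs/(h1_l1 H).
    rewrite big1 ?add0r; last by move=> k _; rewrite zlow// normr0.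
    apply: eq_sm => l; rewrite zN /a /d mulrA mulVf ?mul1r// gt_eqF// sqrtr_gt0.
    exact: t0.
  rewrite (_ : dot d d = W i); last by apply: eq_sm => l; rewrite dd.
  move=> /le_trans; apply; rewrite ler_wpM2r// /dot; under eq_sm do rewrite aa.
  exact: sm_le_bound.
have := bl_bound H (z2 i) (h1_l1 H (zh i)).
rewrite /QQ e1; set bb := sm (fun k => bx b _ k * _).
set s1 := sm _ in n1 *; set n := nrm _ in n2 *; move=> hb.
have s10 : 0 <= s1 by apply: sm_ge0 => //; exact/asm_abs/(h1_l1 H).
have nn0 : 0 <= n by exact: nrm_ge0.
have b4 : K * n * s1 <= W i / 4.
  rewrite -(@ler_pXn2r _ 2)// ?nnegrE ?mulr_ge0//.
  have h1 : (K * n * s1) ^+ 2 <= K ^+ 2 * (W i / g) * (T * W i).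
    by rewrite !exprMn ler_pM ?mulr_ge0 ?sqr_ge0// ler_wpM2l ?sqr_ge0.
  apply: le_trans h1 _.
  have h2 : 16 * (K ^+ 2 * T) / g <= 1 by rewrite ler_pdivrMr// mul1r mulrA.
  have := ler_wpM2r (sqr_ge0 (W i)) h2.
  rewrite (_ : K ^+ 2 * (W i / g) * (T * W i) = 16 * (K ^+ 2 * T) / g * W i ^+ 2 / 16).
    by rewrite (_ : (W i / 4) ^+ 2 = W i ^+ 2 / 16); [lra|field].
  by field; rewrite gt_eqF.
have h3 := le_trans (ler_norm (- bb)) _; rewrite normrN in h3.
have := h3 _ hb; lra.
Qed.

Let A i := sm (fun l => bx b (y i) (N + l)%N ^+ 2 / t l).
Let bxy_bound i k : bx b (y i) k ^+ 2 <= K ^+ 2.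
Proof.
have y1 : dot (y i) (y i) <= 1.
  rewrite -[leRHS](_ : dot (e i) (e i) = 1); last by rewrite eij eqxx.
  by apply: dot_sqr_le => // j; rewrite /y; case: ifP; rewrite ?normr0.
apply: le_trans (cauchy_schwarz (b2 k) (y2 i)) _.
rewrite -[leRHS]mulr1; apply: ler_pM => //; exact: dot_ge0.
Qed.
Let Aasm i : asm (fun l => bx b (y i) (N + l)%N ^+ 2 / t l).
Proof.
apply: asm_le (asmZ (K ^+ 2) tV) => l.
rewrite [leLHS]normrM [leRHS]normrM ler_wpM2r// ger0_norm ?sqr_ge0//.
by rewrite ger0_norm ?sqr_ge0.
Qed.

(** The diagonal part vanishes by disjoint supports. For the rest a square is completed in each
    coordinate, at the price of another quarter of [W i]. *)
Let Qyz i : - (W i / 4) - 4 * A i <= 2 * Q (y i) (z i).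
Proof.
have d0 : sm (fun k => D k * (y i k * z i k)) = 0.
  rewrite -[RHS](sm0 R); apply: eq_sm => k.
  by rewrite /y /z; case: ifP; rewrite ?mul0r ?mulr0.
have hb := bl_asm H (y2 i) (h1_l1 H (zh i)).
rewrite /QQ d0 add0r sm_z// -smZ; last by apply: eq_asm (asm_tail N hb) => l; rewrite zN.
rewrite -[X in - X - _]mulrC -!smZ//; do ?exact: Wasm; do ?exact: Aasm.
rewrite -smN; last exact/asmZ/Wasm.
rewrite -smB; [|exact/asmN/asmZ/Wasm|exact/asmZ/Aasm].
apply: ler_sm.
- by apply: asmB; [exact/asmN/asmZ/Wasm|exact/asmZ/Aasm].
- by apply: asmZ; apply: eq_asm (asm_tail N hb) => l; rewrite zN.
move=> l; have tl := t0 l; set u := bx b _ _; set v := e i _.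
have : 0 <= (t l * v / 2 + 2 * u) ^+ 2 / t l by rewrite divr_ge0 ?sqr_ge0 ?ltW.
rewrite (_ : _ / t l = 4^-1 * (t l * (v * v)) + 2 * (u * v) + 4 * (u ^+ 2 / t l)); first lra.
by field; rewrite gt_eqF.
Qed.

(** Bessel in [i], applied to each truncated row, replaces the sum over [N] eigenvectors by a single
    [K ^+ 2]. *)
Let sumA : \sum_(i < N) A i <= K ^+ 2 * T.
Proof.
rewrite -sm_sum; last by move=> i; exact: Aasm.
apply: (@le_trans _ _ (sm (fun l => K ^+ 2 * (t l)^-1))); last first.
  by rewrite smZ// ler_wpM2l ?sqr_ge0//; exact: sm_le_bound.
apply: ler_sm; [by apply: asm_sum => i; exact: Aasm|exact: asmZ|move=> l].
rewrite -mulr_suml ler_wpM2r ?invr_ge0 ?(ltW (t0 l))//.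
pose bl k := if (k < N)%N then b (N + l)%N k else 0.
have bb k : `|bl k| <= `|b (N + l)%N k| by rewrite /bl; case: ifP; rewrite ?normr0.
have bl2 : l2 bl by exact: l2_le (b2 (N + l)%N) bb.
apply: (@le_trans _ _ (dot bl bl)); last first.
  by apply: le_trans (bK (N + l)%N); apply: dot_sqr_le.
apply: le_trans (@bessel _ 'I_N (fun i => e i) bl _ bl2 _) => //.
by apply: ler_sum => i _; rewrite le_eqVlt; apply/orP; left; apply/eqP; congr (_ ^+ 2);
  apply: eq_sm => k; rewrite /bl /y; case: ifP; rewrite ?mul0r ?mulr0.
Qed.

(** [P] is the matrix of the projection onto the first [N] eigenvectors and [rho k] the component of
    the [k]-th basis vector orthogonal to them, so that [1 - P] is the Gram matrix of the
    [rho k]. *)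
Let P k l := \sum_(i < N) e i k * e i l.
Let rho k j := delta R k j - \sum_(i < N) e i k * e i j.
Let rho2 k : l2 (rho k).
Proof. by apply: l2B; [exact: l2_delta|apply: l2_sum => i; exact: l2Z]. Qed.
Let rhoX k l : dot (rho k) (rho l) = (k == l)%:R - P k l.
Proof.
have s2 k' : l2 (fun j => \sum_(i < N) e i k' * e i j) by apply: l2_sum => i; exact: l2Z.
have dl k' := l2_delta R k'.
have rl := rho2 l.
have pd : dot (fun j => \sum_(i < N) e i k * e i j) (fun j => \sum_(i < N) e i l * e i j) = P k l.
  rewrite dot_suml//; last by move=> i; exact: l2Z.
  apply: eq_bigr => i _; rewrite dotZl// dot_sumr//; last by move=> j; exact: l2Z.
  rewrite (bigD1 i)//= dotZr// eij eqxx mulr1 big1 ?addr0// => j ji.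
  by rewrite dotZr// eij (_ : (i == j :> nat) = false) ?mulr0//; apply/negbTE; rewrite eq_sym.
rewrite [LHS](dotBl (dl k) (s2 k) rl) !(dotBr (dl l) (s2 l))// pd !dot_delta.
rewrite (dotC _ (delta R l)) dot_delta /delta -/(P k l) subrr subr0.
by congr (_ - _); apply: eq_bigr => i _; rewrite mulrC.
Qed.
Let X k := 1 - P k k.
Let XE k : X k = dot (rho k) (rho k). Proof. by rewrite rhoX eqxx. Qed.
Let X0 k : 0 <= X k. Proof. by rewrite XE dot_ge0. Qed.
Let tau := \sum_(k < N) X k.
Let tau_z : tau = \sum_(i < N) dot (z i) (z i).
Proof.
rewrite /tau /X /P sumrB [X in _ - X]exchange_big/= -sumrB.
apply: eq_bigr => i _; rewrite zz -[1](_ : dot (e i) (e i) = 1); last by rewrite eij eqxx.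
by rewrite /dot (sm_tail N (e2 i)) addrC addKr.
Qed.

(** A Gram entry is at most the product of two lengths. Summed against rows of norm [K] over [N]
    indices, these products cost [K * sqrt N] times the trace [tau]. *)
Let lowb : `|\sum_(k < N) \sum_(l < N) b k l * ((k == l)%:R - P k l)| <= K * Num.sqrt N%:R * tau.
Proof.
pose s k := if (k < N)%N then Num.sqrt (X k) else 0.
have s0 k : 0 <= s k by rewrite /s; case: ifP; rewrite ?sqrtr_ge0.
have s2 : l2 s by apply: (@l2_fin _ _ N) => k Nk; rewrite /s ltnNge Nk.
have ss : dot s s = tau.
  rewrite /dot (@sm_fin _ _ N); last by move=> k Nk; rewrite /s ltnNge Nk mulr0.
  by apply: eq_bigr => k _; rewrite /s ltn_ord -expr2 sqr_sqrtr.
have st : nrm s ^+ 2 = tau by rewrite nrm_sqr.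
have fin (f : nat -> R) : \sum_(k < N) f k * s k = dot f s.
  by rewrite /dot (@sm_fin _ _ N)// => k Nk; rewrite /s ltnNge Nk mulr0.
have sum_s : \sum_(k < N) s k <= Num.sqrt N%:R * nrm s.
  pose o k : R := if (k < N)%N then 1 else 0.
  have o2 : l2 o by apply: (@l2_fin _ _ N) => k Nk; rewrite /o ltnNge Nk.
  have := le_trans (ler_norm _) (dot_nrm o2 s2); rewrite -fin.
  rewrite (eq_bigr (fun k : 'I_N => s k)); last by move=> k _; rewrite /o ltn_ord mul1r.
  rewrite (_ : nrm o = Num.sqrt N%:R)// /nrm; congr Num.sqrt.
  rewrite /dot (@sm_fin _ _ N); last by move=> k Nk; rewrite /o ltnNge Nk mulr0.
  rewrite (eq_bigr (fun=> 1)); last by move=> k _; rewrite /o ltn_ord mulr1.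
  by rewrite sumr_const card_ord.
have Xs (k l : 'I_N) : `|(k == l)%:R - P k l| <= s k * s l.
  rewrite -rhoX; apply: le_trans (dot_nrm (rho2 k) (rho2 l)) _.
  by rewrite /nrm -!XE /s !ltn_ord.
have row (k : 'I_N) : \sum_(l < N) `|b k l| * s l <= K * nrm s.
  rewrite (fin (fun l => `|b k l|)); apply: le_trans (ler_norm _) _.
  apply: le_trans (dot_nrm (l2_abs (b2 k)) s2) _; rewrite ler_wpM2r ?nrm_ge0//.
  rewrite -(@ler_pXn2r _ 2)// ?nnegrE ?nrm_ge0// nrm_sqr; last exact: l2_abs.
  by apply: le_trans (bK k); apply: dot_sqr_le => // l; rewrite normr_id.
apply: le_trans (ler_norm_sum _ _ _) _.
apply: (@le_trans _ _ (\sum_(k < N) s k * (K * nrm s))).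
  apply: ler_sum => k _; apply: le_trans (ler_norm_sum _ _ _) _.
  apply: le_trans (ler_wpM2l (s0 k) (row k)); rewrite mulr_sumr; apply: ler_sum => l _.
  by rewrite normrM mulrCA ler_wpM2l.
rewrite -mulr_suml; apply: le_trans (ler_wpM2r _ sum_s) _; first by rewrite mulr_ge0 ?nrm_ge0.
by rewrite -st le_eqVlt; apply/orP; left; apply/eqP; ring.
Qed.

Let Qy : \sum_(k < N) (D k + b k k) - c * tau <= \sum_(i < N) Q (y i) (y i).
Proof.
have Qi i : Q (y i) (y i) = \sum_(k < N) D k * (e i k * e i k) +
    \sum_(k < N) \sum_(l < N) b k l * (e i k * e i l).
  rewrite /QQ (@sm_fin _ _ N); last by move=> k Nk; rewrite /y ltnNge Nk !mulr0.
  congr (_ + _); first by apply: eq_bigr => k _; rewrite /y ltn_ord.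
  rewrite (@sm_fin _ _ N); last by move=> k Nk; rewrite /y ltnNge Nk !mulr0.
  apply: eq_bigr => k _; rewrite /bx /dot (@sm_fin _ _ N); last first.
    by move=> l Nl; rewrite /y [(l < N)%N]ltnNge Nl mulr0.
  by rewrite mulr_suml; apply: eq_bigr => l _; rewrite /y !ltn_ord; ring.
have -> : \sum_(i < N) Q (y i) (y i) = \sum_(i < N) (\sum_(k < N) D k * (e i k * e i k) +
    \sum_(k < N) \sum_(l < N) b k l * (e i k * e i l)).
  by apply: eq_bigr => i _; exact: Qi.
rewrite [leRHS]big_split/= [X in _ <= X + _]exchange_big/=.
rewrite [X in _ <= _ + X]exchange_big/=.
have -> : \sum_(k < N) \sum_(i < N) D k * (e i k * e i k) = \sum_(k < N) D k - \sum_(k < N) D k * X k.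
  rewrite -sumrB; apply: eq_bigr => k _; rewrite -mulr_sumr /X /P; ring.
have -> : \sum_(k < N) \sum_(i < N) \sum_(l < N) b k l * (e i k * e i l) =
    \sum_(k < N) b k k - \sum_(k < N) \sum_(l < N) b k l * ((k == l)%:R - P k l).
  rewrite -sumrB; apply: eq_bigr => k _; rewrite exchange_big/=.
  have -> : b k k = \sum_(l < N) b k l * (k == l)%:R.
    rewrite (bigD1 k)//= eqxx mulr1 big1 ?addr0// => l lk.
    by rewrite eq_sym (negPf lk) mulr0.
  rewrite -sumrB; apply: eq_bigr => l _.
  by rewrite mulrBr subKr /P mulr_sumr.
have h1 := le_trans (ler_norm _) lowb.
have h2 : \sum_(k < N) D k * X k <= (c - K * Num.sqrt N%:R) * tau.
  rewrite /tau mulr_sumr; apply: ler_sum => k _; rewrite ler_wpM2r//.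
  by have := lowD (ltn_ord k); lra.
rewrite big_split/=; lra.
Qed.

(** Each eigenvector is cut at [N]. The mass [tau] beyond [N] costs the low block at most [c * tau],
    since [c] exceeds its diagonal by [K * sqrt N], and the high part returns at least [c * tau].
    Only the cross terms remain, of total size [4 * K ^+ 2 * T]. *)
Lemma kyfan_lower : \sum_(k < N) (D k + b k k) - 4 * K ^+ 2 * T <= \sum_(i < N) E i.
Proof.
have EQ i : E i = Q (y i) (y i) + 2 * Q (y i) (z i) + Q (z i) (z i).
  rewrite -(eigE S i) {1 2}yzE (QQDl H)// ?(QQDr H)//; last exact: (h1D H).
  by rewrite (QQ_sym H (zh i))//; ring.
have h i : Q (y i) (y i) + c * dot (z i) (z i) - 4 * A i <= E i.
  rewrite EQ; have := Qz i; have := Qyz i; have := W0 i; lra.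
apply: (@le_trans _ _ (\sum_(i < N) (Q (y i) (y i) + c * dot (z i) (z i) - 4 * A i)));
  last by apply: ler_sum.
have -> : \sum_(i < N) (Q (y i) (y i) + c * dot (z i) (z i) - 4 * A i) =
    \sum_(i < N) Q (y i) (y i) + c * tau - 4 * \sum_(i < N) A i.
  have gen (f1 f2 f3 : nat -> R) : \sum_(i < N) (f1 i + c * f2 i - 4 * f3 i) =
      \sum_(i < N) f1 i + c * \sum_(i < N) f2 i - 4 * \sum_(i < N) f3 i.
    by rewrite sumrB big_split/= -!mulr_sumr.
  by rewrite tau_z; exact: (gen (fun i => Q (y i) (y i)) (fun i => dot (z i) (z i)) A).
have := Qy; have := sumA; lra.
Qed.

End KyFanLower.
End Perturbation.

(** * Continuity of the eigenvalues under weak convergence *)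

Section WeakContinuity.
Variable R : realType.
Variables (D : nat -> R) (K : R).
Hypothesis D0 : forall k, 0 <= D k.
Hypothesis DV : asm (fun k => (1 + D k)^-1).
Hypothesis Dm : forall i k, (i <= k)%N -> D i <= D k.

Let W0 k : 0 < 1 + D k. Proof. by rewrite ltr_pwDl. Qed.
Definition low L (x : nat -> R) k := if (k < L)%N then x k else 0.
Definition high L (x : nat -> R) k := if (k < L)%N then 0 else x k.
Definition theta_tail L := sm (fun k => (1 + D (L + k)%N)^-1).

Lemma high_l1 (x : nat -> R) L : h1 D x -> asm (high L x) /\
  sm (fun k => `|high L x k|) ^+ 2 <= hn D x * theta_tail L.
Proof.
move=> hx.
pose u k := Num.sqrt (1 + D k) * x k.
pose v k := if (k < L)%N then 0 else (Num.sqrt (1 + D k))^-1.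
have s0 k : Num.sqrt (1 + D k) != 0 by rewrite sqrtr_eq0 -ltNge.
have ss k : Num.sqrt (1 + D k) * Num.sqrt (1 + D k) = 1 + D k by rewrite -expr2 sqr_sqrtr// ltW.
have uu k : u k * u k = (1 + D k) * (x k * x k) by rewrite -[X in _ = X * _]ss /u; ring.
have u2 : l2 u by apply: eq_asm hx => k; rewrite uu.
have uE : dot u u = hn D x by apply: eq_sm => k; rewrite uu.
have vv k : v k * v k = if (k < L)%N then 0 else (1 + D k)^-1.
  by rewrite /v; case: ifP => _; rewrite ?mulr0// -invfM ss.
have v2 : l2 v.
  apply: asm_le DV => k; rewrite vv; case: ifP => _ //; rewrite normr0//.
have vE : dot v v = theta_tail L.
  rewrite /dot (sm_tail L v2) big1 ?add0r; last by move=> k _; rewrite vv ltn_ord.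
  by apply: eq_sm => k; rewrite vv ltnNge leq_addr.
have zE k : high L x k = u k * v k.
  by rewrite /high /u /v; case: ifP => _; rewrite ?mulr0// mulrAC mulfV// mul1r.
split; first by apply: eq_asm (l2_dot u2 v2) => k; rewrite zE.
have := cauchy_schwarz_abs u2 v2; rewrite uE vE.
by rewrite (_ : (fun k => `|u k * v k|) = (fun k => `|high L x k|))//; apply/funext => k; rewrite zE.
Qed.

Lemma mean_double_sum (c : R) L (f : nat -> R) :
  \sum_(k < L) \sum_(l < L) c * ((f l + f k) / 2) = c * L%:R * \sum_(l < L) f l.
Proof.
have h (k : 'I_L) : \sum_(l < L) c * ((f l + f k) / 2) = c / 2 * (\sum_(l < L) f l) + L%:R * (c / 2 * f k).
  rewrite (eq_bigr (fun l : 'I_L => c / 2 * f l + c / 2 * f k)); last by move=> l _; ring.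
  by rewrite big_split/= -mulr_sumr sumr_const card_ord mulr_natl.
rewrite (eq_bigr _ (fun k _ => h k)) big_split/= -!mulr_sumr sumr_const card_ord.
by rewrite -[X in c / 2 * X]mulr_natl; field.
Qed.

(** The form is split at [L]. The low blocks differ by at most [eta * L] times [hn]; every term with
    a high index is bounded through the l^1 norm of the high part, which is at most [eps] times the
    root of [hn]. Three such terms for each of the two matrices give [6 * K * eps]. *)
Lemma form_diff b b' (eta eps : R) L x : adm D b K -> adm D b' K -> h1 D x -> 0 <= eta -> 0 <= eps ->
  (forall k l, (k < L)%N -> (l < L)%N -> `|b' k l - b k l| <= eta) -> theta_tail L <= eps ^+ 2 ->
  QQ D b' x x <= QQ D b x x + (eta * L%:R + 6 * K * eps) * hn D x.
Proof.
move=> H H' hx eta0 eps0 hb ht.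
have K0 : 0 <= K by case: H => _ _ _ [].
pose y := low L x; pose z := high L x.
have hy : h1 D y by apply: (@h1_fin _ _ _ L) => k Lk; rewrite /y /low ltnNge Lk.
have xyz k : x k = y k + z k by rewrite /y /z /low /high; case: ifP => _; rewrite ?addr0 ?add0r.
have hz : h1 D z.
  by apply: eq_asm (h1B H hx hy) => k; rewrite xyz; ring.
have x2 := h1_l2 H hx; have y2 := h1_l2 H hy; have z2 := h1_l2 H hz.
have hn0 := hn_ge0 H hx.
have nx : nrm x <= Num.sqrt (hn D x).
  rewrite /nrm ler_sqrt//; apply: ler_sm => // k; rewrite ler_peMl -?expr2 ?sqr_ge0// lerDl//.
have ny : nrm y <= Num.sqrt (hn D x).
  apply: le_trans nx; rewrite /nrm ler_sqrt ?dot_ge0//; apply: dot_sqr_le => // k.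
  by rewrite /y /low; case: ifP => _; rewrite ?normr0.
have nz : nrm z <= Num.sqrt (hn D x).
  apply: le_trans nx; rewrite /nrm ler_sqrt ?dot_ge0//; apply: dot_sqr_le => // k.
  by rewrite /z /high; case: ifP => _; rewrite ?normr0.
have [z1 zb] := high_l1 L hx; rewrite -/z in z1 zb.
have zl : sm (fun k => `|z k|) <= Num.sqrt (hn D x) * eps.
  rewrite -(@ler_pXn2r _ 2)// ?nnegrE ?mulr_ge0 ?sqrtr_ge0//; last by apply: sm_ge0 => //; exact: asm_abs.
  by rewrite exprMn sqr_sqrtr//; apply: le_trans zb _; rewrite ler_wpM2l.
have sh : Num.sqrt (hn D x) * Num.sqrt (hn D x) = hn D x by rewrite -expr2 sqr_sqrtr.
have sh0 := sqrtr_ge0 (hn D x).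
pose bl (c : nat -> nat -> R) (u v : nat -> R) := sm (fun k => bx c u k * v k).
have blz c u : adm D c K -> l2 u -> nrm u <= Num.sqrt (hn D x) -> `|bl c u z| <= K * eps * hn D x.
  move=> Hc u2 nu; apply: le_trans (bl_bound Hc u2 z1) _; rewrite -!mulrA ler_wpM2l//.
  rewrite (_ : eps * hn D x = Num.sqrt (hn D x) * (Num.sqrt (hn D x) * eps)); last by rewrite mulrA sh mulrC.
  apply: ler_pM; rewrite ?nrm_ge0//; apply: sm_ge0 => //; exact: asm_abs.
have Qx c : adm D c K -> QQ D c x x = sm (fun k => D k * (x k * x k)) + bl c y y + 2 * bl c y z + bl c z z.
  move=> Hc; rewrite /QQ -!addrA; congr (_ + _).
  have y1 := h1_l1 Hc hy; have x1 := h1_l1 Hc hx.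
  have A u v : l2 u -> asm v -> asm (fun k => bx c u k * v k) by move=> *; apply: (bl_asm Hc).
  have bD k : bx c x k = bx c y k + bx c z k.
    rewrite /bx -dotDr//; last by case: Hc => _ _ _ [_ /(_ k)[]].
    by congr dot; apply/funext.
  rewrite (@eq_sm _ _ (fun k => bx c y k * y k + (bx c y k * z k + (bx c z k * y k + bx c z k * z k)))); last first.
    by move=> k; rewrite bD {1}(xyz k); ring.
  have Ayy := A _ _ y2 y1; have Ayz := A _ _ y2 z1; have Azy := A _ _ z2 y1; have Azz := A _ _ z2 z1.
  rewrite smD//; last by apply: asmD => //; exact: asmD.
  rewrite smD//; last exact: asmD.
  rewrite smD// (bl_sym Hc z2 z1 y2 y1) /bl; ring.
have low_sum c : adm D c K -> bl c y y = \sum_(k < L) \sum_(l < L) c k l * x l * x k.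
  move=> Hc; rewrite /bl (@sm_fin _ _ L); last by move=> k Lk; rewrite /y /low ltnNge Lk mulr0.
  apply: eq_bigr => k _; rewrite /bx /dot (@sm_fin _ _ L); last by move=> l Ll; rewrite /y /low ltnNge Ll mulr0.
  by rewrite mulr_suml; apply: eq_bigr => l _; rewrite /y /low !ltn_ord.
have ld : `|bl b' y y - bl b y y| <= eta * L%:R * hn D x.
  rewrite !low_sum// -sumrB; apply: le_trans (ler_norm_sum _ _ _) _.
  apply: (@le_trans _ _ (\sum_(k < L) \sum_(l < L) eta * (`|x l| * `|x k|))).
    apply: ler_sum => k _; rewrite -sumrB; apply: le_trans (ler_norm_sum _ _ _) _.
    apply: ler_sum => l _; rewrite -!mulrBl -!mulrA normrM normrM ler_wpM2r ?mulr_ge0//.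
    exact: hb.
  apply: (@le_trans _ _ (\sum_(k < L) \sum_(l < L) eta * ((x l * x l + x k * x k) / 2))).
    apply: ler_sum => k _; apply: ler_sum => l _; rewrite ler_wpM2l//.
    have := sqr_ge0 (`|x l| - `|x k|); rewrite -!expr2 -(sqr_normr (x l)) -(sqr_normr (x k)) => h.
    rewrite ler_pdivlMr//; nra.
  rewrite (mean_double_sum eta L (fun l => x l * x l)).
  have s1 : \sum_(l < L) x l * x l <= hn D x.
    apply: (@le_trans _ _ (dot x x)); first by apply: psum_le_sm => // k; rewrite -expr2 sqr_ge0.
    by apply: ler_sm => // k; rewrite ler_peMl -?expr2 ?sqr_ge0// lerDl.
  by rewrite ler_wpM2l// mulr_ge0.
have b1 := blz _ _ H y2 ny; have b2 := blz _ _ H z2 nz; have b3 := blz _ _ H' y2 ny; have b4 := blz _ _ H' z2 nz.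
rewrite (Qx _ H) (Qx _ H').
rewrite !ler_norml in b1 b2 b3 b4 ld; case/andP: b1 => ? ?; case/andP: b2 => ? ?; case/andP: b3 => ? ?; case/andP: b4 => ? ?; case/andP: ld => ? ?.
lra.
Qed.

(** A common [K] makes high indices negligible, so finitely many entries determine an eigenvalue up
    to [e0]. The entries will be combinations of Fourier coefficients, whence continuity for weak
    convergence of bounded potentials. *)
Lemma weak_cont (j : nat) (e0 : R) : 0 <= K -> 0 < e0 -> exists (L : nat) (eta : R), 0 < eta /\
  forall b b' E E' e e', adm D b K -> adm D b' K -> spec D b E e -> spec D b' E' e' ->
  (forall k l, (k < L)%N -> (l < L)%N -> `|b' k l - b k l| <= eta) -> `|E' j - E j| <= e0.
Proof.
move=> K0 e00.
(* [eig_upper] bounds [E j + Qlow] by [U] for every matrix with constant [K], and [k0] is chosen so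
   that the error [2 * k0 * U] is [e0 / 2]. *)
pose U := D j + K * Num.sqrt j.+1%:R + Qlow D K.
have th0 : 0 <= theta D by apply: sm_ge0 => // k; rewrite invr_ge0 ltW.
have U1 : 1 <= U.
  rewrite /U /Qlow addrA (_ : _ + _ + 1 + _ = 1 + (D j + K * Num.sqrt j.+1%:R + K ^+ 2 * theta D / 2)); last by ring.
  by rewrite lerDl !addr_ge0 ?mulr_ge0 ?sqrtr_ge0 ?sqr_ge0.
pose k0 := e0 / (4 * U).
have k00 : 0 < k0 by rewrite divr_gt0// mulr_gt0//; lra.
pose eps := k0 / (12 * (K + 1)).
have eps0 : 0 < eps by rewrite divr_gt0// mulr_gt0//; lra.
have eps2 : 0 < eps ^+ 2 by rewrite exprn_gt0.
have [L hL] := tail_small DV eps2.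
have tail : theta_tail L <= eps ^+ 2.
  apply: le_trans (hL L (leqnn L)); have A := asm_tail L DV; apply: ler_sm => //; first exact: asm_abs.
  by move=> k; exact: ler_norm.
pose eta := k0 / (2 * L.+1%:R).
have eta0 : 0 < eta by rewrite divr_gt0// mulr_gt0.
exists L, eta; split=> // b b' E E' e e' H H' S S' hb.
have tot : eta * L%:R + 6 * K * eps <= k0.
  have h1 : eta * L%:R <= k0 / 2.
    have l1 : L.+1%:R^-1 * L%:R <= 1 :> R by rewrite mulrC ler_pdivrMr// mul1r ler_nat.
    have -> : eta * L%:R = k0 * (L.+1%:R^-1 * L%:R) / 2 by rewrite /eta invfM; ring.
    by rewrite ler_wpM2r// ler_piMr// ltW.
  have h2 : 6 * K * eps <= k0 / 2.
    have : eps * (12 * (K + 1)) = k0 by rewrite /eps divfK// gt_eqF// mulr_gt0//; lra.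
    have := ltW eps0; nra.
  lra.
have low c Ec ec : adm D c K -> spec D c Ec ec -> Ec j + Qlow D K <= U.
  by move=> Hc Sc; rewrite /U lerD2r (eig_upper Hc Sc).
have step c c' Ec Ec' ec ec' : adm D c K -> adm D c' K -> spec D c Ec ec -> spec D c' Ec' ec' ->
    (forall k l, (k < L)%N -> (l < L)%N -> `|c' k l - c k l| <= eta) -> Ec' j <= Ec j + e0.
  move=> Hc Hc' Sc Sc' hc.
  have k0' : 0 <= k0 by exact: ltW.
  have := @eig_stable _ D c c' K K k0 Ec Ec' ec ec' j Hc Hc' Sc Sc' k0'.
  move=> st; apply: le_trans (st _) _.
    move=> x hx; apply: le_trans (form_diff Hc Hc' hx (ltW eta0) (ltW eps0) hc tail) _.
    by rewrite lerD2l ler_wpM2r// (hn_ge0 Hc).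
  rewrite lerD2l; apply: (@le_trans _ _ (2 * k0 * U)).
    by apply: ler_wpM2l; [exact: mulr_ge0|exact: (low _ _ _ Hc Sc)].
  have : k0 * (4 * U) = e0 by rewrite /k0 divfK// gt_eqF// mulr_gt0//; lra.
  lra.
have s1 := step _ _ _ _ _ _ H H' S S' hb.
have s2 : E j <= E' j + e0.
  by apply: (step _ _ _ _ _ _ H' H S' S) => k l kL lL; rewrite distrC; exact: hb.
by rewrite ler_norml; apply/andP; split; lra.
Qed.

End WeakContinuity.

(** * Boundary value problems on the unit interval *)

Section UnitInterval.
Variable R : realType.
Notation mu := (@lebesgue_measure R).
Implicit Types (f g q u v : R -> R) (a c : R).

Definition I01 : set R := `[0, 1]%classic.
Definition mf01 f := measurable_fun (I01 : set (measurableTypeR R)) f.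
Definition ig f := mu.-integrable I01 (EFin \o f).
Definition itg f : R := Rintegral mu I01 f.
Definition sq f := mf01 f /\ ig (fun x => f x * f x).
Definition cts01 f := {within I01, continuous f}.

Lemma mI01 : measurable (I01 : set (measurableTypeR R)). Proof. exact: measurable_itv. Qed.
Hint Resolve mI01 : core.

Lemma muI01 : mu I01 = 1%E.
Proof. by rewrite /I01 lebesgue_measure_itv/= lte_fin ltr01 oppr0 adde0. Qed.

Lemma ig_meas f : ig f -> mf01 f.
Proof. by case/integrableP => /measurable_EFinP. Qed.

Lemma igD f g : ig f -> ig g -> ig (fun x => f x + g x).
Proof. by move=> hf hg; have := integrableD mI01 hf hg. Qed.

Lemma igZ a f : ig f -> ig (fun x => a * f x).
Proof. by move=> hf; have := integrableZl mI01 a hf. Qed.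

Lemma igB f g : ig f -> ig g -> ig (fun x => f x - g x).
Proof. by move=> hf hg; have := integrableB mI01 hf hg. Qed.

Lemma ig_abs f : ig f -> ig (fun x => `|f x|).
Proof. by move/integrable_norm. Qed.

Lemma ig0 : ig (fun=> 0).
Proof. by have := integrable0 mu I01. Qed.

Lemma ig_sum (J : Type) (r : seq J) (F : J -> R -> R) :
  (forall i, ig (F i)) -> ig (fun x => \sum_(i <- r) F i x).
Proof.
move=> h; elim: r => [|i r ih].
  by rewrite (_ : (fun x => _) = fun=> 0); [exact: ig0|apply/funext => x; rewrite big_nil].
rewrite (_ : (fun x => _) = (fun x => F i x + \sum_(j <- r) F j x)); first exact: igD.
by apply/funext => x; rewrite big_cons.
Qed.

Lemma ig_le f g : mf01 f -> ig g -> (forall x, I01 x -> `|f x| <= g x) -> ig f.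
Proof.
move=> mf hg h; apply: le_integrable hg => //; first exact/measurable_EFinP.
by move=> x Ix /=; rewrite lee_fin; apply: le_trans (h x Ix) _; rewrite ler_norm.
Qed.

Lemma cts_cts01 f : continuous f -> cts01 f.
Proof. by move=> h; apply: continuous_subspaceT. Qed.

Lemma ig_cts f : cts01 f -> ig f.
Proof. by move=> h; apply: continuous_compact_integrable => //; exact: segment_compact. Qed.

Lemma cts01_meas f : cts01 f -> mf01 f.
Proof. by move=> h; apply: subspace_continuous_measurable_fun. Qed.

Lemma cts01_bounded f : cts01 f -> exists2 M, 0 <= M & forall x, I01 x -> `|f x| <= M.
Proof.
move=> hf; have := @segment_compact R 0 1 => c01.
have cf : {within I01, continuous (fun x => `|f x|)}.
  by move=> x; apply: cvg_norm; exact: hf.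
have [c _ hc] := EVT_max ler01 cf.
by exists `|f c| => // x Ix; apply: hc.
Qed.

Lemma cts01M f g : cts01 f -> cts01 g -> cts01 (fun x => f x * g x).
Proof. by move=> hf hg x; apply: continuousM; [exact: hf|exact: hg]. Qed.

Lemma cts01D f g : cts01 f -> cts01 g -> cts01 (fun x => f x + g x).
Proof. by move=> hf hg x; apply: continuousD; [exact: hf|exact: hg]. Qed.

Lemma cts01B f g : cts01 f -> cts01 g -> cts01 (fun x => f x - g x).
Proof. by move=> hf hg x; apply: continuousB; [exact: hf|exact: hg]. Qed.

Lemma cts01C a : cts01 (fun=> a).
Proof. by move=> x; exact: cvg_cst. Qed.

Lemma igM_cts f u : ig f -> cts01 u -> ig (fun x => f x * u x).
Proof.
move=> hf hu; have [M M0 hM] := cts01_bounded hu.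
apply: (@ig_le _ (fun x => M * `|f x|)); last first.
- by move=> x Ix; rewrite normrM mulrC ler_wpM2r// hM.
- exact/igZ/ig_abs.
- by apply: measurable_funM; [exact: ig_meas|exact: cts01_meas].
Qed.

Lemma sq_cts f : cts01 f -> sq f.
Proof. by move=> hf; split; [exact: cts01_meas|exact/ig_cts/cts01M]. Qed.

Lemma sqM f g : sq f -> sq g -> ig (fun x => f x * g x).
Proof.
move=> [mf f2] [mg g2].
apply: (@ig_le _ (fun x => f x * f x + g x * g x)); first exact: measurable_funM.
  exact: igD.
move=> x _; rewrite normrM.
have nn c : c * c = `|c| * `|c| by rewrite -!expr2 sqr_normr.
rewrite (nn (f x)) (nn (g x)); have := sqr_ge0 (`|f x| - `|g x|).
by have := mulr_ge0 (normr_ge0 (f x)) (normr_ge0 (g x)) => ? ?; nra.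
Qed.

Lemma sq_ig f : sq f -> ig f.
Proof.
move=> hf; have := sqM hf (sq_cts (@cts01C 1)).
by rewrite (_ : (fun x => _) = f)//; apply/funext => x; rewrite mulr1.
Qed.

Lemma sqM_cts f u : sq f -> cts01 u -> sq (fun x => f x * u x).
Proof.
move=> [mf f2] hu; split; first by apply: measurable_funM => //; exact: cts01_meas.
rewrite (_ : (fun x => _) = (fun x => f x * f x * (u x * u x))).
  by apply: igM_cts => //; exact: cts01M.
by apply/funext => x; ring.
Qed.

Lemma eq_itg f g : (forall x, I01 x -> f x = g x) -> itg f = itg g.
Proof. by move=> h; apply: eq_Rintegral => x; rewrite inE => /h. Qed.

Lemma itgD f g : ig f -> ig g -> itg (fun x => f x + g x) = itg f + itg g.
Proof. by move=> hf hg; rewrite /itg RintegralD. Qed.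

Lemma itgB f g : ig f -> ig g -> itg (fun x => f x - g x) = itg f - itg g.
Proof. by move=> hf hg; rewrite /itg RintegralB. Qed.

Lemma itgZ a f : ig f -> itg (fun x => a * f x) = a * itg f.
Proof. by move=> hf; rewrite /itg RintegralZl. Qed.

Lemma itg_cst a : itg (fun=> a) = a.
Proof. rewrite /itg Rintegral_cst; last exact: mI01.
by rewrite [X in a * fine X](_ : _ = 1%E) ?mulr1//; exact: muI01. Qed.

Lemma itg_sum (J : Type) (r : seq J) (F : J -> R -> R) :
  (forall i, ig (F i)) -> itg (fun x => \sum_(i <- r) F i x) = \sum_(i <- r) itg (F i).
Proof.
move=> h; elim: r => [|i r ih].
  rewrite big_nil (@eq_itg _ (fun=> 0)) ?itg_cst// => x _.
  by rewrite big_nil.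
rewrite big_cons -ih -itgD//; last exact: ig_sum.
by apply: eq_itg => x _; rewrite big_cons.
Qed.

Lemma itg_ge0 f : (forall x, I01 x -> 0 <= f x) -> 0 <= itg f.
Proof. by move=> h; apply: Rintegral_ge0. Qed.

Lemma itg_le f g : ig f -> ig g -> (forall x, I01 x -> f x <= g x) -> itg f <= itg g.
Proof. by move=> hf hg h; apply: le_Rintegral. Qed.

Lemma itg_abs f : ig f -> `|itg f| <= itg (fun x => `|f x|).
Proof. by move=> hf; apply: le_normr_Rintegral. Qed.

Lemma discr_le a (B C : R) : (forall t, 0 <= a - 2 * t * B + t ^+ 2 * C) -> 0 <= C -> B ^+ 2 <= a * C.
Proof.
move=> h; rewrite le_eqVlt => /predU1P[y0|y0].
  rewrite -y0 mulr0 in h *.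
  have [->|xy] := eqVneq B 0; first by rewrite expr0n.
  have := h ((a + 1) / (2 * B)).
  rewrite mulr0 (_ : 2 * _ * _ = a + 1); first by move=> ?; lra.
  by field.
have := h (B / C).
rewrite -(ler_pM2r y0) mul0r (_ : (_ - _ + _) * _ = a * C - B ^+ 2).
  by rewrite subr_ge0.
by field; rewrite gt_eqF.
Qed.

(** The squared norms [D k] may vanish; writing the coefficients as [D k * c k] avoids a division.
    It serves both the basis, with [D = 1], and its derivatives, with [D] the free eigenvalues. *)
Lemma itg_bessel (phi : nat -> R -> R) (D c : nat -> R) f n : sq f -> (forall k, cts01 (phi k)) ->
  (forall k l, itg (fun x => phi k x * phi l x) = D k * (k == l)%:R) ->
  (forall k, itg (fun x => f x * phi k x) = D k * c k) ->
  \sum_(k < n) D k * (c k * c k) <= itg (fun x => f x * f x).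
Proof.
move=> hf hp ho hc; have [_ f2] := hf.
have sp k : sq (phi k) by exact: sq_cts.
pose p x := \sum_(k < n) c k * phi k x.
have fp : ig (fun x => f x * p x).
  rewrite (_ : (fun x => _) = fun x => \sum_(k < n) c k * (f x * phi k x)).
    by apply: ig_sum => k; apply/igZ/sqM.
  by apply/funext => x; rewrite mulr_sumr; apply: eq_bigr => k _; ring.
have e1 : itg (fun x => f x * p x) = \sum_(k < n) D k * (c k * c k).
  rewrite (@eq_itg _ (fun x => \sum_(k < n) c k * (f x * phi k x))).
    rewrite itg_sum; last by move=> k; apply/igZ/sqM.
    by apply: eq_bigr => k _; rewrite itgZ ?hc; [ring|exact: sqM].
  by move=> x _; rewrite mulr_sumr; apply: eq_bigr => k _; ring.
have pE x : p x * p x = \sum_(k < n) \sum_(l < n) c k * c l * (phi k x * phi l x).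
  rewrite {1}/p mulr_suml; apply: eq_bigr => k _; rewrite mulr_sumr.
  by apply: eq_bigr => l _; ring.
have pp : ig (fun x => p x * p x).
  rewrite (_ : (fun x => _) = fun x => \sum_(k < n) \sum_(l < n) c k * c l * (phi k x * phi l x)).
    by apply: ig_sum => k; apply: ig_sum => l; apply/igZ/sqM.
  by apply/funext => x; rewrite pE.
have e2 : itg (fun x => p x * p x) = \sum_(k < n) D k * (c k * c k).
  rewrite (@eq_itg _ (fun x => \sum_(k < n) \sum_(l < n) c k * c l * (phi k x * phi l x))).
    rewrite itg_sum; last by move=> k; apply: ig_sum => l; apply/igZ/sqM.
    apply: eq_bigr => k _; rewrite itg_sum; last by move=> l; apply/igZ/sqM.
    rewrite (bigD1 k)//= itgZ ?ho ?eqxx ?mulr1; last exact: sqM.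
    rewrite big1 ?addr0; first by ring.
    move=> l lk; rewrite itgZ ?ho; last exact: sqM.
    by rewrite (_ : (k == l :> nat) = false) ?mulr0//; apply/negbTE; rewrite eq_sym.
  by move=> x _; rewrite pE.
have : 0 <= itg (fun x => (f x - p x) ^+ 2) by apply: itg_ge0 => x _; rewrite sqr_ge0.
rewrite (@eq_itg _ (fun x => f x * f x - 2 * (f x * p x) + p x * p x)); last first.
  by move=> x _; ring.
rewrite itgD ?itgB ?itgZ//; [|exact: igZ|by apply: igB => //; exact: igZ].
by rewrite e1 e2; lra.
Qed.

End UnitInterval.

(** * Function series and integration by parts *)

Section FunctionSeries.
Variable R : realType.
Implicit Types (x M : nat -> R).

(** Dominated convergence for series along any filter: used at a point for continuity, at a
    punctured neighbourhood of 0 for derivatives, and at infinity for truncated double sums. *)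
Lemma sm_dct (T : Type) (F : set_system T) (FF : Filter F) (f : nat -> T -> R) (l : nat -> R) M :
  asm M -> (\forall t \near F, forall k, `|f k t| <= M k) -> (forall k, `|l k| <= M k) ->
  (forall k, f k @ F --> l k) -> (fun t => sm (fun k => f k t)) @ F --> sm l.
Proof.
move=> hM fM lM fl; apply/cvgrPdist_le => e e0.
have e30 : 0 < e / 3 by rewrite divr_gt0.
have [N HN] := tail_small hM e30; have {HN} tN := HN N (leqnn N).
have M0 k : 0 <= M k by apply: le_trans (lM k); exact: normr_ge0.
have hl : asm l by apply: asm_le hM => k; rewrite (ger0_norm (M0 k)).
have fin : (fun t => \sum_(k < N) f k t) @ F --> \sum_(k < N) l k.
  elim: N {tN} => [|N ih].
    by rewrite big_ord0; under eq_fun do rewrite big_ord0; apply: cvg_cst.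
  rewrite big_ord_recr/=; under eq_fun do rewrite big_ord_recr/=.
  by apply: cvgD.
have /cvgrPdist_le /(_ _ e30) h := fin.
near=> t.
have ft : forall k, `|f k t| <= M k by near: t.
have hf : asm (fun k => f k t) by apply: asm_le hM => k; rewrite (ger0_norm (M0 k)).
rewrite (sm_tail N hl) (sm_tail N hf).
have h1 : `|\sum_(k < N) l k - \sum_(k < N) f k t| <= e / 3 by near: t.
have tb g : (forall k, `|g k| <= M k) -> `|sm (fun k => g (N + k)%N)| <= e / 3.
  move=> gM; have hg : asm g by apply: asm_le hM => k; rewrite (ger0_norm (M0 k)).
  apply: le_trans (sm_abs (asm_tail N hg)) _; apply: le_trans tN.
  apply: ler_sm; [exact/asm_abs/(asm_tail N hg)|exact/asm_abs/(asm_tail N hM)|].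
  by move=> k; rewrite (ger0_norm (M0 _)).
have h2 := tb _ lM; have h3 := tb _ ft.
set A := \sum_(k < N) l k in h1 *; set B := \sum_(k < N) f k t in h1 *.
set C1 := sm _ in h2 *; set C2 := sm _ in h3 *.
rewrite (_ : A + C1 - (B + C2) = (A - B) + (C1 - C2)); last by ring.
apply: le_trans (ler_normD _ _) _; have := ler_normB C1 C2; lra.
Unshelve. all: by end_near. Qed.

Definition ser x (phi : nat -> R -> R) (y : R) : R := sm (fun k => x k * phi k y).

Variables (x : nat -> R) (phi psi : nat -> R -> R) (c : R) (N : nat -> R).
Hypothesis phic : forall k y, `|phi k y| <= c.
Hypothesis hx : asm x.

Let c0 : 0 <= c. Proof. by apply: le_trans (phic 0%N 0); exact: normr_ge0. Qed.

Lemma ser_asm y : asm (fun k => x k * phi k y).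
Proof.
apply: asm_le (asmZ c hx) => k; rewrite !normrM mulrC ler_wpM2r//.
by rewrite (ger0_norm c0).
Qed.

Lemma ser_cont : (forall k, continuous (phi k)) -> continuous (ser x phi).
Proof.
move=> hc y.
apply: (@sm_dct _ (nbhs y) _ (fun k y => x k * phi k y) (fun k => x k * phi k y) (fun k => c * `|x k|)).
- exact/asmZ/asm_abs.
- by apply: nearW => t k; rewrite normrM mulrC ler_wpM2r.
- by move=> k; rewrite normrM mulrC ler_wpM2r.
- by move=> k; apply: cvgMr; exact: hc.
Qed.

Lemma itg_ser (f : R -> R) : ig f -> (forall k, continuous (phi k)) ->
  itg (fun y => f y * ser x phi y) = sm (fun k => x k * itg (fun y => f y * phi k y)).
Proof.
move=> hf hc; apply/esym/sm_unique.
have fp k : ig (fun y => f y * phi k y) by apply: igM_cts => //; exact/cts_cts01.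
pose C := itg (fun y => `|f y|).
have C0 : 0 <= C by exact: itg_ge0.
have cs := cts_cts01 (ser_cont hc).
apply: (@cvg_squeeze0 R \oo _ _ (fun n => C * c * sm (fun k => `|x (n + k)%N|))); last first.
  rewrite -[X in _ --> X](mulr0 (C * c)); apply: cvgMr; exact: (tail_cvg0 (asm_abs hx)).
move=> n.
have -> : \sum_(k < n) x k * itg (fun y => f y * phi k y) =
    itg (fun y => \sum_(k < n) x k * (f y * phi k y)).
  rewrite itg_sum; last by move=> k; exact: igZ.
  by apply: eq_bigr => k _; rewrite itgZ.
have fs : ig (fun y => f y * ser x phi y) by exact: igM_cts.
have fn : ig (fun y => \sum_(k < n) x k * (f y * phi k y)) by apply: ig_sum => k; exact: igZ.
rewrite -itgB//; apply: le_trans (itg_abs (igB fn fs)) _.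
rewrite -mulrA mulrC -itgZ; last exact: ig_abs.
apply: itg_le; [exact/ig_abs/igB|exact/igZ/ig_abs|move=> y _].
have -> : \sum_(k < n) x k * (f y * phi k y) - f y * ser x phi y =
    - (f y * sm (fun k => x (n + k)%N * phi (n + k)%N y)).
  rewrite /ser (sm_tail n (ser_asm y)) mulrDr mulr_sumr opprD addrA.
  by rewrite (eq_bigr (fun k : 'I_n => f y * (x k * phi k y))) ?subrr ?sub0r// => k _; ring.
rewrite normrN normrM mulrC ler_wpM2r//.
apply: le_trans (sm_abs (asm_tail n (ser_asm y))) _; rewrite -smZ; last exact: (asm_tail n (asm_abs hx)).
apply: ler_sm; [exact/asm_abs/(asm_tail n (ser_asm y))|exact/asmZ/(asm_tail n (asm_abs hx))|move=> k].
by rewrite normrM mulrC ler_wpM2r.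
Qed.

Lemma ser_derive y : (forall k y, is_derive y (1 : R) (phi k) (psi k y)) ->
  (forall k y, `|psi k y| <= N k) -> asm (fun k => x k * N k) ->
  is_derive y (1 : R) (ser x phi) (ser x psi y).
Proof.
move=> hd hN hxN.
have key : (fun h : R => h^-1 * (ser x phi (h + y) - ser x phi y)) @ 0^' --> ser x psi y.
  rewrite (_ : (fun h : R => _) = (fun h : R =>
      sm (fun k => x k * (h^-1 * (phi k (h + y) - phi k y))))); last first.
    apply/funext => h; rewrite /ser -smB; [|exact: ser_asm|exact: ser_asm].
    rewrite -smZ; last by apply: asmB; exact: ser_asm.
    by apply: eq_sm => k; rewrite -mulrBr mulrCA.
  apply: (@sm_dct R (0 : R)^' _ (fun k (h : R) => x k * (h^-1 * (phi k (h + y) - phi k y)))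
    (fun k => x k * psi k y) (fun k => `|x k * N k|)).
  - exact: asm_abs.
  - near=> h => k.
    have h0 : h != 0 by near: h; exact: nbhs_dnbhs_neq.
    rewrite normrM [leRHS]normrM ler_wpM2l//.
    have N0 : 0 <= N k by apply: le_trans (hN k 0); exact: normr_ge0.
    rewrite (ger0_norm N0).
    (* The mean value theorem gives the difference quotients a majorant independent of [h]. *)
    have lip a b : a < b -> `|phi k b - phi k a| <= N k * (b - a).
      move=> ab; have [|z _ ->] := @MVT _ (phi k) (psi k) a b ab.
        apply: continuous_subspaceT => t; apply: differentiable_continuous.
        by apply/derivable1_diffP; have [] := hd k t.
      have ba : 0 < b - a by rewrite subr_gt0.
      by rewrite normrM (gtr0_norm ba) ler_wpM2r// ltW.
    rewrite normrM normfV.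
    rewrite mulrC ler_pdivrMr ?normr_gt0//.
    case: (ltgtP h 0) h0 => // [hn|hp] _.
      have := @lip (h + y) y; rewrite -subr_gt0 opprD addrCA subrr addr0 oppr_gt0 => /(_ hn).
      by rewrite distrC (ltr0_norm hn).
    have := @lip y (h + y); rewrite -subr_gt0 addrK => /(_ hp).
    by rewrite (gtr0_norm hp).
  - by move=> k; rewrite normrM [leRHS]normrM ler_wpM2l//; apply: le_trans (hN k y) (ler_norm _).
  - move=> k; apply: cvgMr; have [dk ek] := hd k y.
    move: dk; rewrite -ek /derive /derivable.
    rewrite (_ : (fun h : R => h^-1 *: _) = (fun h : R => h^-1 * (phi k (h + y) - phi k y)))//.
    by apply/funext => h /=; rewrite [h *: 1]mulr1.
have eqf : (fun h : R => h^-1 *: ((ser x phi \o shift y) (h *: 1) - ser x phi y)) =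
    (fun h : R => h^-1 * (ser x phi (h + y) - ser x phi y)).
  by apply/funext => h /=; rewrite [h *: 1]mulr1.
split; first by rewrite /derivable eqf; apply/cvg_ex; exists (ser x psi y).
by rewrite /derive eqf; apply: cvg_lim.
Unshelve. all: by end_near. Qed.

End FunctionSeries.

Section Calculus.
Variable R : realType.
Notation mu := (@lebesgue_measure R).
Implicit Types (f g q u v : R -> R).

Definition C1 u v := (forall y : R, is_derive y (1 : R) u (v y)) /\ continuous v.

Lemma C1_cont u v : C1 u v -> continuous u.
Proof.
move=> [h _] y; apply: differentiable_continuous; apply/derivable1_diffP.
by have [] := h y.
Qed.

Lemma C1_LR u v (a b : R) : C1 u v -> derivable_oo_LRcontinuous u a b.
Proof.
move=> h; have cu := C1_cont h; split.
- by move=> y _; case: h => /(_ y)[].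
- by apply: cvg_at_right_filter; exact: cu.
- by apply: cvg_at_left_filter; exact: cu.
Qed.

Lemma C1_ftc u v x : C1 u v -> 0 <= x -> Rintegral mu `[0, x] v = u x - u 0.
Proof.
move=> h; rewrite le_eqVlt => /predU1P[<-|x0].
  by rewrite set_itv1 Rintegral_set1 subrr.
rewrite /Rintegral (continuous_FTC2 x0 (F := u)) //.
- by apply: continuous_subspaceT; case: h.
- exact: C1_LR h.
- by move=> y _; rewrite derive1E; case: h => /(_ y) [].
Qed.

Lemma C1_itg u v : C1 u v -> itg v = u 1 - u 0.
Proof. by move=> h; rewrite -(C1_ftc h). Qed.

(* f need only be integrable: approximate it in L^1 by continuous functions *)
Lemma itg_parts f F (phi psi : R -> R) : ig f -> C1 phi psi -> cts01 F ->
  (forall x, I01 x -> F x = F 0 + Rintegral mu `[0, x] f) ->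
  itg (fun x => f x * phi x) = F 1 * phi 1 - F 0 * phi 0 - itg (fun x => F x * psi x).
Proof.
move=> hf hp cF hF.
have cphi := cts_cts01 (C1_cont hp); have cpsi := cts_cts01 hp.2.
have [M1 M10 hM1] := cts01_bounded cphi; have [M2 M20 hM2] := cts01_bounded cpsi.
have I0 : I01 (0 : R) by rewrite /I01/= in_itv/= lexx ler01.
have I1 : I01 (1 : R) by rewrite /I01/= in_itv/= lexx ler01.
pose L g G := itg (fun x => g x * phi x) - (G 1 * phi 1 - G 0 * phi 0 - itg (fun x => G x * psi x)).
suff : L f F = 0 by move/eqP; rewrite subr_eq0 => /eqP.
have fin1 : (mu (@I01 R) < +oo)%E by rewrite muI01 ltry.
have [g_ [gc gi gl]] := approximation_continuous_integrable (@mI01 R) fin1 hf.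
pose d n := itg (fun x => `|f x - g_ n x|).
have dl : d @ \oo --> (0 : R).
  have := gl; rewrite (_ : (fun n => _) = EFin \o d); last first.
    apply/funext => n /=; rewrite /d /itg /Rintegral fineK//.
    have := ig_abs (igB hf (gi n)) => /integrable_fin_num; apply; exact: mI01.
  by move/fine_cvgP => [].
pose G n x := F 0 + Rintegral mu `[0, x] (g_ n).
have G0 n : G n 0 = F 0 by rewrite /G set_itv1 Rintegral_set1 addr0.
have cG n : cts01 (G n).
  by apply: cts01D; [exact: cts01C|exact: parameterized_integral_continuous].
have dG n (y : R) : y \in `]0, 1[ -> is_derive y (1 : R) (G n) (g_ n y).
  rewrite in_itv/= => /andP[y0 y1].
  have [d1 e1] := continuous_FTC1_closed y1 (gi n) y0 (gc n y).
  have dd : is_derive y (1 : R) (fun x => Rintegral mu `[0, x] (g_ n)) (g_ n y).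
    by split; [exact: d1|rewrite -derive1E; exact: e1].
  by have := is_deriveD (is_derive_cst (F 0) y (1 : R)) dd; rewrite add0r.
have LG n : L (g_ n) (G n) = 0.
  apply/eqP; rewrite subr_eq0; apply/eqP.
  rewrite /itg; under eq_Rintegral do rewrite mulrC.
  rewrite (@Rintegration_by_parts _ phi (G n) psi (g_ n)) //.
  - by rewrite (mulrC (phi 1)) (mulrC (phi 0)); congr (_ - _); under eq_Rintegral do rewrite mulrC.
  - exact: C1_LR hp.
  - by move=> y _; rewrite derive1E; case: hp => /(_ y)[].
  - by apply: continuous_subspaceT; exact: gc.
  - have /(continuous_within_itvP _ ltr01)[_ h1 h2] := cG n.
    by split=> // y hy; have [] := dG n y hy.
  - by move=> y hy; rewrite derive1E; have [] := dG n y hy.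
have FG n x : I01 x -> `|F x - G n x| <= d n.
  move=> Ix; rewrite hF// /G opprD addrACA subrr add0r.
  have sub : `[0, x]%classic `<=` @I01 R.
    move: Ix; rewrite /I01/= in_itv/= => /andP[_ x1] y /=.
    by rewrite !in_itv/= => /andP[-> /le_trans]; apply.
  have mx : measurable (`[0, x]%classic : set (measurableTypeR R)) by exact: measurable_itv.
  have fx : mu.-integrable `[0, x] (EFin \o f) by apply: integrableS hf => //; exact: mI01.
  have gx : mu.-integrable `[0, x] (EFin \o g_ n) by apply: integrableS (gi n) => //; exact: mI01.
  rewrite -RintegralB//; apply: le_trans (le_normr_Rintegral mx _) _.
    by have := integrableB mx fx gx.
  rewrite /d /itg /Rintegral fine_le//.
  - apply: integrable_fin_num => //; have := integrable_norm (integrableB mx fx gx); exact.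
  - apply: integrable_fin_num; first exact: mI01.
    exact: (ig_abs (igB hf (gi n))).
  - apply: ge0_subset_integral => //; first exact: mI01.
    by have := ig_abs (igB hf (gi n)) => /integrableP[].
have LB n : `|L f F| <= (2 * M1 + M2) * d n.
  rewrite -[L f F]subr0 -(LG n) /L.
  have fphi : ig (fun x => f x * phi x) by exact: igM_cts.
  have gphi : ig (fun x => g_ n x * phi x) by exact: (igM_cts (gi n)).
  have Fpsi : ig (fun x => F x * psi x) by exact/ig_cts/cts01M.
  have Gpsi : ig (fun x => G n x * psi x) by exact/ig_cts/cts01M.
  have -> : forall a1 a2 b1 b2 c1 c2 e1 e2 : R, a1 - (b1 - c1 - e1) - (a2 - (b2 - c2 - e2)) =
     (a1 - a2) - (b1 - b2) + (c1 - c2) + (e1 - e2) by move=> *; ring.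
  rewrite G0 subrr addr0 -itgB// -itgB// -mulrBl.
  have dn := igB hf (gi n).
  have h1 : `|itg (fun x => f x * phi x - g_ n x * phi x)| <= M1 * d n.
    apply: le_trans (itg_abs (igB fphi gphi)) _; rewrite -itgZ; last exact: ig_abs.
    apply: itg_le; [exact/ig_abs/igB|exact/igZ/ig_abs|move=> x Ix].
    by rewrite -mulrBl normrM mulrC ler_wpM2r// hM1.
  have h2 : `|(F 1 - G n 1) * phi 1| <= M1 * d n.
    by rewrite normrM mulrC ler_pM// ?hM1// FG.
  have h3 : `|itg (fun x => F x * psi x - G n x * psi x)| <= M2 * d n.
    apply: le_trans (itg_abs (igB Fpsi Gpsi)) _; rewrite -[leRHS]itg_cst.
    apply: itg_le; [exact/ig_abs/igB|exact/ig_cts/cts01C|move=> x Ix].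
    by rewrite -mulrBl normrM mulrC ler_pM// ?hM2// FG.
  apply: le_trans (ler_normD _ _) _; apply: le_trans (lerD (ler_normB _ _) (lexx _)) _.
  lra.
have lim0 : (fun n => (2 * M1 + M2) * d n) @ \oo --> (0 : R).
  by rewrite -[X in _ --> X](mulr0 (2 * M1 + M2)); apply: cvgMr.
by apply/eqP; rewrite -normr_le0; apply: (cvgr_to_ge lim0); exact: nearW.
Qed.

End Calculus.

(** * Free eigenbases and the Hill equation in coordinates *)

Section Systems.
Variable R : realType.
Notation mu := (@lebesgue_measure R).
Implicit Types (f g q u v : R -> R).

(* [Twist s]: u(1) = s u(0), u'(1) = s u'(0); [Sep d0 d1]: Dirichlet at an end
   when the flag is set, Neumann otherwise. *)
Inductive bc := Twist of R | Sep of bool & bool.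

(** Essential conditions, on the function, cut out the form domain; natural ones concern the
    derivative and hold for eigenfunctions. Together they cancel the boundary terms, see [bnd0]. *)
Definition ess (c : bc) (u0 u1 : R) : Prop :=
  match c with
  | Twist s => u1 = s * u0
  | Sep d0 d1 => (d0 -> u0 = 0) /\ (d1 -> u1 = 0)
  end.

Definition ntl (c : bc) (v0 v1 : R) : Prop :=
  match c with
  | Twist s => v1 = s * v0
  | Sep d0 d1 => (~~ d0 -> v0 = 0) /\ (~~ d1 -> v1 = 0)
  end.

Definition bc_ok (c : bc) := if c is Twist s then s * s = 1 else True.

Lemma bnd0 c (u0 u1 v0 v1 : R) : bc_ok c -> ess c u0 u1 -> ntl c v0 v1 -> v1 * u1 = v0 * u0.
Proof.
case: c => [s|d0 d1] /=; first by move=> s1 -> ->; rewrite mulrACA s1 mul1r.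
move=> _ [a0 a1] [b0 b1]; transitivity (0 : R).
  by case: (d1) a1 b1 => [-> //|_ -> //]; rewrite ?mulr0 ?mul0r.
by case: (d0) a0 b0 => [-> //|_ -> //]; rewrite ?mulr0 ?mul0r.
Qed.

(** An eigenbasis [phi] of the free operator, with derivatives [psi] and eigenvalues [D]. [sys_dual]
    says that the derivatives are complete up to constants. [sys_end] disposes of the boundary value
    [F 1 * phi k 1] in [ef_hill]: either [phi k 1] is a fixed multiple of the integral of [psi k],
    or a constant basis function forces [F 1 = 0]. *)
Record system (c : bc) (phi psi : nat -> R -> R) (D : nat -> R) : Prop := System {
  sys_bc : bc_ok c;
  sys_phi : forall k, C1 (phi k) (psi k);
  sys_psi : forall k, C1 (psi k) (fun y => - D k * phi k y);
  sys_bphi : forall k y, `|phi k y| <= 2;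
  sys_bpsi : forall k y, `|psi k y| <= 2 * Num.sqrt (D k);
  sys_D : forall k, (2 * k%:R) ^+ 2 <= D k;
  sys_Dup : forall k, D k <= (4 * k.+1%:R) ^+ 2;
  sys_Dmono : forall i k, (i <= k)%N -> D i <= D k;
  sys_orth : forall k l, itg (fun y => phi k y * phi l y) = (k == l)%:R;
  sys_orthD : forall k l, itg (fun y => psi k y * psi l y) = D k * (k == l)%:R;
  sys_ess : forall k, ess c (phi k 0) (phi k 1);
  sys_ntl : forall k, ntl c (psi k 0) (psi k 1);
  sys_compl : forall h, cts01 h -> (forall k, itg (fun y => h y * phi k y) = 0) ->
    forall y, I01 y -> h y = 0;
  sys_dual : forall h, cts01 h -> (forall k, itg (fun y => h y * psi k y) = 0) ->
    exists a, forall y, I01 y -> h y = a;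
  sys_end : (exists a, forall k, phi k 1 = a * itg (psi k)) \/
    (exists k, (forall y, phi k y = 1) /\ D k = 0) }.

Lemma inv_sq_asm (D : nat -> R) : (forall k, (2 * k%:R) ^+ 2 <= D k) -> asm (fun k => (1 + D k)^-1).
Proof.
move=> hD.
have W1 k : 0 < 1 + D k by apply: ltr_pwDl => //; apply: le_trans (hD k); exact: sqr_ge0.
apply: (@asm_bound _ _ 2); first by move=> k; rewrite invr_ge0 ltW.
(* The majorant telescopes with increments [2 / ((n + 1) (n + 2))]. *)
have h n : \sum_(k < n) (1 + D k)^-1 <= 2 - 2 / n.+1%:R.
  elim: n => [|n ih]; first by rewrite big_ord0 divr1 subrr.
  rewrite big_ord_recr/=; apply: le_trans (lerD ih (lexx _)) _.
  have n0 : 0 <= n%:R :> R by rewrite ler0n.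
  have nn : n%:R <= n%:R * n%:R :> R.
    by case: n {ih n0} => [|n]; rewrite ?mulr0// ler_peMl// ler1n.
  have -> : n.+2%:R = n%:R + 2 :> R by rewrite -addn2 natrD.
  have -> : n.+1%:R = n%:R + 1 :> R by rewrite -addn1 natrD.
  have h1 : (1 + D n)^-1 <= 2 / ((n%:R + 1) * (n%:R + 2)).
    rewrite ler_pdivlMr; last by nra.
    rewrite mulrC ler_pdivrMr//; have := hD n; nra.
  have -> : 2 - 2 / (n%:R + 2) = 2 - 2 / (n%:R + 1) + 2 / ((n%:R + 1) * (n%:R + 2)) :> R.
    by field; apply/andP; split; apply: lt0r_neq0; lra.
  by rewrite lerD2l.
move=> n; apply: le_trans (h n) _; rewrite gerBl divr_ge0 ?ler0n//.
Qed.

Section OneSystem.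
Variables (c : bc) (phi psi : nat -> R -> R) (D : nat -> R).
Hypothesis sys : system c phi psi D.
Variable q : R -> R.
Hypothesis hq : sq q.

Definition mat k l : R := itg (fun y => q y * phi k y * phi l y).
(** The 2 is the uniform bound on the basis: row [k] consists of the coefficients of [q * phi k],
    whose norm is at most twice that of [q]. *)
Definition matK : R := 2 * Num.sqrt (itg (fun y => q y * q y)).

Let D0 k : 0 <= D k. Proof. by apply: le_trans (sys_D sys k); exact: sqr_ge0. Qed.
Let cphi k : continuous (phi k). Proof. exact: C1_cont (sys_phi sys k). Qed.
Let cpsi k : continuous (psi k). Proof. exact: C1_cont (sys_psi sys k). Qed.
Let c1phi k : cts01 (phi k). Proof. exact: cts_cts01. Qed.
Let c1psi k : cts01 (psi k). Proof. exact: cts_cts01. Qed.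
Let orth1 k l : itg (fun y => phi k y * phi l y) = 1 * (k == l)%:R.
Proof. by rewrite mul1r (sys_orth sys). Qed.

Lemma coef_bessel f n : sq f ->
  \sum_(k < n) (itg (fun y => f y * phi k y) * itg (fun y => f y * phi k y)) <= itg (fun y => f y * f y).
Proof.
move=> hf; have := @itg_bessel _ phi (fun=> 1) (fun k => itg (fun y => f y * phi k y)) f n hf c1phi orth1.
move=> /(_ (fun k => esym (mul1r _))) h; apply: le_trans h.
by apply: ler_sum => k _; rewrite mul1r.
Qed.

Lemma coef_l2 f : sq f -> l2 (fun k => itg (fun y => f y * phi k y)).
Proof.
move=> hf; apply: (asm_bound _ (fun n => coef_bessel n hf)) => k.
by rewrite -expr2 sqr_ge0.
Qed.

Lemma mat_adm : adm D mat matK.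
Proof.
split=> //; first exact: inv_sq_asm (sys_D sys).
  by move=> k l; apply: eq_itg => y _; ring.
split; first by rewrite mulr_ge0 ?sqrtr_ge0.
move=> k; have hk : sq (fun y => q y * phi k y) by exact: sqM_cts.
split; first exact: coef_l2 hk.
apply: sm_le_bound; first exact: coef_l2 hk.
move=> n; apply: le_trans (coef_bessel n hk) _.
have q0 : 0 <= itg (fun y => q y * q y) by apply: itg_ge0 => y _; rewrite -expr2 sqr_ge0.
rewrite /matK exprMn sqr_sqrtr// -itgZ; last by case: hq.
apply: itg_le; [by case: hk|by apply: igZ; case: hq|move=> y _].
rewrite (_ : _ * _ = (phi k y) ^+ 2 * (q y * q y)); last by ring.
rewrite ler_wpM2r -?expr2 ?sqr_ge0// -sqr_normr ler_pXn2r ?nnegrE//.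
exact: (sys_bphi sys).
Qed.

Let H := mat_adm.

Lemma ser_ess (x : nat -> R) : asm x -> ess c (ser x phi 0) (ser x phi 1).
Proof.
move=> hx; have a0 := ser_asm (sys_bphi sys) hx 0.
have := sys_ess sys; case: (c) => [s|d0 d1] /= h.
  by rewrite /ser -smZ//; apply: eq_sm => k; rewrite h; ring.
split=> d; rewrite -[RHS](sm0 R); apply: eq_sm => k; have [h0 h1] := h k;
  by rewrite ?h0 ?h1 ?mulr0.
Qed.

Lemma bx_ser (x : nat -> R) k : h1 D x -> bx mat x k = itg (fun y => q y * ser x phi y * phi k y).
Proof.
move=> hx; have x1 := h1_l1 H hx.
rewrite (@eq_itg _ _ (fun y => (q y * phi k y) * ser x phi y)); last by move=> y _; ring.
have iq : ig (fun y => q y * phi k y) := igM_cts (sq_ig hq) (@c1phi k).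
by rewrite (itg_ser (sys_bphi sys) x1 iq cphi); apply: eq_sm => l; rewrite mulrC.
Qed.

Lemma itg_ser2 (x y : nat -> R) : h1 D x -> h1 D y -> itg (fun t => ser x phi t * ser y phi t) = dot x y.
Proof.
move=> hx hy; have x1 := h1_l1 H hx; have y1 := h1_l1 H hy.
have sx := ser_cont (sys_bphi sys) x1 cphi.
rewrite (itg_ser (sys_bphi sys) y1)//; last exact/ig_cts/cts_cts01.
apply: eq_sm => k; rewrite mulrC; congr (_ * _).
rewrite (@eq_itg _ _ (fun t => phi k t * ser x phi t)); last by move=> t _; rewrite mulrC.
rewrite (itg_ser (sys_bphi sys) x1)//; last exact: ig_cts.
rewrite -[RHS](dot_delta x k); apply: eq_sm => l; rewrite (sys_orth sys) /delta eq_sym.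
by rewrite mulrC.
Qed.

Lemma itg_q_ser2 (x y : nat -> R) : h1 D x -> h1 D y ->
  itg (fun t => q t * ser x phi t * ser y phi t) = sm (fun k => bx mat x k * y k).
Proof.
move=> hx hy; have x1 := h1_l1 H hx; have y1 := h1_l1 H hy.
have sx := ser_cont (sys_bphi sys) x1 cphi.
rewrite (itg_ser (sys_bphi sys) y1)//; last by apply: igM_cts (sq_ig hq) _; exact: cts_cts01.
by apply: eq_sm => k; rewrite bx_ser// mulrC.
Qed.

Section Coefficients.
Variables (u v : R -> R).
Hypotheses (cu : cts01 u) (cv : cts01 v).
Hypothesis uv : forall x, I01 x -> u x = u 0 + Rintegral mu `[0, x] v.
Hypothesis eu : ess c (u 0) (u 1).
Definition coef k := itg (fun y => u y * phi k y).

(** The boundary terms cancel by [bnd0], because [u] satisfies the essential conditions and [psi k]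
    the natural ones. *)
Lemma coef_deriv k : itg (fun y => v y * psi k y) = D k * coef k.
Proof.
rewrite (@itg_parts _ v u _ _ _ (sys_psi sys k))//; last exact: ig_cts.
have b := bnd0 (sys_bc sys) eu (sys_ntl sys k).
rewrite (mulrC (u 1)) (mulrC (u 0)) b subrr sub0r.
rewrite (@eq_itg _ _ (fun y => - D k * (u y * phi k y))); last by move=> y _; ring.
by rewrite itgZ ?mulNr ?opprK//; exact/ig_cts/cts01M.
Qed.

Lemma coef_energy n : \sum_(k < n) D k * (coef k * coef k) <= itg (fun y => v y * v y).
Proof.
apply: (@itg_bessel _ psi) => //; [exact: sq_cts|exact: (sys_orthD sys)|exact: coef_deriv].
Qed.

Lemma coef_h1 : h1 D coef.
Proof.
apply: (@asm_bound _ _ (itg (fun y => u y * u y) + itg (fun y => v y * v y))).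
  by move=> k; rewrite mulr_ge0 ?addr_ge0// -expr2 sqr_ge0.
move=> n; under eq_bigr do rewrite mulrDl mul1r.
by rewrite big_split/= lerD ?coef_energy// coef_bessel//; exact: sq_cts.
Qed.

Lemma coef_ser y : I01 y -> ser coef phi y = u y.
Proof.
move=> Iy; apply/esym/eqP; rewrite -subr_eq0; apply/eqP.
have x1 := h1_l1 H coef_h1.
have cs := cts_cts01 (ser_cont (sys_bphi sys) x1 cphi).
apply: (sys_compl sys (h := fun t => u t - ser coef phi t)) Iy; first exact: cts01B.
move=> k; rewrite (@eq_itg _ _ (fun t => u t * phi k t - phi k t * ser coef phi t)); last first.
  by move=> t _; ring.
rewrite itgB; [|exact/ig_cts/cts01M|exact/ig_cts/cts01M].
rewrite (itg_ser (sys_bphi sys) x1)//; last exact: ig_cts.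
apply/eqP; rewrite subr_eq0 -/(coef k) -(dot_delta coef k); apply/eqP/eq_sm => l.
by rewrite (sys_orth sys) /delta eq_sym mulrC.
Qed.

Lemma coef_dot : dot coef coef = itg (fun y => u y * u y).
Proof.
rewrite -itg_ser2; [|exact: coef_h1|exact: coef_h1].
by apply: eq_itg => y Iy; rewrite coef_ser.
Qed.

(** Bessel for the derivative gives an inequality, in the direction that upper bounds by trial
    functions require. *)
Lemma coef_QQ : QQ D mat coef coef <= itg (fun y => v y * v y) + itg (fun y => q y * u y * u y).
Proof.
rewrite /QQ lerD//.
  apply: sm_le_bound coef_energy; exact: (h1_dotD H coef_h1 coef_h1).
rewrite -itg_q_ser2; [|exact: coef_h1|exact: coef_h1].
rewrite le_eqVlt; apply/orP; left; apply/eqP/eq_itg => y Iy.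
by rewrite coef_ser.
Qed.

End Coefficients.

Lemma C1_int u v : C1 u v -> forall x, I01 x -> u x = u 0 + Rintegral mu `[0, x] v.
Proof.
move=> h x; rewrite /I01/= in_itv/= => /andP[x0 _].
by rewrite (C1_ftc h x0) addrC subrK.
Qed.

(** Pairing the integrated equation for [v] with [phi k] gives the eigenvalue equation coordinate by
    coordinate; the natural conditions on [v] remove the boundary terms. *)
Lemma hill_coef lam u v : hill_solution q lam u v -> ess c (u 0) (u 1) -> ntl c (v 0) (v 1) ->
  [/\ h1 D (coef u), forall y, h1 D y -> QQ D mat (coef u) y = lam * dot (coef u) y &
      forall y, I01 y -> ser (coef u) phi y = u y].
Proof.
move=> [cu [cv huv]] eu nv.
have uv x : I01 x -> u x = u 0 + Rintegral mu `[0, x] v.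
  by move=> Ix; have [] := huv x Ix.
have hx := coef_h1 cu cv uv eu; have hs := coef_ser cu cv uv eu.
split=> // y hy.
have fi : ig (fun t => (q t - lam) * u t).
  apply: igM_cts cu; apply: igB; [exact: sq_ig|exact/ig_cts/cts01C].
have ek k : D k * coef u k + bx mat (coef u) k = lam * coef u k.
  have := @itg_parts _ _ v _ _ fi (sys_phi sys k) cv (fun x Ix => (huv x Ix).2).
  have b := bnd0 (sys_bc sys) (sys_ess sys k) nv.
  rewrite b subrr sub0r (coef_deriv cu cv uv eu).
  rewrite bx_ser//.
  rewrite (@eq_itg _ (fun y => q y * ser (coef u) phi y * phi k y) (fun y => q y * u y * phi k y)); last first.
    by move=> t It; rewrite hs.
  rewrite (@eq_itg _ _ (fun t => q t * u t * phi k t - lam * (u t * phi k t))); last first.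
    by move=> t _; ring.
  rewrite itgB; [|by apply: (igM_cts _ (@c1phi k)); exact: igM_cts (sq_ig hq) cu|exact/igZ/ig_cts/cts01M].
  rewrite itgZ; last exact/ig_cts/cts01M.
  by rewrite -/(coef u k) => h; lra.
have x2 := h1_l2 H hx; have y2 := h1_l2 H hy.
rewrite /QQ -smD; [|exact: (h1_dotD H)|by apply: (bl_asm H) => //; exact: (h1_l1 H)].
rewrite -[RHS]smZ; last exact: l2_dot.
by apply: eq_sm => k; rewrite mulrA -mulrDl ek mulrA.
Qed.

Section Eigenfunctions.
Variables (E : nat -> R) (e : nat -> nat -> R).
Hypothesis S : spec D mat E e.

Definition ef j := ser (e j) phi.
Definition ef' j := ser (e j) psi.

Let eh i : h1 D (e i). Proof. by case: S. Qed.
Let e1 i : asm (e i). Proof. exact: (h1_l1 H). Qed.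
Let e2 i : l2 (e i). Proof. exact: (h1_l2 H). Qed.

(** The equation reads [(1 + D) e = (1 + E) e - b e], and [b e] is in l^2, being the coefficients of
    [q] times a continuous function. So [(1 + D) e] is in l^2, which pays for termwise
    differentiation. *)
Lemma ef_decay j : asm (fun k => e j k * (2 * Num.sqrt (D k))).
Proof.
have cs := cts_cts01 (ser_cont (sys_bphi sys) (e1 j) cphi).
have b2 : l2 (bx mat (e j)).
  have := coef_l2 (sqM_cts hq cs); apply: eq_asm => k.
  by rewrite bx_ser.
have w2 : l2 (fun k => (1 + D k) * e j k).
  have := l2B (l2Z (1 + E j) (e2 j)) b2; apply: eq_asm => k.
  by have := eig_coord S j k => h; rewrite !mulrDl mul1r -h; ring.
have [_ DV _ _] := H.
have v2 : l2 (fun k => (Num.sqrt (1 + D k))^-1).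
  by apply: eq_asm DV => k; rewrite -invfM -expr2 sqr_sqrtr// addr_ge0.
apply: asm_le (asmZ 2 (l2_dot w2 v2)) => k.
have W0 : 0 < 1 + D k by rewrite ltr_pwDl.
have s0 : 0 < Num.sqrt (1 + D k) by rewrite sqrtr_gt0.
have dd : (1 + D k) / Num.sqrt (1 + D k) = Num.sqrt (1 + D k).
  by rewrite -{1}(sqr_sqrtr (ltW W0)) expr2 mulfK ?gt_eqF.
rewrite (_ : 2 * _ = 2 * e j k * Num.sqrt (1 + D k)); last by rewrite -{2}dd; ring.
rewrite [X in `|X|](_ : _ = 2 * e j k * Num.sqrt (D k)); last by ring.
rewrite normrM [leRHS]normrM ler_wpM2l// !ger0_norm ?sqrtr_ge0//.
by rewrite ler_sqrt ?lerDr// ltW.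
Qed.

Lemma ef_C1 j : C1 (ef j) (ef' j).
Proof.
split.
  move=> y; apply: (@ser_derive _ _ _ _ 2 (fun k => 2 * Num.sqrt (D k))) => //.
  - exact: (sys_bphi sys).
  - by move=> k; exact: (sys_phi sys k).1.
  - exact: (sys_bpsi sys).
  - exact: ef_decay.
move=> y; apply: (@sm_dct _ _ (nbhs y) _ (fun k y => e j k * psi k y) (fun k => e j k * psi k y)
   (fun k => `|e j k * (2 * Num.sqrt (D k))|)).
- exact/asm_abs/ef_decay.
- apply: nearW => t k; rewrite normrM [leRHS]normrM ler_wpM2l//.
  by apply: le_trans (sys_bpsi sys k t) _; rewrite ler_norm.
- move=> k; rewrite normrM [leRHS]normrM ler_wpM2l//.
  by apply: le_trans (sys_bpsi sys k y) _; rewrite ler_norm.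
- by move=> k; apply: cvgMr; exact: cpsi.
Qed.

Lemma ef_ess j : ess c (ef j 0) (ef j 1).
Proof. exact: ser_ess. Qed.

Lemma ef_ntl j : ntl c (ef' j 0) (ef' j 1).
Proof.
have ha y : asm (fun k => e j k * psi k y).
  apply: asm_le (ef_decay j) => k; rewrite normrM [leRHS]normrM ler_wpM2l//.
  by apply: le_trans (sys_bpsi sys k y) _; rewrite ler_norm.
have := sys_ntl sys; rewrite /ef' /ser; case: (c) => [s|d0 d1] /= h.
  by rewrite -smZ//; apply: eq_sm => k; rewrite h; ring.
split=> d; rewrite -[RHS](sm0 R); apply: eq_sm => k; have [h0 h1] := h k;
  by rewrite ?h0 ?h1 ?mulr0.
Qed.

Lemma ef_coef j k : itg (fun y => ef j y * phi k y) = e j k.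
Proof.
rewrite (@eq_itg _ _ (fun y => phi k y * ef j y)); last by move=> y _; rewrite mulrC.
rewrite (itg_ser (sys_bphi sys) (e1 j))//; last exact: ig_cts.
rewrite -[RHS](dot_delta (e j) k); apply: eq_sm => l.
by rewrite (sys_orth sys) /delta eq_sym mulrC.
Qed.

(** [F] is what [ef'] should be up to a constant. Against [psi k] the difference [ef' - F] gives
    [- F 1 * phi k 1]; once [sys_end] has absorbed this term, [sys_dual] makes the difference
    constant. *)
Lemma ef_hill j : hill_solution q (E j) (ef j) (ef' j).
Proof.
have hc := ef_C1 j; have cu := cts_cts01 (C1_cont hc); have cv := cts_cts01 hc.2.
have uv := C1_int hc.
split=> //; split=> //.
pose f t := (q t - E j) * ef j t.
have fi : ig f by apply: igM_cts cu; apply: igB; [exact: sq_ig|exact/ig_cts/cts01C].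
pose F x := Rintegral mu `[0, x] f.
have F0 : F 0 = 0 by rewrite /F set_itv1 Rintegral_set1.
have cF : cts01 F by exact: (parameterized_integral_continuous ler01 fi).
have FE x : I01 x -> F x = F 0 + Rintegral mu `[0, x] f by rewrite F0 add0r.
have fk k : itg (fun y => f y * phi k y) = - (D k * e j k).
  rewrite (@eq_itg _ _ (fun t => q t * ef j t * phi k t - E j * (ef j t * phi k t))); last first.
    by move=> t _; rewrite /f; ring.
  rewrite itgB; [|by apply: (igM_cts _ (@c1phi k)); exact: igM_cts (sq_ig hq) cu|exact/igZ/ig_cts/cts01M].
  rewrite itgZ; last exact/ig_cts/cts01M.
  rewrite ef_coef -(bx_ser k (eh j)) -(eig_coord S j k); ring.
have Fk k : itg (fun y => F y * psi k y) = F 1 * phi k 1 + D k * e j k.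
  have := itg_parts fi (sys_phi sys k) cF FE.
  by rewrite F0 mul0r subr0 fk => h; lra.
have vk k : itg (fun y => ef' j y * psi k y) = D k * e j k.
  by rewrite (coef_deriv cu cv uv (ef_ess j)) /coef ef_coef.
have wk k : itg (fun y => (ef' j y - F y) * psi k y) = - (F 1 * phi k 1).
  rewrite (@eq_itg _ _ (fun y => ef' j y * psi k y - F y * psi k y)); last by move=> y _; rewrite mulrBl.
  rewrite itgB ?vk ?Fk; [by ring|exact/ig_cts/cts01M|exact/ig_cts/cts01M].
have [b hb] : exists b, forall y, I01 y -> ef' j y - F y = b.
  case: (sys_end sys) => [[a ha]|[k0 [p1 Dk0]]].
    have [b hb] : exists b, forall y, I01 y -> ef' j y - F y + F 1 * a = b.
      apply: (sys_dual sys (h := fun y => ef' j y - F y + F 1 * a)).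
        by apply: cts01D; [exact: cts01B|exact: cts01C].
      move=> k; rewrite (@eq_itg _ _ (fun y => (ef' j y - F y) * psi k y + F 1 * a * psi k y)); last first.
        by move=> y _; rewrite mulrDl.
      rewrite itgD ?wk; [|by apply/ig_cts/cts01M => //; exact: cts01B|exact/igZ/ig_cts].
      by rewrite itgZ ?ha; [ring|exact: ig_cts].
    by exists (b - F 1 * a) => y Iy; rewrite -(hb y Iy) addrK.
  have F10 : F 1 = 0.
    have := fk k0; rewrite Dk0 mul0r oppr0 => <-.
    by apply: eq_itg => y _; rewrite p1 mulr1.
  apply: (sys_dual sys (h := fun y => ef' j y - F y)); first exact: cts01B.
  by move=> k; rewrite wk F10 mul0r oppr0.
move=> x Ix; split; first exact: uv.
have I0 : I01 (0 : R) by rewrite /I01/= in_itv/= lexx ler01.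
have := hb _ Ix; have := hb _ I0; rewrite F0 subr0 => -> <-.
by rewrite -/(F x) subrK.
Qed.

Lemma ef_orth i j : itg (fun y => ef i y * ef j y) = (i == j)%:R.
Proof. by rewrite itg_ser2//; case: S. Qed.

Lemma ef_form i j : itg (fun y => ef' i y * ef' j y) + itg (fun y => q y * ef i y * ef j y) =
  E i * (i == j)%:R.
Proof.
have [cu [cv huv]] := ef_hill i; have hj := ef_C1 j.
have cj := cts_cts01 (C1_cont hj).
have fi : ig (fun t => (q t - E i) * ef i t).
  by apply: igM_cts cu; apply: igB; [exact: sq_ig|exact/ig_cts/cts01C].
have := @itg_parts _ _ (ef' i) _ _ fi hj cv (fun x Ix => (huv x Ix).2).
rewrite (bnd0 (sys_bc sys) (ef_ess j) (ef_ntl i)) subrr sub0r.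
rewrite (@eq_itg _ _ (fun t => q t * ef i t * ef j t - E i * (ef i t * ef j t))); last first.
  by move=> t _; ring.
rewrite itgB; [|by apply: igM_cts cj; exact: igM_cts (sq_ig hq) cu|exact/igZ/ig_cts/cts01M].
rewrite itgZ ?ef_orth; last exact/ig_cts/cts01M.
by move=> h; lra.
Qed.

End Eigenfunctions.
End OneSystem.
End Systems.

(** * Completeness of trigonometric families *)

Section Completeness.
Variable R : realType.
Notation mu := (@lebesgue_measure R).
Implicit Types (f g h p : R -> R).

Lemma itg_indic (a b : R) : 0 <= a -> a <= b -> b <= 1 ->
  ig (\1_`[a, b] : R -> R) /\ itg (\1_`[a, b] : R -> R) = b - a.
Proof.
move=> a0 ab b1.
have sub : `[a, b]%classic `<=` I01 (R := R).
  by move=> z; rewrite /I01/= !in_itv/= => /andP[az zb]; rewrite (le_trans a0 az) (le_trans zb b1).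
split.
  apply: (@ig_le _ _ (fun=> 1)); last first.
  - by move=> y _; rewrite indicE; case: (_ \in _); rewrite ?normr1 ?normr0.
  - exact/ig_cts/cts01C.
  - exact: measurable_indic.
rewrite /itg /Rintegral integral_indic//; [|exact: measurable_itv].
rewrite (_ : _ `&` _ = `[a, b]%classic); last by apply: setIidl.
have muE : mu `[a, b]%classic = (b - a)%:E.
  rewrite lebesgue_measure_itv/= lte_fin; case: ltP => //= ba.
  by rewrite (le_anti (_ : a <= b <= a)) ?subrr// ab.
by rewrite [X in fine X](_ : _ = (b - a)%:E)//; exact: muE.
Qed.

(** Powers of [p] concentrate at [x0]. If [g x0] were positive, an interval around [x0] would
    contribute at least a multiple of [r' ^+ n], while the negative contributions are at most a
    multiple of [r ^+ n] with [r < r']. *)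
Lemma itg_peak_pos g p (x0 : R) : cts01 g -> continuous p -> 0 < x0 < 1 ->
  (forall y, I01 y -> 0 <= p y) -> p x0 = 1 -> (forall y, I01 y -> y != x0 -> p y < 1) ->
  (forall n, itg (fun y => g y * p y ^+ n) = 0) -> g x0 <= 0.
Proof.
move=> cg cp /andP[x00 x01] p0 px0 p1 hn; rewrite leNgt; apply/negP => gx0.
have [cgi _ _] := (continuous_within_itvP g ltr01).1 cg.
have cgx : {for x0, continuous g} by apply: cgi; rewrite in_itv/= x00 x01.
have [d [d0 hd0 hd1 hd]] : exists d : R, [/\ 0 < d, d <= x0, d <= 1 - x0 &
    forall y, `|y - x0| < d -> g x0 / 2 <= g y].
  have g2 : 0 < g x0 / 2 by rewrite divr_gt0.
  have : \forall y \near x0, `|g x0 - g y| < g x0 / 2 by move/cvgrPdist_lt : cgx; exact.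
  case/nbhs_ballP => d /= d0 hd.
  exists (Num.min d (Num.min x0 (1 - x0))); split.
  - by rewrite !lt_min d0 x00 subr_gt0.
  - by rewrite !ge_min lexx !orbT.
  - by rewrite !ge_min lexx !orbT.
  - move=> y; rewrite !lt_min => /andP[yd _].
    have := hd y; rewrite /ball/= distrC => /(_ yd); rewrite ltr_norml => /andP[_]; lra.
have I0 : I01 (0 : R) by rewrite /I01/= in_itv/= lexx ler01.
have I1 : I01 (1 : R) by rewrite /I01/= in_itv/= lexx ler01.
have [r [r0 r1 hr]] : exists r : R, [/\ 0 <= r, r < 1 &
    forall y, I01 y -> d <= `|y - x0| -> p y <= r].
  have h1 : 0 <= x0 - d by lra.
  have h2 : x0 + d <= 1 by lra.
  have [y1 Iy1 hy1] := @EVT_max R p 0 (x0 - d) h1 (continuous_subspaceT cp).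
  have [y2 Iy2 hy2] := @EVT_max R p (x0 + d) 1 h2 (continuous_subspaceT cp).
  have J1 : I01 y1 /\ y1 != x0.
    by move: Iy1; rewrite /I01/= !in_itv/= => /andP[-> ?]; split; [apply/andP; split=> //; lra|rewrite lt_eqF//; lra].
  have J2 : I01 y2 /\ y2 != x0.
    by move: Iy2; rewrite /I01/= !in_itv/= => /andP[? ->]; split; [rewrite andbT; lra|rewrite gt_eqF//; lra].
  exists (Num.max (p y1) (p y2)); split.
  - by rewrite le_max p0//; case: J1.
  - by case: J1 J2 => ? ? [? ?]; rewrite gt_max !p1.
  - move=> y; rewrite /I01/= in_itv/= => /andP[y0 y1']; rewrite ler_normr le_max => /orP[h|h].
      by rewrite hy2 ?orbT// in_itv/= y1' andbT; lra.
    by rewrite hy1// in_itv/= y0/=; lra.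
pose r' := (1 + r) / 2.
have rr' : r < r' by rewrite /r'; lra.
have r'0 : 0 < r' by rewrite /r'; lra.
have [d' [d'0 dd' hd']] : exists d' : R, [/\ 0 < d', d' < d & forall y, `|y - x0| <= d' -> r' <= p y].
  have e0 : 0 < 1 - r' by rewrite /r'; lra.
  have : \forall y \near x0, `|p x0 - p y| < 1 - r' by move: (cp x0) => /cvgrPdist_lt; exact.
  case/nbhs_ballP => d' /= d0' hd'.
  exists (Num.min d' d / 2); split.
  - by rewrite divr_gt0// lt_min d0' d0.
  - have : Num.min d' d <= d by rewrite ge_min lexx orbT.
    lra.
  - move=> y hy; have hy' : `|y - x0| < d'.
      have : Num.min d' d <= d' by rewrite ge_min lexx.
      lra.
    have := hd' y; rewrite /ball/= distrC => /(_ hy'); rewrite px0 ltr_norml => /andP[_]; lra.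
have [M M0 hM] := cts01_bounded cg.
have [ii iE] := @itg_indic (x0 - d') (x0 + d') ltac:(lra) ltac:(lra) ltac:(lra).
have cgp n : cts01 (fun y => g y * p y ^+ n).
  apply: cts01M => //; apply: cts_cts01 => y; exact: (continuous_comp (cp y) (@exprn_continuous R n _)).
have key n : g x0 / 2 * r' ^+ n * (2 * d') <= M * r ^+ n.
  have : itg (fun y => g x0 / 2 * r' ^+ n * \1_`[x0 - d', x0 + d'] y - M * r ^+ n) <=
         itg (fun y => g y * p y ^+ n).
    apply: itg_le; [by apply: igB; [exact: igZ|exact/ig_cts/cts01C]|exact: ig_cts|move=> y Iy].
    have pn : 0 <= p y ^+ n by rewrite exprn_ge0// p0.
    have Mr : 0 <= M * r ^+ n by rewrite mulr_ge0// exprn_ge0.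
    rewrite indicE; case: (boolP (y \in _)) => [|yn].
      rewrite inE/= in_itv/= => /andP[ya yb] /=.
      have hy : `|y - x0| <= d' by rewrite ler_norml; apply/andP; split; lra.
      have h1 : g x0 / 2 <= g y by apply: hd; apply: le_lt_trans dd'.
      have h2 : r' ^+ n <= p y ^+ n by rewrite lerXn2r ?nnegrE ?(ltW r'0) ?p0// hd'.
      have h3 : g x0 / 2 * r' ^+ n <= g y * p y ^+ n.
        by apply: ler_pM => //; [rewrite divr_ge0// ltW|rewrite exprn_ge0// ltW].
      lra.
    rewrite mulr0 sub0r; case: (ltP `|y - x0| d) => hy.
      by apply: (@le_trans _ _ 0); [rewrite oppr_le0|rewrite mulr_ge0//; apply: le_trans (hd y hy); rewrite divr_ge0// ltW].
    have : `|g y * p y ^+ n| <= M * r ^+ n.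
      rewrite normrM; apply: ler_pM => //; first exact: hM.
      by rewrite ger0_norm// lerXn2r ?nnegrE ?p0// hr.
    by rewrite ler_norml => /andP[].
  rewrite hn itgB; [|exact: igZ|exact/ig_cts/cts01C].
  rewrite itgZ// iE itg_cst; lra.
have : (fun n => M * (r / r') ^+ n) @ \oo --> M * 0.
  have rr0 : 0 <= r / r' by exact: divr_ge0 r0 (ltW r'0).
  by apply: cvgMr; apply: cvg_expr; rewrite ger0_norm// ltr_pdivrMr// mul1r.
rewrite mulr0 => /cvgrPdist_lt/(_ (g x0 / 2 * (2 * d'))) []; first by nra.
move=> n _ /(_ n (leqnn n)) /=; rewrite sub0r normrN => hh.
have := key n; rewrite leNgt => /negP; apply.
have rn : 0 < r' ^+ n by rewrite exprn_gt0.
rewrite mulrAC -ltr_pdivrMr//; apply: le_lt_trans hh.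
by rewrite -mulrA -expr_div_n ler_norm.
Qed.

Lemma itg_peak g p (x0 : R) : cts01 g -> continuous p -> 0 < x0 < 1 ->
  (forall y, I01 y -> 0 <= p y) -> p x0 = 1 -> (forall y, I01 y -> y != x0 -> p y < 1) ->
  (forall n, itg (fun y => g y * p y ^+ n) = 0) -> g x0 = 0.
Proof.
move=> cg cp x0I p0 px0 p1 hn; apply/eqP; rewrite eq_le (itg_peak_pos cg cp)//=.
rewrite -oppr_le0; apply: (@itg_peak_pos (fun y => - g y) p) => //.
  by move=> y; apply: continuousN; exact: cg.
move=> n; rewrite (@eq_itg _ _ (fun y => -1 * (g y * p y ^+ n))); last by move=> y _; rewrite mulN1r mulNr.
rewrite itgZ ?hn ?mulr0//; apply: ig_cts; apply: cts01M => //.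
by apply: cts_cts01 => y; exact: (continuous_comp (cp y) (@exprn_continuous R n _)).
Qed.

Lemma cts01_zero h : cts01 h -> (forall y, 0 < y < 1 -> h y = 0) -> forall y, I01 y -> h y = 0.
Proof.
move=> ch h0 y; have [_ c0 c1] := (continuous_within_itvP h ltr01).1 ch.
rewrite /I01/= in_itv/= => /andP[]; rewrite le_eqVlt => /predU1P[<- _|y0].
  have : h @ 0^'+ --> (0 : R).
    apply: cvg_near_cst; near=> t; apply: h0; apply/andP; split; near: t; first exact: nbhs_right_gt.
    exact: nbhs_right_lt.
  by move=> h2; exact: (cvg_unique (@Rhausdorff R) c0 h2).
rewrite le_eqVlt => /predU1P[->|y1]; last by rewrite h0// y0.
have : h @ 1^'- --> (0 : R).
  apply: cvg_near_cst; near=> t; apply: h0; apply/andP; split; near: t; last exact: nbhs_left_lt.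
  exact: nbhs_left_gt.
by move=> h2; exact: (cvg_unique (@Rhausdorff R) c1 h2).
Unshelve. all: by end_near.
Qed.

Definition complete (F : nat -> R -> R) := forall h, cts01 h ->
  (forall k, itg (fun y => h y * F k y) = 0) -> forall y, I01 y -> h y = 0.

Definition csp (t y : R) : R := cos (pi * t * y).
Definition snp (t y : R) : R := sin (pi * t * y).

Lemma csp_cont t : continuous (csp t).
Proof.
by move=> y; apply: (@continuous_comp _ _ _ (fun y => pi * t * y) cos); [exact: mulrl_continuous|exact: continuous_cos].
Qed.
Lemma snp_cont t : continuous (snp t).
Proof.
by move=> y; apply: (@continuous_comp _ _ _ (fun y => pi * t * y) sin); [exact: mulrl_continuous|exact: continuous_sin].
Qed.

Lemma cspN t y : csp (- t) y = csp t y. Proof. by rewrite /csp mulrN mulNr cosN. Qed.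
Lemma snpN t y : snp (- t) y = - snp t y. Proof. by rewrite /snp mulrN mulNr sinN. Qed.
Lemma csp0 y : csp 0 y = 1. Proof. by rewrite /csp mulr0 mul0r cos0. Qed.
Lemma snp0 y : snp 0 y = 0. Proof. by rewrite /snp mulr0 mul0r sin0. Qed.
Lemma csp_x0 t : csp t 0 = 1. Proof. by rewrite /csp mulr0 cos0. Qed.
Lemma snp_x0 t : snp t 0 = 0. Proof. by rewrite /snp mulr0 sin0. Qed.
Lemma cspD s t y : csp (s + t) y = csp s y * csp t y - snp s y * snp t y.
Proof. by rewrite /csp mulrDr mulrDl cosD. Qed.
Lemma snpD s t y : snp (s + t) y = snp s y * csp t y + csp s y * snp t y.
Proof. by rewrite /snp mulrDr mulrDl sinD. Qed.
Lemma cspB s t y : csp (s - t) y = csp s y * csp t y + snp s y * snp t y.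
Proof. by rewrite cspD cspN snpN mulrN opprK. Qed.
Lemma snpB s t y : snp (s - t) y = snp s y * csp t y - csp s y * snp t y.
Proof. by rewrite snpD cspN snpN mulrN. Qed.
Lemma csp_sqr t y : csp t y ^+ 2 + snp t y ^+ 2 = 1. Proof. exact: cos2Dsin2. Qed.
Lemma csp_le t y : `|csp t y| <= 1. Proof. exact: cos_max. Qed.
Lemma csp_nat n : csp n%:R 1 = (-1) ^+ n /\ snp n%:R 1 = 0.
Proof.
elim: n => [|n [ihc ihs]]; first by rewrite csp0 snp0.
rewrite -natr1 cspD snpD ihc ihs.
have -> : csp 1 1 = -1 by rewrite /csp !mulr1 cospi.
have -> : snp 1 1 = 0 by rewrite /snp !mulr1 sinpi.
by rewrite !mul0r !mulr0 subr0 addr0 exprSr.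
Qed.

Lemma csp_half : csp (1/2) 1 = 0 /\ snp (1/2) 1 = 1.
Proof. by rewrite /csp /snp mulr1 mulrA mulr1 cos_pihalf sin_pihalf. Qed.

Lemma itgM_cts0 h (F G : R -> R) a b : cts01 h -> continuous F -> continuous G ->
  itg (fun y => h y * F y) = 0 -> itg (fun y => h y * G y) = 0 ->
  itg (fun y => h y * (a * F y + b * G y)) = 0.
Proof.
move=> ch cF cG F0 G0; have iF := ig_cts (cts01M ch (cts_cts01 cF)).
have iG := ig_cts (cts01M ch (cts_cts01 cG)).
rewrite (@eq_itg _ _ (fun y => a * (h y * F y) + b * (h y * G y))); last by move=> y _; ring.
by rewrite itgD ?itgZ ?F0 ?G0 ?mulr0 ?addr0//; exact: igZ.
Qed.

(* Orthogonality to the family is preserved by multiplication by cos(pi y), hence by the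
   peaked function p = 1 - (cos(pi y) - cos(pi x0))^2/4 and its powers. *)
Lemma complete_rec (F : nat -> R -> R) (a b : R) : (forall k, continuous (F k)) ->
  (forall y, csp 1 y * F 0%N y = a * F 1%N y + b * F 0%N y) ->
  (forall k y, csp 1 y * F k.+1 y = 2^-1 * F k.+2 y + 2^-1 * F k y) ->
  (forall y, 0 < y < 1 -> F 0%N y != 0) -> complete F.
Proof.
move=> cF F0 FS Fn h ch hF; apply: cts01_zero => // x0 hx0.
pose perp g := forall k, itg (fun y => g y * F k y) = 0.
have cC : cts01 (csp 1) by exact: cts_cts01 (@csp_cont 1).
have pC g : cts01 g -> perp g -> perp (fun y => g y * csp 1 y).
  move=> cg hg [|k].
    rewrite (@eq_itg _ _ (fun y => g y * (a * F 1%N y + b * F 0%N y))); last by move=> y _; rewrite -F0; ring.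
    exact: itgM_cts0.
  rewrite (@eq_itg _ _ (fun y => g y * (2^-1 * F k.+2 y + 2^-1 * F k y))); last by move=> y _; rewrite -FS; ring.
  exact: itgM_cts0.
pose c0 := csp 1 x0; pose p y := 1 - (csp 1 y - c0) ^+ 2 / 4.
have cp : continuous p.
  move=> y; apply: cvgB; first exact: cvg_cst.
  apply: cvgMl; rewrite (_ : (fun y : R => _) = (fun y => (csp 1 y - c0) * (csp 1 y - c0))); last first.
    by apply/funext => t; rewrite expr2.
  by rewrite expr2; apply: cvgM; apply: cvgB; try exact: cvg_cst; exact: csp_cont.
have pp g : cts01 g -> perp g -> perp (fun y => g y * p y).
  move=> cg hg k; have h1 := pC _ cg hg; have cg1 := cts01M cg cC; have h2 := pC _ cg1 h1.
  have cg2 := cts01M cg1 cC; have cFk := cts_cts01 (@cF k).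
  rewrite (@eq_itg _ _ (fun y => (1 - c0 ^+ 2 / 4) * (g y * F k y) + (c0 / 2 * (g y * csp 1 y * F k y) +
     (- 4^-1) * (g y * csp 1 y * csp 1 y * F k y)))); last by move=> y _; rewrite /p; field.
  have i1 := ig_cts (cts01M cg cFk); have i2 := ig_cts (cts01M cg1 cFk); have i3 := ig_cts (cts01M cg2 cFk).
  rewrite itgD; [|exact: igZ|by apply: igD; exact: igZ].
  by rewrite itgD ?itgZ ?hg ?h1 ?h2 ?mulr0 ?addr0//; exact: igZ.
have cpn n : cts01 (fun y => h y * p y ^+ n).
  by apply: cts01M => //; apply: cts_cts01 => y; exact: (continuous_comp (cp y) (@exprn_continuous R n _)).
have hpn n : perp (fun y => h y * p y ^+ n).
  elim: n => [|n ih k].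
    by move=> k; rewrite -[RHS](hF k); apply: eq_itg => y _; rewrite expr0 mulr1.
  rewrite -[RHS](pp _ (cpn n) ih k); apply: eq_itg => y _; rewrite exprSr; ring.
have : h x0 * F 0%N x0 = 0.
  apply: (@itg_peak (fun y => h y * F 0%N y) p) => //.
  - by apply: cts01M => //; exact: cts_cts01.
  - move=> y _; rewrite /p; have := csp_le 1 y; have := csp_le 1 x0; rewrite -/c0 !ler_norml; nra.
  - by rewrite /p subrr expr0n mul0r subr0.
  - move=> y Iy yx0; rewrite /p ltrBlDr ltrDl divr_gt0// lt_neqAle sqr_ge0 andbT eq_sym sqrf_eq0 subr_eq0.
    apply: contra yx0 => /eqP; rewrite /c0 /csp !mulr1 => /cos_inj e.
    have p0 := pi_gt0 R; have : pi * y = pi * x0.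
      move: Iy hx0; rewrite /I01/= in_itv/= => /andP[y0 y1] /andP[x00 x01].
      by apply: e; rewrite in_itv/= mulr_ge0 ?(ltW p0)// ?(ltW x00)//= -[leRHS]mulr1 ler_wpM2l ?(ltW p0)// ltW.
    by move/(mulfI (lt0r_neq0 p0)) => ->.
  - move=> n; rewrite -[RHS](hpn n 0%N); apply: eq_itg => y _; ring.
by move/eqP; rewrite mulf_eq0 (negPf (Fn x0 hx0)) orbF => /eqP.
Qed.

Lemma csp1_mul t y : csp 1 y * csp (t + 1) y = 2^-1 * csp (t + 2) y + 2^-1 * csp t y.
Proof.
have -> : t + 2 = (t + 1) + 1 by ring.
have -> : csp t y = csp (t + 1 - 1) y by rewrite addrK.
by rewrite (cspD (t + 1)) cspB; field.
Qed.

Lemma csp1_muls t y : csp 1 y * snp (t + 1) y = 2^-1 * snp (t + 2) y + 2^-1 * snp t y.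
Proof.
have -> : t + 2 = (t + 1) + 1 by ring.
have -> : snp t y = snp (t + 1 - 1) y by rewrite addrK.
by rewrite (snpD (t + 1)) snpB; field.
Qed.

Lemma complete_cos : complete (fun k => csp k%:R).
Proof.
apply: (@complete_rec _ 1 0) => [k|y|k y|y _]; first exact: csp_cont.
- by rewrite csp0; ring.
- by rewrite -natr1 csp1_mul -natrD addn2.
- by rewrite csp0 oner_eq0.
Qed.

Lemma complete_sin : complete (fun k => snp k.+1%:R).
Proof.
apply: (@complete_rec _ (2^-1) 0) => [k|y|k y|y hy]; first exact: snp_cont.
- by have := csp1_muls 0 y; rewrite !add0r snp0 mulr0 => ->; rewrite mul0r.
- by rewrite -natr1 csp1_muls -natrD addn2.
- rewrite /snp mulr1 gt_eqF// sin_gt0_pi// mulr_gt0 ?pi_gt0//=; last by case/andP: hy.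
  by case/andP: hy => _ y1; rewrite -[ltRHS]mulr1 ltr_pM2l// pi_gt0.
Qed.

Lemma complete_cosh : complete (fun k => csp (k%:R + 1/2)).
Proof.
apply: (@complete_rec _ (2^-1) (2^-1)) => [k|y|k y|y hy]; first exact: csp_cont.
- have := csp1_mul (-1/2) y; rewrite (_ : -1/2 + 1 = 0 + 1/2); last by field.
  rewrite (_ : -1/2 + 2 = 1 + 1/2); last by field.
  by move=> ->; congr (_ + _ * _); rewrite -cspN; congr csp; field.
- rewrite (_ : k.+1%:R + 1/2 = k%:R + 1/2 + 1); last by rewrite -(natr1 k); ring.
  by rewrite csp1_mul; congr (_ * csp _ _ + _); rewrite -addn2 natrD; ring.
- case/andP: hy => y0 y1; have p0 := pi_gt0 R.
  by rewrite /csp add0r gt_eqF// cos_gt0_pihalf//; apply/andP; split; nra.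
Qed.

Lemma complete_sinh : complete (fun k => snp (k%:R + 1/2)).
Proof.
apply: (@complete_rec _ (2^-1) (- 2^-1)) => [k|y|k y|y hy]; first exact: snp_cont.
- have := csp1_muls (-1/2) y; rewrite (_ : -1/2 + 1 = 0 + 1/2); last by field.
  rewrite (_ : -1/2 + 2 = 1 + 1/2); last by field.
  move=> ->; rewrite (_ : -1/2 = - (0 + 1/2)); last by field.
  by rewrite snpN; ring.
- rewrite (_ : k.+1%:R + 1/2 = k%:R + 1/2 + 1); last by rewrite -(natr1 k); ring.
  by rewrite csp1_muls; congr (_ * snp _ _ + _); rewrite -addn2 natrD; ring.
- case/andP: hy => y0 y1; have p0 := pi_gt0 R.
  by rewrite /snp add0r gt_eqF// sin_gt0_pi//; apply/andP; split; nra.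
Qed.

(* Same idea with p = cos^2(pi (y - x0)), which preserves orthogonality to all frequencies
   of one parity class a + 2Z. *)
Lemma complete_twist (a : R) h : cts01 h ->
  (forall m : int, itg (fun y => h y * csp (2 * m%:~R + a) y) = 0 /\
                   itg (fun y => h y * snp (2 * m%:~R + a) y) = 0) -> forall y, I01 y -> h y = 0.
Proof.
move=> ch hF; apply: cts01_zero => // x0 hx0.
pose perp g := forall m : int, itg (fun y => g y * csp (2 * m%:~R + a) y) = 0 /\
                   itg (fun y => g y * snp (2 * m%:~R + a) y) = 0.
have fS (m : int) : 2 * (m + 1)%:~R + a = 2 * m%:~R + a + 2 :> R by rewrite rmorphD/=; ring.
have fB (m : int) : 2 * (m - 1)%:~R + a = 2 * m%:~R + a - 2 :> R by rewrite rmorphB/=; ring.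
have pC g : cts01 g -> perp g -> perp (fun y => g y * csp 2 y).
  move=> cg hg m; have [a1 b1] := hg (m + 1); have [a2 b2] := hg (m - 1); rewrite fS in a1 b1; rewrite fB in a2 b2.
  split.
    rewrite (@eq_itg _ _ (fun y => g y * (2^-1 * csp (2 * m%:~R + a + 2) y + 2^-1 * csp (2 * m%:~R + a - 2) y))).
      by apply: itgM_cts0 => //; exact: csp_cont.
    by move=> y _; rewrite (cspD (2 * m%:~R + a)) (cspB (2 * m%:~R + a)); field.
  rewrite (@eq_itg _ _ (fun y => g y * (2^-1 * snp (2 * m%:~R + a + 2) y + 2^-1 * snp (2 * m%:~R + a - 2) y))).
    by apply: itgM_cts0 => //; exact: snp_cont.
  by move=> y _; rewrite (snpD (2 * m%:~R + a)) (snpB (2 * m%:~R + a)); field.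
have pS g : cts01 g -> perp g -> perp (fun y => g y * snp 2 y).
  move=> cg hg m; have [a1 b1] := hg (m + 1); have [a2 b2] := hg (m - 1); rewrite fS in a1 b1; rewrite fB in a2 b2.
  split.
    rewrite (@eq_itg _ _ (fun y => g y * (2^-1 * snp (2 * m%:~R + a + 2) y + (- 2^-1) * snp (2 * m%:~R + a - 2) y))).
      by apply: itgM_cts0 => //; exact: snp_cont.
    by move=> y _; rewrite (snpD (2 * m%:~R + a)) (snpB (2 * m%:~R + a)); field.
  rewrite (@eq_itg _ _ (fun y => g y * ((- 2^-1) * csp (2 * m%:~R + a + 2) y + 2^-1 * csp (2 * m%:~R + a - 2) y))).
    by apply: itgM_cts0 => //; exact: csp_cont.
  by move=> y _; rewrite (cspD (2 * m%:~R + a)) (cspB (2 * m%:~R + a)); field.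
pose p y := cos (pi * (y - x0)) ^+ 2.
have pE y : p y = 2^-1 + 2^-1 * (csp 2 x0 * csp 2 y + snp 2 x0 * snp 2 y).
  rewrite mulrC addrC -[csp 2 x0 * _ + _]/(_ + _) /p.
  have -> : csp 2 x0 * csp 2 y + snp 2 x0 * snp 2 y = cos (pi * (y - x0) *+ 2).
    rewrite (_ : pi * (y - x0) *+ 2 = pi * 2 * y - pi * 2 * x0); last by ring.
    by rewrite cosB /csp /snp; ring.
  by rewrite cos_mulr2n mulr2n; field.
have cp : continuous p.
  rewrite (_ : p = (fun y => 2^-1 + 2^-1 * (csp 2 x0 * csp 2 y + snp 2 x0 * snp 2 y))); last exact/funext.
  move=> y; apply: cvgD; first exact: cvg_cst.
  by apply: cvgMr; apply: cvgD; apply: cvgMr; [exact: csp_cont|exact: snp_cont].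
have pp g : cts01 g -> perp g -> perp (fun y => g y * p y).
  move=> cg hg m; have [c1 d1] := hg m; have [c2 d2] := pC _ cg hg m; have [c3 d3] := pS _ cg hg m.
  have cg1 := cts01M cg (cts_cts01 (@csp_cont 2)); have cg2 := cts01M cg (cts_cts01 (@snp_cont 2)).
  have aux (F : R -> R) : continuous F -> itg (fun y => g y * F y) = 0 ->
      itg (fun y => g y * csp 2 y * F y) = 0 -> itg (fun y => g y * snp 2 y * F y) = 0 ->
      itg (fun y => g y * p y * F y) = 0.
    move=> /cts_cts01 cF e1 e2 e3.
    rewrite (@eq_itg _ _ (fun y => 2^-1 * (g y * F y) + (2^-1 * csp 2 x0 * (g y * csp 2 y * F y) +
       2^-1 * snp 2 x0 * (g y * snp 2 y * F y)))); last by move=> y _; rewrite pE; ring.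
    have i1 := ig_cts (cts01M cg cF); have i2 := ig_cts (cts01M cg1 cF); have i3 := ig_cts (cts01M cg2 cF).
    rewrite itgD; [|exact: igZ|by apply: igD; exact: igZ].
    by rewrite itgD ?itgZ ?e1 ?e2 ?e3 ?mulr0 ?addr0//; exact: igZ.
  by split; apply: aux => //; [exact: csp_cont|exact: snp_cont].
have cpn n : cts01 (fun y => h y * p y ^+ n).
  by apply: cts01M => //; apply: cts_cts01 => y; exact: (continuous_comp (cp y) (@exprn_continuous R n _)).
have hpn n : perp (fun y => h y * p y ^+ n).
  elim: n => [|n ih] m.
    by have [c d] := hF m; split; [rewrite -[RHS]c|rewrite -[RHS]d]; apply: eq_itg => y _; rewrite expr0 mulr1.
  have [c d] := pp _ (cpn n) ih m.
  by split; [rewrite -[RHS]c|rewrite -[RHS]d]; apply: eq_itg => y _; rewrite exprSr; ring.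
have key (F : R -> R) : continuous F -> (forall n, itg (fun y => h y * p y ^+ n * F y) = 0) -> h x0 * F x0 = 0.
  move=> cF hh; apply: (@itg_peak (fun y => h y * F y) p) => //.
  - by apply: cts01M => //; exact: cts_cts01.
  - by move=> y _; exact: sqr_ge0.
  - by rewrite /p subrr mulr0 cos0 expr1n.
  - move=> y Iy yx0; rewrite /p cos2sin2 ltrBlDr ltrDl lt_neqAle sqr_ge0 andbT eq_sym sqrf_eq0.
    have p0 := pi_gt0 R.
    move: Iy hx0; rewrite /I01/= in_itv/= => /andP[y0 y1] /andP[x00 x01].
    case: (ltgtP y x0) yx0 => // yx _.
      rewrite -oppr_eq0 -sinN gt_eqF// sin_gt0_pi// -mulrN opprB mulr_gt0 ?subr_gt0//=.
      by rewrite -[ltRHS]mulr1 ltr_pM2l//; lra.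
    rewrite gt_eqF// sin_gt0_pi// mulr_gt0 ?subr_gt0//=.
    by rewrite -[ltRHS]mulr1 ltr_pM2l//; lra.
  - by move=> n; rewrite -[RHS](hh n); apply: eq_itg => y _; ring.
have e1 := key _ (@csp_cont a) (fun n => ltac:(have := (hpn n 0).1; rewrite mulr0 add0r; exact)).
have e2 := key _ (@snp_cont a) (fun n => ltac:(have := (hpn n 0).2; rewrite mulr0 add0r; exact)).
have := csp_sqr a x0 => h1.
by rewrite -[LHS]mulr1 -h1 mulrDr !expr2 !mulrA e1 e2 !mul0r addr0.
Qed.

End Completeness.

(** * Six free boundary value problems with trigonometric eigenbases *)

Section TrigSystems.
Variable R : realType.
Notation mu := (@lebesgue_measure R).

Definition trig (t c s : nat -> R) k y := c k * csp (t k) y + s k * snp (t k) y.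
Definition trig' (t c s : nat -> R) k y := pi * t k * (s k * csp (t k) y - c k * snp (t k) y).

Lemma csp_derive (t y : R) : is_derive y (1 : R) (csp t) (- (pi * t) * snp t y).
Proof.
have h : is_derive y (1 : R) (fun z : R => pi * t * z) (pi * t).
  have := @is_deriveZ R R R id (pi * t) y 1 1 (is_derive_id _ _).
  by rewrite /= (_ : pi * t *: 1 = pi * t)//; rewrite /GRing.scale/= mulr1.
have := @is_derive1_comp R cos (fun z : R => pi * t * z) y _ _ (is_derive_cos _) h.
by rewrite (_ : - sin _ * _ = - (pi * t) * snp t y)//= /snp; ring.
Qed.

Lemma snp_derive (t y : R) : is_derive y (1 : R) (snp t) (pi * t * csp t y).
Proof.
have h : is_derive y (1 : R) (fun z : R => pi * t * z) (pi * t).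
  have := @is_deriveZ R R R id (pi * t) y 1 1 (is_derive_id _ _).
  by rewrite /= (_ : pi * t *: 1 = pi * t)//; rewrite /GRing.scale/= mulr1.
have := @is_derive1_comp R sin (fun z : R => pi * t * z) y _ _ (is_derive_sin _) h.
by rewrite (_ : cos _ * _ = pi * t * csp t y)//= /csp; ring.
Qed.

Lemma trig_C1 (t a b : R) :
  C1 (fun y => a * csp t y + b * snp t y) (fun y => pi * t * (b * csp t y - a * snp t y)).
Proof.
split=> y; last first.
  apply: cvgMr; apply: cvgB; apply: cvgMr; [exact: csp_cont|exact: snp_cont].
have hc := @is_deriveZ R R R (csp t) a y 1 _ (csp_derive t y).
have hs := @is_deriveZ R R R (snp t) b y 1 _ (snp_derive t y).
have := is_deriveD hc hs.
rewrite (_ : a *: _ + b *: _ = pi * t * (b * csp t y - a * snp t y))//.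
by rewrite /GRing.scale/=; ring.
Qed.

Section Make.
Variables (b : bc R) (t c s : nat -> R).
Hypothesis hb : bc_ok b.
Hypothesis ht : forall k, k%:R <= t k <= k.+1%:R.
Hypothesis tm : forall i k, (i <= k)%N -> t i <= t k.
Hypothesis amp : forall k, (t k = 0 /\ c k = 1 /\ s k = 0) \/ (0 < t k /\ c k ^+ 2 + s k ^+ 2 = 2).
Hypothesis dist : forall k l, k != l -> t k = t l -> 0 < t k /\ c k * c l + s k * s l = 0.
Hypothesis hess : forall k, ess b (trig t c s k 0) (trig t c s k 1).
Hypothesis hntl : forall k, ntl b (trig' t c s k 0) (trig' t c s k 1).
Hypothesis hcompl : complete (trig t c s).
Hypothesis hdual : forall h : R -> R, cts01 h -> (forall k, itg (fun y => h y * trig' t c s k y) = 0) ->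
    exists a, forall y, I01 y -> h y = a.
Hypothesis hend : (exists a, forall k, trig t c s k 1 = a * itg (trig' t c s k)) \/
    (exists k, (forall y, trig t c s k y = 1) /\ (pi * t k) ^+ 2 = 0).
Let D k := (pi * t k) ^+ 2.
Let p0 : 0 < pi :> R. Proof. exact: pi_gt0. Qed.
Let t0 k : 0 <= t k. Proof. by have /andP[h _] := ht k; apply: le_trans h; rewrite ler0n. Qed.

Let phC k : C1 (trig t c s k) (trig' t c s k). Proof. exact: trig_C1. Qed.
Let psC k : C1 (trig' t c s k) (fun y => - D k * trig t c s k y).
Proof.
have := trig_C1 (t k) (pi * t k * s k) (- (pi * t k * c k)).
rewrite (_ : (fun y => _) = trig' t c s k); last by apply/funext => y; rewrite /trig'; ring.
by rewrite (_ : (fun y => _) = (fun y => - D k * trig t c s k y))//; apply/funext => y; rewrite /trig /D; ring.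
Qed.

Let byparts k l : itg (fun y => trig' t c s k y * trig' t c s l y) =
  D l * itg (fun y => trig t c s k y * trig t c s l y).
Proof.
have ck := cts_cts01 (C1_cont (phC k)); have cl := cts_cts01 (C1_cont (phC l)).
rewrite (itg_parts (ig_cts (cts_cts01 (phC k).2)) (psC l) ck (C1_int (phC k))).
have := bnd0 hb (hess k) (hntl l); rewrite (mulrC (trig' _ _ _ l 1)) (mulrC (trig' _ _ _ l 0)) => ->.
rewrite subrr sub0r (@eq_itg _ _ (fun y => - D l * (trig t c s k y * trig t c s l y))); last by move=> y _; ring.
by rewrite itgZ ?mulNr ?opprK//; exact/ig_cts/cts01M.
Qed.

(** No trigonometric integral is evaluated. For equal frequencies
    [trig' k * trig' l + D * trig k * trig l] is constant, and integration by parts relates its two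
    integrals. For different frequencies [orth] applies [byparts] in both orders. *)
Let same k l : t k = t l -> 2 * (D k * itg (fun y => trig t c s k y * trig t c s l y)) =
  D k * (c k * c l + s k * s l).
Proof.
move=> kl; have ck i := cts_cts01 (C1_cont (phC i)); have cp i := cts_cts01 (phC i).2.
have <- : itg (fun y => trig' t c s k y * trig' t c s l y + D k * (trig t c s k y * trig t c s l y)) =
    D k * (c k * c l + s k * s l).
  rewrite -[RHS]itg_cst; apply: eq_itg => y _.
  by rewrite -[RHS]mulr1 -(csp_sqr (t l) y) /trig /trig' /D kl; ring.
rewrite itgD; [|exact/ig_cts/cts01M|exact/igZ/ig_cts/cts01M].
by rewrite itgZ ?byparts /D ?kl ?mulr2n; [ring|exact/ig_cts/cts01M].
Qed.

Let orth k l : itg (fun y => trig t c s k y * trig t c s l y) = (k == l)%:R.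
Proof.
have [kl|kl] := eqVneq k l.
  rewrite -kl; case: (amp k) => [[tk [ck sk]]|[tk cs]].
    rewrite -[RHS](itg_cst 1); apply: eq_itg => y _; rewrite /trig tk ck sk csp0; ring.
  have Dk : D k != 0 by rewrite /D sqrf_eq0 mulf_neq0// gt_eqF.
  apply: (mulfI Dk); have := same (erefl (t k)); rewrite -!expr2 cs /= => h; lra.
have [tkl|tkl] := eqVneq (t k) (t l).
  have [tk z] := dist kl tkl.
  have Dk : D k != 0 by rewrite /D sqrf_eq0 mulf_neq0// gt_eqF.
  by apply: (mulfI Dk); have := same tkl; rewrite z /= => h; lra.
have h : D k * itg (fun y => trig t c s k y * trig t c s l y) = D l * itg (fun y => trig t c s k y * trig t c s l y).
  rewrite -byparts (@eq_itg _ (fun y => trig' t c s k y * trig' t c s l y) (fun y => trig' t c s l y * trig' t c s k y)); last by move=> y _; rewrite mulrC.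
  by rewrite byparts; congr (_ * _); apply: eq_itg => y _; rewrite mulrC.
have Dkl : D k - D l != 0.
  rewrite subr_eq0 /D eqrXn2 ?mulr_ge0 ?(ltW p0)//; apply: contra tkl => /eqP/(mulfI (lt0r_neq0 p0)) ->//.
by apply: (mulfI Dkl); rewrite mulrBl h subrr mulr0.
Qed.

Let cs2 k : c k ^+ 2 + s k ^+ 2 <= 2.
Proof. by case: (amp k) => [[_ [-> ->]]|[_ ->]]//; rewrite expr1n expr0n addr0 ler1n. Qed.

Let bnd (a d : R) k y : a ^+ 2 + d ^+ 2 <= 2 -> `|a * csp (t k) y + d * snp (t k) y| <= 2.
Proof.
move=> h; rewrite -(ger0_norm (ler0n R 2)) -ler_sqr ?nnegrE// !sqr_normr.
set C := csp _ _; set S := snp _ _.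
have -> : (a * C + d * S) ^+ 2 = (a ^+ 2 + d ^+ 2) * (C ^+ 2 + S ^+ 2) - (a * S - d * C) ^+ 2 by ring.
by rewrite csp_sqr; have := sqr_ge0 (a * S - d * C); lra.
Qed.

Lemma trig_system : system b (trig t c s) (trig' t c s) (fun k => (pi * t k) ^+ 2).
Proof.
have p2 : 2 <= pi :> R by exact: pi_ge2.
have p4 : pi <= 4 :> R by have := pihalf_lt2 R; lra.
split=> //.
- by move=> k y; rewrite /trig bnd.
- move=> k y; rewrite sqrtr_sqr /trig' normrM mulrC ler_wpM2r//.
  by rewrite -mulNr bnd// sqrrN addrC.
- move=> k; have /andP[h _] := ht k; rewrite lerXn2r ?nnegrE ?mulr_ge0 ?(ltW p0)//.
  by apply: ler_pM => //; rewrite ler0n.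
- move=> k; have /andP[_ h] := ht k; rewrite lerXn2r ?nnegrE ?mulr_ge0 ?(ltW p0)//.
  by apply: ler_pM => //; exact: ltW.
- move=> i k ik; rewrite lerXn2r ?nnegrE ?mulr_ge0 ?(ltW p0)//.
  by rewrite ler_wpM2l ?(ltW p0)// tm.
- by move=> k l; rewrite byparts orth; case: eqVneq => [->//|_]; rewrite !mulr0.
Qed.

End Make.

Let r2 : R := Num.sqrt 2.
Let r2K : r2 ^+ 2 = 2. Proof. by rewrite /r2 sqr_sqrtr. Qed.
Let r2n : r2 != 0. Proof. by rewrite /r2 sqrtr_eq0 -ltNge. Qed.

Let nz (x : R) : 0 < x -> pi * x * r2 != 0.
Proof. by move=> x0; rewrite !mulf_neq0// gt_eqF// pi_gt0. Qed.

Definition nn_c (k : nat) : R := if k == 0%N then 1 else Num.sqrt 2.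
Definition zz (k : nat) : R := 0.
Definition dd_s (k : nat) : R := Num.sqrt 2.
Definition nn_t (k : nat) : R := k%:R.
Definition dd_t (k : nat) : R := k.+1%:R.
Definition hh_t (k : nat) : R := k%:R + 1/2.
(** In units of pi, periodic index 0 is the constant, and [2m - 1], [2m] are the sine and cosine of
    frequency [2m]; antiperiodic [2m], [2m + 1] are the cosine and sine of frequency [2m + 1]. *)
Definition per_t (k : nat) : R := (uphalf k).*2%:R.
Definition anti_t (k : nat) : R := (k./2).*2.+1%:R.
Definition per_c (k : nat) : R := if k == 0%N then 1 else if odd k then 0 else Num.sqrt 2.
Definition anti_c k : R := if odd k then 0 else Num.sqrt 2.
Definition od_s k : R := if odd k then Num.sqrt 2 else 0.

Lemma itg_scale0 (h F : R -> R) a : a != 0 -> cts01 h -> continuous F ->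
  itg (fun y => h y * (a * F y)) = 0 -> itg (fun y => h y * F y) = 0.
Proof.
move=> a0 ch /cts_cts01 cF; rewrite (@eq_itg _ _ (fun y => a * (h y * F y))); last by move=> y _; ring.
by rewrite itgZ; [move/eqP; rewrite mulf_eq0 (negPf a0) => /eqP|exact/ig_cts/cts01M].
Qed.

Lemma nn_system : system (Sep R false false) (trig nn_t nn_c zz) (trig' nn_t nn_c zz)
  (fun k => (pi * nn_t k) ^+ 2).
Proof.
apply: trig_system => //.
- by move=> k; rewrite lexx ler_nat leqnSn.
- by move=> i k ik; rewrite ler_nat.
- move=> [|k]; [by left|right]; split; first by rewrite ltr0n.
  by rewrite /nn_c /zz /= r2K expr0n addr0.
- by move=> k l kl /eqP; rewrite eqr_nat (negPf kl).
- move=> k; rewrite /trig' /zz /nn_t snp_x0; have [_ ->] := csp_nat R k; split=> _; ring.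
- move=> h ch hk; apply: (@complete_cos R) => // k.
  apply: (itg_scale0 (a := nn_c k)) => //; [by rewrite /nn_c; case: (k) => //=; exact: oner_neq0|exact: csp_cont|].
  by rewrite -[RHS](hk k); apply: eq_itg => y _; rewrite /trig /zz mul0r addr0.
- move=> h ch hk; exists 0; apply: (@complete_sin R) => // k.
  apply: (itg_scale0 (a := - (pi * k.+1%:R * r2))) => //; first by rewrite oppr_eq0 nz.
    exact: snp_cont.
  by rewrite -[RHS](hk k.+1); apply: eq_itg => y _; rewrite /trig' /zz /nn_c /nn_t /= -/r2; ring.
- right; exists 0%N; split; last by rewrite mulr0 expr0n.
  by move=> y; rewrite /trig /zz csp0 mul0r addr0 mulr1.
Qed.

Lemma dd_system : system (Sep R true true) (trig dd_t zz dd_s) (trig' dd_t zz dd_s)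
  (fun k => (pi * dd_t k) ^+ 2).
Proof.
apply: trig_system => //.
- by move=> k; rewrite lexx ler_nat leqnSn.
- by move=> i k ik; rewrite ler_nat ltnS.
- move=> k; right; split; first by rewrite ltr0n.
  by rewrite /zz /dd_s r2K expr0n add0r.
- by move=> k l kl /eqP; rewrite eqr_nat eqSS (negPf kl).
- move=> k; rewrite /trig /zz /dd_t snp_x0; have [_ ->] := csp_nat R k.+1; split=> _; ring.
- move=> h ch hk; apply: (@complete_sin R) => // k.
  apply: (itg_scale0 (a := r2)) => //; first exact: snp_cont.
  by rewrite -[RHS](hk k); apply: eq_itg => y _; rewrite /trig /zz mul0r add0r.
- move=> h ch hk; exists (itg h) => y Iy; apply/eqP; rewrite -subr_eq0; apply/eqP.
  apply: (@complete_cos R (fun y => h y - itg h)) Iy; first by apply: cts01B => //; exact: cts01C.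
  have ih := ig_cts ch; have ic : ig (fun=> itg h) by exact/ig_cts/cts01C.
  move=> [|k].
    rewrite (@eq_itg _ _ (fun y => h y - itg h)); last by move=> z _; rewrite csp0 mulr1.
    by rewrite itgB// itg_cst subrr.
  have ck := cts_cts01 (@csp_cont R k.+1%:R).
  rewrite (@eq_itg _ _ (fun y => h y * csp k.+1%:R y - itg h * csp k.+1%:R y)); last by move=> z _; ring.
  rewrite itgB; [|exact/ig_cts/cts01M|exact/igZ/ig_cts].
  rewrite (itg_scale0 (a := pi * k.+1%:R * r2) _ ch)//.
  + have pk : pi * k.+1%:R != 0 :> R by rewrite mulf_neq0 ?gt_eqF ?pi_gt0.
    have := C1_itg (trig_C1 k.+1%:R 0 (1 : R)); have [_ ->] := csp_nat R k.+1.
    rewrite snp_x0 !mulr0 !mul0r addr0 subrr (@eq_itg _ _ (fun y => pi * k.+1%:R * csp k.+1%:R y)); last by move=> z _; ring.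
    rewrite itgZ; last exact: ig_cts.
    move=> /eqP; rewrite mulf_eq0 (negPf pk) /= => /eqP z.
    by rewrite itgZ ?z ?mulr0 ?subrr//; exact: ig_cts.
  + by rewrite nz.
  + exact: csp_cont.
  + by rewrite -[RHS](hk k); apply: eq_itg => z _; rewrite /trig' /zz /dd_s /dd_t -/r2; ring.
- left; exists 0 => k; rewrite mul0r /trig /zz /dd_t; have [_ ->] := csp_nat R k.+1; ring.
Qed.

Lemma csp_hh (k : nat) : csp (hh_t k) 1 = 0.
Proof.
rewrite /hh_t cspD; have [-> ->] := csp_half R; have [_ ->] := csp_nat R k; ring.
Qed.

Lemma hh_bound k : (k%:R : R) <= hh_t k <= k.+1%:R.
Proof. by rewrite /hh_t -(natr1 k); apply/andP; split; lra. Qed.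

Lemma hh_pos k : 0 < hh_t k.
Proof. by rewrite /hh_t ltr_wpDl. Qed.

Lemma nd_system : system (Sep R false true) (trig hh_t dd_s zz) (trig' hh_t dd_s zz)
  (fun k => (pi * hh_t k) ^+ 2).
Proof.
apply: trig_system => //.
- exact: hh_bound.
- by move=> i k ik; rewrite lerD2r ler_nat.
- move=> k; right; split; first exact: hh_pos.
  by rewrite /zz /dd_s r2K expr0n addr0.
- by move=> k l kl /addIr/eqP; rewrite eqr_nat (negPf kl).
- by move=> k; split=> // _; rewrite /trig csp_hh /zz; ring.
- by move=> k; split=> // _; rewrite /trig' /zz snp_x0; ring.
- move=> h ch hk; apply: (@complete_cosh R) => // k.
  apply: (itg_scale0 (a := r2)) => //; first exact: csp_cont.
  by rewrite -[RHS](hk k); apply: eq_itg => y _; rewrite /trig /zz mul0r addr0.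
- move=> h ch hk; exists 0; apply: (@complete_sinh R) => // k.
  apply: (itg_scale0 (a := - (pi * hh_t k * r2))) => //; first by rewrite oppr_eq0 nz// hh_pos.
    exact: snp_cont.
  by rewrite -[RHS](hk k); apply: eq_itg => y _; rewrite /trig' /zz /dd_s -/r2 -/(hh_t k); ring.
- by left; exists 0 => k; rewrite mul0r /trig csp_hh /zz; ring.
Qed.

Lemma dn_system : system (Sep R true false) (trig hh_t zz dd_s) (trig' hh_t zz dd_s)
  (fun k => (pi * hh_t k) ^+ 2).
Proof.
apply: trig_system => //.
- exact: hh_bound.
- by move=> i k ik; rewrite lerD2r ler_nat.
- move=> k; right; split; first exact: hh_pos.
  by rewrite /zz /dd_s r2K expr0n add0r.
- by move=> k l kl /addIr/eqP; rewrite eqr_nat (negPf kl).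
- by move=> k; split=> // _; rewrite /trig snp_x0 /zz; ring.
- by move=> k; split=> // _; rewrite /trig' csp_hh /zz; ring.
- move=> h ch hk; apply: (@complete_sinh R) => // k.
  apply: (itg_scale0 (a := r2)) => //; first exact: snp_cont.
  by rewrite -[RHS](hk k); apply: eq_itg => y _; rewrite /trig /zz mul0r add0r.
- move=> h ch hk; exists 0; apply: (@complete_cosh R) => // k.
  apply: (itg_scale0 (a := pi * hh_t k * r2)) => //; first by rewrite nz// hh_pos.
    exact: csp_cont.
  by rewrite -[RHS](hk k); apply: eq_itg => y _; rewrite /trig' /zz /dd_s -/r2 -/(hh_t k); ring.
- left; exists 1 => k; rewrite mul1r (C1_itg (trig_C1 (hh_t k) (zz k) (dd_s k))).
  by rewrite /trig snp_x0 /zz; ring.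
Qed.

Lemma csp_even (n : nat) : csp (n.*2%:R : R) 1 = 1 /\ snp (n.*2%:R : R) 1 = 0.
Proof. by have [-> ->] := csp_nat R n.*2; rewrite -signr_odd odd_double. Qed.

Lemma csp_odd (n : nat) : csp (n.*2.+1%:R : R) 1 = -1 /\ snp (n.*2.+1%:R : R) 1 = 0.
Proof. by have [-> ->] := csp_nat R n.*2.+1; rewrite -signr_odd /= odd_double. Qed.

Lemma complete_twist_nat (a : bool) (h : R -> R) : cts01 h ->
  (forall n : nat, itg (fun y => h y * csp (n.*2 + a)%:R y) = 0 /\
                   itg (fun y => h y * snp (n.*2 + a)%:R y) = 0) -> forall y, I01 y -> h y = 0.
Proof.
move=> ch hn; apply: (@complete_twist R a%:R) => // -[n|n].
  by have := hn n; rewrite natrD -muln2 natrM mulrC.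
(* A negative frequency is the opposite of a nonnegative one in the same parity class. *)
have -> : 2 * (Negz n)%:~R + a%:R = - ((n.+1 - a).*2 + a)%:R :> R.
  have -> : (Negz n)%:~R = - (n%:R + 1) :> R by rewrite NegzE mulrNz -pmulrn natr1.
  rewrite -muln2 natrD natrM; case: (a); rewrite ?subn1 ?subn0 /=; first by ring.
  by rewrite -(natr1 n); ring.
have [c d] := hn (n.+1 - a)%N; split.
  by rewrite -[RHS]c; apply: eq_itg => y _; rewrite cspN.
rewrite (@eq_itg _ _ (fun y => -1 * (h y * snp ((n.+1 - a).*2 + a)%:R y))); last first.
  by move=> y _; rewrite snpN; ring.
rewrite itgZ ?d ?mulr0//; apply: ig_cts; apply: cts01M => //; exact: cts_cts01 (@snp_cont R _).
Qed.

Lemma uphalf_bounds k : (k <= (uphalf k).*2 <= k.+1)%N.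
Proof.
by move: (odd_double_half k); rewrite uphalf_half; case: (odd k) => /=; lia.
Qed.

Lemma half_bounds k : (k <= (k./2).*2.+1 <= k.+1)%N.
Proof. by move: (odd_double_half k); case: (odd k) => /=; lia. Qed.

Lemma itg_csp_even (n : nat) : (0 < n)%N -> itg (csp n.*2%:R : R -> R) = 0 /\ itg (snp n.*2%:R : R -> R) = 0.
Proof.
move=> n0; have pn : pi * n.*2%:R != 0 :> R.
  by rewrite mulf_neq0 ?gt_eqF ?pi_gt0// ltr0n double_gt0.
have [c1 s1] := csp_even n.
have ic := ig_cts (cts_cts01 (@csp_cont R n.*2%:R)); have is' := ig_cts (cts_cts01 (@snp_cont R n.*2%:R)).
split; apply: (mulfI pn); rewrite mulr0 -itgZ//.
  have := C1_itg (trig_C1 n.*2%:R 0 (1 : R)); rewrite c1 s1 csp_x0 snp_x0 => h.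
  transitivity (0 * 1 + 1 * 0 - (0 * 1 + 1 * 0) : R); last by ring.
  by rewrite -h; apply: eq_itg => y _; ring.
have := C1_itg (trig_C1 n.*2%:R (-1) (0 : R)); rewrite c1 s1 csp_x0 snp_x0 => h.
transitivity (-1 * 1 + 0 * 0 - (-1 * 1 + 0 * 0) : R); last by ring.
by rewrite -h; apply: eq_itg => y _; ring.
Qed.

Lemma per_system : system (Twist 1) (trig per_t per_c od_s) (trig' per_t per_c od_s)
  (fun k => (pi * per_t k) ^+ 2).
Proof.
have odE n : (0 < n)%N -> odd n.*2.-1 by case: n => // n _; rewrite doubleS /= odd_double.
have upE n : (0 < n)%N -> uphalf n.*2.-1 = n by case: n => // n _; rewrite doubleS /= doubleK.
have npos n : (0 < n)%N -> 0 < n.*2%:R :> R by move=> n0; rewrite ltr0n double_gt0.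
apply: trig_system => //=.
- by rewrite mulr1.
- by move=> k; rewrite !ler_nat uphalf_bounds.
- by move=> i k ik; rewrite ler_nat leq_double; exact: (@half_leq i.+1 k.+1).
- move=> [|k]; [by left|right]; split; first by rewrite ltr0n double_gt0.
  by rewrite /per_c /od_s; case: (odd _); rewrite /= r2K expr0n ?addr0 ?add0r.
- move=> k l kl /eqP; rewrite eqr_nat => /eqP/double_inj e.
  have lk : k = 0%N -> False.
    move=> k0; move: e kl; rewrite k0 /= => e; have := uphalf_bounds l; rewrite -e; by case: (l).
  have ll : l = 0%N -> False.
    move=> k0; move: e kl; rewrite k0 /= => e; have := uphalf_bounds k; rewrite e; by case: (k).
  split; first by rewrite ltr0n double_gt0; case: (k) lk.
  have : odd k != odd l.
    apply: contra kl => /eqP o; move: e; rewrite !uphalf_half o => /addnI e.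
    by rewrite -(odd_double_half k) -(odd_double_half l) o e.
  rewrite /per_c /od_s; case: (k) lk => [/(_ erefl)//|k' _]; case: (l) ll => [/(_ erefl)//|l' _].
  by case: (odd k'.+1); case: (odd l'.+1) => //= _; ring.
- by move=> k; rewrite /trig /per_t csp_x0 snp_x0; have [-> ->] := csp_even (uphalf k); rewrite mul1r.
- by move=> k; rewrite /trig' /per_t csp_x0 snp_x0; have [-> ->] := csp_even (uphalf k); rewrite mul1r.
- move=> h ch hk; apply: (@complete_twist_nat false) => // n; rewrite addn0; split.
    apply: (itg_scale0 (a := per_c n.*2)) => //.
    + by rewrite /per_c double_eq0 odd_double; case: (n == 0)%N => //; exact: oner_neq0.
    + exact: csp_cont.
    + rewrite -[RHS](hk n.*2); apply: eq_itg => y _.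
      by rewrite /trig /od_s /per_t odd_double uphalf_double mul0r addr0.
  case: n => [|n].
    by rewrite -[RHS](itg_cst (0 : R)); apply: eq_itg => y _; rewrite snp0 mulr0.
  apply: (itg_scale0 (a := r2)) => //; first exact: snp_cont.
  rewrite -[RHS](hk n.+1.*2.-1); apply: eq_itg => y _.
  by rewrite /trig /od_s /per_t /per_c odE// upE// doubleS /= -/r2; ring.
- move=> h ch hk; exists (itg h) => y Iy; apply/eqP; rewrite -subr_eq0; apply/eqP.
  apply: (@complete_twist_nat false (fun y => h y - itg h)) Iy; first by apply: cts01B => //; exact: cts01C.
  have ih := ig_cts ch; have ic : ig (fun=> itg h) by exact/ig_cts/cts01C.
  move=> n; rewrite addn0; case: n => [|n].
    split; last by rewrite -[RHS](itg_cst (0 : R)); apply: eq_itg => z _; rewrite snp0 mulr0.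
    rewrite (@eq_itg _ _ (fun y => h y - itg h)); last by move=> z _; rewrite csp0 mulr1.
    by rewrite itgB// itg_cst subrr.
  have [zc zs] := itg_csp_even (ltn0Sn n).
  have aux (F : R -> R) : continuous F -> itg F = 0 -> itg (fun y => h y * F y) = 0 ->
      itg (fun y => (h y - itg h) * F y) = 0.
    move=> /cts_cts01 cF F0 hF.
    rewrite (@eq_itg _ _ (fun y => h y * F y - itg h * F y)); last by move=> z _; ring.
    rewrite itgB; [|exact/ig_cts/cts01M|exact/igZ/ig_cts].
    by rewrite itgZ ?F0 ?hF ?mulr0 ?subrr//; exact: ig_cts.
  split; apply: aux => //; try exact: csp_cont; try exact: snp_cont.
    apply: (itg_scale0 (a := pi * n.+1.*2%:R * r2)) => //; [by rewrite nz// npos|exact: csp_cont|].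
    rewrite -[RHS](hk n.+1.*2.-1); apply: eq_itg => z _.
    by rewrite /trig' /od_s /per_t /per_c odE// upE// doubleS /= -/r2; ring.
  apply: (itg_scale0 (a := - (pi * n.+1.*2%:R * r2))) => //; [by rewrite oppr_eq0 nz// npos|exact: snp_cont|].
  rewrite -[RHS](hk n.+1.*2); apply: eq_itg => z _.
  rewrite /trig' /od_s /per_t /per_c odd_double uphalf_double double_eq0 /= -/r2; ring.
- right; exists 0%N; split; last by rewrite /per_t mulr0 expr0n.
  by move=> y; rewrite /trig /per_t /od_s /per_c /= csp0 snp0; ring.
Qed.

Lemma anti_system : system (Twist (-1)) (trig anti_t anti_c od_s) (trig' anti_t anti_c od_s)
  (fun k => (pi * anti_t k) ^+ 2).
Proof.
have npos n : 0 < n.*2.+1%:R :> R by rewrite ltr0n.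
apply: trig_system => //=.
- by rewrite mulrNN mulr1.
- by move=> k; rewrite !ler_nat half_bounds.
- by move=> i k ik; rewrite ler_nat ltnS leq_double half_leq.
- move=> k; right; split; first exact: npos.
  by rewrite /anti_c /od_s; case: (odd _); rewrite /= r2K expr0n ?addr0 ?add0r.
- move=> k l kl /eqP; rewrite eqr_nat => /eqP[]/double_inj e.
  split; first exact: npos.
  have : odd k != odd l.
    by apply: contra kl => /eqP o; rewrite -(odd_double_half k) -(odd_double_half l) o e.
  by rewrite /anti_c /od_s; case: (odd k); case: (odd l) => //= _; ring.
- by move=> k; rewrite /trig /anti_t csp_x0 snp_x0; have [-> ->] := csp_odd (k./2); ring.
- by move=> k; rewrite /trig' /anti_t csp_x0 snp_x0; have [-> ->] := csp_odd (k./2); ring.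
- move=> h ch hk; apply: (@complete_twist_nat true) => // n; rewrite addn1; split.
    apply: (itg_scale0 (a := r2)) => //; first exact: csp_cont.
    rewrite -[RHS](hk n.*2); apply: eq_itg => y _.
    by rewrite /trig /od_s /anti_c /anti_t odd_double doubleK mul0r addr0.
  apply: (itg_scale0 (a := r2)) => //; first exact: snp_cont.
  rewrite -[RHS](hk n.*2.+1); apply: eq_itg => y _.
  by rewrite /trig /od_s /anti_t /anti_c /= odd_double uphalf_double /= mul0r add0r.
- move=> h ch hk; exists 0; apply: (@complete_twist_nat true) => // n; rewrite addn1; split.
    apply: (itg_scale0 (a := pi * n.*2.+1%:R * r2)) => //; [by rewrite nz// npos|exact: csp_cont|].
    rewrite -[RHS](hk n.*2.+1); apply: eq_itg => z _.
    by rewrite /trig' /od_s /anti_t /anti_c /= odd_double uphalf_double /= -/r2; ring.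
  apply: (itg_scale0 (a := - (pi * n.*2.+1%:R * r2))) => //; [by rewrite oppr_eq0 nz// npos|exact: snp_cont|].
  rewrite -[RHS](hk n.*2); apply: eq_itg => z _.
  by rewrite /trig' /od_s /anti_t /anti_c odd_double doubleK /= -/r2; ring.
- left; exists (2^-1) => k; rewrite (C1_itg (trig_C1 (anti_t k) (anti_c k) (od_s k))).
  by rewrite /trig /anti_t csp_x0 snp_x0; have [-> ->] := csp_odd (k./2); field.
Qed.

End TrigSystems.

(** * Comparison of boundary conditions and enumeration of eigenvalues *)

Section Trial.
Variable R : realType.
Notation mu := (@lebesgue_measure R).
Implicit Types (f g q u v : R -> R).

Lemma ig_sum2 n (c : 'I_n -> R) (u : 'I_n -> 'I_n -> R -> R) : (forall i j, ig (u i j)) ->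
  ig (fun y => \sum_i \sum_j c i * c j * u i j y) /\
  itg (fun y => \sum_i \sum_j c i * c j * u i j y) = \sum_i \sum_j c i * c j * itg (u i j).
Proof.
move=> h; have h2 i : ig (fun y => \sum_j c i * c j * u i j y).
  by apply: ig_sum => j; exact: igZ.
split; first exact: ig_sum.
rewrite itg_sum//; apply: eq_bigr => i _; rewrite itg_sum; last by move=> j; exact: igZ.
by apply: eq_bigr => j _; rewrite itgZ.
Qed.

Lemma sum2E n (c : 'I_n -> R) (u : 'I_n -> R) (q : R) :
  q * (\sum_i c i * u i) * (\sum_i c i * u i) = \sum_i \sum_j c i * c j * (q * u i * u j).
Proof.
rewrite [q * _]mulr_sumr mulr_suml; apply: eq_bigr => i _; rewrite mulr_sumr.
by apply: eq_bigr => j _; ring.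
Qed.

Lemma sum2_diag n (c a : 'I_n -> R) :
  \sum_i \sum_j c i * c j * (a i * (i == j)%:R) = \sum_i a i * c i ^+ 2.
Proof.
apply: eq_bigr => i _; rewrite (bigD1 i)//= eqxx mulr1 big1 ?addr0; first by ring.
by move=> j; rewrite eq_sym => /negPf->; rewrite !mulr0.
Qed.

Lemma cts01_sum n (u : 'I_n -> R -> R) (c : 'I_n -> R) :
  (forall i, cts01 (u i)) -> cts01 (fun y => \sum_i c i * u i y).
Proof.
move=> h; elim: n u c h => [|n ih] u c h.
  by rewrite (_ : (fun _ => _) = (fun=> 0)); [exact: cts01C|apply/funext => y; rewrite big_ord0].
rewrite (_ : (fun _ => _) = (fun y => (\sum_(i < n) c (widen_ord (leqnSn n) i) * u (widen_ord (leqnSn n) i) y)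
   + c ord_max * u ord_max y)); last by apply/funext => y; rewrite big_ord_recr.
apply: cts01D; last by apply: cts01M => //; exact: cts01C.
exact: (ih (fun i => u (widen_ord (leqnSn n) i)) (fun i => c (widen_ord (leqnSn n) i))).
Qed.

(** Rayleigh-Ritz with functions that need not lie in the form domain individually: the [m]
    constraints bring their combinations into it. The coefficients of a combination preserve its
    norm exactly and do not increase its energy, by [coef_QQ]. *)
Lemma trial_upper (c : bc R) phi psi D (sys : system c phi psi D) q (hq : sq q) E e
    (S : spec D (mat phi q) E e) (n m j : nat) (u v : 'I_n -> R -> R)
    (l : 'I_m -> 'I_n -> R) (lam : 'I_n -> R) (M : R) :
  (m + j < n)%N -> (forall i, cts01 (u i)) -> (forall i, cts01 (v i)) ->
  (forall i x, I01 x -> u i x = u i 0 + Rintegral mu `[0, x] (v i)) ->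
  (forall i k, itg (fun y => u i y * u k y) = (i == k)%:R) ->
  (forall i k, itg (fun y => v i y * v k y) + itg (fun y => q y * u i y * u k y) = lam i * (i == k)%:R) ->
  (forall i, lam i <= M) ->
  (forall a : 'I_n -> R, (forall s, \sum_i a i * l s i = 0) ->
    ess c (\sum_i a i * u i 0) (\sum_i a i * u i 1)) -> E j <= M.
Proof.
move=> mjn cu cv uv uo vo lM hes.
have H := mat_adm sys hq.
apply: (@minmax_up _ _ _ _ H _ _ S n m j (fun i => coef phi (u i)) l) => //.
  by move=> i; exact: (coef_l2 sys (sq_cts (cu i))).
move=> a [i0 ai0] la x.
pose U y := \sum_i a i * u i y; pose V y := \sum_i a i * v i y.
have cU : cts01 U by exact: cts01_sum.
have cV : cts01 V by exact: cts01_sum.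
have UV t : I01 t -> U t = U 0 + Rintegral mu `[0, t] V.
  move=> It; have t0 : 0 <= t by move: It; rewrite /I01/= in_itv/= => /andP[].
  have t1 : t <= 1 by move: It; rewrite /I01/= in_itv/= => /andP[].
  have sub : `[0, t] `<=` I01 (R := R).
    by move=> z; rewrite /I01/= !in_itv/= => /andP[-> /le_trans->].
  rewrite /U (eq_bigr (fun i => a i * u i 0 + a i * Rintegral mu `[0, t] (v i))); last first.
    by move=> i _; rewrite (uv i _ It) mulrDr.
  rewrite big_split/=; congr (_ + _).
  have mt : measurable (`[0, t] : set (measurableTypeR R)) by exact: measurable_itv.
  have iv i : mu.-integrable `[0, t] (EFin \o v i).
    by apply: (@integrableS _ _ _ mu _ _ _ _ _ sub (ig_cts (cv i))); exact: measurable_itv.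
  have zv i : mu.-integrable `[0, t] (EFin \o (fun y => a i * v i y)).
    by have := integrableZl (mt : measurable (`[0, t] : set (measurableTypeR R))) (a i) (iv i).
  rewrite /V; elim: (index_enum _) => [|i r ih].
    rewrite big_nil (_ : (fun _ => _) = (fun=> 0)); last by apply/funext => y; rewrite big_nil.
    by rewrite Rintegral_cst ?mul0r//; exact: measurable_itv.
  rewrite big_cons ih (_ : (fun y : R => \sum_(j <- i :: r) _) =
    (fun y => a i * v i y + \sum_(j <- r) a j * v j y)); last by apply/funext => y; rewrite big_cons.
  rewrite RintegralD ?RintegralZl//; try exact: measurable_itv.
  elim: (r) => [|k s ih'].
    rewrite (_ : (EFin \o _) = (fun=> 0%E)); first exact: integrable0.
    by apply/funext => y /=; rewrite big_nil.
  rewrite (_ : (EFin \o _) = (fun y => (a k * v k y)%:E + (\sum_(j <- s) a j * v j y)%:E)%E); last first.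
    by apply/funext => y /=; rewrite big_cons EFinD.
  by apply: integrableD (zv k) ih'; exact: measurable_itv.
have eU : ess c (U 0) (U 1) by exact: hes.
have xE : x = coef phi U.
  apply/funext => k; rewrite /x /coef.
  rewrite (@eq_itg _ (fun y => U y * phi k y) (fun y => \sum_i a i * (u i y * phi k y))); last first.
    by move=> y _; rewrite /U mulr_suml; apply: eq_bigr => i _; rewrite mulrA.
  have ip i : ig (fun y => u i y * phi k y).
    by apply/ig_cts/cts01M => //; exact: cts_cts01 (C1_cont (sys_phi sys k)).
  by rewrite itg_sum => [|i]; [apply: eq_bigr => i _; rewrite itgZ|exact: igZ].
have UU : itg (fun y => U y * U y) = \sum_i a i ^+ 2.
  rewrite (@eq_itg _ _ (fun y => \sum_i \sum_j a i * a j * (u i y * u j y))); last first.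
    move=> y _; have := sum2E a (fun i => u i y) 1; rewrite mul1r => ->.
    by apply: eq_bigr => i _; apply: eq_bigr => k _; rewrite mul1r.
  have [_ ->] := @ig_sum2 n a (fun i k y => u i y * u k y) (fun i k => ig_cts (cts01M (cu i) (cu k))).
  under eq_bigr => i _ do under eq_bigr => k _ do rewrite uo -[X in _ * X]mul1r.
  by rewrite sum2_diag; apply: eq_bigr => i _; rewrite mul1r.
have QU : itg (fun y => V y * V y) + itg (fun y => q y * U y * U y) = \sum_i lam i * a i ^+ 2.
  rewrite (@eq_itg _ (fun y => V y * V y) (fun y => \sum_i \sum_j a i * a j * (v i y * v j y))); last first.
    move=> y _; have := sum2E a (fun i => v i y) 1; rewrite mul1r => ->.
    by apply: eq_bigr => i _; apply: eq_bigr => k _; rewrite mul1r.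
  have [_ ->] := @ig_sum2 n a (fun i k y => v i y * v k y) (fun i k => ig_cts (cts01M (cv i) (cv k))).
  rewrite (@eq_itg _ (fun y => q y * U y * U y)
    (fun y => \sum_i \sum_j a i * a j * (q y * u i y * u j y))); last first.
    by move=> y _; rewrite sum2E.
  have iq i k : ig (fun y => q y * u i y * u k y).
    by apply: igM_cts (cu k); exact: igM_cts (sq_ig hq) (cu i).
  have [_ ->] := @ig_sum2 n a (fun i k y => q y * u i y * u k y) iq.
  rewrite -big_split/= -sum2_diag; apply: eq_bigr => i _.
  by rewrite -big_split/=; apply: eq_bigr => k _; rewrite -vo; ring.
rewrite xE; split; first exact: (coef_h1 sys cU cV UV eU).
  rewrite (coef_dot sys hq cU cV UV eU) UU (bigD1 i0)//= ltr_pwDl//.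
    by rewrite lt_neqAle sqr_ge0 andbT eq_sym sqrf_eq0.
  by apply: sumr_ge0 => i _; exact: sqr_ge0.
apply: le_trans (coef_QQ sys hq cU cV UV eU) _.
rewrite (coef_dot sys hq cU cV UV eU) UU QU mulr_sumr; apply: ler_sum => i _.
by rewrite ler_wpM2r ?sqr_ge0.
Qed.

(** The trial functions are eigenfunctions of the first problem. If [m] linear conditions on
    boundary values bring its form domain into that of the second, eigenvalues shift by at most [m]
    places. *)
Lemma compare (c1 c2 : bc R) phi1 psi1 D1 phi2 psi2 D2 (sys1 : system c1 phi1 psi1 D1)
    (sys2 : system c2 phi2 psi2 D2) q (hq : sq q) E1 e1 E2 e2
    (S1 : spec D1 (mat phi1 q) E1 e1) (S2 : spec D2 (mat phi2 q) E2 e2) (m j : nat)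
    (l0 l1 : 'I_m -> R) :
  (forall u0 u1 : R, ess c1 u0 u1 -> (forall s, l0 s * u0 + l1 s * u1 = 0) -> ess c2 u0 u1) ->
  E2 j <= E1 (m + j)%N.
Proof.
move=> hes.
have [_ _ _ Em _] := S1.
have hc i := ef_C1 sys1 hq S1 i.
apply: (@trial_upper _ _ _ _ sys2 _ hq _ _ S2 (m + j).+1 m j (fun i => ef phi1 e1 i)
  (fun i => ef' psi1 e1 i) (fun s i => l0 s * ef phi1 e1 i 0 + l1 s * ef phi1 e1 i 1) (fun i => E1 i)) => //.
- by move=> i; exact: cts_cts01 (C1_cont (hc i)).
- by move=> i; exact: cts_cts01 (hc i).2.
- by move=> i; exact: C1_int.
- by move=> i k; rewrite (ef_orth sys1 hq S1).
- by move=> i k; rewrite (ef_form sys1 hq S1).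
- by move=> i; rewrite Em// -ltnS.
move=> a ha; apply: hes.
  have h (i : 'I_(m + j).+1) := ef_ess sys1 hq S1 i.
  move: h; case: (c1) => [s|d0 d1] /= h.
    by rewrite mulr_sumr; apply: eq_bigr => i _; rewrite h mulrCA.
  by split=> d; apply: big1 => i _; have [h0 h1] := h i; rewrite ?h0 ?h1 ?mulr0.
move=> s; rewrite -[RHS](ha s) !mulr_sumr -big_split/=; apply: eq_bigr => i _; ring.
Qed.

End Trial.

Section Enumeration.
Variable R : realType.

Definition mult (e : nat -> R) lam m := exists ks : 'I_m -> nat, injective ks /\ forall i, e (ks i) = lam.

Lemma mult_lt (e e' : nat -> R) n : (forall i j, (i <= j)%N -> e i <= e j) ->
  (forall lam m, mult e' lam m -> mult e lam m) ->
  (forall i, (i < n)%N -> e i = e' i) -> e n <= e' n.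
Proof.
move=> em h hi; rewrite leNgt; apply/negP => lt.
pose B : {set 'I_n.+1} := [set i : 'I_n.+1 | e' i == e' n]%SET.
have [|ks [kinj kE]] := h (e' n) #|B|.
  exists (fun i : 'I_#|B| => val (enum_val i)); split.
    by move=> i j /val_inj/enum_val_inj.
  by move=> i; have := enum_valP i; rewrite inE => /eqP.
have kn i : (ks i < n)%N.
  rewrite ltnNge; apply/negP => /em; rewrite kE => h'.
  by have := le_lt_trans h' lt; rewrite ltxx.
pose f (i : 'I_#|B|) : 'I_n.+1 := inord (ks i).
have fE i : f i = ks i :> nat by rewrite inordK// ltnS ltnW.
have finj : injective f by move=> i j /(congr1 val) /=; rewrite !fE => /kinj.
have : (f @: [set: 'I_#|B|] \subset B :\ ord_max)%SET.
  apply/fintype.subsetP => _ /imsetP[i _ ->]; rewrite !inE -hi ?fE// kE eqxx andbT.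
  by rewrite -val_eqE /= fE neq_ltn kn.
move/subset_leq_card; rewrite card_imset// cardsT card_ord.
have nB : ord_max \in B by rewrite inE.
by rewrite [X in (X <= _)%N](cardsD1 ord_max) nB ltnn.
Qed.

Lemma mult_unique (e e' : nat -> R) : (forall i j, (i <= j)%N -> e i <= e j) ->
  (forall i j, (i <= j)%N -> e' i <= e' j) -> (forall lam m, mult e lam m <-> mult e' lam m) -> e = e'.
Proof.
move=> em em' h; apply/funext; elim/ltn_ind => n ih.
apply/eqP; rewrite eq_le; apply/andP; split; apply: mult_lt => //.
- by move=> lam m /h.
- by move=> lam m /h.
- by move=> i /ih.
Qed.

Lemma eigen_enum_unique (q : R -> R) s e e' : eigen_enum q s e -> eigen_enum q s e' -> e = e'.
Proof.
move=> [m h] [m' h']; apply: mult_unique => // lam k.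
by split=> [/(h lam k)/(h' lam k)|/(h' lam k)/(h lam k)].
Qed.

Variables (s : R) (phi psi : nat -> R -> R) (D : nat -> R).
Hypothesis sys : system (Twist s) phi psi D.
Variable q : R -> R.
Hypothesis hq : sq q.
Variables (E : nat -> R) (e : nat -> nat -> R).
Hypothesis S : spec D (mat phi q) E e.

(** Copies of [lam] give independent eigenfunctions. Conversely, with more independent solutions
    than copies, a nontrivial combination of their coefficient vectors would be orthogonal to every
    eigenvector, hence zero by [spec_total]. *)
Lemma ef_enum : eigen_enum q s E.
Proof.
have H := mat_adm sys hq; have [eh eij eE Em [_ Einf]] := S.
split=> // lam m; split; last first.
  move=> [ks [kinj kE]]; exists (fun i => ef phi e (ks i)); split.
    move=> i; exists (ef' psi e (ks i)); split; first by rewrite -(kE i); exact: (ef_hill sys hq S).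
    by split; [exact: (ef_ess sys hq S)|exact: (ef_ntl sys hq S)].
  move=> c hc i.
  have ce k := cts_cts01 (C1_cont (ef_C1 sys hq S k)).
  have : itg (fun y => \sum_(k < m) c k * (ef phi e (ks k) y * ef phi e (ks i) y)) = 0.
    rewrite -[RHS](itg_cst (0 : R)); apply: eq_itg => y Iy; rewrite -[RHS](mul0r (ef phi e (ks i) y)).
    by rewrite -[X in _ = X * _](hc y Iy) mulr_suml; apply: eq_bigr => k _; rewrite mulrA.
  have ik k : ig (fun y => ef phi e (ks k) y * ef phi e (ks i) y) by exact/ig_cts/cts01M.
  rewrite itg_sum => [|k]; last exact: igZ.
  rewrite (bigD1 i)//= itgZ// (ef_orth sys hq S) eqxx mulr1 big1 ?addr0// => k ki.
  by rewrite itgZ// (ef_orth sys hq S) (inj_eq kinj) (negPf ki) mulr0.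
move=> [us [hus li]].
have hv i : exists v, hill_solution q lam (us i) v /\ us i 1 = s * us i 0 /\ v 1 = s * v 0 by exact: hus.
pose x i := coef phi (us i).
have hx i : [/\ h1 D (x i), forall y, h1 D y -> QQ D (mat phi q) (x i) y = lam * dot (x i) y &
      forall y, I01 y -> ser (x i) phi y = us i y].
  by have [v [hs [e0 e1]]] := hv i; exact: (hill_coef sys hq hs).
have [J hJ] := Einf lam.
pose A : {set 'I_J} := [set i : 'I_J | E i == lam]%SET.
case: (leqP m #|A|) => [mA|Am].
  exists (fun i => val (enum_val (widen_ord mA i))); split.
    by move=> i j /val_inj/enum_val_inj/(congr1 val)/= /val_inj.
  by move=> i; have := enum_valP (widen_ord mA i); rewrite inE => /eqP.
have [c [[i0 ci0] hc]] := @lin_dep R #|A| m (fun i t => dot (x i) (e (enum_val t))) Am.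
pose z k := \sum_i c i * x i k.
have x2 i : l2 (x i) by case: (hx i) => h _ _; exact: (h1_l2 H h).
have e2 i : l2 (e i) by exact: (h1_l2 H (eh i)).
have hz : h1 D z by apply: (h1_sum H) => i; apply: (h1Z H); case: (hx i).
have z0 k : z k = 0.
  apply: (spec_total H S hz) => j.
  rewrite /z dot_suml//; last by move=> i; exact: l2Z.
  have [jl|jl] := eqVneq (E j) lam; last first.
    rewrite big1// => i _; rewrite dotZl//.
    by case: (hx i) => h1 h2 _; rewrite (eigvec_ortho H S h1 h2 jl) mulr0.
  have jJ : (j < J)%N by rewrite ltnNge; apply/negP => /hJ; rewrite jl ltxx.
  have jA : Ordinal jJ \in A by rewrite inE /= jl.
  rewrite -[RHS](hc (enum_rank_in jA (Ordinal jJ))) enum_rankK_in//.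
  by apply: eq_bigr => i _; rewrite dotZl.
have /li/(_ i0)/eqP : forall y, y \in `[0, 1] -> \sum_i c i * us i y = 0.
  move=> y Iy; have Iy' : I01 y by [].
  transitivity (ser z phi y); last by rewrite /ser -[RHS](sm0 R); apply: eq_sm => k; rewrite z0 mul0r.
  rewrite /ser /z (@eq_sm _ _ (fun k => \sum_i c i * (x i k * phi k y))); last first.
    by move=> k; rewrite mulr_suml; apply: eq_bigr => i _; rewrite mulrA.
  have ha i : asm (fun k => x i k * phi k y).
    by apply: (ser_asm (sys_bphi sys)); case: (hx i) => h _ _; exact: (h1_l1 H h).
  rewrite sm_sum => [|i]; last exact: asmZ.
  apply: eq_bigr => i _; rewrite smZ//; congr (_ * _).
  by case: (hx i) => _ _ /(_ y Iy') <-.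
by rewrite (negPf ci0).
Qed.

(** Uniqueness of the enumeration identifies the value that [xget] chooses in [per_eig] and
    [anti_eig] with the eigenvalues built by minimisation. *)
Lemma xget_eigen_enum : xget (fun=> 0) (eigen_enum q s) = E.
Proof. by apply: (eigen_enum_unique (q := q) (s := s)); [exact: (xgetI _ ef_enum)|exact: ef_enum]. Qed.

End Enumeration.

(** * The periodic and antiperiodic matrices *)

Section Matrices.
Variable R : realType.
Variable q : R -> R.
Hypothesis hq : sq q.

Definition cosc (t : R) : R := itg (fun y => q y * csp t y).
Definition sinc (t : R) : R := itg (fun y => q y * snp t y).
(** The modulus of the [m]-th Fourier coefficient. Frequencies in [cosc] and [sinc] are counted in
    units of pi, so this coefficient sits at [2 * m]. *)
Definition rr (m : nat) : R := Num.sqrt (fourier_sq q m).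

Let ic t : ig (fun y => q y * csp t y).
Proof. exact: igM_cts (sq_ig hq) (cts_cts01 (@csp_cont R t)). Qed.
Let isn t : ig (fun y => q y * snp t y).
Proof. exact: igM_cts (sq_ig hq) (cts_cts01 (@snp_cont R t)). Qed.

Lemma alN t : cosc (- t) = cosc t.
Proof. by apply: eq_itg => y _; rewrite cspN. Qed.

Lemma beN t : sinc (- t) = - sinc t.
Proof.
rewrite /sinc (@eq_itg _ _ (fun y => -1 * (q y * snp t y))); last by move=> y _; rewrite snpN; ring.
by rewrite itgZ// mulN1r.
Qed.

Lemma mat_trig t c s k l : mat (trig t c s) q k l =
  2^-1 * ((c k * c l + s k * s l) * cosc (t k - t l) + (c k * c l - s k * s l) * cosc (t k + t l) +
          (s k * c l + c k * s l) * sinc (t k + t l) + (s k * c l - c k * s l) * sinc (t k - t l)).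
Proof.
rewrite /mat (@eq_itg _ _ (fun y => 2^-1 * ((c k * c l + s k * s l) * (q y * csp (t k - t l) y) +
  ((c k * c l - s k * s l) * (q y * csp (t k + t l) y) +
  ((s k * c l + c k * s l) * (q y * snp (t k + t l) y) +
   (s k * c l - c k * s l) * (q y * snp (t k - t l) y)))))); last first.
  by move=> y _; rewrite cspB snpB cspD snpD /trig; field.
rewrite itgZ; last by do 3?apply: igD; exact: igZ.
rewrite itgD; [|exact: igZ|by do 2?apply: igD; exact: igZ].
rewrite itgD; [|exact: igZ|by apply: igD; exact: igZ].
rewrite itgD; [|exact: igZ|exact: igZ].
by rewrite !itgZ// !addrA.
Qed.

Lemma fourier_sq_al m : fourier_sq q m = cosc (2 * m%:R) ^+ 2 + sinc (2 * m%:R) ^+ 2.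
Proof.
have e (y : R) : 2 * pi * m%:R * y = pi * (2 * m%:R) * y by ring.
congr (_ ^+ 2 + _ ^+ 2); apply: eq_itg => y _; [rewrite /csp|rewrite /snp]; by rewrite -e.
Qed.

Lemma rr_ge0 m : 0 <= rr m. Proof. exact: sqrtr_ge0. Qed.

Lemma rr_sqr m : rr m ^+ 2 = fourier_sq q m.
Proof. by rewrite sqr_sqrtr// fourier_sq_al addr_ge0 ?sqr_ge0. Qed.

Lemma al_le m : `|cosc (2 * m%:R)| <= rr m.
Proof.
by rewrite -sqrtr_sqr ler_sqrt fourier_sq_al ?lerDl ?addr_ge0 ?sqr_ge0.
Qed.

Lemma be_le m : `|sinc (2 * m%:R)| <= rr m.
Proof.
by rewrite -sqrtr_sqr ler_sqrt fourier_sq_al ?lerDr ?addr_ge0 ?sqr_ge0.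
Qed.

(** The distance [|i - j|], through truncated subtraction. *)
Definition ddn (i j : nat) := ((i - j) + (j - i))%N.

Lemma ddnC i j : ddn i j = ddn j i. Proof. by rewrite /ddn addnC. Qed.

Lemma ddn_cases i j : (i%:R - j%:R = (ddn i j)%:R :> R) \/ (i%:R - j%:R = - (ddn i j)%:R :> R).
Proof.
case: (leqP j i) => h; [left|right].
  by rewrite /ddn (_ : (j - i = 0)%N) ?addn0 ?natrB//; apply/eqP; rewrite subn_eq0.
rewrite /ddn (_ : (i - j = 0)%N) ?add0n ?natrB ?opprB//; first exact: ltnW.
by apply/eqP; rewrite subn_eq0 ltnW.
Qed.

Lemma al_dd i j : `|cosc (2 * (i%:R - j%:R))| <= rr (ddn i j).
Proof. by case: (ddn_cases i j) => ->; rewrite ?mulrN ?alN al_le. Qed.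

Lemma be_dd i j : `|sinc (2 * (i%:R - j%:R))| <= rr (ddn i j).
Proof. by case: (ddn_cases i j) => ->; rewrite ?mulrN ?beN ?normrN be_le. Qed.

(* [a] selects antiperiodic; even indices are cosines, odd indices sines; [twg] is the
   frequency index, so that the frequency is pi (2 twg + a). *)
Variable a : bool.

Definition twt := if a then @anti_t R else @per_t R.
Definition twc := if a then @anti_c R else @per_c R.
Definition twphi := trig twt twc (@od_s R).
Definition twpsi := trig' twt twc (@od_s R).
Definition twD k := (pi * twt k) ^+ 2.
Definition twb := mat twphi q.
Definition twg (k : nat) := if a then k./2 else uphalf k.
(** [twz] singles out the constant mode of the periodic problem. [tws] exchanges the cosine and sine
    of a frequency and fixes the constant mode; [twe] carries the sign of the conjugation and
    vanishes there. *)
Definition twz (k : nat) := ~~ a && (k == 0%N).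
Definition tws (k : nat) := if twz k then 0%N else if a (+) odd k then k.+1 else k.-1.
Definition twe (k : nat) : R := if odd k then 1 else if twz k then 0 else -1.

Lemma tw_system : system (Twist (if a then -1 else 1)) twphi twpsi twD.
Proof. by rewrite /twphi /twpsi /twD /twt /twc; case: (a); [exact: anti_system|exact: per_system]. Qed.

Lemma twtE k : twt k = 2 * (twg k)%:R + a%:R.
Proof.
rewrite /twt /twg; case: (a); rewrite /anti_t /per_t -?natr1 -muln2 natrM ?addr0 //=; ring.
Qed.

Lemma twz_a k : twz k -> a = false /\ k = 0%N.
Proof. by rewrite /twz; case: (a) => //= /eqP. Qed.

Lemma twg0 k : twz k -> twg k = 0%N.
Proof. by move=> /twz_a[a0 ->]; rewrite /twg a0. Qed.

Lemma tws_odd k : ~~ twz k -> odd (tws k) = ~~ odd k.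
Proof.
rewrite /tws => /[dup] z /negPf ->; move: z; rewrite /twz; case: (a) => /=.
  by case o : (odd k) => _ /=; [case: k o => //= k /negbTE|rewrite o].
by case: k => // k _ /=; case o : (odd k) => /=; rewrite ?o.
Qed.

Lemma tws_z k : ~~ twz k -> ~~ twz (tws k).
Proof.
move=> z; apply/negP => /[dup] /twz_a[a0 s0] _; have := tws_odd z; rewrite s0 /=.
move: s0 z; rewrite /tws /twz a0 /=; case: k => //= k; case: (odd k) => //=; case: k => //.
Qed.

Lemma twsK k : tws (tws k) = k.
Proof.
case z : (twz k); first by rewrite /tws z; have [a0 ->] := twz_a z; rewrite /twz a0.
rewrite {1}/tws (negPf (tws_z (negbT z))) (tws_odd (negbT z)).
move: z; rewrite /tws /twz; case: (a) => /=; case: k => //= k.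
  by case: (odd k).
by case: (odd k).
Qed.

Lemma twg_s k : twg (tws k) = twg k.
Proof.
rewrite /tws /twg /twz; case: (a) => /=; first by case: ifP => o; lia.
by case: ifP => h; last case: ifP => o; lia.
Qed.

Lemma twt_s k : twt (tws k) = twt k.
Proof. by rewrite !twtE twg_s. Qed.

Let r2 : R := Num.sqrt 2.
Let r2K : r2 * r2 = 2. Proof. by rewrite -expr2 sqr_sqrtr. Qed.

Definition twa k : R := if twz k then 1 else r2.

Lemma twcs k : twc k = (if odd k then 0 else twa k) /\ @od_s R k = (if odd k then twa k else 0).
Proof.
rewrite /twc /od_s /twa /twz /anti_c /per_c; case: (a) => /=; first by [].
by case: k => //= k; case: (odd k).
Qed.

Lemma twbE k l : twb k l = 2^-1 * (twa k * twa l) *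
  (if odd k then if odd l then cosc (twt k - twt l) - cosc (twt k + twt l) else sinc (twt k + twt l) + sinc (twt k - twt l)
   else if odd l then sinc (twt k + twt l) - sinc (twt k - twt l) else cosc (twt k - twt l) + cosc (twt k + twt l)).
Proof.
rewrite /twb /twphi mat_trig; have [-> ->] := twcs k; have [-> ->] := twcs l.
by case: (odd k); case: (odd l); ring.
Qed.

Lemma twt_sub k l : twt k - twt l = 2 * ((twg k)%:R - (twg l)%:R).
Proof. by rewrite !twtE; ring. Qed.

Lemma twt_add k l : twt k + twt l = 2 * (twg k + twg l + a)%:R.
Proof. by rewrite !twtE !natrD; case: (a) => /=; ring. Qed.

Lemma twa_bound k l : 0 <= 2^-1 * (twa k * twa l) <= 1.
Proof.
have r20 : 0 <= r2 by exact: sqrtr_ge0.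
have r21 : 1 <= r2 by rewrite /r2 -[leLHS]sqrtr1 ler_sqrt ?ler1n.
have r22 : r2 <= 2 by have := r2K; nra.
have h (x y : R) : 0 <= x -> 0 <= y -> x * y <= 2 -> 0 <= 2^-1 * (x * y) <= 1.
  by move=> x0 y0 xy; rewrite mulr_ge0 ?mulr_ge0//= mulrC ler_pdivrMr// mul1r.
by rewrite /twa; case: (twz k); case: (twz l); apply: h => //; rewrite ?mulr1 ?mul1r ?r2K// ler1n.
Qed.

Lemma twb_bound k l : `|twb k l| <= rr (ddn (twg k) (twg l)) + rr (twg k + twg l + a)%N.
Proof.
rewrite twbE normrM; have /andP[h0 h1] := twa_bound k l.
have x1 := al_dd (twg k) (twg l); have x2 := be_dd (twg k) (twg l).
have y1 := al_le (twg k + twg l + a)%N; have y2 := be_le (twg k + twg l + a)%N.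
rewrite -twt_sub -twt_add in x1 x2 y1 y2.
rewrite (ger0_norm h0) -[leRHS]mul1r ler_pM//.
case: (odd k); case: (odd l).
- by apply: le_trans (ler_normB _ _) _; exact: lerD.
- by apply: le_trans (ler_normD _ _) _; rewrite addrC; exact: lerD.
- by apply: le_trans (ler_normB _ _) _; rewrite addrC; exact: lerD.
- by apply: le_trans (ler_normD _ _) _; exact: lerD.
Qed.

Lemma twb_sym k l : twb k l = twb l k.
Proof. by apply: eq_itg => y _; ring. Qed.

(** The matrix of [b] composed with the conjugation, symmetrised. By [twN_E] the terms at frequency
    differences cancel: between indices of the same frequency only twice the Fourier coefficient of
    that gap is left. *)
Definition twN k l := twe (tws k) * twb (tws k) l + twe (tws l) * twb k (tws l).

Lemma twN_E k l : ~~ twz k -> ~~ twz l ->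
  twN k l = if odd k (+) odd l then - (2 * cosc (twt k + twt l))
            else if odd k then - (2 * sinc (twt k + twt l)) else 2 * sinc (twt k + twt l).
Proof.
move=> zk zl; have zk' := tws_z zk; have zl' := tws_z zl.
rewrite /twN !twbE /twe /twa (negPf zk) (negPf zl) (negPf zk') (negPf zl') !tws_odd// !twt_s r2K mulVf//.
by case: (odd k); case: (odd l) => /=; ring.
Qed.

Lemma twN_bound k l : `|twN k l| <= 2 * rr (twg k + twg l + a)%N.
Proof.
case zk : (twz k).
  have [a0 k0] := twz_a zk.
  have sk : tws k = 0%N by rewrite /tws zk.
  have ek : twe 0 = 0 by rewrite /twe /= /twz a0.
  rewrite /twN sk ek mul0r add0r normrM.
  have e1 : `|twe (tws l)| <= 1 by rewrite /twe; case: (odd _); case: (twz _); rewrite ?normr1 ?normr0 ?normrN1.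
  rewrite -[leRHS]mul1r ler_pM//; apply: le_trans (twb_bound _ _) _.
  by rewrite twg_s (twg0 zk) /ddn sub0n subn0 add0n a0 addn0 mulrDl mul1r.
case zl : (twz l).
  have [a0 k0] := twz_a zl.
  have sk : tws l = 0%N by rewrite /tws zl.
  have ek : twe 0 = 0 by rewrite /twe /= /twz a0.
  rewrite /twN sk ek mul0r addr0 normrM.
  have e1 : `|twe (tws k)| <= 1 by rewrite /twe; case: (odd _); case: (twz _); rewrite ?normr1 ?normr0 ?normrN1.
  rewrite -[leRHS]mul1r ler_pM//; apply: le_trans (twb_bound _ _) _.
  by rewrite twg_s (twg0 zl) /ddn sub0n subn0 addn0 a0 addn0 mulrDl mul1r.
have y1 := al_le (twg k + twg l + a)%N; have y2 := be_le (twg k + twg l + a)%N.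
rewrite twN_E ?zk ?zl// twt_add.
case: (odd k); case: (odd l) => /=; rewrite ?normrN normrM ger0_norm// ler_wpM2l//.
Qed.

End Matrices.

(** * Gap lengths and Fourier coefficients *)

Section Conjugation.
Variable R : realType.
Variable q : R -> R.
Hypothesis hq : sq q.
Variable a : bool.
Notation D := (@twD R a).
Notation b := (twb q a).
Notation sg := (tws a).
Notation ee := (@twe R a).
Let H : adm D b (matK q) := mat_adm (tw_system R a) hq.

Lemma twD_s k : D (sg k) = D k.
Proof. by rewrite /twD twt_s. Qed.

Lemma twe_s k : ee (sg k) = - ee k.
Proof.
case z : (twz a k).
  have [a0 ->] := twz_a z; by rewrite /tws /twe /twz a0 /= oppr0.
by rewrite /twe tws_odd ?z// (negPf (tws_z (negbT z))); case: (odd k) => /=; rewrite ?opprK.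
Qed.

Lemma twe_sqr k : ee k ^+ 2 <= 1.
Proof. by rewrite /twe; case: (odd k); case: (twz a k); rewrite ?expr1n ?expr0n ?sqrrN ?expr1n. Qed.

(** Truncation lengths closed under [tws]: complete pairs, preceded in the periodic case by the
    constant mode. *)
Definition len (j : nat) := (j.*2 + ~~ a)%N.

Lemma tws_len j k : (k < len j)%N -> (sg k < len j)%N.
Proof.
rewrite /tws /len /twz; case: (a) => /=; first by case: ifP => o; lia.
by case: ifP => h; last case: ifP => o; lia.
Qed.

Lemma sum_tws j (F : nat -> R) : \sum_(k < len j) F (sg k) = \sum_(k < len j) F k.
Proof.
pose h (k : 'I_(len j)) := Ordinal (tws_len (ltn_ord k)).
rewrite [RHS](reindex h) //=; exists h => k _; apply: val_inj; exact: twsK.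
Qed.

Lemma len_oo : len @ \oo --> \oo.
Proof.
move=> A [N _ hN]; exists N => // j /= Nj; apply: hN => /=; rewrite /len.
by apply: leq_trans Nj _; rewrite -addnn -addnA leq_addr.
Qed.

Lemma asm_tws (f : nat -> R) : asm f -> asm (fun k => f (sg k)).
Proof.
move=> [C hC]; exists C => n.
have nl : (n <= len n)%N by rewrite /len -addnn -addnA leq_addr.
apply: le_trans (hC (len n)); rewrite -(sum_tws n (fun k => `|f k|)).
exact: (@psum_mono _ (fun k => `|f (sg k)|)).
Qed.

Lemma sm_tws (f : nat -> R) : asm f -> sm (fun k => f (sg k)) = sm f.
Proof.
move=> hf; have h1 := cvg_comp _ _ len_oo (sm_cvg hf); have h2 := cvg_comp _ _ len_oo (sm_cvg (asm_tws hf)).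
have e : (fun n => \sum_(k < n) f (sg k)) \o len = (fun n => \sum_(k < n) f k) \o len.
  by apply/funext => j /=; rewrite sum_tws.
by rewrite e in h2; exact: (cvg_unique (@Rhausdorff R) h2 h1).
Qed.

Definition JJ (x : nat -> R) k := ee k * x (sg k).

Lemma JJ_h1 x : h1 D x -> h1 D (JJ x).
Proof.
move=> hx; apply: asm_le (asm_tws hx) => k; rewrite twD_s /JJ.
have D0 : 0 <= 1 + D k by rewrite addr_ge0// sqr_ge0.
rewrite [X in `|X| <= _](_ : _ = ee k ^+ 2 * ((1 + D k) * (x (sg k) * x (sg k)))); last by ring.
by rewrite normrM ler_piMl// ger0_norm ?sqr_ge0 ?twe_sqr.
Qed.

(** Reindexing by the swap preserves [c] and flips [twe]. It is applied with [c = D] and with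
    [c = 1]. *)
Lemma JJ_anti (c : nat -> R) x y : (forall k, c (sg k) = c k) -> asm (fun k => c k * (x k * JJ y k)) ->
  sm (fun k => c k * (y k * JJ x k)) = - sm (fun k => c k * (x k * JJ y k)).
Proof.
move=> cs ha; rewrite -(sm_tws ha) -smN; last exact: (asm_tws ha).
by apply: eq_sm => k; rewrite /JJ cs twe_s twsK; ring.
Qed.

(** Finite sums over squares closed under the swap allow [J_form] to move the conjugation from the
    vectors to the matrix by reindexing. *)
Lemma bl_trunc x z : h1 D x -> h1 D z ->
  (fun j => \sum_(k < len j.+1) \sum_(l < len j.+1) b k l * x l * z k) @ \oo --> sm (fun k => bx b x k * z k).
Proof.
move=> hx hz; have z1 := h1_l1 H hz; have x2 := h1_l2 H hx.
have len_oo' : (fun j => len j.+1) @ \oo --> \oo.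
  by apply: cvg_comp len_oo; move=> A [N _ hN]; exists N => // j /= Nj; apply: hN => /=; exact: leqW.
have b2 k : l2 (b k) by case: H => _ _ _ [_ /(_ k)[]].
have bK k : dot (b k) (b k) <= matK q ^+ 2 by case: H => _ _ _ [_ /(_ k)[]].
have K0 : 0 <= matK q by case: H => _ _ _ [].
pose f k j := if (k < len j.+1)%N then (\sum_(l < len j.+1) b k l * x l) * z k else 0.
have bb k L : `|\sum_(l < L) b k l * x l| <= matK q * nrm x.
  apply: le_trans (ler_norm_sum _ _ _) _.
  apply: le_trans (psum_le_sm L (asm_abs (l2_dot (b2 k) x2)) (fun=> normr_ge0 _)) _.
  apply: le_trans (dot_nrm_abs (b2 k) x2) _; rewrite ler_wpM2r ?nrm_ge0//.
  by rewrite -(@ler_pXn2r _ 2)// ?nnegrE ?nrm_ge0// nrm_sqr.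
rewrite (_ : (fun j => _) = (fun j => sm (fun k => f k j))); last first.
  apply/funext => j; rewrite (@sm_fin _ _ (len j.+1)); last by move=> k kj; rewrite /f ltnNge kj.
  by apply: eq_bigr => k _; rewrite /f ltn_ord mulr_suml.
apply: (@sm_dct _ _ _ _ f _ (fun k => matK q * nrm x * `|z k|)).
- exact/asmZ/asm_abs.
- apply: nearW => j k; rewrite /f; case: ifP => _; last by rewrite normr0 !mulr_ge0 ?nrm_ge0.
  by rewrite normrM ler_wpM2r.
- by move=> k; rewrite normrM ler_wpM2r// (bx_bound H).
- move=> k; have h := cvg_comp _ _ len_oo' (sm_cvg (l2_dot (b2 k) x2)).
  have h2 : (fun j => (\sum_(l < len j.+1) b k l * x l) * z k) @ \oo --> bx b x k * z k by apply: cvgMl.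
  apply: cvg_trans h2; apply: near_eq_cvg; exists k => // j /= kj; rewrite /f.
  by rewrite ifT// /len; lia.
Qed.

Lemma J_form x y : h1 D x -> h1 D y ->
  (fun j => \sum_(k < len j.+1) \sum_(l < len j.+1) twN q a k l * x l * y k) @ \oo -->
  sm (fun k => bx b x k * JJ y k) + sm (fun k => bx b y k * JJ x k).
Proof.
move=> hx hy; apply: cvg_trans (cvgD (bl_trunc hx (JJ_h1 hy)) (bl_trunc hy (JJ_h1 hx))).
apply: near_eq_cvg; apply: nearW => j; rewrite fctE.
rewrite -(sum_tws j.+1 (fun k => \sum_(l < _) b k l * x l * JJ y k)).
rewrite -(sum_tws j.+1 (fun k => \sum_(l < _) b k l * y l * JJ x k)).
rewrite [X in _ + X]exchange_big/= -big_split/=; apply: eq_bigr => k _; rewrite -big_split/=.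
apply: eq_bigr => l _; rewrite /JJ !twsK /twN (twb_sym q a k); ring.
Qed.

Variables (E : nat -> R) (e : nat -> nat -> R).
Hypothesis S : spec D b E e.

(** The equation of [e i] is paired with [JJ (e j)], that of [e j] with [JJ (e i)], and the two are
    added: by [JJ_anti] the diagonal parts cancel and the eigenvalues appear only through their
    difference. The case [i = j] is a second, independent constraint. *)
Lemma J_identity i j : (E i - E j) * dot (e i) (JJ (e j)) =
  sm (fun k => bx b (e i) k * JJ (e j) k) + sm (fun k => bx b (e j) k * JJ (e i) k).
Proof.
have [eh _ eE _ _] := S; have hi := eh i; have hj := eh j.
have Ji := JJ_h1 hi; have Jj := JJ_h1 hj.
have e1 := eE i _ Jj; have e2 := eE j _ Ji; rewrite /QQ in e1 e2.
have aD := h1_dotD H hi Jj.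
have a1 := l2_dot (h1_l2 H hi) (h1_l2 H Jj).
have z1 := JJ_anti twD_s aD.
have z2 : dot (e j) (JJ (e i)) = - dot (e i) (JJ (e j)).
  rewrite /dot (@eq_sm _ _ (fun k => 1 * (e j k * JJ (e i) k))); last by move=> k; rewrite mul1r.
  rewrite (@JJ_anti (fun=> 1))//; last by apply: eq_asm a1 => k; rewrite mul1r.
  by congr (- _); apply: eq_sm => k; rewrite mul1r.
rewrite z1 in e2; rewrite z2 in e2.
rewrite mulrBl; lra.
Qed.

Lemma J_bound i j (M B : R) n0 :
  (forall n, (n0 <= n)%N ->
     `|\sum_(k < len n.+1) \sum_(l < len n.+1) twN q a k l * e i l * e j k - M| <= B) ->
  `|(E i - E j) * dot (e i) (JJ (e j)) - M| <= B.
Proof.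
move=> h; have [eh _ _ _ _] := S; rewrite J_identity.
have c := J_form (eh i) (eh j).
have c2 : (fun n => `|\sum_(k < len n.+1) \sum_(l < len n.+1) twN q a k l * e i l * e j k - M|) @ \oo -->
   `|sm (fun k => bx b (e i) k * JJ (e j) k) + sm (fun k => bx b (e j) k * JJ (e i) k) - M|.
  by apply: cvg_norm; apply: cvgB c _; exact: cvg_cst.
rewrite -(cvg_lim _ c2)//; apply: limr_le; first by apply/cvg_ex; eexists; exact: c2.
by exists n0.
Qed.

End Conjugation.

Section Fibers.
Variable R : realType.

Lemma sum_fiber (I J : finType) (f : J -> R) (h : I -> J) (c : nat) : (forall j, 0 <= f j) ->
  (forall j, exists s : seq I, (size s <= c)%N /\ forall i, h i = j -> i \in s) ->
  \sum_i f (h i) <= c%:R * \sum_j f j.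
Proof.
move=> f0 hs; rewrite (partition_big h xpredT)//= mulr_sumr; apply: ler_sum => j _.
rewrite (eq_bigr (fun=> f j)); last by move=> i /eqP ->.
rewrite sumr_const -[X in X <= _]mulr_natl ler_wpM2r// ler_nat.
have [s [sc hj]] := hs j; apply: leq_trans sc; rewrite cardE; apply: uniq_leq_size; first exact: enum_uniq.
by move=> i; rewrite mem_enum => /eqP; exact: hj.
Qed.

Lemma sum_fiber_nat (f : nat -> R) (h : nat -> nat) (c : nat) (C : R) : (forall j, 0 <= f j) ->
  (forall n, \sum_(j < n) f j <= C) ->
  (forall j, exists s : seq nat, (size s <= c)%N /\ forall i, h i = j -> i \in s) ->
  forall n, \sum_(i < n) f (h i) <= c%:R * C.
Proof.
move=> f0 fC hs [|n].
  by rewrite big_ord0 mulr_ge0//; apply: le_trans (fC 0%N); rewrite big_ord0.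
pose M := \max_(i < n.+1) h i.
have hM (i : 'I_n.+1) : (h i < M.+1)%N by rewrite ltnS; exact: (leq_bigmax i).
pose h' (i : 'I_n.+1) : 'I_M.+1 := Ordinal (hM i).
apply: le_trans (ler_wpM2l (ler0n R c) (fC M.+1)).
apply: (@sum_fiber _ _ (fun j : 'I_M.+1 => f j) h') => // j.
have [s [sc hj]] := hs j; exists [seq inord i | i <- s]; split; first by rewrite size_map.
move=> i hi; rewrite -(inord_val i); apply: map_f; apply: hj.
by rewrite -[LHS]/(val (h' i)) hi.
Qed.

(** The bound 4 used below comes from two basis indices for each frequency and two frequencies at a
    given distance. *)
Definition few (h : nat -> nat) (c : nat) :=
  forall j, exists s : seq nat, (size s <= c)%N /\ forall i, h i = j -> i \in s.

Lemma l2_few (v : nat -> R) h : l2 v -> few h 4 -> l2 (fun k => v (h k)) /\ nrm (fun k => v (h k)) <= 2 * nrm v.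
Proof.
move=> v2 hh; have vv k : 0 <= v k * v k by rewrite -expr2 sqr_ge0.
have hb := sum_fiber_nat vv (fun n => psum_le_sm n v2 vv) hh.
have l : l2 (fun k => v (h k)) by apply: (asm_bound _ hb) => k.
split=> //; rewrite -(@ler_pXn2r _ 2)// ?nnegrE ?mulr_ge0 ?nrm_ge0// exprMn !nrm_sqr//.
by apply: sm_le_bound => // n; apply: le_trans (hb n) _; rewrite -natrX.
Qed.

Lemma twg_few (a : bool) v : exists s : seq nat, (size s <= 2)%N /\ forall k, twg a k = v -> k \in s.
Proof.
exists (if a then [:: v.*2; v.*2.+1] else [:: v.*2.-1; v.*2]); split; first by case: (a).
by move=> k; rewrite /twg; case: (a); rewrite !inE => h; lia.
Qed.

Lemma dd_few a g : few (fun k => ddn (twg a k) g) 4.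
Proof.
move=> j; have [s [s2 hs]] := twg_few a (g + j); have [s' [s2' hs']] := twg_few a (g - j).
exists (s ++ s'); split; first by rewrite size_cat (leq_add s2 s2').
move=> k e; rewrite mem_cat; case: (leqP g (twg a k)) => h.
  by rewrite hs//; move: e; rewrite /ddn; lia.
by rewrite hs' ?orbT//; move: e; rewrite /ddn; lia.
Qed.

Lemma add_few a g (c : nat) : few (fun k => twg a k + g + c)%N 4.
Proof.
move=> j; have [s [s2 hs]] := twg_few a (j - c - g).
exists s; split; first exact: leq_trans s2 _.
by move=> k e; apply: hs; move: e; lia.
Qed.

End Fibers.

Section Localization.
Variable R : realType.
Variables (D : nat -> R) (b : nat -> nat -> R) (K : R) (E : nat -> R) (e : nat -> nat -> R).
Hypothesis H : adm D b K.
Hypothesis S : spec D b E e.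
Hypothesis Dlow : forall k, (2 * k%:R) ^+ 2 <= D k.
Hypothesis Dup : forall k, D k <= (4 * k.+1%:R) ^+ 2.
Hypothesis Dm : forall i k, (i <= k)%N -> D i <= D k.

Lemma inv_sq_tail (j n : nat) : (0 < j)%N -> \sum_(k < n) ((2 * (j + k)%:R) ^+ 2)^-1 <= j%:R^-1 :> R.
Proof.
move=> j0; have j0' : 0 < j%:R :> R by rewrite ltr0n.
(* A telescoping majorant: with [x = j + m] the next term is at most [1 / (2 x (x + 1))], because
   [x >= 1]. *)
have h m : \sum_(k < m) ((2 * (j + k)%:R) ^+ 2)^-1 <= j%:R^-1 - 2^-1 / (j + m)%:R :> R.
  elim: m => [|m ih].
    rewrite big_ord0 addn0; have : 0 < j%:R^-1 :> R by rewrite invr_gt0.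
    lra.
  rewrite big_ord_recr/=; apply: le_trans (lerD ih (lexx _)) _.
  set x : R := (j + m)%:R; have x1 : 1 <= x by rewrite ler1n addn_gt0 j0.
  have -> : (j + m.+1)%:R = x + 1 :> R by rewrite addnS -natr1.
  have -> : j%:R^-1 - 2^-1 / (x + 1) = j%:R^-1 - 2^-1 / x + 2^-1 / (x * (x + 1)).
    by field; rewrite !lt0r_neq0//; lra.
  rewrite lerD2l ler_pdivlMr; last by nra.
  rewrite mulrC ler_pdivrMr; last by nra.
  nra.
apply: le_trans (h n) _; rewrite gerBl mulr_ge0// invr_ge0//.
Qed.

(** The errors of [eig_upper] and of [eig_lower] with [T = 1 / sqrt j] are of order [K * sqrt j];
    the hypothesis [256 * K ^+ 2 <= j] makes them at most [j / 2]. *)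
Lemma eig_loc (j : nat) : (0 < j)%N -> 256 * K ^+ 2 <= j%:R -> `|E j - D j| <= j%:R / 2.
Proof.
move=> j0 Kj; have K0 : 0 <= K by case: H => _ _ _ [].
have j1 : 1 <= j%:R :> R by rewrite ler1n.
have sj0 : 0 <= Num.sqrt j%:R :> R by exact: sqrtr_ge0.
have sj : Num.sqrt j%:R ^+ 2 = j%:R :> R by rewrite sqr_sqrtr.
have Ks : 16 * K <= Num.sqrt j%:R.
  rewrite -(@ler_pXn2r _ 2)// ?nnegrE ?mulr_ge0// sj exprMn.
  by apply: le_trans Kj; rewrite -natrX.
have s1 : Num.sqrt j.+1%:R <= 2 * Num.sqrt j%:R :> R.
  rewrite -(@ler_pXn2r _ 2)// ?nnegrE ?mulr_ge0 ?sqrtr_ge0// exprMn sj sqr_sqrtr ?ler0n//.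
  by rewrite -natr1; nra.
have Dj : 0 < D j.
  apply: lt_le_trans (Dlow j); rewrite exprn_gt0// mulr_gt0// ltr0n//.
have sD : Num.sqrt (D j) <= 8 * j%:R.
  apply: (@le_trans _ _ (4 * j.+1%:R)).
    by rewrite -[leRHS]ger0_norm// -sqrtr_sqr ler_sqrt ?sqr_ge0.
  by rewrite -natr1; lra.
have sD2 : 2 * j%:R <= Num.sqrt (D j).
  rewrite -[leLHS]ger0_norm ?mulr_ge0// -sqrtr_sqr ler_sqrt//; exact: ltW.
have sjn : Num.sqrt j%:R != 0 :> R by rewrite -sqrf_eq0 sj gt_eqF// ltr0n.
pose T : R := (Num.sqrt j%:R)^-1.
have T0 : 0 <= T by rewrite invr_ge0.
have Tj : T * j%:R = Num.sqrt j%:R by rewrite -{1}sj expr2 mulrA mulVf// mul1r.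
have low := eig_lower H S (j := j) (T := T) Dm Dj T0.
have up := eig_upper H S j Dm.
rewrite ler_norml; apply/andP; split.
  have h1 : forall n, \sum_(k < n) (D (j + k)%N)^-1 <= T ^+ 2.
    move=> n; rewrite /T exprVn sj; apply: le_trans (inv_sq_tail n j0).
    apply: ler_sum => k _; have p : 0 < (2 * (j + k)%:R) ^+ 2 :> R.
      by rewrite exprn_gt0// mulr_gt0// ltr0n addn_gt0 j0.
    by rewrite lef_pV2 ?posrE//; exact: lt_le_trans p (Dlow _).
  have T1 : T <= 1.
    rewrite invf_le1 ?lt0r ?sjn//; rewrite -(@ler_pXn2r _ 2)// ?nnegrE// sj expr1n//.
  have h2 : K * T <= 2 * Num.sqrt (D j).
    have sjj : Num.sqrt j%:R <= j%:R :> R by nra.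
    nra.
  have := low h1 h2; have : K * T * Num.sqrt (D j) <= K * (8 * Num.sqrt j%:R).
    rewrite -mulrA ler_wpM2l// -Tj; nra.
  nra.
nra.
Qed.

End Localization.

Lemma gap_algebra_aux (R : realType) (gam rho d m x y B1 B2 : R) :
  0 <= gam -> 0 <= rho -> 0 <= d -> d <= 1 / 6 -> 1 - d <= m -> m <= 1 ->
  - (2 * (d * B2 + B1 + gam * d)) <= m * gam - 2 * y ->
  m * gam - 2 * y <= 2 * (d * B2 + B1 + gam * d) ->
  y <= rho * m -> rho * m <= x + y -> 2 * x <= B2 -> 0 <= B2 -> 0 <= B1 ->
  `|gam - 2 * rho| <= 16 * d * rho + 4 * B1 + 6 * B2.
Proof.
move=> g0 rho0 d0 d6 m0 m1 k3 k4 Yup Ylow X2 B20 B10.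
have mg1 : m * gam <= gam by rewrite ler_piMl.
have mg2 : gam - d * gam <= m * gam by rewrite -[X in X - _]mul1r -mulrBl ler_wpM2r.
have rm1 : rho * m <= rho by rewrite ler_piMr.
have rm2 : rho - d * rho <= rho * m by rewrite -[X in X - _]mul1r -mulrBl mulrC ler_wpM2l.
have dB : d * B2 <= 1 / 6 * B2 by rewrite ler_wpM2r.
have dB1 : d * B1 <= 1 / 6 * B1 by rewrite ler_wpM2r.
have dg : d * gam <= 1 / 6 * gam by rewrite ler_wpM2r.
have rd : 0 <= d * rho by rewrite mulr_ge0.
rewrite (mulrC gam d) in k3 k4.
have u2 : gam <= 4 * rho + 4 * B1 + 2 * B2 by lra.
have u3 : d * gam <= 4 * (d * rho) + 4 * (d * B1) + 2 * (d * B2).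
  by apply: le_trans (ler_wpM2l d0 u2) _; rewrite le_eqVlt; apply/orP; left; apply/eqP; ring.
by rewrite -mulrA ler_norml; apply/andP; split; lra.
Qed.

(* With z = p + i r, w = p' + i r' and Q = cosc + i sinc, the two identities say that
   gam * Im(conj z w) and 0 are close to 2 Im(Q conj(z w)) and 2 Im(Q conj(z z)). *)
Lemma gap_algebra (R : realType) (p r p' r' cosc sinc gam rho d dd B1 B2 : R) :
  0 <= gam -> 0 <= rho -> rho ^+ 2 = cosc ^+ 2 + sinc ^+ 2 -> 0 <= d -> d <= 1 / 6 ->
  1 - d <= p ^+ 2 + r ^+ 2 <= 1 -> 1 - d <= p' ^+ 2 + r' ^+ 2 <= 1 -> `|p * p' + r * r'| <= d ->
  `|dd - (r * p' - p * r')| <= d ->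
  `|gam * dd - 2 * (sinc * (p * p' - r * r') - cosc * (p * r' + r * p'))| <= B1 ->
  `|2 * (sinc * (p * p - r * r) - cosc * (p * r + r * p))| <= B2 ->
  `|gam - 2 * rho| <= 16 * d * rho + 4 * B1 + 6 * B2.
Proof.
move=> g0 rho0 rhoE d0 d6 /andP[m0 m1] /andP[m0' m1'] eta dde h1 h2.
pose m := p ^+ 2 + r ^+ 2; pose m' := p' ^+ 2 + r' ^+ 2.
pose De := r * p' - p * r'; pose et := p * p' + r * r'.
(* [Y] and [X] are the real and imaginary parts of Q conj(z z), so their squares add up to
   [(rho * m) ^+ 2]. The last hypothesis makes [X] small, hence [|Y|] close to [rho * m], and the
   other one compares [m * gam] with [2 * Y]. *)
pose X := sinc * (p ^+ 2 - r ^+ 2) - 2 * cosc * p * r; pose Y := cosc * (p ^+ 2 - r ^+ 2) + 2 * sinc * p * r.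
have XY : X ^+ 2 + Y ^+ 2 = (rho * m) ^+ 2 by rewrite exprMn rhoE /X /Y /m; ring.
have mM : m * (2 * (sinc * (p * p' - r * r') - cosc * (p * r' + r * p'))) = 2 * (et * X + De * Y).
  by rewrite /m /et /X /De /Y; ring.
have DE : De ^+ 2 + et ^+ 2 = m * m' by rewrite /De /et /m /m'; ring.
have X2 : 2 * `|X| <= B2.
  by rewrite -(ger0_norm (ler0n R 2)) -normrM; apply: le_trans h2; rewrite le_eqVlt; apply/orP; left; apply/eqP; congr (`|_|); rewrite /X; ring.
have rm0 : 0 <= rho * m by rewrite mulr_ge0// addr_ge0 ?sqr_ge0.
have Yup : `|Y| <= rho * m.
  by rewrite -(@ler_pXn2r _ 2)// ?nnegrE// sqr_normr -XY lerDr sqr_ge0.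
have Ylow : rho * m <= `|X| + `|Y|.
  rewrite -(@ler_pXn2r _ 2)// ?nnegrE ?addr_ge0// -XY -(sqr_normr X) -(sqr_normr Y).
  have : 0 <= `|X| * `|Y| by rewrite mulr_ge0.
  by move: `|X| `|Y| => x y xy; nra.
have X0 : 0 <= `|X| by [].
have De2 : 1 / 2 <= `|De|.
  have e2 : et ^+ 2 <= d ^+ 2 by rewrite -sqr_normr ler_pXn2r ?nnegrE.
  have : 1 / 4 <= De ^+ 2 by rewrite -/m -/m' in m0 m1 m0' m1'; nra.
  rewrite -sqr_normr; have : 0 <= `|De| by []. nra.
have key : `|De| * `|m * gam - 2 * Y| <= d * B2 + B1 + gam * d.
  rewrite -normrM.
  have -> : De * (m * gam - 2 * Y) = 2 * (et * X) + m * (gam * dd - 2 * (sinc * (p * p' - r * r') - cosc * (p * r' + r * p'))) -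
     m * gam * (dd - De) by rewrite [m * (_ - _)]mulrBr mM; ring.
  have t1 : `|2 * (et * X)| <= d * B2.
    rewrite !normrM ger0_norm// mulrCA; apply: ler_pM => //; exact: mulr_ge0.
  have t2 : `|m * (gam * dd - 2 * (sinc * (p * p' - r * r') - cosc * (p * r' + r * p')))| <= B1.
    rewrite normrM -[leRHS]mul1r ler_pM// ger0_norm// addr_ge0 ?sqr_ge0//.
  have t3 : `|m * gam * (dd - De)| <= gam * d.
    rewrite normrM ler_pM// normrM (ger0_norm g0) ler_piMl// ger0_norm// addr_ge0 ?sqr_ge0//.
  apply: le_trans (ler_normB _ _) _; apply: lerD => //.
  by apply: le_trans (ler_normD _ _) _; exact: lerD.
have B20 : 0 <= B2 by apply: le_trans X2; exact: mulr_ge0.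
have k2 : `|m * gam - 2 * Y| <= 2 * (d * B2 + B1 + gam * d).
  have : 0 <= `|m * gam - 2 * Y| by []. nra.
have k3 : `|m * gam - 2 * `|Y| | <= 2 * (d * B2 + B1 + gam * d).
  apply: le_trans k2; have mg : 0 <= m * gam by rewrite mulr_ge0// addr_ge0 ?sqr_ge0.
  have := ler_dist_dist (m * gam) (2 * Y); rewrite (ger0_norm mg) normrM ger0_norm//.
rewrite ler_norml in k3; case/andP: k3 => k3 k4.
have B10 : 0 <= B1 by apply: le_trans h1.
exact: (gap_algebra_aux g0 rho0 d0 d6 m0 m1 k3 k4 Yup Ylow X2 B20 B10).
Qed.

Section FourierL2.
Variable R : realType.

Lemma nrm_le (x y : nat -> R) : l2 y -> (forall k, `|x k| <= `|y k|) -> nrm x <= nrm y.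
Proof. by move=> hy h; rewrite /nrm ler_sqrt ?dot_ge0//; exact: dot_sqr_le. Qed.

Lemma sm_dot_le (x y z : nat -> R) : l2 x -> l2 y -> (forall k, 0 <= z k <= x k * y k) ->
  asm z /\ sm z <= nrm x * nrm y.
Proof.
move=> hx hy h; have az : asm z.
  apply: asm_le (l2_dot hx hy) => k; have /andP[z0 zx] := h k.
  by rewrite (ger0_norm z0) ger0_norm// (le_trans z0).
split=> //; apply: le_trans (dot_nrm_abs hx hy).
apply: ler_sm => //; first exact/asm_abs/l2_dot.
by move=> k; have /andP[_ zx] := h k; apply: le_trans (ler_norm _).
Qed.

(** The convention [0^-1 = 0] makes this a square summable sequence from index 0 on. *)
Definition inv (j : nat) : R := j%:R^-1.

Lemma inv_l2 : l2 inv /\ nrm inv <= 2.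
Proof.
have h n : \sum_(k < n) inv k * inv k <= 4.
  apply: (@le_trans _ _ (\sum_(k < n.+1) inv k * inv k)).
    by apply: (@psum_mono _ (fun k => inv k * inv k)) => // k; rewrite -expr2 sqr_ge0.
  rewrite big_ord_recl {1 2}/inv invr0 mulr0 add0r.
  have := @inv_sq_tail R 1 n isT; rewrite invr1 => h.
  apply: le_trans (_ : _ <= 4 * 1) _; last by rewrite mulr1.
  apply: le_trans (ler_wpM2l (ler0n R 4) h); rewrite mulr_sumr; apply: ler_sum => k _.
  rewrite /inv lift0 -add1n; have x0 : (1 + k)%:R != 0 :> R by rewrite pnatr_eq0.
  by rewrite le_eqVlt; apply/orP; left; apply/eqP; field.
have l : l2 inv by apply: (asm_bound _ h) => k; rewrite -expr2 sqr_ge0.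
split=> //; rewrite -(@ler_pXn2r _ 2)// ?nnegrE ?nrm_ge0// nrm_sqr// -natrX.
exact: sm_le_bound.
Qed.

Variable q : R -> R.
Hypothesis hq : sq q.

(** Bessel in the periodic basis, whose even and odd indices give the cosine and sine
    coefficients. *)
Lemma rr_l2 : l2 (rr q).
Proof.
pose c k := itg (fun y => q y * @twphi R false k y).
have c2 : l2 c by exact: (coef_l2 (tw_system R false) hq).
have f1 : few (fun m => m.*2) 4.
  by move=> j; exists [:: j./2]; split=> // i <-; rewrite doubleK inE.
have f2 : few (fun m => m.*2.-1) 4.
  move=> j; exists [:: 0%N; uphalf j]; split=> // i <-; rewrite !inE; case: i => // i.
  by rewrite doubleS /= doubleK eqxx.
have [l1 _] := l2_few c2 f1; have [l3 _] := l2_few c2 f2.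
have aE m : c m.*2 = twa R false m.*2 * cosc q (2 * m%:R).
  rewrite /cosc -itgZ; last exact: igM_cts (sq_ig hq) (cts_cts01 (@csp_cont R _)).
  apply: eq_itg => y _; rewrite /twphi /trig; have [-> ->] := twcs R false m.*2.
  by rewrite odd_double twtE /twg uphalf_double addr0; ring.
have bE m : (0 < m)%N -> c m.*2.-1 = twa R false m.*2.-1 * sinc q (2 * m%:R).
  move=> m0; rewrite /sinc -itgZ; last exact: igM_cts (sq_ig hq) (cts_cts01 (@snp_cont R _)).
  apply: eq_itg => y _; rewrite /twphi /trig; have [-> ->] := twcs R false m.*2.-1.
  have -> : odd m.*2.-1 by case: m m0 => // m _; rewrite doubleS /= odd_double.
  have -> : twt R false m.*2.-1 = 2 * m%:R.
    by rewrite twtE addr0 /twg; case: m m0 => // m _; rewrite doubleS /= doubleK.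
  ring.
have a1 k : 1 <= twa R false k.
  by rewrite /twa; case: (twz _ _) => //; rewrite -[leLHS]sqrtr1 ler_sqrt ?ler1n.
have A2 : l2 (fun m => cosc q (2 * m%:R)).
  apply: l2_le l1 _ => m; rewrite aE normrM ler_peMl//.
  by rewrite ger0_norm ?a1// (le_trans ler01 (a1 _)).
have B2 : l2 (fun m => sinc q (2 * m%:R)).
  apply: l2_le l3 _ => -[|m].
    rewrite (_ : sinc q _ = 0) ?normr0// /sinc -[RHS](itg_cst 0); apply: eq_itg => y _.
    by rewrite mulr0 snp0 mulr0.
  by rewrite bE// normrM ler_peMl// ger0_norm ?a1// (le_trans ler01 (a1 _)).
apply: eq_asm (asmD A2 B2) => m; rewrite -!expr2 rr_sqr fourier_sq_al//.
Qed.

End FourierL2.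

Lemma ddn_tri i j k : (ddn i k <= ddn j i + ddn j k)%N.
Proof. by rewrite /ddn; lia. Qed.

Lemma ddn_add i j k a : (ddn i k <= j + i + a + ddn j k)%N.
Proof. by rewrite /ddn; lia. Qed.

(** * Decay of the two eigenvectors of a gap away from its frequency *)

Section OneGap.
Variable R : realType.
Variable q : R -> R.
Hypothesis hq : sq q.
Variables (a : bool) (n : nat).
Hypothesis (an : odd n = a) (n0 : (0 < n)%N).
Notation D := (@twD R a).
Notation b := (twb q a).
Notation g := (twg a).
Notation G := (twg a n).
Notation r := (rr q).
Variables (E : nat -> R) (e : nat -> nat -> R).
Hypothesis S : spec D b E e.
Let H : adm D b (matK q) := mat_adm (tw_system R a) hq.

(** The two basis indices of frequency [n]; they are also the indices of the two eigenvalues that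
    bound the gap. *)
Definition inI k := (k == n) || (k == n.-1).
Hypothesis loc : forall j, inI j -> `|E j - (pi * n%:R) ^+ 2| <= n%:R / 2.

Lemma I_n : inI n. Proof. by rewrite /inI eqxx. Qed.
Lemma I_n1 : inI n.-1. Proof. by rewrite /inI eqxx orbT. Qed.

Lemma twg_n : (G.*2 + a)%N = n.
Proof. by rewrite /twg -an; case: (boolP (odd n)) => o; lia. Qed.

Lemma twg_I k : inI k -> g k = G.
Proof. by rewrite /inI /twg -an => /orP[/eqP->//|/eqP->]; case: (boolP (odd n)) => o; lia. Qed.

Lemma twg_notI k : ~~ inI k -> g k != G.
Proof.
move=> h; apply/negP => /eqP; move: h; rewrite /inI /twg -an.
by case: (boolP (odd n)) => o; lia.
Qed.

Lemma twD_I j : inI j -> D j = (pi * n%:R) ^+ 2.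
Proof. move=> /twg_I h; rewrite /twD twtE h.
have -> : n%:R = 2 * G%:R + a%:R :> R by rewrite -{1}twg_n natrD -muln2 natrM mulrC.
by []. Qed.

Notation dk k := (ddn (g k) G).
Notation mk k := (g k + G + a)%N.

(** With [f] the frequency of [k], [|n^2 - f^2| = |n - f| (n + f)], where [|n - f|] is twice the
    distance and [n + f] is at least [n] and at least twice the distance. The shift of [E j], at
    most [n / 2], is absorbed since [pi ^ 2 >= 4]. *)
Lemma gapE j k : inI j -> ~~ inI k ->
  2 * ((dk k)%:R * n%:R) <= `|E j - D k| /\ 4 * ((dk k)%:R * (dk k)%:R) <= `|E j - D k|.
Proof.
move=> Ij Ik; set dd : R := (dk k)%:R; set f : R := twt R a k.
have d1 : 1 <= dd by rewrite ler1n /ddn; have := twg_notI Ik; lia.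
have n1 : 1 <= n%:R :> R by rewrite ler1n.
have fE : f = 2 * (g k)%:R + a%:R by rewrite /f twtE.
have nE : n%:R = 2 * G%:R + a%:R :> R by rewrite -{1}twg_n natrD -muln2 natrM mulrC.
have f0 : 0 <= f by rewrite fE addr_ge0 ?mulr_ge0.
have fd : 2 * dd <= n%:R + f.
  have : (dk k)%:R <= (g k)%:R + G%:R :> R by rewrite -natrD ler_nat /ddn; lia.
  have : 0 <= a%:R :> R by [].
  by rewrite -/dd fE nE; lra.
have dist : `|f - n%:R| = 2 * dd.
  have -> : f - n%:R = 2 * ((g k)%:R - G%:R) by rewrite fE nE; ring.
  by rewrite normrM ger0_norm//; case: (ddn_cases R (g k) G) => ->; rewrite ?normrN ger0_norm.
have p2 : 2 <= pi :> R by exact: pi_ge2.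
have big : 4 * (2 * dd * (n%:R + f)) <= `|(pi * n%:R) ^+ 2 - D k|.
  rewrite /twD -/f (_ : _ - _ = pi ^+ 2 * ((n%:R - f) * (n%:R + f))); last by ring.
  rewrite !normrM distrC dist (ger0_norm (_ : 0 <= n%:R + f)); last by lra.
  rewrite ler_wpM2r//; first by rewrite mulr_ge0 ?mulr_ge0//; lra.
  by rewrite ger0_norm ?sqr_ge0//; nra.
have tri : `|(pi * n%:R) ^+ 2 - D k| <= `|E j - D k| + n%:R / 2.
  have -> : (pi * n%:R) ^+ 2 - D k = (E j - D k) - (E j - (pi * n%:R) ^+ 2) by ring.
  by apply: le_trans (ler_normB _ _) _; rewrite lerD2l loc.
have h : 2 * dd * (n%:R + f) <= `|E j - D k| by nra.
by split; apply: le_trans h; nra.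
Qed.

(** Both eigenvectors obey the same inequalities, so they are estimated together through the sum of
    their moduli; [coef_off] drops the resonant pair. *)
Definition coef_abs k := `|e n k| + `|e n.-1 k|.
Definition coef_off k := if inI k then 0 else coef_abs k.

Let eh i : h1 D (e i). Proof. by case: S. Qed.
Let e2 i : l2 (e i). Proof. exact: (h1_l2 H). Qed.
Let e1 i : nrm (e i) = 1. Proof. by case: S => _ h _ _ _; rewrite /nrm h eqxx sqrtr1. Qed.
Let r2 : l2 r. Proof. exact: rr_l2. Qed.
Let r0 m : 0 <= r m. Proof. exact: rr_ge0. Qed.
Let n1 : 1 <= n%:R :> R. Proof. by rewrite ler1n. Qed.

Lemma xi_ge0 k : 0 <= coef_abs k. Proof. by rewrite addr_ge0. Qed.
Lemma xx_ge0 k : 0 <= coef_off k. Proof. by rewrite /coef_off; case: (inI k) => //; exact: xi_ge0. Qed.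
Lemma xi_le2 k : coef_abs k <= 2.
Proof.
have h i : `|e i k| <= 1 by rewrite -(e1 i); exact: nrm_coord.
by rewrite (_ : 2 = 1 + 1)//; exact: lerD.
Qed.
Lemma xi_l2 : l2 coef_abs. Proof. by apply: l2D; apply: l2_abs. Qed.
Lemma xi_nrm : nrm coef_abs <= 2.
Proof.
have na i : nrm (fun k => `|e i k|) = 1.
  by rewrite -(e1 i) /nrm; congr Num.sqrt; apply: eq_sm => k; rewrite -!expr2 sqr_normr.
apply: le_trans (nrmD (l2_abs (e2 n)) (l2_abs (e2 n.-1))) _.
by rewrite !na.
Qed.
Lemma xx_le k : coef_off k <= coef_abs k.
Proof. by rewrite /coef_off; case: (inI k) => //; exact: xi_ge0. Qed.
Lemma xx_l2 : l2 coef_off.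
Proof. by apply: l2_le xi_l2 _ => k; rewrite !ger0_norm ?xx_le ?xx_ge0 ?xi_ge0. Qed.

Lemma b_l2 k : l2 (b k). Proof. by case: H => _ _ _ [_ /(_ k)[]]. Qed.

Lemma eig_ineq k : ~~ inI k -> forall c, 0 <= c ->
  c <= `|E n - D k| -> c <= `|E n.-1 - D k| -> c * coef_off k <= sm (fun l => `|b k l| * coef_abs l).
Proof.
move=> Ik c c0 h1 h2; rewrite /coef_off (negPf Ik) /coef_abs mulrDr.
have aux j : c <= `|E j - D k| -> c * `|e j k| <= sm (fun l => `|b k l| * `|e j l|).
  move=> hc; apply: le_trans (ler_wpM2r (normr_ge0 _) hc) _; rewrite -normrM.
  have -> : (E j - D k) * e j k = bx b (e j) k.
    by have := eig_coord S j k => h; rewrite mulrBl -h; ring.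
  apply: le_trans (sm_abs (l2_dot (b_l2 k) (e2 j))) _.
  by rewrite le_eqVlt; apply/orP; left; apply/eqP/eq_sm => l; rewrite normrM.
apply: le_trans (lerD (aux n h1) (aux n.-1 h2)) _.
have A j : asm (fun l => `|b k l| * `|e j l|) by apply: l2_dot; apply: l2_abs; [exact: b_l2|exact: e2].
rewrite -smD//; apply: ler_sm.
- exact: asmD.
- by apply: l2_dot; [exact/l2_abs/b_l2|exact: xi_l2].
- by move=> l; rewrite /coef_abs mulrDr.
Qed.

Definition vdd k (v : nat -> R) l := v (ddn (g l) (g k)).
Definition vad k (v : nat -> R) l := v (g l + g k + a)%N.

Lemma vdd_l2 k v : l2 v -> l2 (vdd k v) /\ nrm (vdd k v) <= 2 * nrm v.
Proof. by move=> hv; apply: (l2_few hv); exact: dd_few. Qed.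
Lemma vad_l2 k v : l2 v -> l2 (vad k v) /\ nrm (vad k v) <= 2 * nrm v.
Proof. by move=> hv; apply: (l2_few hv); exact: add_few. Qed.

Lemma row_sum k (v z : nat -> R) : l2 v -> l2 z -> (forall m, 0 <= v m) -> (forall l, 0 <= z l) ->
  asm (fun l => (vdd k v l + vad k v l) * z l) /\
  sm (fun l => (vdd k v l + vad k v l) * z l) <= 4 * nrm v * nrm z.
Proof.
move=> hv hz v0 z0; have [d2 dn] := vdd_l2 k hv; have [a2 an'] := vad_l2 k hv.
have [||A B] := @sm_dot_le R (fun l => vdd k v l + vad k v l) z (fun l => (vdd k v l + vad k v l) * z l) _ hz.
- exact: l2D.
- by move=> l; rewrite lexx andbT mulr_ge0// addr_ge0 ?v0.
split=> //; apply: le_trans B _; rewrite ler_wpM2r ?nrm_ge0//.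
apply: le_trans (nrmD d2 a2) _; lra.
Qed.

Lemma b_le k l : `|b k l| <= vdd k r l + vad k r l.
Proof. by rewrite /vdd /vad twb_sym; exact: twb_bound. Qed.

Definition inv_dist k : R := if inI k then 0 else inv R (dk k).

Lemma Id_l2 : l2 inv_dist /\ nrm inv_dist <= 4.
Proof.
have [i2 iN] := inv_l2 R; have [d2 dn] := vdd_l2 n i2.
have le k : `|inv_dist k| <= `|vdd n (inv R) k| by rewrite /inv_dist /vdd; case: (inI k); rewrite ?normr0.
split; first exact: l2_le d2 le.
apply: le_trans (nrm_le d2 le) _; lra.
Qed.

Lemma Id_ge0 k : 0 <= inv_dist k. Proof. by rewrite /inv_dist /inv; case: (inI k). Qed.

Lemma IdK k : ~~ inI k -> inv_dist k * (dk k)%:R = 1.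
Proof.
move=> Ik; rewrite /inv_dist (negPf Ik) /inv mulVf// pnatr_eq0.
by have := twg_notI Ik; rewrite /ddn; lia.
Qed.

Section Weight.
Variables (W rt : nat -> R) (c M : R).
Hypothesis W0 : forall j, 0 <= W j.
Hypothesis WM : forall j, W j <= M.
Hypothesis Wc : forall i j k, (i <= j + k)%N -> W i <= c * (W j + W k).
Hypothesis c0 : 0 <= c.
Hypothesis rt2 : l2 rt.
Hypothesis Wr : forall j, W j * r j <= rt j.
Let rt0 j : 0 <= rt j. Proof. by apply: le_trans (Wr j); rewrite mulr_ge0. Qed.

Definition coef_wt k := W (dk k) * coef_off k.

Lemma yy_ge0 k : 0 <= coef_wt k. Proof. by rewrite mulr_ge0 ?xx_ge0. Qed.

Lemma yy_l2 : l2 coef_wt.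
Proof.
have M0 : 0 <= M by apply: le_trans (WM 0%N).
apply: l2_le (l2Z M xx_l2) _ => k; rewrite !ger0_norm ?mulr_ge0 ?xx_ge0//.
by rewrite ler_wpM2r ?xx_ge0.
Qed.

(** [Wc] splits the weight at [k] into the weight of the matrix frequency, which falls on [r], and
    the weight at [l], which falls on the eigenvector. The latter brings back the unknown norm with
    a factor [8 * c * nrm r / n], at most one half by hypothesis, and is absorbed. *)
Lemma weighted : 16 * c * nrm r <= n%:R ->
  nrm coef_wt <= 4 * (c * (8 * nrm rt + 8 * W 0%N * nrm r)) / n%:R.
Proof.
move=> nbig.
pose zz l := W (dk l) * coef_abs l.
have M0 : 0 <= M by apply: le_trans (WM 0%N).
have z0 l : 0 <= zz l by rewrite mulr_ge0 ?xi_ge0.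
have z2 : l2 zz.
  apply: l2_le (l2Z M xi_l2) _ => k; rewrite !ger0_norm ?mulr_ge0 ?xi_ge0//.
  by rewrite ler_wpM2r ?xi_ge0.
have zn : nrm zz <= nrm coef_wt + 2 * W 0%N.
  pose w l := if inI l then W 0%N * coef_abs l else 0.
  have w2 : l2 w.
    apply: l2_le (l2Z (W 0%N) xi_l2) _ => k; rewrite /w; case: (inI k) => //.
    by rewrite normr0.
  rewrite (_ : zz = (fun l => coef_wt l + w l)); last first.
    apply/funext => l; rewrite /zz /coef_wt /w /coef_off; case: (boolP (inI l)) => Il.
      by rewrite mulr0 add0r (twg_I Il) /ddn subnn.
    by rewrite addr0.
  apply: le_trans (nrmD yy_l2 w2) _; rewrite lerD2l.
  apply: (@le_trans _ _ (nrm (fun k => W 0%N * coef_abs k))).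
    apply: nrm_le; first exact/l2Z/xi_l2.
    by move=> k; rewrite /w; case: (inI k); rewrite ?normr0.
  by rewrite nrmZ ?ger0_norm//; [rewrite mulrC ler_wpM2r// xi_nrm|exact: xi_l2].
pose A := c * (8 * nrm rt + 8 * W 0%N * nrm r) + 4 * c * nrm r * nrm coef_wt.
have A0 : 0 <= A by rewrite addr_ge0// ?mulr_ge0 ?addr_ge0 ?mulr_ge0 ?nrm_ge0.
have yk k : coef_wt k <= A / (2 * n%:R) * inv_dist k.
  case: (boolP (inI k)) => Ik; first by rewrite /coef_wt /coef_off Ik /inv_dist Ik !mulr0.
  have [g1 _] := gapE I_n Ik; have [g2 _] := gapE I_n1 Ik.
  have h := eig_ineq Ik (_ : 0 <= 2 * ((dk k)%:R * n%:R)) g1 g2.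
  have hy : 2 * ((dk k)%:R * n%:R) * coef_wt k <= A.
    rewrite /coef_wt mulrCA; apply: le_trans (ler_wpM2l (W0 _) (h _)) _; first by rewrite !mulr_ge0.
    have [B1 s1] := row_sum k rt2 xi_l2 rt0 xi_ge0.
    have [B2 s2] := row_sum k r2 z2 r0 z0.
    have ab : asm (fun l => `|b k l| * coef_abs l) by apply: l2_dot; [exact/l2_abs/b_l2|exact: xi_l2].
    rewrite -smZ//.
    apply: (@le_trans _ _ (sm (fun l => c * ((vdd k rt l + vad k rt l) * coef_abs l) + c * ((vdd k r l + vad k r l) * zz l)))).
      apply: ler_sm; [exact: asmZ|by apply: asmD; exact: asmZ|move=> l].
      rewrite [leLHS]mulrA -[leRHS](_ : c * ((vdd k rt l + vad k rt l) + (vdd k r l + vad k r l) * W (dk l)) * coef_abs l = _); last first.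
        by rewrite /zz; ring.
      rewrite ler_wpM2r ?xi_ge0//; apply: le_trans (ler_wpM2l (W0 _) (b_le k l)) _.
      have t1 : W (dk k) * vdd k r l <= c * (vdd k rt l + vdd k r l * W (dk l)).
        have le : (dk k <= ddn (g l) (g k) + dk l)%N by exact: ddn_tri.
        apply: le_trans (ler_wpM2r (r0 _) (Wc le)) _; rewrite -mulrA ler_wpM2l// mulrDl.
        by rewrite (mulrC (W (dk l))) lerD2r Wr.
      have t2 : W (dk k) * vad k r l <= c * (vad k rt l + vad k r l * W (dk l)).
        have le : (dk k <= (g l + g k + a) + dk l)%N by exact: ddn_add.
        apply: le_trans (ler_wpM2r (r0 _) (Wc le)) _; rewrite -mulrA ler_wpM2l// mulrDl.
        by rewrite (mulrC (W (dk l))) lerD2r Wr.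
      rewrite mulrDr; apply: le_trans (lerD t1 t2) _.
      by rewrite le_eqVlt; apply/orP; left; apply/eqP; ring.
    rewrite smD ?smZ//; try exact: asmZ.
    have u1 : sm (fun l => (vdd k rt l + vad k rt l) * coef_abs l) <= 8 * nrm rt.
      apply: le_trans s1 _; rewrite (_ : 8 * nrm rt = 4 * nrm rt * 2); last by ring.
      by rewrite ler_wpM2l ?mulr_ge0 ?nrm_ge0// xi_nrm.
    have u2 : sm (fun l => (vdd k r l + vad k r l) * zz l) <= 4 * nrm r * (nrm coef_wt + 2 * W 0%N).
      by apply: le_trans s2 _; rewrite ler_wpM2l ?mulr_ge0 ?nrm_ge0.
    apply: le_trans (lerD (ler_wpM2l c0 u1) (ler_wpM2l c0 u2)) _.
    by rewrite /A le_eqVlt; apply/orP; left; apply/eqP; ring.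
  have di := IdK Ik; have i0 := Id_ge0 k.
  rewrite mulrAC ler_pdivlMr; last by rewrite mulr_gt0// ltr0n.
  have -> : coef_wt k * (2 * n%:R) = inv_dist k * (2 * ((dk k)%:R * n%:R) * coef_wt k).
    by transitivity (inv_dist k * (dk k)%:R * (coef_wt k * (2 * n%:R))); [rewrite di mul1r|ring].
  by rewrite mulrC ler_wpM2r.
have [I2 IN] := Id_l2.
have c1 : 0 <= A / (2 * n%:R) by rewrite divr_ge0// mulr_ge0.
have : nrm coef_wt <= A / (2 * n%:R) * 4.
  apply: (@le_trans _ _ (nrm (fun k => A / (2 * n%:R) * inv_dist k))).
    apply: nrm_le; first exact: l2Z.
    by move=> k; rewrite !ger0_norm ?yy_ge0 ?mulr_ge0 ?Id_ge0.
  by rewrite nrmZ// ger0_norm// ler_wpM2l.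
have np : 0 < n%:R :> R by rewrite ltr0n.
rewrite ler_pdivlMr// mulrAC ler_pdivlMr; last by rewrite mulr_gt0.
rewrite /A; have y0 := nrm_ge0 coef_wt; move: nbig; set N := n%:R; set B := c * (_ + _).
by nra.
Qed.

End Weight.
End OneGap.

(** * The gap length up to explicit errors *)

Section GapEstimate.
Variable R : realType.
Variable q : R -> R.
Hypothesis hq : sq q.
Variables (a : bool) (n : nat).
Hypothesis (an : odd n = a) (n0 : (0 < n)%N).
Notation D := (@twD R a).
Notation b := (twb q a).
Notation g := (twg a).
Notation G := (twg a n).
Notation r := (rr q).
Variables (E : nat -> R) (e : nat -> nat -> R).
Hypothesis S : spec D b E e.
Hypothesis loc : forall j, inI n j -> `|E j - (pi * n%:R) ^+ 2| <= n%:R / 2.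
Notation dk k := (ddn (g k) G).
Notation mk k := (g k + G + a)%N.
Notation xx := (coef_off n e).
Notation xi := (coef_abs n e).
Notation Id := (inv_dist R a n).
Notation rho := (nrm (rr q)).
Let H : adm D b (matK q) := mat_adm (tw_system R a) hq.
Let gI k : inI n k -> g k = G := @twg_I _ _ hq _ _ an n0 _ _ S k.
Let x2 : l2 xx := xx_l2 hq n S.
Let x0 k : 0 <= xx k := xx_ge0 n e k.
Let r2 : l2 r := rr_l2 hq.
Let r0 m : 0 <= r m := rr_ge0 q m.
Let n1 : 1 <= n%:R :> R. Proof. by rewrite ler1n. Qed.
Let np : 0 < n%:R :> R. Proof. by rewrite ltr0n. Qed.
Let rho0 : 0 <= rho. Proof. exact: nrm_ge0. Qed.
Let eh i : h1 D (e i). Proof. by case: S. Qed.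
Let e2 i : l2 (e i). Proof. exact: (h1_l2 H). Qed.
Let e1 i : nrm (e i) = 1. Proof. by case: S => _ h _ _ _; rewrite /nrm h eqxx sqrtr1. Qed.
Let ele i k : `|e i k| <= 1. Proof. by rewrite -(e1 i); exact: nrm_coord. Qed.
Let Id0 k : 0 <= Id k := Id_ge0 R a n k.

Definition RR k := r (dk k) + r (mk k).

(** In row [k] the two resonant columns have entries at most [RR k] and coordinates at most 2, which
    gives [4 * RR k]; the other columns are summed by Cauchy-Schwarz. *)
Lemma xx_eq k : ~~ inI n k -> forall c, 0 <= c -> c <= `|E n - D k| -> c <= `|E n.-1 - D k| ->
  c * xx k <= 4 * RR k + 4 * rho * nrm xx.
Proof.
move=> Ik c c0 h1 h2; apply: le_trans (eig_ineq hq S Ik c0 h1 h2) _.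
pose w l := if inI n l then xi l else 0.
pose d l : R := 2 * (delta R n l + delta R n.-1 l).
have ad i : asm (delta R i) by apply: (@asm_fin _ _ i.+1) => l il; rewrite /delta gtn_eqF.
have sd i : sm (delta R i) = 1.
  by rewrite -[RHS](dot_delta (fun=> 1 : R) i); apply: eq_sm => l; rewrite mulr1.
have a1 : asm (fun l => RR k * d l) by apply: asmZ; apply: asmZ; exact: asmD.
have [a2 s2] := row_sum a k r2 x2 r0 x0.
have -> : 4 * RR k = sm (fun l => RR k * d l).
  rewrite smZ ?smZ ?smD ?sd//; first (by ring); try exact: asmD.
  by apply: asmZ; exact: asmD.
apply: (@le_trans _ _ (sm (fun l => RR k * d l + (vdd a k r l + vad a k r l) * xx l))); last first.
  by rewrite smD// lerD2l.
apply: ler_sm; [|exact: asmD|move=> l].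
  by apply: l2_dot; [exact/l2_abs/(b_l2 hq)|exact: (xi_l2 hq n S)].
have bl := b_le hq a k l.
have d0 : 0 <= d l by rewrite mulr_ge0// addr_ge0// /delta; case: (_ == _).
have R0 : 0 <= RR k by rewrite addr_ge0.
case: (boolP (inI n l)) => Il; last first.
  have -> : xi l = xx l by rewrite /coef_off (negPf Il).
  by apply: ler_wpDl; [rewrite mulr_ge0|rewrite ler_wpM2r].
have -> : xx l = 0 by rewrite /coef_off Il.
rewrite mulr0 addr0; apply: ler_pM => //; first exact: xi_ge0.
  by move: bl; rewrite /vdd /vad (gI Il) ddnC (addnC G).
apply: le_trans (xi_le2 hq n S l) _; rewrite /d ler_peMr//.
move: Il; rewrite /inI /delta => /orP[/eqP->|/eqP->]; rewrite eqxx /= ?lerDl ?lerDr; by case: (_ == _).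
Qed.

Lemma xx_bound1 k : xx k <= (2 * RR k + 2 * rho * nrm xx) / n%:R * Id k.
Proof.
case: (boolP (inI n k)) => Ik; first by rewrite /coef_off Ik /inv_dist Ik mulr0.
have [g1 _] := gapE hq an n0 S loc (I_n n) Ik; have [g2 _] := gapE hq an n0 S loc (I_n1 n) Ik.
have d0 : 0 <= 2 * ((dk k)%:R * n%:R) :> R by rewrite !mulr_ge0.
have := xx_eq Ik d0 g1 g2; have di := IdK hq an n0 S Ik => h.
rewrite mulrAC ler_pdivlMr// -(@ler_pM2l _ 2)//.
have -> : 2 * (xx k * n%:R) = Id k * (2 * ((dk k)%:R * n%:R) * xx k).
  by transitivity (Id k * (dk k)%:R * (2 * (xx k * n%:R))); [rewrite di mul1r|ring].
apply: le_trans (ler_wpM2l (Id0 k) h) _.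
by rewrite le_eqVlt; apply/orP; left; apply/eqP; ring.
Qed.

(** The larger of the two denominators in [gapE] is available, so each term may be given the one
    that makes it summable in [k]: [RR] goes with [Id / n], the constant term with [Id ^+ 2]. *)
Lemma xx_bound2 k : xx k <= 2 / n%:R * (RR k * Id k) + rho * nrm xx * (Id k * Id k).
Proof.
case: (boolP (inI n k)) => Ik; first by rewrite /coef_off Ik /inv_dist Ik !mulr0 addr0.
have [g1 f1] := gapE hq an n0 S loc (I_n n) Ik; have [g2 f2] := gapE hq an n0 S loc (I_n1 n) Ik.
have d0 : 0 <= 2 * ((dk k)%:R * n%:R) :> R by rewrite !mulr_ge0.
have d0' : 0 <= 4 * ((dk k)%:R * (dk k)%:R) :> R by rewrite !mulr_ge0.
have h := xx_eq Ik d0 g1 g2; have h' := xx_eq Ik d0' f1 f2; have di := IdK hq an n0 S Ik.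
set dd : R := (dk k)%:R in d0 d0' h h' di.
have dd0 : 0 < dd.
  rewrite lt0r ler0n andbT; apply/eqP => z; move: di; rewrite z mulr0 => /eqP.
  by rewrite eq_sym oner_eq0.
have iE : Id k = dd^-1 by apply: (mulIf (lt0r_neq0 dd0)); rewrite di mulVf// gt_eqF.
have R0 : 0 <= RR k by rewrite addr_ge0.
have X0 : 0 <= rho * nrm xx by rewrite mulr_ge0 ?nrm_ge0.
have -> : 2 / n%:R * (RR k * Id k) + rho * nrm xx * (Id k * Id k) =
   (4 * RR k) / (2 * (dd * n%:R)) + (4 * (rho * nrm xx)) / (4 * (dd * dd)).
  by rewrite iE; field; rewrite !gt_eqF.
have c1 : 0 < 2 * (dd * n%:R) by rewrite !mulr_gt0.
have c2 : 0 < 4 * (dd * dd) by rewrite !mulr_gt0.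
rewrite -mulrA in h h'.
case: (leP (2 * (dd * n%:R)) (4 * (dd * dd))) => le.
  apply: (@le_trans _ _ ((4 * RR k + 4 * (rho * nrm xx)) / (4 * (dd * dd)))).
    by rewrite ler_pdivlMr// mulrC.
  rewrite mulrDl lerD2r ler_wpM2l ?mulr_ge0//.
  by rewrite lef_pV2 ?posrE.
apply: (@le_trans _ _ ((4 * RR k + 4 * (rho * nrm xx)) / (2 * (dd * n%:R)))).
  by rewrite ler_pdivlMr// mulrC.
by rewrite mulrDl lerD2l; apply: ler_wpM2l; [exact: mulr_ge0|rewrite lef_pV2 ?posrE// ltW].
Qed.

Lemma xx_l1 : asm xx /\ sm xx <= 32 * rho / n%:R + 16 * rho * nrm xx.
Proof.
have [I2 I4] := Id_l2 R a n; have [A1 s1] := row_sum a n r2 I2 r0 Id0.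
have A2 := I2 : asm (fun k => Id k * Id k).
have s2 : dot Id Id <= 16.
  rewrite -nrm_sqr// (_ : 16 = 4 ^+ 2); last by rewrite -natrX.
  by rewrite ler_pXn2r ?nnegrE ?nrm_ge0.
have X0 : 0 <= rho * nrm xx by rewrite mulr_ge0 ?nrm_ge0.
have A3 : asm (fun k => 2 / n%:R * (RR k * Id k) + rho * nrm xx * (Id k * Id k)).
  by apply: asmD; exact: asmZ.
have A4 : asm xx.
  apply: asm_le A3 => k; rewrite ger0_norm// ger0_norm ?xx_bound2//.
  by apply: le_trans (xx_bound2 k).
split=> //; apply: le_trans (ler_sm A4 A3 xx_bound2) _.
rewrite smD ?smZ//; try exact: asmZ.
have n2 : 0 <= 2 / n%:R :> R by rewrite divr_ge0// ltW.
apply: lerD.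
  apply: (@le_trans _ _ (2 / n%:R * (4 * rho * 4))); last first.
    by rewrite le_eqVlt; apply/orP; left; apply/eqP; ring.
  rewrite ler_wpM2l//; apply: le_trans s1 _; rewrite ler_wpM2l ?mulr_ge0//.
by rewrite [leRHS](_ : _ = rho * nrm xx * 16); [rewrite ler_wpM2l|ring].
Qed.

(** The interaction between the off-resonant coordinates and the resonant pair; it involves [r] at
    frequency sums only. *)
Definition PP := sm (fun k => r (mk k) * xx k).

Lemma PP_asm : asm (fun k => r (mk k) * xx k).
Proof. by have [v2 _] := vad_l2 a n r2; exact: (l2_dot v2 x2). Qed.

Definition off (x : nat -> R) k := if inI n k then 0 else x k.
Definition onI (x : nat -> R) k := if inI n k then x k else 0.

Lemma sum_onI L (F : nat -> R) : (n < L)%N -> \sum_(l < L) onI F l = F n + F n.-1.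
Proof.
move=> nL; have n1L : (n.-1 < L)%N by apply: leq_ltn_trans nL; exact: leq_pred.
rewrite (bigD1 (Ordinal nL))//= (bigD1 (Ordinal n1L))/=; last first.
  by rewrite -val_eqE /= ltn_eqF// ltn_predL.
rewrite /onI I_n I_n1 big1 ?addr0// => l /andP[h1 h2].
by rewrite /inI -!val_eqE /= in h1 h2 *; rewrite (negPf h1) (negPf h2).
Qed.

Lemma off_le i k : inI n i -> `|off (e i) k| <= xx k.
Proof.
rewrite /off /coef_off /coef_abs; case: (inI n k); first by rewrite normr0.
by move=> /orP[/eqP->|/eqP->]; rewrite ?lerDl ?lerDr.
Qed.

Lemma dot_off x y : l2 x -> l2 y -> dot x y = x n * y n + x n.-1 * y n.-1 + dot (off x) (off y).
Proof.
move=> hx hy; have ho z : l2 z -> l2 (off z).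
  by move=> hz; apply: l2_le hz _ => k; rewrite /off; case: (inI n k); rewrite ?normr0.
rewrite -(sum_onI (fun l => x l * y l) (ltnSn n)).
rewrite -(@sm_fin _ (onI (fun l => x l * y l)) n.+1); last first.
  by move=> k nk; rewrite /onI /inI !gtn_eqF//; apply: leq_ltn_trans nk; exact: leq_pred.
rewrite /dot -smD; last exact: (l2_dot (ho _ hx) (ho _ hy)); last first.
  apply: (@asm_fin _ _ n.+1) => k nk; rewrite /onI /inI !gtn_eqF//.
  by apply: leq_ltn_trans nk; exact: leq_pred.
by apply: eq_sm => k; rewrite /onI /off; case: (inI n k); rewrite ?mulr0 ?addr0 ?add0r.
Qed.

Lemma dot_off_le x y : (forall k, `|off x k| <= xx k) -> l2 y -> nrm (off y) <= nrm xx ->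
  `|dot (off x) (off y)| <= nrm xx ^+ 2.
Proof.
move=> hx hy ny; have ox : l2 (off x) by apply: l2_le x2 _ => k; rewrite (ger0_norm (x0 k)).
have oy : l2 (off y) by apply: l2_le hy _ => k; rewrite /off; case: (inI n k); rewrite ?normr0.
apply: le_trans (dot_nrm ox oy) _; rewrite expr2 ler_pM ?nrm_ge0//.
by apply: nrm_le x2 _ => k; rewrite (ger0_norm (x0 k)).
Qed.

Variable SS : R.
Hypothesis hSS : forall L, \sum_(k < L) \sum_(l < L) r (g k + g l + a)%N * xx k * xx l <= SS.

(** Both eigenvectors are split into resonant and off-resonant parts. The resonant block is the main
    term, the two mixed blocks cost [4 * PP] each, and the off-resonant block costs [2 * SS]. *)
Lemma off_block i j : inI n i -> inI n j ->
  `|(E i - E j) * dot (e i) (JJ a (e j)) -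
    (twN q a n n * e i n * e j n + twN q a n n.-1 * e i n.-1 * e j n +
     (twN q a n.-1 n * e i n * e j n.-1 + twN q a n.-1 n.-1 * e i n.-1 * e j n.-1))| <= 8 * PP + 2 * SS.
Proof.
move=> Ii Ij; apply: (J_bound hq S (n0 := n)) => N nN.
have nL : (n < len a N.+1)%N by rewrite /len; lia.
set L := len a N.+1 in nL *.
have split x k : x k = onI x k + off x k.
  by rewrite /onI /off; case: (inI n k); rewrite ?addr0 ?add0r.
have NE : \sum_(k < L) \sum_(l < L) twN q a k l * e i l * e j k =
   \sum_(k < L) \sum_(l < L) twN q a k l * onI (e i) l * onI (e j) k +
   \sum_(k < L) \sum_(l < L) twN q a k l * onI (e i) l * off (e j) k +
   (\sum_(k < L) \sum_(l < L) twN q a k l * off (e i) l * onI (e j) k +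
   \sum_(k < L) \sum_(l < L) twN q a k l * off (e i) l * off (e j) k).
  rewrite -!big_split/=; apply: eq_bigr => k _; rewrite -!big_split/=; apply: eq_bigr => l _.
  by rewrite {1}(split (e i) l) {1}(split (e j) k); ring.
have M1 : \sum_(k < L) \sum_(l < L) twN q a k l * onI (e i) l * onI (e j) k =
   twN q a n n * e i n * e j n + twN q a n n.-1 * e i n.-1 * e j n +
     (twN q a n.-1 n * e i n * e j n.-1 + twN q a n.-1 n.-1 * e i n.-1 * e j n.-1).
  rewrite -(sum_onI (fun k => twN q a k n * e i n * e j k + twN q a k n.-1 * e i n.-1 * e j k) nL).
  apply: eq_bigr => k _; rewrite /onI; case: (inI n k); last by rewrite big1// => l _; rewrite mulr0.
  rewrite -(sum_onI (fun l => twN q a k l * e i l * e j k) nL); apply: eq_bigr => l _.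
  by rewrite /onI; case: (inI n l); rewrite ?mulr0 ?mul0r.
have P0 k : 0 <= r (mk k) * xx k by rewrite mulr_ge0.
have Pfin : \sum_(k < L) r (mk k) * xx k <= PP by exact: (psum_le_sm L PP_asm P0).
have on_le i' k : `|onI (e i') k| <= onI (fun=> 1) k.
  by rewrite /onI; case: (inI n k); rewrite ?normr0.
have T1 i' j' (F : 'I_L -> 'I_L -> R) : inI n j' ->
    (forall k l, `|F k l| <= 2 * r (g k + g l + a)%N * `|onI (e i') l| * `|off (e j') k|) ->
    \sum_(k < L) \sum_(l < L) `|F k l| <= 4 * PP.
  move=> Ij' hF; apply: (@le_trans _ _ (\sum_(k < L) 4 * (r (mk k) * xx k))); last first.
    by rewrite -mulr_sumr ler_wpM2l.
  apply: ler_sum => k _.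
  apply: (@le_trans _ _ (\sum_(l < L) (2 * (r (mk k) * xx k)) * onI (fun=> 1) l)); last first.
    by rewrite -mulr_sumr (sum_onI (fun=> 1) nL); rewrite le_eqVlt; apply/orP; left; apply/eqP; ring.
  apply: ler_sum => l _; apply: le_trans (hF k l) _.
  have := on_le i' l; rewrite /onI; case: (boolP (inI n l)) => Il; last by rewrite normr0 !mulr0 mul0r.
  rewrite (gI Il) mulr1 => e1'; rewrite -!mulrA ler_wpM2l// ler_wpM2l//.
  by rewrite -[leRHS]mul1r ler_pM// off_le.
rewrite NE M1 addrAC (addrAC _ _ (- _)) subrr add0r.
have T1' := T1 i j (fun k l => twN q a k l * onI (e i) l * off (e j) k) Ij.
have T2' := T1 j i (fun l k => twN q a k l * off (e i) l * onI (e j) k) Ii.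
have b1 : `|\sum_(k < L) \sum_(l < L) twN q a k l * onI (e i) l * off (e j) k| <= 4 * PP.
  apply: le_trans (ler_norm_sum _ _ _) _; apply: le_trans (T1' _).
    by apply: ler_sum => k _; exact: ler_norm_sum.
  by move=> k l; rewrite !normrM ler_wpM2r// ler_wpM2r// twN_bound.
have b2 : `|\sum_(k < L) \sum_(l < L) twN q a k l * off (e i) l * onI (e j) k| <= 4 * PP.
  apply: le_trans (ler_norm_sum _ _ _) _; apply: le_trans (T2' _).
    rewrite exchange_big/=; apply: ler_sum => k _; exact: ler_norm_sum.
  move=> l k; rewrite !normrM -mulrA [X in _ * X]mulrC mulrA ler_wpM2r// ler_wpM2r//.
  by rewrite (addnC (g l)) twN_bound.
have b3 : `|\sum_(k < L) \sum_(l < L) twN q a k l * off (e i) l * off (e j) k| <= 2 * SS.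
  apply: le_trans (ler_norm_sum _ _ _) _; apply: (@le_trans _ _ (2 * \sum_(k < L) \sum_(l < L) r (g k + g l + a)%N * xx k * xx l)); last first.
    by rewrite ler_wpM2l.
  rewrite mulr_sumr; apply: ler_sum => k _; apply: le_trans (ler_norm_sum _ _ _) _.
  rewrite mulr_sumr; apply: ler_sum => l _; rewrite !normrM.
  rewrite (_ : 2 * _ = 2 * r (g k + g l + a)%N * xx l * xx k); last by ring.
  by apply: ler_pM; rewrite ?mulr_ge0 ?off_le//; apply: ler_pM => //; rewrite ?off_le ?twN_bound.
apply: le_trans (ler_normD _ _) _.
have := ler_normD (\sum_(k < L) \sum_(l < L) twN q a k l * off (e i) l * onI (e j) k)
   (\sum_(k < L) \sum_(l < L) twN q a k l * off (e i) l * off (e j) k).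
lra.
Qed.

(** The indices of the cosine and of the sine of frequency [n], that is, the even and the odd one
    among [n] and [n.-1]. *)
Let ic := if a then n.-1 else n.
Let is_ := if a then n else n.-1.

Let twz_I k : inI n k -> ~~ twz a k.
Proof.
rewrite /twz; case: (boolP a) => //= na; rewrite /inI => /orP[/eqP->|/eqP->]; first by rewrite -lt0n.
by move: an n0; rewrite (negPf na); case: (n) => // -[|m].
Qed.

Let oddI : odd ic = false /\ odd is_ = true.
Proof.
by rewrite /ic /is_; move: an n0; case: (n) => // m /=; case: (a) => /=; case: (odd m).
Qed.

Let twt_I k : inI n k -> twt R a k = n%:R.
Proof.
move=> Ik; rewrite twtE (gI Ik).
by rewrite -[in RHS](twg_n hq an n0 S) natrD -muln2 natrM mulrC.
Qed.

Let sI k : inI n k -> tws a k = (if k == n then n.-1 else n).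
Proof.
move=> Ik; rewrite /tws (negPf (twz_I Ik)) -an; move: Ik n0; rewrite /inI.
case: (n) => // m /=; case: eqP => [->|_] /=; first by case: (odd m).
by move=> /eqP-> _; rewrite addNb addbb.
Qed.

(** [off_block] at [(n, n.-1)] involves the gap length, and at [(n, n)] its left-hand side vanishes;
    these are the two approximate identities that [gap_algebra] combines. *)
Lemma gap_bound : nrm xx ^+ 2 <= 1 / 6 ->
  `|E n - E n.-1 - 2 * r n| <= 16 * nrm xx ^+ 2 * r n + 10 * (8 * PP + 2 * SS).
Proof.
move=> X6; have [oc os] := oddI.
have In := I_n n; have In1 := I_n1 n.
have Ic : inI n ic by rewrite /ic; case: (a).
have Is : inI n is_ by rewrite /is_; case: (a).
have sum_cs (F : nat -> R) : F n + F n.-1 = F ic + F is_.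
  by rewrite /ic /is_; case: (a) => //; rewrite addrC.
have t2 k l : inI n k -> inI n l -> twt R a k + twt R a l = 2 * n%:R.
  by move=> Ik Il; rewrite !twt_I// mulrDl mul1r.
pose M (u w : nat -> R) := 2 * (sinc q (2 * n%:R) * (u ic * w ic - u is_ * w is_) -
   cosc q (2 * n%:R) * (u ic * w is_ + u is_ * w ic)).
have mainE (u w : nat -> R) : twN q a n n * u n * w n + twN q a n n.-1 * u n.-1 * w n +
     (twN q a n.-1 n * u n * w n.-1 + twN q a n.-1 n.-1 * u n.-1 * w n.-1) = M u w.
  rewrite (sum_cs (fun l => twN q a n l * u l * w n)) (sum_cs (fun l => twN q a n.-1 l * u l * w n.-1)).
  rewrite (sum_cs (fun k => twN q a k ic * u ic * w k + twN q a k is_ * u is_ * w k)).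
  by rewrite !(twN_E hq) ?twz_I// !t2// oc os /= /M; ring.
have b1 := off_block In In1; have b2 := off_block In In; rewrite !mainE in b1 b2.
rewrite subrr mul0r sub0r normrN in b2.
have [_ eij _ Em _] := S.
have on i : nrm (off (e i)) <= nrm xx \/ ~~ inI n i.
  case: (boolP (inI n i)) => Ii; [left|by right].
  by apply: nrm_le x2 _ => k; rewrite (ger0_norm (x0 k)) off_le.
have onI' i : inI n i -> nrm (off (e i)) <= nrm xx by case: (on i) => // /negPf->.
have dII i j : inI n i -> inI n j ->
    `|(i == j)%:R - (e i ic * e j ic + e i is_ * e j is_)| <= nrm xx ^+ 2.
  move=> Ii Ij; rewrite -eij dot_off// (sum_cs (fun k => e i k * e j k)) addrAC subrr add0r.
  by apply: dot_off_le => //; [move=> k; exact: off_le|exact: onI'].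
have nn : (n == n.-1) = false by rewrite gtn_eqF// ltn_predL.
have hu := dII n n In In; have hw := dII n.-1 n.-1 In1 In1; have huw := dII n n.-1 In In1.
rewrite eqxx /= in hu; rewrite eqxx /= in hw; rewrite nn sub0r normrN in huw.
have JJc (w : nat -> R) : JJ a w ic = - w is_.
  rewrite /JJ /twe oc (negPf (twz_I Ic)) sI// /ic /is_.
  by case: (a); rewrite ?eqxx ?(eq_sym _ n) ?nn mulN1r.
have JJs (w : nat -> R) : JJ a w is_ = w ic.
  rewrite /JJ /twe os sI// /ic /is_.
  by case: (a); rewrite ?eqxx ?(eq_sym _ n) ?nn mul1r.
have J2 : l2 (JJ a (e n.-1)) := h1_l2 H (JJ_h1 (eh n.-1)).
have nJ : nrm (off (JJ a (e n.-1))) <= nrm xx.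
  have xs : asm (fun k => xx (tws a k) * xx (tws a k)) := asm_tws a x2.
  have -> : nrm xx = nrm (fun k => xx (tws a k)).
    by rewrite /nrm; congr Num.sqrt; rewrite /dot (sm_tws a x2).
  apply: nrm_le; first exact: xs.
  move=> k; rewrite (ger0_norm (x0 _)) /off; case: (boolP (inI n k)) => Ik; first by rewrite normr0.
  have Isk : ~~ inI n (tws a k).
    apply: contra Ik => Is'; rewrite -(twsK a k) sI//; case: ifP => _ //.
  rewrite /JJ normrM; apply: (@le_trans _ _ `|e n.-1 (tws a k)|).
    rewrite ler_piMl//; have := twe_sqr R a k; rewrite -sqr_normr => h.
    by rewrite -(@ler_pXn2r _ 2)// ?nnegrE// expr1n.
  by rewrite /coef_off (negPf Isk) /coef_abs lerDr.
have dJ : `|dot (e n) (JJ a (e n.-1)) - (e n is_ * e n.-1 ic - e n ic * e n.-1 is_)| <= nrm xx ^+ 2.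
  rewrite dot_off// (sum_cs (fun k => e n k * JJ a (e n.-1) k)) JJc JJs.
  rewrite (_ : _ - _ = dot (off (e n)) (off (JJ a (e n.-1)))); last by ring.
  by apply: dot_off_le => // k; exact: off_le.
have rE : r n ^+ 2 = cosc q (2 * n%:R) ^+ 2 + sinc q (2 * n%:R) ^+ 2 by rewrite rr_sqr// fourier_sq_al.
have le1 i : inI n i -> `|1 - (e i ic * e i ic + e i is_ * e i is_)| <= nrm xx ^+ 2 ->
    1 - nrm xx ^+ 2 <= e i ic ^+ 2 + e i is_ ^+ 2 <= 1.
  move=> Ii; rewrite ler_norml => /andP[_ h]; rewrite -!expr2 in h; apply/andP; split; first lra.
  have := dot_off (e2 i) (e2 i); rewrite eij eqxx /= (sum_cs (fun k => e i k * e i k)) -!expr2.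
  have : 0 <= dot (off (e i)) (off (e i)).
    by apply: dot_ge0; apply: l2_le (e2 i) _ => k; rewrite /off; case: (inI n k); rewrite ?normr0.
  lra.
have := @gap_algebra R (e n ic) (e n is_) (e n.-1 ic) (e n.-1 is_) (cosc q (2 * n%:R)) (sinc q (2 * n%:R))
  (E n - E n.-1) (r n) (nrm xx ^+ 2) (dot (e n) (JJ a (e n.-1))) (8 * PP + 2 * SS) (8 * PP + 2 * SS).
rewrite subr_ge0 => /(_ (Em _ _ (leq_pred n)) (r0 n) rE (sqr_ge0 _) X6 (le1 _ In hu) (le1 _ In1 hw) huw dJ b1 b2).
by move=> h; apply: le_trans h _; lra.
Qed.

End GapEstimate.

Lemma dbl_le_mid (i j m c : nat) : (m.*2 + c <= i + j + c + (ddn i m + ddn j m))%N.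
Proof. by rewrite /ddn; lia. Qed.

Lemma dbl_le_add (i m c : nat) : (m.*2 + c <= (i + m + c) + (i + m + c))%N.
Proof. by lia. Qed.

Section WeightedGap.
Variable R : realType.
Variable q : R -> R.
Hypothesis hq : sq q.
Variables (a : bool) (n : nat).
Hypothesis (an : odd n = a) (n0 : (0 < n)%N).
Notation D := (@twD R a).
Notation b := (twb q a).
Notation g := (twg a).
Notation G := (twg a n).
Notation r := (rr q).
Variables (E : nat -> R) (e : nat -> nat -> R).
Hypothesis S : spec D b E e.
Hypothesis loc : forall j, inI n j -> `|E j - (pi * n%:R) ^+ 2| <= n%:R / 2.
Notation dk k := (ddn (g k) G).
Notation mk k := (g k + G + a)%N.
Notation xx := (coef_off n e).
Notation Id := (inv_dist R a n).
Notation rho := (nrm (rr q)).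
Let x2 : l2 xx := xx_l2 hq n S.
Let x0 k : 0 <= xx k := xx_ge0 n e k.
Let r2 : l2 r := rr_l2 hq.
Let r0 m : 0 <= r m := rr_ge0 q m.
Let np : 0 < n%:R :> R. Proof. by rewrite ltr0n. Qed.
Let rho0 : 0 <= rho. Proof. exact: nrm_ge0. Qed.
Let Id0 k : 0 <= Id k := Id_ge0 R a n k.

Lemma double_sum (v z : nat -> R) L : l2 v -> l2 z -> (forall m, 0 <= v m) -> (forall l, 0 <= z l) ->
  asm xx -> \sum_(k < L) \sum_(l < L) v (g k + g l + a)%N * z k * xx l <= sm xx * (2 * nrm v * nrm z).
Proof.
move=> hv hz v0 z0 x1; rewrite exchange_big/=.
apply: (@le_trans _ _ (\sum_(l < L) xx l * (2 * nrm v * nrm z))).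
  apply: ler_sum => l _; rewrite -mulr_suml mulrC ler_wpM2l//.
  have [w2 wn] := vad_l2 a l hv.
  have vz0 k : 0 <= vad a l v k * z k by rewrite mulr_ge0 ?v0.
  apply: le_trans (psum_le_sm L (l2_dot w2 hz) vz0) _.
  have [|A B] := @sm_dot_le R (vad a l v) z (fun k => vad a l v k * z k) w2 hz.
    by move=> k; rewrite vz0 lexx.
  by apply: le_trans B _; rewrite ler_wpM2r ?nrm_ge0.
rewrite -mulr_suml ler_wpM2r ?mulr_ge0 ?nrm_ge0//; exact: (psum_le_sm L x1 x0).
Qed.

Variables (W rt : nat -> R) (c M : R).
Hypothesis W0 : forall j, 0 <= W j.
Hypothesis Wn : 0 < W n.
Hypothesis WM : forall j, W j <= M.
Hypothesis Wc : forall i j k, (i <= j + k)%N -> W i <= c * (W j + W k).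
Hypothesis c0 : 0 <= c.
Hypothesis rt2 : l2 rt.
Hypothesis Wr : forall j, W j * r j <= rt j.
Notation tau := (nrm rt).
Notation yy := (coef_wt a n e W).
Let rt0 j : 0 <= rt j. Proof. by apply: le_trans (Wr j); rewrite mulr_ge0. Qed.
Let y2 : l2 yy := yy_l2 hq n S W0 WM.
Let y0 k : 0 <= yy k := yy_ge0 a n e W0 k.

(** The part of the error for which no pointwise rate is available. The rest of [gap_est] decays
    like [1 / n]; [ZZ] is square summable over [n] by the double sums of [ZZ_l2]. *)
Definition ZZ := sm (fun k => rt (mk k) * (RR q a n k * Id k)).

Lemma ZZ_asm : asm (fun k => rt (mk k) * (RR q a n k * Id k)).
Proof.
have [i2 _] := Id_l2 R a n.
have [m2 mn] := vad_l2 a n rt2.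
apply: (l2_dot m2).
have [C hC] : exists C, forall k, RR q a n k <= C.
  by exists (rho + rho) => k; apply: lerD; rewrite -[leLHS]ger0_norm//; exact: nrm_coord.
apply: l2_le (l2Z C i2) _ => k.
have R0 : 0 <= RR q a n k by rewrite addr_ge0.
have C0 : 0 <= C by apply: le_trans (hC k).
by rewrite !normrM ler_wpM2r// !ger0_norm.
Qed.

(** [Cx / n] bounds the l^1 mass of the off-resonant coordinates and [Cy / n] their weighted norm;
    [Cf] collects the errors of second order. *)
Definition Cx := 32 * rho + 1024 * rho ^+ 2.
Definition Cy := 4 * (c * (8 * tau + 8 * W 0%N * rho)).
Definition Cf := 16 * (64 * rho) ^+ 2 * tau + 320 * c * (512 * rho ^+ 2 * tau) +
  20 * (Cx * (128 * c * tau * rho + 4 * c ^+ 2 * rho * Cy)).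

Lemma gap_est : 16 * c * rho <= n%:R -> 192 * rho <= n%:R ->
  n%:R * W n * `|E n - E n.-1 - 2 * r n| <= 320 * c * ZZ + Cf / n%:R.
Proof.
move=> nb1 nb2.
have tau0 : 0 <= tau by exact: nrm_ge0.
have X : nrm xx <= 64 * rho / n%:R.
  have := @weighted R q hq a n an n0 E e S loc (fun=> 1) r 1 1 (fun=> ler01) (fun=> lexx 1).
  rewrite !mulr1 !mul1r => /(_ _ ler01 r2 _ _) h.
  rewrite (_ : xx = coef_wt a n e (fun=> 1)); last by apply/funext => k; rewrite /coef_wt mul1r.
  apply: le_trans (h _ _ _) _.
  - by move=> _ _ _ _; lra.
  - by move=> j; rewrite mul1r.
  - by apply: le_trans nb2; rewrite ler_wpM2r// ler_nat.
  - by rewrite le_eqVlt; apply/orP; left; apply/eqP; congr (_ / _); ring.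
have Y : nrm yy <= Cy / n%:R := weighted hq an n0 S loc W0 WM Wc c0 rt2 Wr nb1.
have [x1 L1'] := xx_l1 hq an n0 S loc.
have ni : 0 < n%:R^-1 :> R by rewrite invr_gt0.
have L1 : sm xx <= Cx / n%:R.
  apply: le_trans L1' _; rewrite (_ : Cx / n%:R = 32 * rho / n%:R + 16 * rho * (64 * rho / n%:R)); last first.
    by rewrite /Cx; ring.
  by rewrite lerD2l ler_wpM2l// mulr_ge0.
have X0 := nrm_ge0 xx; have Y0 := nrm_ge0 yy.
have Lx0 : 0 <= sm xx by exact: sm_ge0.
have Cx0 : 0 <= Cx.
  by rewrite /Cx; apply: addr_ge0; apply: mulr_ge0; rewrite ?ler0n ?sqr_ge0.
have Cy0 : 0 <= Cy.
  rewrite /Cy; apply: mulr_ge0; first exact: ler0n.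
  apply: mulr_ge0 => //; apply: addr_ge0; first by apply: mulr_ge0; rewrite ?ler0n.
  by apply: mulr_ge0 => //; apply: mulr_ge0; rewrite ?ler0n.
pose B := sm xx * (c * (2 * tau * nrm xx) + 2 * c ^+ 2 * (2 * rho * nrm yy)).
(* Since [n] is at most the frequency sum plus the two distances, applying [Wc] twice distributes
   [W n] over the three factors of the summand. *)
have hSS L : \sum_(k < L) \sum_(l < L) r (g k + g l + a)%N * xx k * xx l <= B / W n.
  rewrite ler_pdivlMr// mulr_suml.
  have d1 := double_sum L rt2 x2 rt0 x0 x1; have d2 := double_sum L r2 y2 r0 y0 x1.
  have d3 : \sum_(k < L) \sum_(l < L) r (g k + g l + a)%N * xx k * yy l <= sm xx * (2 * rho * nrm yy).
    rewrite exchange_big/=; apply: le_trans d2; apply: ler_sum => k _; apply: ler_sum => l _.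
    by rewrite (addnC (g l)) mulrAC.
  apply: (@le_trans _ _ (c * \sum_(k < L) \sum_(l < L) rt (g k + g l + a)%N * xx k * xx l +
     c ^+ 2 * (\sum_(k < L) \sum_(l < L) r (g k + g l + a)%N * yy k * xx l +
               \sum_(k < L) \sum_(l < L) r (g k + g l + a)%N * xx k * yy l))); last first.
    have t1 := ler_wpM2l c0 d1; have t2 := ler_wpM2l (sqr_ge0 c) (lerD d2 d3).
    apply: le_trans (lerD t1 t2) _.
    by rewrite /B le_eqVlt; apply/orP; left; apply/eqP; ring.
  rewrite -big_split/= !mulr_sumr -big_split/=; apply: ler_sum => k _.
  rewrite -big_split/= !mulr_sumr mulr_suml -big_split/=; apply: ler_sum => l _.
  have le1 : (n <= (g k + g l + a) + (dk k + dk l))%N.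
    by rewrite -{1}(twg_n hq an n0 S); exact: dbl_le_mid.
  have h1 := Wc le1; have h2 := Wc (leqnn (dk k + dk l)).
  have h3 : W n <= c * W (g k + g l + a)%N + c ^+ 2 * (W (dk k) + W (dk l)).
    apply: le_trans h1 _; rewrite mulrDr lerD2l expr2 -mulrA ler_wpM2l//.
  have rxx : 0 <= r (g k + g l + a)%N * xx k * xx l by rewrite !mulr_ge0.
  apply: le_trans (ler_wpM2l rxx h3) _; rewrite mulrDr; apply: lerD.
    rewrite (_ : _ * (c * _) = c * ((W (g k + g l + a)%N * r (g k + g l + a)%N) * xx k * xx l)); last by ring.
    by rewrite ler_wpM2l// ler_wpM2r// ler_wpM2r.
  by rewrite /coef_wt le_eqVlt; apply/orP; left; apply/eqP; ring.
have X6 : nrm xx ^+ 2 <= 1 / 6.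
  have : nrm xx <= 1 / 3 by apply: le_trans X _; rewrite ler_pdivrMr//; lra.
  by nra.
have := gap_bound hq an n0 S hSS X6; set gm := `| _ | => hg.
(* Here [n] is at most twice the frequency sum, so the whole weight falls on [r], and [xx_bound1]
   supplies the factor [1 / n]. *)
have PPw : W n * PP q a n e <= 4 * c / n%:R * (ZZ + 512 * rho ^+ 2 * tau / n%:R).
  have PPa : asm (fun k => r (mk k) * xx k) by have [v2 _] := vad_l2 a n r2; exact: (l2_dot v2 x2).
  rewrite /PP -[leLHS]smZ//.
  have [i2 iN] := Id_l2 R a n; have [m2 mn] := vad_l2 a n rt2.
  have A1 : asm (fun k => rt (mk k) * Id k) := l2_dot m2 i2.
  have s1 : sm (fun k => rt (mk k) * Id k) <= 8 * tau.
    have [|_ s] := @sm_dot_le R (vad a n rt) Id (fun k => rt (mk k) * Id k) m2 i2.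
      by move=> k; rewrite mulr_ge0 ?rt0 //= lexx.
    apply: le_trans s _; rewrite (_ : 8 * tau = (2 * tau) * 4); last by ring.
    by rewrite ler_pM ?nrm_ge0.
  have A2 := asmZ (4 * c / n%:R) ZZ_asm; have A3 := asmZ (4 * c / n%:R * (rho * nrm xx)) A1.
  apply: (@le_trans _ _ (sm (fun k => 4 * c / n%:R * (rt (mk k) * (RR q a n k * Id k)) +
      4 * c / n%:R * (rho * nrm xx) * (rt (mk k) * Id k)))).
    apply: ler_sm; [exact: asmZ|exact: asmD|move=> k].
    have le2 : (n <= mk k + mk k)%N.
      by rewrite -{1}(twg_n hq an n0 S); exact: dbl_le_add.
    have h := Wc le2; have hx := xx_bound1 hq an n0 S loc k.
    have Wm : W n * r (mk k) <= 2 * c * rt (mk k).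
      apply: le_trans (ler_wpM2r (r0 _) h) _.
      by have := ler_wpM2l c0 (Wr (mk k)); lra.
    rewrite mulrA; apply: le_trans (ler_pM _ (x0 k) Wm hx) _; first by rewrite mulr_ge0.
    by rewrite le_eqVlt; apply/orP; left; apply/eqP; ring.
  rewrite smD// !smZ//; last exact: ZZ_asm.
  rewrite mulrDr lerD2l -mulrA ler_wpM2l//; first by rewrite divr_ge0 ?mulr_ge0// ltW.
  apply: (@le_trans _ _ (rho * (64 * rho / n%:R) * (8 * tau))).
    apply: ler_pM => //; [by rewrite mulr_ge0|by apply: sm_ge0 => // k; rewrite mulr_ge0|].
    by rewrite ler_wpM2l.
  by rewrite le_eqVlt; apply/orP; left; apply/eqP; ring.
have Bw : B <= Cx / n%:R * ((128 * c * tau * rho + 4 * c ^+ 2 * rho * Cy) / n%:R).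
  rewrite /B; apply: ler_pM => //; first by rewrite addr_ge0 ?mulr_ge0 ?exprn_ge0.
  rewrite (_ : _ / n%:R = c * (2 * tau * (64 * rho / n%:R)) + 2 * c ^+ 2 * (2 * rho * (Cy / n%:R))); last by ring.
  apply: lerD; first by rewrite ler_wpM2l// ler_wpM2l// mulr_ge0.
  by rewrite ler_wpM2l ?mulr_ge0 ?exprn_ge0// ler_wpM2l// mulr_ge0.
have X2w : nrm xx ^+ 2 <= (64 * rho / n%:R) ^+ 2 by rewrite ler_pXn2r ?nnegrE// divr_ge0 ?mulr_ge0// ltW.
have rtau : W n * r n <= tau.
  by apply: le_trans (Wr n) _; rewrite -[leLHS]ger0_norm//; exact: nrm_coord.
have nW : 0 <= n%:R * W n by rewrite mulr_ge0// ltW.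
apply: le_trans (ler_wpM2l nW hg) _.
rewrite [leLHS](_ : _ = 16 * (n%:R * nrm xx ^+ 2) * (W n * r n) + 80 * n%:R * (W n * PP q a n e) + 20 * n%:R * B); last first.
  by field; rewrite gt_eqF.
have t1 : 16 * (n%:R * nrm xx ^+ 2) * (W n * r n) <= 16 * (n%:R * (64 * rho / n%:R) ^+ 2) * tau.
  apply: ler_pM => //.
  - by rewrite !mulr_ge0 ?exprn_ge0// ltW.
  - by rewrite mulr_ge0// ltW.
  - by rewrite ler_wpM2l// ler_wpM2l// ltW.
have n80 : 0 <= 80 * n%:R :> R by rewrite mulr_ge0// ltW.
have n20 : 0 <= 20 * n%:R :> R by rewrite mulr_ge0// ltW.
have t2 := ler_wpM2l n80 PPw; have t3 := ler_wpM2l n20 Bw.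
apply: le_trans (lerD (lerD t1 t2) t3) _.
rewrite le_eqVlt; apply/orP; left; apply/eqP; rewrite /Cf; field; rewrite gt_eqF//.
Qed.

End WeightedGap.

Lemma twg_nE n : ((twg (odd n) n).*2 + odd n)%N = n.
Proof. by rewrite /twg; case: (boolP (odd n)) => o; lia. Qed.

(** * Square summability of the errors over all gaps *)

Section DoubleSums.
Variable R : realType.

Lemma sum_fiber_val (I J : finType) (T : eqType) (v : I -> T) (f : J -> R) (h : I -> J) (c : nat) :
  injective v -> (forall j, 0 <= f j) ->
  (forall j, exists s : seq T, (size s <= c)%N /\ forall i, h i = j -> v i \in s) ->
  \sum_i f (h i) <= c%:R * \sum_j f j.
Proof.
move=> vi f0 hs; apply: sum_fiber => // j; have [s [sc hj]] := hs j.
exists [seq i <- enum I | v i \in s]; split; last first.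
  by move=> i hi; rewrite mem_filter mem_enum andbT hj.
apply: leq_trans sc; rewrite -(size_map v); apply: uniq_leq_size.
  by rewrite map_inj_uniq// filter_uniq// enum_uniq.
by move=> x /mapP[i]; rewrite mem_filter => /andP[h1 _] ->.
Qed.

Lemma cs_fin K (s f g : nat -> R) : (forall k, 0 <= f k) -> (forall k, 0 <= g k) ->
  (forall k, s k ^+ 2 <= f k * g k) ->
  (\sum_(k < K) s k) ^+ 2 <= (\sum_(k < K) f k) * (\sum_(k < K) g k).
Proof.
move=> f0 g0 h; apply: discr_le; last by apply: sumr_ge0.
move=> t; rewrite !mulr_sumr -sumrN -!big_split/=; apply: sumr_ge0 => k _.
have := f0 k; rewrite le_eqVlt => /predU1P[z|fp].
  have s0 : s k = 0.
    by apply/eqP; rewrite -sqrf_eq0 eq_le sqr_ge0 andbT; have := h k; rewrite -z mul0r.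
  by rewrite -z s0 mulr0 oppr0 !add0r mulr_ge0 ?sqr_ge0.
rewrite -(pmulr_rge0 _ fp).
have -> : f k * (f k - 2 * t * s k + t ^+ 2 * g k) = (f k - t * s k) ^+ 2 + t ^+ 2 * (f k * g k - s k ^+ 2) by ring.
by rewrite addr_ge0 ?sqr_ge0// mulr_ge0 ?sqr_ge0// subr_ge0.
Qed.

(** Cauchy-Schwarz in [k] for each [n]: the row sums of [f] are bounded uniformly, and what is left
    is the double sum of [g]. *)
Lemma l2_double (s f g : nat -> nat -> R) (M C : R) : (forall n k, 0 <= s n k) ->
  (forall n k, 0 <= f n k) -> (forall n k, 0 <= g n k) ->
  (forall n k, s n k ^+ 2 <= f n k * g n k) -> (forall n K, \sum_(k < K) f n k <= M) ->
  (forall N K, \sum_(n < N) \sum_(k < K) g n k <= C) -> (forall n, asm (s n)) ->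
  l2 (fun n => sm (s n)).
Proof.
move=> s0 f0 g0 h hf hg sa.
apply: (@asm_bound _ _ (M * C)); first by move=> n; rewrite -expr2 sqr_ge0.
move=> N.
have c : (fun K => \sum_(n < N) (\sum_(k < K) s n k) * (\sum_(k < K) s n k)) @ \oo -->
    \sum_(n < N) sm (s n) * sm (s n).
  apply: (@cvg_sum_ord R \oo _ N (fun K n => (\sum_(k < K) s n k) * (\sum_(k < K) s n k))
     (fun n => sm (s n) * sm (s n))) => n.
  by apply: cvgM; exact: sm_cvg.
rewrite -(cvg_lim _ c)//; apply: limr_le; first by apply/cvg_ex; eexists; exact: c.
apply: nearW => K.
have M0 : 0 <= M by apply: le_trans (hf 0%N 0%N); rewrite big_ord0.
apply: (@le_trans _ _ (M * \sum_(n < N) \sum_(k < K) g n k)); last by rewrite ler_wpM2l.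
rewrite mulr_sumr; apply: ler_sum => n _; rewrite -expr2.
apply: le_trans (cs_fin K (f0 n) (g0 n) (h n)) _; rewrite ler_wpM2r//; exact: sumr_ge0.
Qed.

(** Frequency sum and distance determine [(n, k)] up to 8 choices: the parity of [n], the sign of
    the difference, and the two basis indices that share the frequency of [k]. *)
Lemma pair_fiber (F1 F2 : nat -> R) (A B : R) N K : (forall j, 0 <= F1 j) -> (forall j, 0 <= F2 j) ->
  (forall n, \sum_(j < n) F1 j <= A) -> (forall n, \sum_(j < n) F2 j <= B) ->
  \sum_(n < N) \sum_(k < K) F1 (twg (odd n) k + twg (odd n) n + odd n)%N * F2 (ddn (twg (odd n) k) (twg (odd n) n)) <=
  8 * (A * B).
Proof.
move=> F10 F20 hA hB.
have A0 : 0 <= A by apply: le_trans (hA 0%N); rewrite big_ord0.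
pose L := (N + K).+2.
have tg (a : bool) k : (twg a k <= k)%N by rewrite /twg; case: a; lia.
have b1 (n : 'I_N) (k : 'I_K) : (twg (odd n) k + twg (odd n) n + odd n < L)%N.
  have := tg (odd n) k; have := tg (odd n) n; have := ltn_ord n; have := ltn_ord k.
  by rewrite /L; move: (twg _ k) (twg _ n) => x y; case: (odd n) => /=; lia.
have b2 (n : 'I_N) (k : 'I_K) : (ddn (twg (odd n) k) (twg (odd n) n) < L)%N.
  have := tg (odd n) k; have := tg (odd n) n; have := ltn_ord n; have := ltn_ord k.
  by rewrite /L /ddn; move: (twg _ k) (twg _ n) => x y; lia.
pose h (p : 'I_N * 'I_K) : 'I_L * 'I_L := (Ordinal (b1 p.1 p.2), Ordinal (b2 p.1 p.2)).
rewrite pair_bigA/=.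
apply: (@le_trans _ _ (8 * \sum_(p : 'I_L * 'I_L) F1 p.1 * F2 p.2)); last first.
  rewrite ler_wpM2l// -(pair_bigA _ (fun (i j : 'I_L) => F1 i * F2 j))/=.
  rewrite (_ : \sum_(i < L) _ = (\sum_(i < L) F1 i) * (\sum_(j < L) F2 j)); last first.
    by rewrite mulr_suml; apply: eq_bigr => i _; rewrite mulr_sumr.
  by apply: ler_pM; rewrite ?sumr_ge0.
apply: (@sum_fiber_val _ _ _ (fun p : 'I_N * 'I_K => (val p.1, val p.2)) (fun p : 'I_L * 'I_L => F1 p.1 * F2 p.2) h 8).
- by move=> [n k] [n' k'] [/val_inj -> /val_inj ->].
- by move=> p; rewrite mulr_ge0.
move=> [m j].
pose cand (a : bool) (x : nat) : seq (nat * nat) :=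
  [seq ((x.*2 + a)%N, k) | k <- sval (cid (twg_few a (m - x - a)))].
have szc a x : (size (cand a x) <= 2)%N by rewrite size_map; case: cid => t [].
exists (cand false ((m + j)./2) ++ cand false ((m - j)./2) ++
          cand true ((m.-1 + j)./2) ++ cand true ((m.-1 - j)./2)); split.
  rewrite !size_cat; apply: (@leq_trans (2 + (2 + (2 + 2)))) => //.
  by rewrite !leq_add.
move=> [n k] [] /(congr1 val)/= em /(congr1 val)/= ej.
have inc x : twg (odd n) n = x -> (val n, val k) \in cand (odd n) x.
  move=> ex; have -> : (val n, val k) = ((x.*2 + odd n)%N, val k) by rewrite -ex twg_nE.
  apply: map_f.
  by case: cid => t [_ ht] /=; apply: ht; rewrite -em ex; lia.
rewrite !mem_cat.
case o : (odd n); rewrite o in em ej inc.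
  case: (leqP (twg true n) (twg true k)) => le.
    by rewrite (inc (m.-1 - j)./2) ?orbT//; move: em ej le; rewrite /ddn /=; lia.
  by rewrite (inc (m.-1 + j)./2) ?orbT//; move: em ej le; rewrite /ddn /=; lia.
case: (leqP (twg false n) (twg false k)) => le.
  by rewrite (inc (m - j)./2) ?orbT//; move: em ej le; rewrite /ddn /=; lia.
by rewrite (inc (m + j)./2) ?orbT//; move: em ej le; rewrite /ddn /=; lia.
Qed.

End DoubleSums.

Section GapsInWeightedSpace.
Variable R : realType.
Variable q : R -> R.
Hypothesis hq : sq q.
Notation r := (rr q).

Lemma l2_eventually (f h : nat -> R) n0 : l2 h -> (forall n, (n0 <= n)%N -> `|f n| <= `|h n|) -> l2 f.
Proof.
move=> hh le; pose f1 n := if (n < n0)%N then f n else 0; pose f2 n := if (n < n0)%N then 0 else f n.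
have l1 : l2 f1 by apply: (@l2_fin _ _ n0) => k nk; rewrite /f1 ltnNge nk.
have l3 : l2 f2.
  apply: l2_le hh _ => n; rewrite /f2; case: ltnP => nn; [by rewrite normr0|exact: le].
by apply: eq_asm (l2D l1 l3) => n; rewrite /f1 /f2; case: ltnP => _; rewrite ?addr0 ?add0r.
Qed.

(** The two terms of [RR] are treated separately. In each, one factor is summable in [k] uniformly
    in [n], and the other is a function of the frequency sum times a function of the distance, the
    form that [pair_fiber] handles. *)
Lemma ZZ_l2 (rt : nat -> R) : l2 rt -> (forall m, 0 <= rt m) -> l2 (fun n => ZZ q (odd n) n rt).
Proof.
move=> rt2 rt0; have r2 := rr_l2 hq; have r0 := rr_ge0 q.
pose mk n k := (twg (odd n) k + twg (odd n) n + odd n)%N.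
pose dk n k := ddn (twg (odd n) k) (twg (odd n) n).
pose I n k := inv_dist R (odd n) n k.
have I0 n k : 0 <= I n k by exact: Id_ge0.
have Ile n k : I n k <= inv R (dk n k) by rewrite /I /inv_dist; case: (inI n k) => //; rewrite invr_ge0.
have Il2 n : l2 (I n) by case: (Id_l2 R (odd n) n).
have IN n : nrm (I n) <= 4 by case: (Id_l2 R (odd n) n).
have [i2 iN] := inv_l2 R.
have mv (v : nat -> R) n : l2 v -> l2 (fun k => v (mk n k)) /\ nrm (fun k => v (mk n k)) <= 2 * nrm v by move=> hv; exact: vad_l2.
have dv (v : nat -> R) n : l2 v -> l2 (fun k => v (dk n k)) /\ nrm (fun k => v (dk n k)) <= 2 * nrm v by move=> hv; exact: vdd_l2.
have rle m : r m <= nrm r by rewrite -[leLHS]ger0_norm//; exact: nrm_coord.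
have asl (v w : nat -> nat -> R) n : l2 (v n) -> l2 (w n) -> (forall k, w n k <= nrm r) -> (forall k, 0 <= w n k) ->
    asm (fun k => v n k * (w n k * I n k)).
  move=> hv hw wr w0; apply: (l2_dot hv); apply: l2_le (l2Z (nrm r) (Il2 n)) _ => k.
  by rewrite !normrM ler_wpM2r// !ger0_norm ?nrm_ge0.
have a1 n : asm (fun k => rt (mk n k) * (r (dk n k) * I n k)).
  apply: (asl (fun n k => rt (mk n k)) (fun n k => r (dk n k))) => //; [by case: (mv rt n rt2)|by case: (dv r n r2)].
have a2 n : asm (fun k => rt (mk n k) * (r (mk n k) * I n k)).
  apply: (asl (fun n k => rt (mk n k)) (fun n k => r (mk n k))) => //; [by case: (mv rt n rt2)|by case: (mv r n r2)].
have pos (f h : nat -> R) k : (forall k, 0 <= f k) -> (forall k, 0 <= h k) -> 0 <= f k * h k.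
  by move=> *; rewrite mulr_ge0.
have rt2' n : \sum_(j < n) rt j * rt j <= dot rt rt by apply: psum_le_sm => // k; rewrite mulr_ge0.
have ri2 n : \sum_(j < n) r j * inv R j <= sm (fun j => r j * inv R j).
  by apply: psum_le_sm; [exact: l2_dot|move=> k; rewrite mulr_ge0// invr_ge0].
have rr2 n : \sum_(j < n) rt j * r j <= sm (fun j => rt j * r j).
  by apply: psum_le_sm; [exact: l2_dot|move=> k; rewrite mulr_ge0].
have ii2 n : \sum_(j < n) inv R j * inv R j <= dot (inv R) (inv R).
  by apply: psum_le_sm => // k; rewrite mulr_ge0// invr_ge0.
have iv0 j : 0 <= inv R j by rewrite invr_ge0.
have L1 : l2 (fun n => sm (fun k => rt (mk n k) * (r (dk n k) * I n k))).
  apply: (@l2_double _ _ (fun n k => r (dk n k) * I n k) (fun n k => rt (mk n k) * rt (mk n k) * (r (dk n k) * inv R (dk n k)))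
     (2 * nrm r * 4) (8 * (dot rt rt * sm (fun j => r j * inv R j)))) => //.
  - by move=> n k; rewrite !mulr_ge0.
  - by move=> n k; rewrite !mulr_ge0.
  - by move=> n k; rewrite !mulr_ge0.
  - move=> n k; rewrite (_ : _ ^+ 2 = r (dk n k) * I n k * (rt (mk n k) * rt (mk n k) * (r (dk n k) * I n k))); last by ring.
    by rewrite ler_wpM2l ?mulr_ge0// ler_wpM2l ?mulr_ge0// ler_wpM2l.
  - move=> n K; have [d2 dn] := dv r n r2.
    have f0 k : 0 <= r (dk n k) * I n k by rewrite mulr_ge0.
    apply: le_trans (psum_le_sm K (l2_dot d2 (Il2 n)) f0) _.
    have [|_ s] := @sm_dot_le R _ _ (fun k => r (dk n k) * I n k) d2 (Il2 n); first by move=> k; rewrite f0 lexx.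
    by apply: le_trans s _; apply: ler_pM; rewrite ?nrm_ge0.
  - move=> N K; apply: (@pair_fiber R (fun m => rt m * rt m) (fun j => r j * inv R j)) => //.
      by move=> j; rewrite mulr_ge0.
    by move=> j; rewrite mulr_ge0.
have L2 : l2 (fun n => sm (fun k => rt (mk n k) * (r (mk n k) * I n k))).
  apply: (@l2_double _ _ (fun n k => rt (mk n k) * r (mk n k)) (fun n k => rt (mk n k) * r (mk n k) * (inv R (dk n k) * inv R (dk n k)))
     (2 * nrm rt * (2 * nrm r)) (8 * (sm (fun j => rt j * r j) * dot (inv R) (inv R)))) => //.
  - by move=> n k; rewrite !mulr_ge0.
  - by move=> n k; rewrite !mulr_ge0.
  - by move=> n k; rewrite !mulr_ge0.
  - move=> n k; rewrite (_ : _ ^+ 2 = rt (mk n k) * r (mk n k) * (rt (mk n k) * r (mk n k) * (I n k * I n k))); last by ring.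
    by rewrite ler_wpM2l ?mulr_ge0// ler_wpM2l ?mulr_ge0// ler_pM.
  - move=> n K; have [d2 dn] := mv rt n rt2; have [d3 dn'] := mv r n r2.
    have f0 k : 0 <= rt (mk n k) * r (mk n k) by rewrite mulr_ge0.
    apply: le_trans (psum_le_sm K (l2_dot d2 d3) f0) _.
    have [|_ s] := @sm_dot_le R _ _ (fun k => rt (mk n k) * r (mk n k)) d2 d3; first by move=> k; rewrite f0 lexx.
    by apply: le_trans s _; apply: ler_pM; rewrite ?nrm_ge0.
  - move=> N K; apply: (@pair_fiber R (fun m => rt m * r m) (fun j => inv R j * inv R j)) => //.
      by move=> j; rewrite mulr_ge0.
    by move=> j; rewrite mulr_ge0.
apply: eq_asm (l2D L1 L2) => n; rewrite -!smD//.
by congr (_ * _); apply: eq_sm => k; rewrite /RR -/(mk n k) -/(dk n k) -/(I n k); ring.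
Qed.

Variables (E : bool -> nat -> R) (e : bool -> nat -> nat -> R).
Hypothesis S : forall a, spec (@twD R a) (twb q a) (E a) (e a).

Definition gam n := E (odd n) n - E (odd n) n.-1.

Lemma gap_weighted (t : R) : 0 <= t -> l2 (fun m => m%:R `^ t * r m) ->
  l2 (fun n => n%:R * n%:R `^ t * (gam n - 2 * r n)).
Proof.
move=> t0 rt2; set rt := (fun m => _) in rt2.
have r0 := rr_ge0 q; have rt0 m : 0 <= rt m by rewrite mulr_ge0// powR_ge0.
pose c : R := 2 `^ t; have c0 : 0 <= c by exact: powR_ge0.
(* The weight is cut off at [n]. It is then bounded, so all weighted norms of the eigenvectors are
   finite beforehand, while [W n n] is still the full weight. *)
pose W n j : R := (minn j n)%:R `^ t.
have W0 n j : 0 <= W n j by exact: powR_ge0.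
have mon (i j : nat) : (i <= j)%N -> i%:R `^ t <= j%:R `^ t :> R.
  by move=> ij; apply: ge0_ler_powR => //; rewrite ?nnegrE ?ler_nat.
have WM n j : W n j <= n%:R `^ t by apply: mon; exact: geq_minr.
have Wc n i j k : (i <= j + k)%N -> W n i <= c * (W n j + W n k).
  move=> ijk; pose x := maxn (minn j n) (minn k n).
  apply: (@le_trans _ _ ((2 * x)%:R `^ t)); first by apply: mon; rewrite /x; lia.
  rewrite natrM powRM// ler_wpM2l// /x /W; case: leqP => _; rewrite ?lerDl ?lerDr; exact: powR_ge0.
pose K := matK q; pose rho := nrm r.
(* The final [.+2] keeps [n.-1] positive and large enough, so that [eig_loc] applies to both indices
   of the pair. *)
pose n0 := (Num.bound (16 * c * rho) + Num.bound (192 * rho) + Num.bound (256 * K ^+ 2)).+2.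
have rho0 : 0 <= rho by exact: nrm_ge0.
have bnd (x : R) n m : 0 <= x -> (Num.bound x <= m)%N -> (m <= n)%N -> x <= n%:R.
  move=> x0 h1 h2; apply: (@le_trans _ _ (Num.bound x)%:R); first exact/ltW/archi_boundP.
  by rewrite ler_nat (leq_trans h1).
pose C2 := Cf q (fun=> 0 `^ t) rt c.
have h2 : l2 (fun n => 320 * c * ZZ q (odd n) n rt + C2 * inv R n).
  by apply: l2D; [apply/l2Z/ZZ_l2|apply: l2Z; case: (inv_l2 R)].
apply: (l2_eventually (n0 := n0) h2) => n nn.
have np : (0 < n)%N by apply: leq_trans nn.
have loc : forall j, inI n j -> `|E (odd n) j - (pi * n%:R) ^+ 2| <= n%:R / 2.
  move=> j Ij; rewrite -(twD_I hq (erefl (odd n)) np (S (odd n)) Ij).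
  have jn : (n0.-1 <= j <= n)%N.
    by move: Ij nn; rewrite /inI => /orP[/eqP->|/eqP->]; move: (n0) np => m; lia.
  have sys := tw_system R (odd n).
  have jp : (0 < j)%N by case/andP: jn => h _; apply: leq_trans h.
  have Kj : 256 * K ^+ 2 <= j%:R.
    apply: (@bnd _ _ n0.-1); rewrite ?mulr_ge0 ?sqr_ge0//; last by case/andP: jn.
    by rewrite /n0 /= leqW// leq_addl.
  apply: le_trans (eig_loc (mat_adm sys hq) (S (odd n)) (sys_D sys) (sys_Dup sys) (sys_Dmono sys) jp Kj) _.
  by rewrite ler_wpM2r// ler_nat; case/andP: jn.
have Wn : 0 < W n n by rewrite /W minnn powR_gt0// ltr0n.
have Wr j : W n j * r j <= rt j by rewrite ler_wpM2r//; apply: mon; exact: geq_minl.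
have nb1 : 16 * c * rho <= n%:R.
  apply: (bnd _ _ n0) nn; first by rewrite !mulr_ge0.
  by rewrite /n0 -addnA -addnS -addnS leq_addr.
have nb2 : 192 * rho <= n%:R.
  apply: (bnd _ _ n0) nn; first by rewrite mulr_ge0.
  by rewrite /n0 -addnA addnCA -addnS -addnS leq_addr.
have := gap_est hq (erefl (odd n)) np (S (odd n)) loc (W0 n) Wn (WM n) (Wc n) c0 rt2 Wr nb1 nb2.
rewrite {1}/W minnn -/(gam n) => h.
rewrite normrM (ger0_norm (_ : 0 <= n%:R * n%:R `^ t)) ?mulr_ge0 ?powR_ge0//.
apply: le_trans h _; apply: le_trans (ler_norm _); rewrite lerD2l /C2 /Cf /Cy /W min0n.
exact: lexx.
Qed.

End GapsInWeightedSpace.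

(** * From the l^2 estimates to the weighted spaces *)

Section Assembly.
Variable R : realType.
Notation mu := (@lebesgue_measure R).

Lemma esum_asm (f : nat -> R) : (forall k, 0 <= f k) ->
  (\sum_(0 <= k <oo) (f k)%:E < +oo)%E <-> asm f.
Proof.
move=> f0.
have pe n : (\sum_(0 <= k < n) (f k)%:E)%E = (\sum_(k < n) f k)%:E by rewrite big_mkord sumEFin.
split=> [h|h].
  have fin : (\sum_(0 <= k <oo) (f k)%:E)%E \is a fin_num.
    by rewrite ge0_fin_numE//; apply: nneseries_ge0 => k _ _; rewrite lee_fin.
  apply: (@asm_bound _ _ (fine (\sum_(0 <= k <oo) (f k)%:E)%E)) => // n.
  rewrite -lee_fin fineK// -pe; apply: nneseries_lim_ge => k _ _; by rewrite lee_fin.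
apply: (@le_lt_trans _ _ (sm f)%:E); last exact: ltry.
apply: lime_le; first by apply: is_cvg_nneseries => k _ _; rewrite lee_fin.
by apply: nearW => n; rewrite pe lee_fin; exact: psum_le_sm.
Qed.

Lemma L2T_sq (q : R -> R) : L2T q -> sq q.
Proof.
move=> [mq [_ hi]].
have mq1 : mf01 q by apply: (@measurable_funS _ _ _ _ setT) => //; exact: measurableT.
split=> //; apply/integrableP; split.
  by apply/measurable_EFinP; exact: measurable_funM.
apply: le_lt_trans hi; rewrite le_eqVlt; apply/orP; left; apply/eqP.
by apply: eq_integral => x _ /=; rewrite ger0_norm -?expr2// sqr_ge0.
Qed.

Lemma hwE (w a : nat -> R) : hw w a <-> l2 (fun k => w k * a k).
Proof.
rewrite /hw (eq_eseriesr (g := fun k => ((w k * a k) * (w k * a k))%:E)); last first.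
  by move=> k _; congr (_%:E); ring.
by apply: esum_asm => k; rewrite -expr2 sqr_ge0.
Qed.

Lemma HwE (w : nat -> R) (q : R -> R) : L2T q -> Hw w q <-> l2 (fun k => w k * rr q k.+1).
Proof.
move=> hq; have sqq := L2T_sq hq; rewrite -hwE /Hw /hw.
under eq_eseriesr do rewrite -(rr_sqr q).
by split=> [[]|].
Qed.

Lemma gap_gam (q : R -> R) : L2T q -> exists (E : bool -> nat -> R) (e : bool -> nat -> nat -> R),
  (forall a, spec (@twD R a) (twb q a) (E a) (e a)) /\ forall k, gap q k = gam E k.+1.
Proof.
move=> hq; have sqq := L2T_sq hq.
have hS a := spec_exists (mat_adm (tw_system R a) sqq).
pose E a := sval (cid (hS a)); pose e a := sval (cid (svalP (cid (hS a)))).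
have S a : spec (@twD R a) (twb q a) (E a) (e a) := svalP (cid (svalP (cid (hS a)))).
exists E, e; split=> // k; rewrite /gap /gam.
have xe a := xget_eigen_enum (tw_system R a) sqq (S a).
by rewrite /anti_eig /per_eig; case: (odd k.+1); rewrite ?(xe true) ?(xe false).
Qed.

Lemma l2_shift (f : nat -> R) : l2 (fun k => f k.+1) <-> l2 f.
Proof.
split=> h; last by have := @asm_tail _ _ 1 h; apply: eq_asm => k; rewrite add1n.
apply: (@asm_bound _ _ (f 0%N * f 0%N + sm (fun k => f k.+1 * f k.+1))).
  by move=> k; rewrite -expr2 sqr_ge0.
move=> [|n]; first by rewrite big_ord0 addr_ge0 -?expr2 ?sqr_ge0//; apply: sm_ge0 => // k; rewrite -expr2 sqr_ge0.
by rewrite big_ord_recl lerD2l; apply: psum_le_sm => // k; rewrite -expr2 sqr_ge0.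
Qed.

Section Weights.
Variables (s : R) (w : nat -> R) (c1 c2 : R).
Hypothesis s0 : 0 <= s.
Hypothesis w0 : forall k, 0 < w k.
Hypothesis c10 : 0 < c1.
Hypothesis c20 : 0 < c2.
Hypothesis wb : forall k : nat, c1 * (k.+1%:R `^ s) <= w k /\ w k <= c2 * (k.+1%:R `^ (1 + s)).
Variable q : R -> R.
Hypothesis hq : L2T q.
Let sqq := L2T_sq hq.
Variables (E : bool -> nat -> R) (e : bool -> nat -> nat -> R).
Hypothesis S : forall a, spec (@twD R a) (twb q a) (E a) (e a).
Notation r := (rr q).
Notation g := (gam E).

Let low (x : nat -> R) : l2 (fun k => w k * x k.+1) -> l2 (fun n => n%:R `^ s * x n).
Proof.
move=> h; apply/l2_shift; apply: l2_le (l2Z c1^-1 h) _ => k; have [lo _] := wb k.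
rewrite mulrA normrM [leRHS]normrM ler_wpM2r//.
rewrite !ger0_norm ?powR_ge0// ?mulr_ge0 ?invr_ge0 ?(ltW (w0 k)) ?(ltW c10)//.
by rewrite mulrC ler_pdivlMr// mulrC.
Qed.

Let up (x : nat -> R) : l2 (fun n => n%:R * n%:R `^ s * x n) -> l2 (fun k => w k * x k.+1).
Proof.
move=> h'; have h := l2Z c2 ((l2_shift _).2 h'); apply: l2_le h _ => k; have [_ hi] := wb k.
rewrite mulrA normrM [leRHS]normrM ler_wpM2r//.
rewrite !ger0_norm ?(ltW (w0 k))// ?mulr_ge0 ?powR_ge0 ?(ltW c20)//.
apply: le_trans hi _; rewrite ler_wpM2l ?(ltW c20)//.
by rewrite powRD ?powRr1//; apply/implyP => _; rewrite pnatr_eq0.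
Qed.

Lemma gap_of_fourier : l2 (fun k => w k * r k.+1) -> l2 (fun k => w k * g k.+1).
Proof.
move=> h; have h1 := up (x := fun n => g n - 2 * r n) (gap_weighted sqq S s0 (low h)).
by apply: eq_asm (l2D h1 (l2Z 2 h)) => k; congr (_ * _); ring.
Qed.

Lemma fourier_of_gap : l2 (fun k => w k * g k.+1) -> l2 (fun k => w k * r k.+1).
Proof.
move=> h; have hs := low h.
have step (t t' : R) : 0 <= t -> t' <= s -> t' <= 1 + t -> l2 (fun n => n%:R `^ t * r n) -> l2 (fun n => n%:R `^ t' * r n).
  move=> t0 t's t't hr; have h1 := gap_weighted sqq S t0 hr.
  have A : l2 (fun n => n%:R `^ t' * (g n - 2 * r n)).
    apply: (l2_eventually (n0 := 1) h1) => n n1; rewrite normrM [leRHS]normrM ler_wpM2r//.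
    rewrite !ger0_norm ?mulr_ge0 ?powR_ge0//.
    rewrite -{2}(powRr1 (ler0n R n)) -powRD; last by apply/implyP => _; rewrite pnatr_eq0 -lt0n.
    by apply: ler_powR => //; rewrite ler1n.
  have B : l2 (fun n => n%:R `^ t' * g n).
    apply: (l2_eventually (n0 := 1) hs) => n n1; rewrite normrM [leRHS]normrM ler_wpM2r//.
    by rewrite !ger0_norm ?powR_ge0//; apply: ler_powR => //; rewrite ler1n.
  by apply: eq_asm (l2Z 2^-1 (l2B B A)) => n; congr (_ * _); field.
(* Each turn gains one power, capped at [s], because only [n ^ s] times the gap lengths is known to
   be square summable. *)
have all (j : nat) : l2 (fun n => n%:R `^ (Num.min s j%:R) * r n).
  elim: j => [|j ih].
    have -> : Num.min s 0%:R = 0 by apply/min_idPr.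
    by apply: eq_asm (rr_l2 sqq) => n; rewrite powRr0 mul1r.
  apply: (step (Num.min s j%:R)) ih; first by rewrite le_min s0 ler0n.
    by rewrite ge_min lexx.
  have [sj|js] := leP s j%:R; rewrite ge_min -natr1; apply/orP; [left|right]; lra.
have rs : l2 (fun n => n%:R `^ s * r n).
  have := all (Num.bound s); rewrite (_ : Num.min _ _ = s)//.
  by apply/min_idPl; exact/ltW/archi_boundP.
(* From exponent [s] the difference gains the weight [n ^ (1 + s)], which dominates [w]. *)
have h1 := up (x := fun n => g n - 2 * r n) (gap_weighted sqq S s0 rs).
by apply: eq_asm (l2Z 2^-1 (l2B h h1)) => k; congr (_ * _); field.
Qed.

End Weights.

Lemma theorem_from_surjectivity (s : R) (w : nat -> R) :
  (forall a : nat -> R, (forall k, 0 <= a k) -> l2 a -> exists q : R -> R, L2T q /\ gap q = a) ->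
  0 <= s ->
  (forall k, 0 < w k) ->
  (exists c1 c2 : R, 0 < c1 /\ 0 < c2 /\
     forall k : nat, c1 * (k.+1%:R `^ s) <= w k /\ w k <= c2 * (k.+1%:R `^ (1 + s))) ->
  (@gap R) @` (Hw w) = hw_plus w /\
  (L2T (R:=R)) `&` (@gap R) @^-1` (hw_plus w) = Hw w.
Proof.
move=> surj s0 w0 [c1 [c2 [c10 [c20 wb]]]].
have fwd (q : R -> R) : Hw w q -> hw_plus w (gap q).
  move=> hw'; have hq : L2T q by case: hw'.
  have [E [e [S gE]]] := gap_gam hq.
  split; last first.
    by move=> k; rewrite gE /gam subr_ge0; case: (S (odd k.+1)) => _ _ _ Em _; exact: Em.
  apply/hwE; move/(HwE w hq) : hw' => /(gap_of_fourier s0 w0 c10 c20 wb hq S).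
  by apply: eq_asm => k; rewrite gE.
have bwd (q : R -> R) : L2T q -> hw_plus w (gap q) -> Hw w q.
  move=> hq [/hwE h _]; have [E [e [S gE]]] := gap_gam hq.
  apply/(HwE w hq); apply: (fourier_of_gap s0 w0 c10 c20 wb hq S).
  by apply: eq_asm h => k; rewrite gE.
split.
  apply/seteqP; split=> [_ [q hq <-]|a [/hwE ha a0]]; first exact: fwd.
  (* [w] is bounded below by [c1] because [k.+1 ^ s] is at least 1, so a sequence in the weighted
     space is in l^2. *)
  have [|q [hq gq]] := surj a a0.
    apply: l2_le (l2Z c1^-1 ha) _ => k; rewrite mulrA normrM ler_peMl//.
    rewrite ger0_norm; last by rewrite mulr_ge0 ?invr_ge0 ?(ltW (w0 k)) ?(ltW c10).
    rewrite mulrC ler_pdivlMr// mul1r; have [lo _] := wb k; apply: le_trans lo.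
    rewrite ler_peMr ?(ltW c10)//; apply: (@le_trans _ _ (1 `^ s)); first by rewrite powR1.
    by apply: ge0_ler_powR => //; rewrite ?nnegrE// ler1n.
  exists q => //; apply: bwd => //; rewrite gq; split=> //; exact/hwE.
apply/seteqP; split=> [q [hq]|q hw']; first exact: bwd.
by split; [case: hw'|exact: fwd].
Qed.

End Assembly.

(** * The Poincare-Miranda theorem *)

Section Kuhn.
Variables (n k : nat).
Notation pt := {ffun 'I_n -> 'I_k.+1}.
Implicit Types (x y p : pt) (A : {set 'I_n}).

(** Steps wrap around: a sum over the whole torus is invariant under [inc i], which gives Stokes
    without boundary terms. Cubes that would wrap are kept out by [dm]. *)
Definition inc (i : 'I_n) p : pt := [ffun j => if j == i then ordS (p j) else p j].

Lemma incC i j p : inc i (inc j p) = inc j (inc i p).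
Proof. by apply/ffunP => a; rewrite !ffunE; case: (a == i); case: (a == j). Qed.

Lemma inc_inj i : injective (inc i).
Proof.
move=> x y /ffunP h; apply/ffunP => j; have := h j; rewrite !ffunE.
by case: (j == i) => // /ordS_inj.
Qed.

Variable l : nat -> pt -> 'F_2.

(* The cup product of the coboundaries of [l m, ..., l (m + d - 1)], evaluated
   on the cube with corner [p] and directions [A]. *)
Fixpoint cup (d : nat) A (m : nat) p : 'F_2 :=
  if d is d'.+1 then
    \sum_(i in A) (l m p + l m (inc i p)) * cup d' (A :\ i) m.+1 (inc i p)
  else 1.

Lemma F2_double (a : 'F_2) : a + a = 0.
Proof. by case: a => [[|[|//]] ?]; apply/val_inj. Qed.

Lemma F2_eq (a b : 'F_2) : a + b = 0 -> a = b.
Proof. by move=> h; rewrite -[LHS]addr0 -(F2_double b) addrA h add0r. Qed.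

Lemma F2_leibniz (p q e f : 'F_2) : p * e + q * f = (p + q) * f + p * (e + f).
Proof. by rewrite -[LHS]addr0 -(F2_double (p * f)); ring. Qed.

Lemma F2_sym (A : {set 'I_n}) (f : 'I_n -> 'I_n -> 'F_2) :
  (forall i j, f i j = f j i) -> \sum_(i in A) \sum_(j in A :\ i) f i j = 0.
Proof.
move=> fC.
rewrite (eq_bigr (fun i : 'I_n => \sum_(j in A | (j < i)%N) f i j +
                           \sum_(j in A | (i < j)%N) f i j)); last first.
  move=> i _; rewrite (bigID (fun j : 'I_n => (j < i)%N)) /=; congr (_ + _).
    by apply: eq_bigl => j; rewrite !inE -val_eqE /=; case: ltngtP; rewrite ?andbF ?andbT.
  by apply: eq_bigl => j; rewrite !inE -val_eqE /=; case: ltngtP; rewrite ?andbF ?andbT.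
rewrite big_split /=.
rewrite [X in _ + X](exchange_big_dep (mem A)) /=; last by move=> ? ? _ /andP[].
rewrite -[RHS](F2_double (\sum_(i in A) \sum_(j in A | (j < i)%N) f i j)).
congr (_ + _); apply: eq_bigr => i iA; apply: eq_big => j; last by rewrite fC.
by rewrite iA.
Qed.

(** A cup product of cocycles is a cocycle. The Leibniz rule splits its coboundary into a part
    symmetric in two directions, which vanishes mod 2, and the coboundary of the shorter product,
    which vanishes by induction. *)
Lemma cup_closed d A m p :
  \sum_(i in A) (cup d (A :\ i) m p + cup d (A :\ i) m (inc i p)) = 0.
Proof.
elim: d A m p => [|d IH] A m p.
  by apply: big1 => i _; rewrite F2_double.
pose f i j := (l m p + l m (inc j p) + (l m (inc i p) + l m (inc i (inc j p)))) *
   cup d (A :\ i :\ j) m.+1 (inc i (inc j p)).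
rewrite -[RHS](@F2_sym A f); last first.
  move=> i j; rewrite /f (incC i j) (_ : A :\ i :\ j = A :\ j :\ i).
    by congr (_ * _); rewrite addrACA.
  by apply/setP => a; rewrite !inE; case: (a != i); case: (a != j).
pose g i j := (l m p + l m (inc j p)) * (cup d (A :\ i :\ j) m.+1 (inc j p) +
   cup d (A :\ i :\ j) m.+1 (inc i (inc j p))).
have -> : \sum_(i in A) (cup d.+1 (A :\ i) m p + cup d.+1 (A :\ i) m (inc i p)) =
   \sum_(i in A) \sum_(j in A :\ i) f i j + \sum_(i in A) \sum_(j in A :\ i) g i j.
  rewrite -big_split /=; apply: eq_bigr => i iA; rewrite -!big_split /=.
  apply: eq_bigr => j jA; rewrite /f /g (incC j i).
  exact: F2_leibniz.
rewrite [X in _ + X](_ : _ = 0) ?addr0 //.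
rewrite (exchange_big_dep (mem A)) /=; last by move=> i j _; rewrite !inE => /andP[].
apply: big1 => j jA.
transitivity ((l m p + l m (inc j p)) * 0); last by rewrite mulr0.
rewrite -[in RHS](IH (A :\ j) m.+1 (inc j p)) mulr_sumr.
apply: eq_big => i; first by rewrite !inE jA andbT andbC eq_sym.
move=> _; rewrite /g (_ : A :\ i :\ j = A :\ j :\ i) //.
by apply/setP => a; rewrite !inE; case: (a != i); case: (a != j).
Qed.

(** The first factor is the coboundary of [l m] and the remaining product is closed, so the whole is
    the coboundary of [l m] times the rest. *)
Lemma cup_stokes d A m p : cup d.+1 A m p =
  \sum_(i in A) (l m p * cup d (A :\ i) m.+1 p +
                 l m (inc i p) * cup d (A :\ i) m.+1 (inc i p)).
Proof.
rewrite /=; apply: F2_eq; rewrite -big_split /=.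
transitivity (l m p * 0); last by rewrite mulr0.
rewrite -[in RHS](cup_closed d A m.+1 p) mulr_sumr.
apply: eq_bigr => i _; rewrite !mulrDl mulrDr addrACA F2_double addr0.
by rewrite addrC.
Qed.

(** One factor is the coboundary of [l i], which vanishes on a face where the coordinate [i] is
    fixed at [v] and [l i] is constant. *)
Lemma cup0 (i : 'I_n) (v : 'I_k.+1) (c : 'F_2) d A m p :
  (forall y, y i = v -> l i y = c) -> i \notin A -> p i = v ->
  (m <= i < m + d)%N -> cup d A m p = 0.
Proof.
move=> lv; elim: d A m p => [|d IH] A m p iA pv; first by rewrite addn0 leqNgt; case: ltnP.
rewrite addnS -addSn => /andP[mi id] /=; apply: big1 => j jA.
have ij : i != j by apply: contraNneq iA => ->.
have iv : inc j p i = v by rewrite ffunE (negbTE ij).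
move: mi; rewrite leq_eqVlt => /orP[/eqP mi|mi].
  by rewrite mi !lv // F2_double mul0r.
by rewrite IH ?mulr0 // ?inE ?negb_and ?iA ?orbT // mi id.
Qed.

Hypothesis l0 : forall (i : 'I_n) p, p i = ord0 -> l i p = 0.
Hypothesis l1 : forall (i : 'I_n) p, p i = ord_max -> l i p = 1.

(** The corners of the cubes of one face: the first [m] coordinates are fixed at the maximum and the
    others leave room for a step. *)
Definition dm (m : nat) p := [forall j : 'I_n, (p j == ord_max) == (j < m)%N].

(** On the torus the sum over [x i] not maximal equals the one over [x i] maximal, where the step
    leads to [x i = 0]. For [i > m] both ends vanish by [cup0]; for [i = m] the end at the maximum
    survives, because there [l m] is 1 and at the other end it is 0. *)
Lemma cup_face m : (m < n)%N ->
  \sum_(x | dm m x) cup (n - m) [set j : 'I_n | (m <= j)%N]%SET m x =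
  \sum_(x | dm m.+1 x) cup (n - m.+1) [set j : 'I_n | (m.+1 <= j)%N]%SET m.+1 x.
Proof.
move=> mn; rewrite (_ : n - m = (n - m.+1).+1)%N; last by rewrite -subSn.
set d := (n - m.+1)%N; set A := [set j : 'I_n | (m <= j)%N]%SET.
under eq_bigr => x _ do rewrite cup_stokes.
pose H i x := l m x * cup d (A :\ i) m.+1 x.
have tel i : i \in A -> \sum_(x | dm m x) (H i x + H i (inc i x)) =
    \sum_(x : pt | [forall j : 'I_n, (x j == ord_max) == ((j < m)%N || (j == i))])
      (H i x + H i (inc i x)).
  move=> iA.
  pose P x := [forall j : 'I_n, (j != i) ==> ((x j == ord_max) == (j < m)%N)].
  have PS : \sum_(x | P x) (H i x + H i (inc i x)) = 0.
    rewrite big_split /=; rewrite [X in X + _](reindex_inj (@inc_inj i)) /=.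
    rewrite (eq_bigl P) ?F2_double // => x; apply/forallP/forallP => h j;
      by have := h j; rewrite ffunE; case: (j == i).
  apply: F2_eq; rewrite -[RHS]PS [RHS](bigID (fun x : pt => x i == ord_max)) /= addrC.
  have im : (i < m)%N = false by move: iA; rewrite inE leqNgt => /negbTE.
  congr (_ + _); apply: eq_bigl => x.
    apply/forallP/andP => [h|[/forallP h xi] j].
      split; last by rewrite (eqP (h i)) im.
      by apply/forallP => j; apply/implyP => _; apply: h.
    have [->|/negbTE ji] := eqVneq j i; first by rewrite im (negbTE xi).
    by have := h j; rewrite ji.
  apply/forallP/andP => [h|[/forallP h xi] j].
    split; last by rewrite (eqP (h i)) eqxx orbT.
    by apply/forallP => j; apply/implyP => /negbTE ji; rewrite (eqP (h j)) ji orbF.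
  have [->|/negbTE ji] := eqVneq j i; first by rewrite xi orbT.
  by have := h j; rewrite ji orbF.
rewrite exchange_big /=; under eq_bigr => i iA do rewrite tel //.
pose im := Ordinal mn.
have imA : im \in A by rewrite inE.
rewrite (bigD1 im) //= [X in _ + X]big1 ?addr0; last first.
  move=> i /andP[iA ii]; apply: big1 => x /forallP hx.
  have xi : x i = ord_max by apply/eqP; rewrite (eqP (hx i)) eqxx orbT.
  have lt : (m.+1 <= i < m.+1 + d)%N.
    rewrite /d subnKC // ltn_ord andbT ltn_neqAle; move: iA; rewrite inE => ->.
    by rewrite andbT eq_sym; move: ii; rewrite -val_eqE.
  have ni : i \notin A :\ i by rewrite !inE eqxx.
  rewrite /H (cup0 (v := ord_max) (c := 1) _ ni xi lt) => [|y]; last exact: l1.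
  rewrite (cup0 (v := ord0) (c := 0) _ ni _ lt) ?mulr0 ?addr0 // => [y|]; first exact: l0.
  by rewrite ffunE eqxx xi; apply/val_inj; rewrite /= modnn.
apply: eq_big => x.
  have e (j : 'I_n) : ((j < m)%N || (j == im)) = (j < m.+1)%N.
    by rewrite ltnS [RHS]leq_eqVlt orbC; congr (_ || _).
  by apply/forallP/forallP => h j; have := h j; rewrite e.
move=> /forallP hx; have xi : x im = ord_max by apply/eqP; rewrite (eqP (hx im)) eqxx orbT.
rewrite /H (l1 xi) (@l0 im (inc im x)) ?mul0r ?addr0 ?mul1r; last first.
  by rewrite ffunE eqxx xi; apply/val_inj; rewrite /= modnn.
by congr cup; apply/setP => j; rewrite !inE ltn_neqAle eq_sym -val_eqE.
Qed.

(** [cup_face] lowers the dimension until one corner is left, with all coordinates maximal and an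
    empty product. *)
Lemma cup_total : \sum_(x | dm 0 x) cup n [set: 'I_n]%SET 0 x = 1.
Proof.
have key m : (m <= n)%N ->
  \sum_(x | dm 0 x) cup (n - 0) [set j : 'I_n | (0 <= j)%N]%SET 0 x =
  \sum_(x | dm m x) cup (n - m) [set j : 'I_n | (m <= j)%N]%SET m x.
  elim: m => [//|m IH] mn.
  by rewrite (IH (ltnW mn)) (cup_face mn).
have := key n (leqnn n); rewrite subn0 subnn /=.
rewrite (_ : [set j : 'I_n | (0 <= j)%N]%SET = [set: 'I_n]%SET); last by apply/setP => j; rewrite !inE.
move=> ->; rewrite (big_pred1 [ffun=> ord_max]) // => x.
apply/forallP/eqP => [h|-> j]; last by rewrite ffunE eqxx ltn_ord.
by apply/ffunP => j; rewrite ffunE; apply/eqP; rewrite (eqP (h j)) ltn_ord.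
Qed.

Lemma cup_neq0 d A m p : cup d A m p != 0 -> forall j, (m <= j < m + d)%N ->
  exists y z, [/\ l j y = 0, l j z = 1 &
    forall w, w = y \/ w = z -> forall i, w i = p i \/ (i \in A) && (w i == ordS (p i))].
Proof.
elim: d A m p => [|d IH] A m p; first by move=> _ j; rewrite addn0 leqNgt; case: ltnP.
move=> /= h j; rewrite addnS -addSn => /andP[mj jd].
have [i iA] : exists2 i, i \in A & (l m p + l m (inc i p)) * cup d (A :\ i) m.+1 (inc i p) != 0.
  apply: contraNP h => h; apply/eqP; apply: big1 => i iA; apply/eqP.
  by apply: contra_notT h => h; exists i.
rewrite mulf_eq0 negb_or => /andP[li ci].
have st (w : pt) : w = inc i p -> forall a, w a = p a \/ (a \in A) && (w a == ordS (p a)).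
  move=> -> a; rewrite ffunE; case: eqVneq => [->|_]; last by left.
  by right; rewrite iA /=.
move: mj; rewrite leq_eqVlt => /orP[/eqP <-|mj].
  have : (l m p == 0) && (l m (inc i p) == 1) || (l m p == 1) && (l m (inc i p) == 0).
    by move: li; case: (l m p) => [[|[|//]] ?]; case: (l m (inc i p)) => [[|[|//]] ?].
  case/orP => /andP[/eqP a /eqP b]; [exists p, (inc i p)|exists (inc i p), p]; split => // w.
    by case=> [-> i'|/st//]; left.
  by case=> [/st//|-> i']; left.
have [|y [z [ly lz hyz]]] := IH _ _ _ ci j; first by rewrite mj.
exists y, z; split => // w /hyz hw a; case: (hw a) => [->|]; first exact: st.
rewrite !inE ffunE => /andP[/andP[/negbTE -> aA] /eqP ->].
by right; rewrite aA /=.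
Qed.

(** By [cup_total] some cube has a nonzero product; each of its factors is then nonzero along some
    edge, where the label [l j] changes. *)
Lemma kuhn : exists x, (forall i, x i != ord_max) /\ forall j : 'I_n, exists y z,
  [/\ l j y = 0, l j z = 1 & forall w, w = y \/ w = z -> forall i,
    (x i <= w i <= (x i).+1)%N].
Proof.
have [x dx cx] : exists2 x, dm 0 x & cup n [set: 'I_n]%SET 0 x != 0.
  have := cup_total; apply: contra_eqP => h; rewrite big1 1?eq_sym ?oner_neq0 // => x dx.
  by apply/eqP; apply: contra_notT h => h; exists x.
have xm i : x i != ord_max by rewrite (eqP (forallP dx i)).
exists x; split => // j.
have [|y [z [ly lz h]]] := cup_neq0 cx (j := j); first by rewrite /= add0n ltn_ord.
exists y, z; split => // w /h hw i; case: (hw i) => [->|]; first by rewrite leqnn leqnSn.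
move=> /andP[_ /eqP ->] /=; rewrite modn_small ?leqnn ?leqnSn //.
by rewrite ltnS ltn_neqAle -ltnS ltn_ord andbT; have := xm i; rewrite -val_eqE.
Qed.

End Kuhn.

Section Miranda.
Variables (R : realType) (n : nat) (c : R) (F : ('I_n -> R) -> 'I_n -> R).
Definition cube (x : 'I_n -> R) := forall i, `|x i| <= c.
Hypothesis c0 : 0 < c.
Hypothesis Fc : forall (U : set_system nat) (X : nat -> 'I_n -> R) x, UltraFilter U ->
  (forall k, cube (X k)) -> cube x -> (forall i, (fun k => X k i) @ U --> x i) ->
  forall i, (fun k => F (X k) i) @ U --> F x i.
Hypothesis Fn : forall x i, cube x -> x i = - c -> F x i < 0.
Hypothesis Fp : forall x i, cube x -> x i = c -> 0 <= F x i.

Let gr (k : nat) (p : {ffun 'I_n -> 'I_k.+2}) : 'I_n -> R :=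
  fun i => - c + 2 * c * ((p i)%:R / k.+1%:R).

Let gr_cube k p : cube (@gr k p).
Proof.
move=> i; rewrite /gr; have : 0 <= (p i)%:R / k.+1%:R :> R by rewrite divr_ge0.
have : (p i)%:R / k.+1%:R <= 1 :> R.
  by rewrite ler_pdivrMr ?ltr0n // mul1r ler_nat -ltnS ltn_ord.
move: (_ / _ : R) => t t1 t0; rewrite ler_norml.
have : 0 <= c * t by rewrite mulr_ge0 // ltW.
have : c * t <= c by rewrite -[leRHS]mulr1 ler_wpM2l // ltW.
by move=> ? ?; apply/andP; split; lra.
Qed.

(** The labels are the signs of [F] on a grid of mesh [2 * c / (k + 1)]; the strict inequality in
    [Fn] and the weak one in [Fp] match the two label values. *)
Let step k : exists x : 'I_n -> R, cube x /\ forall i, exists y z,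
  [/\ cube y, cube z, F y i < 0, 0 <= F z i &
    forall w, w = y \/ w = z -> forall j, `|w j - x j| <= 2 * c / k.+1%:R].
Proof.
pose l (j : nat) (p : {ffun 'I_n -> 'I_k.+2}) : 'F_2 :=
  if insub j is Some i then (if F (gr p) i < 0 then 0 else 1) else 0.
have [i p pi|i p pi|x [_ hx]] := @kuhn n k.+1 l.
- have h : gr p i = - c by rewrite /gr pi mul0r mulr0 addr0.
  by rewrite /l valK (Fn (gr_cube p) h).
- have h : gr p i = c by rewrite /gr pi /= divff ?mulr1 ?pnatr_eq0 //; ring.
  by rewrite /l valK ltNge (Fp (gr_cube p) h).
exists (gr x); split; first exact: gr_cube.
move=> i; have [y [z [ly lz h]]] := hx i; exists (gr y), (gr z); split.
- exact: gr_cube.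
- exact: gr_cube.
- by move: ly; rewrite /l valK; case: ifP => // _ /eqP; rewrite oner_eq0.
- by move: lz; rewrite /l valK; case: ltP => // _ /eqP; rewrite eq_sym oner_eq0.
have nr (w : {ffun 'I_n -> 'I_k.+2}) : (forall i, (x i <= w i <= (x i).+1)%N) ->
    forall j, `|gr w j - gr x j| <= 2 * c / k.+1%:R.
  move=> hw j; have /andP[h1 h2] := hw j.
  rewrite /gr; have -> : - c + 2 * c * ((w j)%:R / k.+1%:R) - (- c + 2 * c * ((x j)%:R / k.+1%:R))
    = 2 * c / k.+1%:R * ((w j)%:R - (x j)%:R) by ring.
  have a0 : 0 <= 2 * c / k.+1%:R by rewrite divr_ge0 // mulr_ge0 // ltW.
  rewrite normrM ger0_norm // -[leRHS]mulr1 ler_wpM2l //.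
  rewrite ger0_norm ?subr_ge0 ?ler_nat // lerBlDr -[1]/(1%:R) -natrD ler_nat; lia.
by move=> w [] ->; apply: nr; apply: h; [left|right].
Qed.

(** Cubes of vanishing mesh on which every component of [F] takes both signs accumulate at a point
    along an ultrafilter; continuity along vertices of either sign makes each component vanish
    there. *)
Lemma miranda : exists2 x, cube x & forall i, F x i = 0.
Proof.
have [X hX] := choice step.
have [U [UU Uoo]] := ultra_oo.
have [x hx] : exists x : 'I_n -> R, forall i, (fun k => X k i) @ U --> x i.
  have h i : exists a : R, (fun k => X k i) @ U --> a.
    by apply: (ultra_limit (C := c)) => k; exact: (hX k).1.
  by have [x hx] := choice h; exists x.
have cx : cube x.
  move=> i; have hn : (fun k => `|X k i|) @ U --> `|x i| by apply: cvg_norm.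
  rewrite -(cvg_lim (@Rhausdorff R) hn); apply: limr_le; first by apply: cvgP hn.
  by apply: nearW => k; exact: (hX k).1.
exists x => // i.
have nr (Y : nat -> 'I_n -> R) :
    (forall k j, `|Y k j - X k j| <= 2 * c / k.+1%:R) -> (forall k, cube (Y k)) ->
    (fun k => F (Y k) i) @ U --> F x i.
  move=> YX cY; apply: Fc => // j; rewrite -[X in _ --> X]addr0.
  rewrite (_ : (fun k => Y k j) = (fun k => X k j + (Y k j - X k j))); last first.
    by apply/funext => k; ring.
  apply: cvgD; first exact: hx.
  apply/cvgr0Pnorm_le => e e0; have e1 : 0 < e / (2 * c) by rewrite divr_gt0 // mulr_gt0.
  apply: Uoo; near=> k; have h : k.+1%:R^-1 < e / (2 * c).
    by near: k; exact: near_infty_natSinv_lt (PosNum e1).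
  apply: le_trans (YX k j) _; apply: le_trans (ler_wpM2l _ (ltW h)) _; first by rewrite mulr_ge0 // ltW.
  by rewrite le_eqVlt; apply/orP; left; apply/eqP; field; rewrite gt_eqF.
have [Y hY] := choice (fun k => (hX k).2 i); have [Z hZ] := choice hY.
have cvY : (fun k => F (Y k) i) @ U --> F x i.
  by apply: nr => k; have [? _ _ _ h] := hZ k => // j; apply: h; left.
have cvZ : (fun k => F (Z k) i) @ U --> F x i.
  by apply: nr => k; have [_ ? _ _ h] := hZ k => // j; apply: h; right.
apply/eqP; rewrite eq_le; apply/andP; split.
  rewrite -(cvg_lim (@Rhausdorff R) cvY); apply: limr_le; first exact: cvgP cvY.
  by apply: nearW => k; have [_ _ /ltW] := hZ k.
rewrite -(cvg_lim (@Rhausdorff R) cvZ); apply: limr_ge; first exact: cvgP cvZ.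
by apply: nearW => k; have [] := hZ k.
Unshelve. all: by end_near. Qed.

End Miranda.

(** * Even potentials *)

Section RieszFischer.
Variable R : realType.
Notation mu := (@lebesgue_measure R).
Variable phi : nat -> R -> R.
Hypothesis phiT : forall k, continuous (phi k).
Let phiC k : cts01 (phi k). Proof. exact: cts_cts01. Qed.
Hypothesis phiB : forall k y, `|phi k y| <= 2.
Hypothesis phiO : forall k l, itg (fun y => phi k y * phi l y) = (k == l)%:R.
Variable x : nat -> R.
Hypothesis hx : l2 x.

Let psm m y := \sum_(k < m) x k * phi k y.

Let psmC m : cts01 (psm m).
Proof. exact: (@cts01_sum _ m (fun k => phi k) (fun k => x k)). Qed.

Let itg_block m (c : 'I_m -> R) :
  itg (fun y => (\sum_k c k * phi k y) * (\sum_k c k * phi k y)) = \sum_k c k ^+ 2.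
Proof.
have i2 (i j : 'I_m) : ig (fun y => 1 * phi i y * phi j y).
  by apply: ig_cts; apply: cts01M => //; apply: cts01M => //; exact: cts01C.
rewrite (@eq_itg _ _ (fun y => \sum_i \sum_j c i * c j * (1 * phi i y * phi j y))); last first.
  by move=> y _; rewrite -(@sum2E R m c (fun i => phi i y) 1) mul1r.
rewrite (@ig_sum2 R m c (fun i j y => 1 * phi i y * phi j y) i2).2.
transitivity (\sum_i \sum_j c i * c j * (1 * (i == j)%:R : R)).
  apply: eq_bigr => i _; apply: eq_bigr => j _; congr (_ * _); rewrite mul1r -[RHS]phiO.
  by apply: eq_itg => y _; rewrite mul1r.
by rewrite (@sum2_diag R m c (fun=> 1)); apply: eq_bigr => i _; rewrite mul1r.
Qed.

Let itg_tail m p : (m <= p)%N -> itg (fun y => (psm p y - psm m y) * (psm p y - psm m y)) =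
  \sum_(k < p) x k * x k - \sum_(k < m) x k * x k.
Proof.
move=> mp; have e (F : nat -> R) : \sum_(k < p) F k - \sum_(k < m) F k =
    \sum_(k < p) (if (m <= k)%N then F k else 0).
  rewrite -(subnKC mp) !big_split_ord /= addrAC subrr add0r [X in _ = X + _]big1 ?add0r.
    by apply: eq_bigr => k _; rewrite leq_addr.
  by move=> k _; rewrite leqNgt ltn_ord.
rewrite (@eq_itg _ _ (fun y => (\sum_(k < p) (if (m <= k)%N then x k else 0) * phi k y) *
   (\sum_(k < p) (if (m <= k)%N then x k else 0) * phi k y))); last first.
  have h y : psm p y - psm m y = \sum_(k < p) (if (m <= k)%N then x k else 0) * phi k y.
    rewrite /psm (e (fun k => x k * phi k y)); apply: eq_bigr => k _.
    by case: (m <= k)%N; rewrite ?mul0r.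
  by move=> y _; rewrite h.
rewrite itg_block (e (fun k => x k * x k)); apply: eq_bigr => k _.
by case: (m <= k)%N; rewrite ?expr2 ?mul0r.
Qed.

Let C0 := dot x x + 1.

(** Tails of order [4 ^ (-i)] against the weights [2 ^ i] of [h] below leave a convergent geometric
    series. *)
Let fast : exists N : nat -> nat, [/\ N 0%N = 0%N, forall i, (i <= N i)%N, forall i, (N i <= N i.+1)%N &
  forall i p, (N i <= p)%N -> \sum_(k < p) x k * x k - \sum_(k < N i) x k * x k <= C0 * (4 ^+ i)^-1].
Proof.
have x0 k : 0 <= x k * x k by rewrite -expr2 sqr_ge0.
have C00 : 1 <= C0 by rewrite lerDr dot_ge0.
have step i : exists n : nat, ((i = 0%N -> n = 0%N) /\ (0 < i -> 0 < n)%N) /\ forall m p : nat, (n <= m <= p)%N ->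
    \sum_(k < p) x k * x k - \sum_(k < m) x k * x k <= C0 * (4 ^+ i)^-1.
  case: i => [|i].
    exists 0%N; split => // m p _; rewrite expr0 invr1 mulr1 lerBlDr.
    apply: le_trans (psum_le_sm p hx x0) _; rewrite /C0 /dot -addrA lerDl addr_ge0 //.
    by apply: sumr_ge0.
  have e0 : 0 < C0 * (4 ^+ i.+1)^-1 by rewrite mulr_gt0 ?invr_gt0 ?exprn_gt0 // (lt_le_trans _ C00).
  have [n hn] := tail_small hx e0; exists n.+1; split => // m p /andP[/ltnW nm mp].
  rewrite -(subnKC mp); move: (p - m)%N => {mp} {}p.
  apply: le_trans (hn m nm).
  apply: le_trans (psum_le_sm p (asm_tail m (asm_abs hx)) (fun k => normr_ge0 _)).
  rewrite big_split_ord /= addrAC subrr add0r.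
  by apply: ler_sum => k _; rewrite ler_norm.
have [n hn] := choice step.
exists (fun i => \sum_(j < i.+1) n j)%N; split.
- by rewrite big_ord1 (hn 0%N).1.1.
- elim=> [//|i IH]; rewrite big_ord_recr /=.
  have h := (hn i.+1).1.2 isT; rewrite -[X in (X <= _)%N]addn1; exact: leq_add.
- by move=> i; rewrite [leqRHS]big_ord_recr /= leq_addr.
- move=> i p ip; apply: (hn i).2; rewrite ip andbT.
  by rewrite big_ord_recr /= leq_addl.
Qed.

(** The sum [g] of [2 ^ i] times the squared increments is integrable, hence finite almost
    everywhere, and there the partial sums converge. Cauchy-Schwarz against [2 ^ (-i)] bounds their
    squares by [2 * g], which supplies the majorant for dominated convergence. *)
Lemma riesz_fischer : exists f, [/\ sq f, forall k, itg (fun y => f y * phi k y) = x k,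
  itg (fun y => f y * f y) = dot x x, measurable_fun setT f &
  forall t, (forall k y, phi k (y + t) = phi k y) -> forall y, f (y + t) = f y].
Proof.
have [N [N0 Ni Nm Nt]] := fast.
pose s i := psm (N i); pose d i y := s i.+1 y - s i y.
have sC i : cts01 (s i) by exact: psmC.
have dC i : cts01 (d i) by exact: cts01B.
have sE i y : s i y = \sum_(j < i) d j y.
  elim: i => [|i IH]; first by rewrite big_ord0 /s N0 /psm big_ord0.
  by rewrite big_ord_recr /= -IH /d addrC subrK.
have geo n : \sum_(j < n) 2^-1 ^+ j <= 2 :> R.
  suff -> : \sum_(j < n) 2^-1 ^+ j = 2 - 2 * 2^-1 ^+ n :> R by rewrite gerBl mulr_ge0 ?exprn_ge0.
  elim: n => [|n IH]; first by rewrite big_ord0 expr0 mulr1 subrr.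
  by rewrite big_ord_recr /= IH exprS; field.
pose h i y : R := 2 ^+ i * (d i y * d i y).
have h0 i y : 0 <= h i y by rewrite mulr_ge0 ?exprn_ge0 // -expr2 sqr_ge0.
have hC i : cts01 (h i) by apply: cts01M; [exact: cts01C|exact: cts01M].
pose g y : \bar R := (\sum_(0 <= i <oo) (h i y)%:E)%E.
have mh i : measurable_fun (@I01 R : set (measurableTypeR R)) (EFin \o h i).
  by apply/measurable_EFinP; exact: cts01_meas.
have g0 y : (0 <= g y)%E by apply: nneseries_ge0 => i _ _; rewrite lee_fin.
have mg : measurable_fun (@I01 R : set (measurableTypeR R)) g.
  have := @ge0_emeasurable_sum _ _ R (@I01 R) (fun i => EFin \o h i) xpredT.
  have p0 k (y : R) : I01 y -> true -> (0 <= (EFin \o h k) y)%E by rewrite lee_fin.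
  by move=> /(_ p0 (fun k _ => mh k)).
have gI : mu.-integrable (@I01 R) g.
  apply/integrableP; split => //.
  under eq_integral do rewrite gee0_abs //.
  rewrite integral_nneseries //; [|exact: mI01|by move=> i y _; rewrite lee_fin].
  have ge : (\sum_(0 <= i <oo) (\int[mu]_(y in @I01 R) (EFin \o h i) y) <=
      \sum_(0 <= i <oo) (C0 * 2^-1 ^+ i)%:E)%E.
    apply: lee_nneseries => [i _ _|i _].
      by apply: integral_ge0 => y _; rewrite lee_fin.
    rewrite (_ : \int[mu]_(y in @I01 R) _ = (itg (h i))%:E)%E; last first.
      by rewrite /itg /Rintegral fineK //; apply: integrable_fin_num; [exact: mI01|exact: ig_cts].
    rewrite lee_fin /h itgZ; last by apply: ig_cts; exact: cts01M.
    rewrite itg_tail //; have := Nt i _ (Nm i) => /(ler_wpM2l (exprn_ge0 i (ler0n _ 2))) /le_trans; apply.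
    have p0 : 0 < 2 ^+ i :> R by rewrite exprn_gt0.
    have -> : 4 ^+ i = 2 ^+ i * 2 ^+ i :> R by rewrite -exprMn -natrM.
    by rewrite exprVn le_eqVlt; apply/orP; left; apply/eqP; field; rewrite gt_eqF.
  apply: le_lt_trans ge _.
  rewrite (_ : (fun n => _) = (fun n => (series (geometric C0 2^-1) n)%:E)); last first.
    by apply/funext => n; rewrite sumEFin.
  have gc : series (geometric C0 2^-1) @ \oo --> C0 / (1 - 2^-1).
    by apply: cvg_geometric_series; rewrite ger0_norm // invf_lt1 ?ltr1n.
  by rewrite EFin_lim ?ltry //; exact: cvgP gc.
(* A limit superior is defined at every point, is measurable, and inherits every common period of
   the basis. *)
pose f y := fine (limn_esup (fun i => (s i y)%:E)).
have mf : mf01 f.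
  apply: (measurableT_comp (fine_measurable measurableT)); apply: measurable_fun_limn_esup => i.
  by apply/measurable_EFinP; exact: cts01_meas.
have sq2 i y : (((s i y) ^+ 2)%:E <= 2%:E * g y)%E.
  have h1 : s i y ^+ 2 <= 2 * \sum_(j < i) h j y.
    rewrite sE; apply: le_trans (@cs_fin _ i (d^~ y) (fun j => 2^-1 ^+ j) (h^~ y) _ (h0^~ y) _) _.
    - by move=> j; rewrite exprn_ge0.
    - move=> j; rewrite /h mulrA -exprMn mulVf // expr1n mul1r expr2 //.
    by rewrite ler_wpM2r ?geo // sumr_ge0.
  apply: (@le_trans _ _ (2 * \sum_(j < i) h j y)%:E); first by rewrite lee_fin.
  rewrite EFinM lee_pmul2l ?lte_fin //.
  rewrite -sumEFin -(big_mkord xpredT (fun j => (h j y)%:E)).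
  by apply: nneseries_lim_ge => j _ _; rewrite lee_fin.
have good y : g y \is a fin_num -> (fun i => s i y) @ \oo --> f y.
  move=> gy; have ah : asm (h^~ y).
    by apply/(esum_asm (h0^~ y)); move: gy; rewrite ge0_fin_numE.
  have ad : asm (d^~ y).
    have ag : asm (fun j => 2^-1 ^+ j : R) by apply: (asm_bound _ geo) => j; rewrite exprn_ge0.
    apply: asm_le (asmD ag ah) => j; apply: le_trans (ler_norm _).
    have := h0 j y; rewrite /h; set a := d j y; set p : R := 2 ^+ j => _.
    have p0 : 0 < p by rewrite exprn_gt0.
    have -> : (2^-1 ^+ j : R) = p^-1 by rewrite exprVn.
    have : 0 <= (p^-1) * (1 - p * `|a|) ^+ 2 by rewrite mulr_ge0 ?sqr_ge0 // invr_ge0 ltW.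
    have -> : p^-1 * (1 - p * `|a|) ^+ 2 = p^-1 - 2 * `|a| + p * (`|a| * `|a|).
      by field; rewrite gt_eqF.
    by rewrite -[`|a| * `|a|]expr2 sqr_normr expr2; have := normr_ge0 a; lra.
  have cs : (fun i => s i y) @ \oo --> sm (d^~ y).
    by under eq_fun do rewrite sE; exact: sm_cvg.
  suff -> : f y = sm (d^~ y) by [].
  have ce : (fun i => (s i y)%:E) @ \oo --> (sm (d^~ y))%:E by apply: cvg_EFin => //; exact: nearW.
  by rewrite /f is_cvg_limn_esupE ?(cvg_lim _ ce) //; exact: cvgP ce.
have gae := integrable_ae (@mI01 R) gI.
pose G (y : R) : \bar R := (1%:E + 2%:E * g y)%E.
have GI : mu.-integrable (@I01 R) G.
  have i1 := @ig_cts R (fun=> 1) (@cts01C R 1).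
  by have := integrableD (@mI01 R) i1 (integrableZl (@mI01 R) 2 gI).
have dct (F : R -> R -> R) : (forall y, continuous (F y)) ->
    (forall i, mf01 (fun y => F y (s i y))) -> mf01 (fun y => F y (f y)) ->
    (forall y t, `|F y t| <= 1 + t ^+ 2) ->
    ig (fun y => F y (f y)) /\ (fun i => itg (fun y => F y (s i y))) @ \oo --> itg (fun y => F y (f y)).
  move=> Fc mF mFf FB.
  have me i : measurable_fun (@I01 R : set (measurableTypeR R)) (EFin \o (fun y => F y (s i y))).
    exact: (measurable_EFinP _ _).2 (mF i).
  have mef : measurable_fun (@I01 R : set (measurableTypeR R)) (EFin \o (fun y => F y (f y))).
    exact: (measurable_EFinP _ _).2 mFf.
  have [|||||igf _ cf] := @dominated_convergence _ _ _ mu (@I01 R) (@mI01 R)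
    (fun i y => (F y (s i y))%:E) (fun y => (F y (f y))%:E) G.
  - exact: me.
  - exact: mef.
  - apply: filterS gae => y hy Iy; apply: cvg_EFin; first exact: nearW.
    exact: (cvg_comp _ _ (good y (hy Iy)) (Fc y (f y))).
  - exact: GI.
  - apply: nearW => y i _; apply: (@le_trans _ _ (1 + (s i y) ^+ 2)%:E); first by rewrite lee_fin FB.
    by rewrite /G EFinD leeD2l.
  split; first exact: igf.
  apply: fine_cvg; rewrite fineK; first exact: cf.
  by apply: integrable_fin_num igf; exact: mI01.
have [|i|||i2 c2] := dct (fun y t => t * t).
- by move=> y t; apply: cvgM; exact: cvg_id.
- by apply: cts01_meas; exact: cts01M.
- by apply: measurable_funM.
- by move=> y t; rewrite ger0_norm -expr2 ?sqr_ge0 // lerDr.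
have e2 : itg (fun y => f y * f y) = dot x x.
  apply: (cvg_unique (@Rhausdorff R) c2).
  rewrite (_ : (fun i => itg (fun y => s i y * s i y)) =
    (fun n => \sum_(k < n) x k * x k) \o N); last first.
    apply/funext => i /=; have := itg_tail (leq0n (N i)); rewrite [X in _ - X]big_ord0 subr0 => <-.
    by apply: eq_itg => y _; rewrite [psm 0 y]big_ord0 subr0.
  apply: cvg_comp (sm_cvg hx) => A [n _ hA]; exists n => // i /= ni.
  by apply: hA; rewrite /= (leq_trans ni).
have mfT : measurable_fun [set: R] f.
  apply: (measurableT_comp (fine_measurable measurableT)); apply: measurable_fun_limn_esup => i.
  apply/measurable_EFinP; apply: continuous_measurable_fun.
  rewrite (_ : s i = fun y => \sum_(k < N i) x k * phi k y) //.
  elim: (N i) => [|m IH] y.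
    by rewrite (_ : (fun y => _) = fun=> 0); [exact: cvg_cst|apply/funext => z; rewrite big_ord0].
  rewrite (_ : (fun y => _) = fun y => \sum_(k < m) x k * phi k y + x m * phi m y); last first.
    by apply/funext => z; rewrite big_ord_recr.
  by apply: cvgD; [exact: IH|apply: cvgM; [exact: cvg_cst|exact: phiT]].
have pf t : (forall k y, phi k (y + t) = phi k y) -> forall y, f (y + t) = f y.
  move=> pt y; rewrite /f; congr (fine (limn_esup _)); apply/funext => i; congr _%:E.
  by apply: eq_bigr => k _; rewrite pt.
exists f; split; [by split| |exact: e2|exact: mfT|exact: pf].
move=> k; have [|i|||i1 c1] := dct (fun y t => t * phi k y).
- by move=> y t; apply: cvgM; [exact: cvg_id|exact: cvg_cst].
- by apply: cts01_meas; exact: cts01M.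
- by apply: measurable_funM => //; exact: cts01_meas.
- move=> y t; rewrite normrM; apply: (@le_trans _ _ (`|t| * 2)); first by rewrite ler_wpM2l.
  by rewrite -(sqr_normr t); have := sqr_ge0 (`|t| - 1); lra.
apply: (cvg_unique (@Rhausdorff R) c1); apply: cvg_near_cst; near=> i.
have ki : (k < N i)%N by apply: leq_trans (Ni i); near: i; exists k.+1.
rewrite (@eq_itg _ _ (fun y => \sum_(l < N i) x l * (phi l y * phi k y))); last first.
  by move=> y _; rewrite mulr_suml; apply: eq_bigr => l _; rewrite mulrA.
have ip l : ig (fun y => phi l y * phi k y) by apply: ig_cts; exact: cts01M.
rewrite itg_sum; last by move=> l; exact: igZ.
rewrite (bigD1 (Ordinal ki)) //= big1 ?addr0 ?itgZ ?phiO ?eqxx ?mulr1 // => l.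
by rewrite -val_eqE /= => /negbTE lk; rewrite itgZ // phiO lk mulr0.
Unshelve. all: by end_near. Qed.

End RieszFischer.

(** * Merging the spectra of two blocks *)

Section Parity.
Variable R : realType.
Implicit Types (f x y : nat -> R).

Definition ev x j := x j.*2.
Definition od x j := x j.*2.+1.
Definition emb (p : bool) y k := if odd k == p then y k./2 else 0.

Lemma psum_parity f n : \sum_(k < n.*2) f k = \sum_(j < n) ev f j + \sum_(j < n) od f j.
Proof.
elim: n => [|n IH]; first by rewrite !big_ord0 addr0.
by rewrite doubleS !big_ord_recr /= IH /ev /od; ring.
Qed.

Lemma asm_ev f : asm f -> asm (ev f).
Proof.
move=> [C h]; exists C => n; apply: le_trans (h n.*2).
rewrite (psum_parity (fun k => `|f k|)); apply: ler_wpDr => //.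
by apply: sumr_ge0 => k _; exact: normr_ge0.
Qed.

Lemma asm_od f : asm f -> asm (od f).
Proof.
move=> [C h]; exists C => n; apply: le_trans (h n.*2).
rewrite (psum_parity (fun k => `|f k|)); apply: ler_wpDl => //.
by apply: sumr_ge0 => k _; exact: normr_ge0.
Qed.

Lemma asm_parity f : asm (ev f) -> asm (od f) -> asm f.
Proof.
move=> [C h] [C' h']; exists (C + C') => n; apply: le_trans (lerD (h n) (h' n)).
rewrite -(psum_parity (fun k => `|f k|)); apply: (@psum_mono _ (fun k => `|f k|)) => //.
by rewrite -addnn leq_addr.
Qed.

Lemma sm_parity f : asm f -> sm f = sm (ev f) + sm (od f).
Proof.
move=> hf; have h : (fun n => \sum_(j < n) ev f j + \sum_(j < n) od f j) @ \oo --> sm (ev f) + sm (od f).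
  by apply: cvgD; [exact: sm_cvg (asm_ev hf)|exact: sm_cvg (asm_od hf)].
apply/esym; apply: (cvg_unique (@Rhausdorff R) h).
rewrite (_ : (fun n => \sum_(j < n) ev f j + \sum_(j < n) od f j) = (fun n => \sum_(k < n) f k) \o double); last first.
  by apply/funext => n /=; rewrite psum_parity.
apply: cvg_comp (sm_cvg hf) => A [n _ hA]; exists n => // i /= ni.
by apply: hA; rewrite /= (leq_trans ni) // -addnn leq_addr.
Qed.

Lemma ev_emb p y j : emb p y j.*2 = if p then 0 else y j.
Proof. by rewrite /emb odd_double doubleK; case: p. Qed.

Lemma od_emb p y j : emb p y j.*2.+1 = if p then y j else 0.
Proof. by rewrite /emb /= odd_double uphalf_double; case: p. Qed.

Variables (D D0 D1 : nat -> R) (b b0 b1 : nat -> nat -> R) (K K0 K1 kp : R).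
Variables (E E0 E1 : nat -> R) (e e0 e1 : nat -> nat -> R).
Hypotheses (H : adm D b K) (H0 : adm D0 b0 K0) (H1 : adm D1 b1 K1).
Hypotheses (S : spec D b E e) (S0 : spec D0 b0 E0 e0) (S1 : spec D1 b1 E1 e1).
Hypothesis kp1 : 1 <= kp.
Hypothesis hD0 : forall j, D j.*2 = kp * D0 j.
Hypothesis hD1 : forall j, D j.*2.+1 = kp * D1 j.
Hypothesis hb0 : forall j l, b j.*2 l.*2 = kp * b0 j l.
Hypothesis hb1 : forall j l, b j.*2.+1 l.*2.+1 = kp * b1 j l.
Hypothesis hb01 : forall j l, b j.*2 l.*2.+1 = 0.
Hypothesis hb10 : forall j l, b j.*2.+1 l.*2 = 0.

Let kp0 : 0 < kp. Proof. exact: lt_le_trans kp1. Qed.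
Let D0p k : 0 <= D0 k. Proof. by case: H0. Qed.
Let D1p k : 0 <= D1 k. Proof. by case: H1. Qed.

Let w_le (u v t : R) : 0 <= u <= v -> `|u * (t * t)| <= `|v * (t * t)|.
Proof.
move=> /andP[u0 uv]; have t0 : 0 <= t * t by rewrite -expr2 sqr_ge0.
rewrite !ger0_norm; [exact: ler_wpM2r| |exact: mulr_ge0].
by apply: mulr_ge0 => //; exact: le_trans uv.
Qed.

Let w0 u : 0 <= u -> 0 <= 1 + u <= 1 + kp * u.
Proof. by move=> u0; rewrite addr_ge0 //= lerD2l ler_peMl. Qed.

Let w1 u : 0 <= u -> 0 <= 1 + kp * u <= kp * (1 + u).
Proof. by move=> u0; rewrite addr_ge0 ?mulr_ge0 ?(ltW kp0) //= mulrDr mulr1 lerD2r. Qed.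

Let ev_h1 x : h1 D x -> h1 D0 (ev x).
Proof. by move=> /asm_ev; apply: asm_le => k; rewrite /ev hD0 w_le ?w0. Qed.

Let od_h1 x : h1 D x -> h1 D1 (od x).
Proof. by move=> /asm_od; apply: asm_le => k; rewrite /od hD1 w_le ?w0. Qed.

Let parity_h1 x : h1 D0 (ev x) -> h1 D1 (od x) -> h1 D x.
Proof.
move=> h0 h1; apply: asm_parity.
  by apply: asm_le (asmZ kp h0) => k; rewrite mulrA; apply: w_le; rewrite hD0 w1.
by apply: asm_le (asmZ kp h1) => k; rewrite mulrA; apply: w_le; rewrite hD1 w1.
Qed.

Lemma dot_parity x y : l2 x -> l2 y -> dot x y = dot (ev x) (ev y) + dot (od x) (od y).
Proof. by move=> hx hy; rewrite /dot (sm_parity (l2_dot hx hy)). Qed.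

Lemma QQ_parity x : h1 D x ->
  QQ D b x x = kp * (QQ D0 b0 (ev x) (ev x) + QQ D1 b1 (od x) (od x)).
Proof.
move=> hx; have h0 := ev_h1 hx; have h1 := od_h1 hx.
have x2 := h1_l2 H hx; have x20 := h1_l2 H0 h0; have x21 := h1_l2 H1 h1.
have b2 k : l2 (b k) by case: H => _ _ _ [_ /(_ k)[]].
have b20 k : l2 (b0 k) by case: H0 => _ _ _ [_ /(_ k)[]].
have b21 k : l2 (b1 k) by case: H1 => _ _ _ [_ /(_ k)[]].
have bxe j : bx b x j.*2 = kp * bx b0 (ev x) j.
  rewrite /bx dot_parity // [X in _ + X](_ : _ = 0) ?addr0.
    by rewrite -dotZl //; apply: eq_sm => k; rewrite /ev hb0.
  by rewrite -[RHS](sm0 R); apply: eq_sm => k; rewrite /od hb01 mul0r.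
have bxo j : bx b x j.*2.+1 = kp * bx b1 (od x) j.
  rewrite /bx dot_parity // [X in X + _](_ : _ = 0) ?add0r.
    by rewrite -dotZl //; apply: eq_sm => k; rewrite /od hb1.
  by rewrite -[RHS](sm0 R); apply: eq_sm => k; rewrite /ev hb10 mul0r.
have aD := h1_dotD H hx hx; have ab := bl_asm H x2 (h1_l1 H hx).
have aD0 := h1_dotD H0 h0 h0; have ab0 := bl_asm H0 x20 (h1_l1 H0 h0).
have aD1 := h1_dotD H1 h1 h1; have ab1 := bl_asm H1 x21 (h1_l1 H1 h1).
rewrite /QQ (sm_parity aD) (sm_parity ab) addrACA mulrDr !(mulrDr kp (sm _)).
rewrite -!smZ //.
congr (_ + _ + (_ + _)); apply: eq_sm => k; rewrite /ev /od ?hD0 ?hD1 ?bxe ?bxo; ring.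
Qed.

(** Eigenvectors of the two blocks, extended by zero, span a trial space of dimension [p + r];
    [block_lower] uses the same vectors as orthogonality constraints. *)
Lemma block_upper n p r (M : R) : (n < p + r)%N -> (forall s, (s < p)%N -> kp * E0 s <= M) ->
  (forall s, (s < r)%N -> kp * E1 s <= M) -> E n <= M.
Proof.
move=> npr g0 g1.
pose f (s : 'I_(p + r)) := match fintype.split s with inl i => emb false (e0 i) | inr i => emb true (e1 i) end.
have e0h i : h1 D0 (e0 i) by case: S0.
have e1h i : h1 D1 (e1 i) by case: S1.
have fl (i : 'I_p) : f (lshift r i) = emb false (e0 i).
  by rewrite /f -[lshift r i]/(unsplit (inl i)) unsplitK.
have fr (i : 'I_r) : f (rshift p i) = emb true (e1 i).
  by rewrite /f -[rshift p i]/(unsplit (inr i)) unsplitK.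
have fh s : h1 D (f s).
  rewrite /f; case: (fintype.split s) => i; apply: parity_h1.
  - by apply: eq_asm (e0h i) => k; rewrite /ev ev_emb.
  - by apply: eq_asm (h10 D1) => k; rewrite /od od_emb.
  - by apply: eq_asm (h10 D0) => k; rewrite /ev ev_emb.
  - by apply: eq_asm (e1h i) => k; rewrite /od od_emb.
apply: (@minmax_up R D b K H E e S (p + r) 0 n f (fun=> fun=> 0) M) => //.
  by move=> s; apply: (h1_l2 H).
move=> c [i0 ci0] _ x.
have hx : h1 D x by apply: (h1_sum H) => i; exact: (h1Z H).
have x2 := h1_l2 H hx.
pose c0 i := if insub i is Some o then c (lshift r o) else 0.
pose c1 i := if insub i is Some o then c (rshift p o) else 0.
have xe : ev x = fun k => \sum_(i < p) c0 i * e0 i k.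
  apply/funext => k; rewrite /ev /x big_split_ord /= [X in _ + X]big1 ?addr0.
    by apply: eq_bigr => i _; rewrite fl ev_emb /c0 valK.
  by move=> i _; rewrite fr ev_emb mulr0.
have xo : od x = fun k => \sum_(i < r) c1 i * e1 i k.
  apply/funext => k; rewrite /od /x big_split_ord /= [X in X + _]big1 ?add0r.
    by apply: eq_bigr => i _; rewrite fr od_emb /c1 valK.
  by move=> i _; rewrite fl od_emb mulr0.
have dx : dot x x = \sum_(i < p) c0 i ^+ 2 + \sum_(i < r) c1 i ^+ 2.
  by rewrite dot_parity // xe xo (span_dot H0 S0) (span_dot H1 S1).
split => //.
  rewrite dx; case: (splitP i0) => i Ei.
    have -> : \sum_(i < p) c0 i ^+ 2 = c i0 ^+ 2 + \sum_(j < p | j != i) c0 j ^+ 2.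
      rewrite (bigD1 i) //= /c0 valK; congr (c _ ^+ 2 + _); exact: val_inj.
    by rewrite -addrA ltr_pwDl ?exprn_even_gt0 ?addr_ge0 ?sumr_ge0 // => *; exact: sqr_ge0.
  have -> : \sum_(i < r) c1 i ^+ 2 = c i0 ^+ 2 + \sum_(j < r | j != i) c1 j ^+ 2.
    rewrite (bigD1 i) //= /c1 valK; congr (c _ ^+ 2 + _); exact: val_inj.
  by rewrite addrCA ltr_pwDl ?exprn_even_gt0 ?addr_ge0 ?sumr_ge0 // => *; exact: sqr_ge0.
rewrite QQ_parity // dx xe xo (span_Q H0 S0) (span_Q H1 S1) !mulrDr !mulr_sumr.
by apply: lerD; apply: ler_sum => i _; rewrite mulrA ler_wpM2r ?sqr_ge0 // ?g0 ?g1.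
Qed.

Lemma block_lower p r (M : R) : M <= kp * E0 p -> M <= kp * E1 r -> M <= E (p + r)%N.
Proof.
move=> g0 g1.
have e0h i : h1 D0 (e0 i) by case: S0.
have e1h i : h1 D1 (e1 i) by case: S1.
pose g i := if (i < p)%N then emb false (e0 i) else emb true (e1 (i - p)%N).
have gh s : h1 D (g s).
  rewrite /g; case: ifP => _; apply: parity_h1.
  - by apply: eq_asm (e0h s) => k; rewrite /ev ev_emb.
  - by apply: eq_asm (h10 D1) => k; rewrite /od od_emb.
  - by apply: eq_asm (h10 D0) => k; rewrite /ev ev_emb.
  - by apply: eq_asm (e1h (s - p)%N) => k; rewrite /od od_emb.
apply: (@maxmin_low R D b K H E e S (p + r) g M) => [i _|x hx ox]; first exact: (h1_l2 H).
have x2 := h1_l2 H hx.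
have ho0 : ortho e0 p (ev x).
  move=> i ip; have := ox i (leq_trans ip (leq_addr _ _)).
  rewrite (dot_parity x2 (h1_l2 H (gh i))) /g ip [X in _ + X](_ : _ = 0) ?addr0.
    by move=> <-; apply: eq_sm => k; rewrite /ev ev_emb.
  by rewrite -[RHS](sm0 R); apply: eq_sm => k; rewrite /od od_emb mulr0.
have ho1 : ortho e1 r (od x).
  move=> i ir; have pi : (p + i < p)%N = false by rewrite ltnNge leq_addr.
  have := ox (p + i)%N; rewrite ltn_add2l => /(_ ir).
  rewrite (dot_parity x2 (h1_l2 H (gh (p + i)%N))) /g pi addKn [X in X + _](_ : _ = 0) ?add0r.
    by move=> <-; apply: eq_sm => k; rewrite /od od_emb.
  by rewrite -[RHS](sm0 R); apply: eq_sm => k; rewrite /ev ev_emb mulr0.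
have [_ _ _ _ [m0 _]] := S0; have [_ _ _ _ [m1 _]] := S1.
have h2 := m0 p _ (ev_h1 hx) ho0; have h3 := m1 r _ (od_h1 hx) ho1.
rewrite dot_parity // QQ_parity // mulrDr [leRHS]mulrDr.
have d0 := dot_ge0 (h1_l2 H0 (ev_h1 hx)); have d1 := dot_ge0 (h1_l2 H1 (od_h1 hx)).
apply: lerD.
  by apply: le_trans (ler_wpM2r d0 g0) _; rewrite -mulrA ler_wpM2l // ltW.
by apply: le_trans (ler_wpM2r d1 g1) _; rewrite -mulrA ler_wpM2l // ltW.
Qed.

(* [a] is the antiperiodic flag, and [n = 2 g + a] labels the gap. *)
Variable a : bool.
Definition sgm n := kp * (E0 n./2 - E1 (n.-1)./2).

(** Of the two block eigenvalues that compete for the places [n.-1] and [n], the larger bounds [E n]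
    from above and the smaller bounds [E n.-1] from below. *)
Lemma gap_le_sgm n : odd n = a -> (0 < n)%N -> E n - E n.-1 <= `|sgm n|.
Proof.
move=> na n0; set i := n./2; set j := (n.-1)./2.
have ij : (i + j = n.-1)%N by rewrite /i /j; lia.
pose M := kp * Num.max (E0 i) (E1 j); pose m := kp * Num.min (E0 i) (E1 j).
have E0m s : (s <= i)%N -> E0 s <= E0 i by case: S0 => _ _ _ + _; apply.
have E1m s : (s <= j)%N -> E1 s <= E1 j by case: S1 => _ _ _ + _; apply.
have up : E n <= M.
  apply: (@block_upper n i.+1 j.+1); first by lia.
    by move=> s si; rewrite /M ler_pM2l // le_max E0m.
  by move=> s si; rewrite /M ler_pM2l // le_max E1m ?orbT.
have lo : m <= E n.-1.
  by rewrite -ij; apply: block_lower; rewrite /m ler_pM2l // ge_min lexx ?orbT.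
apply: le_trans (lerB up lo) _; rewrite /sgm -/i -/j normrM gtr0_norm // /M /m -mulrBr ler_pM2l //.
case: (leP (E0 i) (E1 j)) => h; first by rewrite ler0_norm ?opprB // subr_le0.
by rewrite ger0_norm // subr_ge0 ltW.
Qed.

Hypothesis order : forall i, E0 i <= E1 (i + a)%N.

(** [order] and the sign give [E1 j <= E0 i <= E1 j.+1], and every earlier [E0 s] is at most [E1 j].
    The merged order is thus known, with [E1 j] and [E0 i] at the places [n.-1] and [n]. *)
Lemma gap_eq_sgm n : odd n = a -> (0 < n)%N -> 0 <= sgm n -> E n - E n.-1 = sgm n.
Proof.
move=> na n0; rewrite /sgm; set i := n./2; set j := (n.-1)./2 => s0.
have ij : (i + j = n.-1)%N by rewrite /i /j; lia.
have ji : (j.+1 = i + a)%N by rewrite /i /j -na; lia.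
have le : E1 j <= E0 i by move: s0; rewrite pmulr_rge0 // subr_ge0.
have E0m s : (s <= i)%N -> E0 s <= E0 i by case: S0 => _ _ _ + _; apply.
have E1m s : (s <= j)%N -> E1 s <= E1 j by case: S1 => _ _ _ + _; apply.
have e_n : E n = kp * E0 i.
  apply/eqP; rewrite eq_le; apply/andP; split.
    apply: (@block_upper n i.+1 j.+1); first by lia.
      by move=> s si; rewrite ler_pM2l // E0m.
    by move=> s si; rewrite ler_pM2l //; apply: le_trans le; exact: E1m.
  have -> : n = (i + j.+1)%N by lia.
  by apply: block_lower; rewrite ler_pM2l // ji.
have e_m : E n.-1 = kp * E1 j.
  apply/eqP; rewrite eq_le; apply/andP; split.
    apply: (@block_upper n.-1 i j.+1); first by lia.
      move=> s si; rewrite ler_pM2l //; apply: le_trans (order s) _; apply: E1m; lia.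
    by move=> s si; rewrite ler_pM2l // E1m.
  by rewrite -ij; apply: block_lower; rewrite ler_pM2l.
by rewrite e_n e_m mulrBr.
Qed.

End Parity.

Lemma csp_shift (R : realType) (t y z : R) : csp t (y + z) = csp t y * csp t z - snp t y * snp t z.
Proof. by rewrite /csp mulrDr cosD. Qed.

Lemma snp_shift (R : realType) (t y z : R) : snp t (y + z) = snp t y * csp t z + csp t y * snp t z.
Proof. by rewrite /snp mulrDr sinD. Qed.

(** * Half-period problems and signed gaps *)

Section Blocks.
Variable R : realType.
Implicit Types (al : nat -> R) (a P : bool).
Local Notation r2 := (Num.sqrt 2 : R).

Let r2K : r2 * r2 = 2. Proof. by rewrite -expr2 sqr_sqrtr. Qed.

(* The cosine ([P = false]) and sine ([P = true]) blocks of the periodic ([a = false]) and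
   antiperiodic ([a = true]) problems of an even potential with cosine coefficients [al], scaled to
   the half period, where they are the four separated boundary value problems. *)
Definition bkt a P : nat -> R := if a then @hh_t R else if P then @dd_t R else @nn_t R.
Definition bkw a P : nat -> R := if a || P then @dd_s R else @nn_c R.
Definition bkphi a P := trig (bkt a P) (if P then @zz R else bkw a P) (if P then bkw a P else @zz R).
Definition bkpsi a P := trig' (bkt a P) (if P then @zz R else bkw a P) (if P then bkw a P else @zz R).
Definition bkD a P k := (pi * bkt a P k) ^+ 2.
Definition bko a P : nat := if a then 1%N else if P then 2%N else 0%N.
Definition bk al a P j l : R := 8^-1 * (bkw a P j * bkw a P l) *
  (if P then al (ddn j l) - al (j + l + bko a P)%N else al (ddn j l) + al (j + l + bko a P)%N).

Lemma bk_system a P : system (Sep R P (a (+) P)) (bkphi a P) (bkpsi a P) (bkD a P).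
Proof.
case: a; case: P.
- exact: dn_system.
- exact: nd_system.
- exact: dd_system.
- exact: nn_system.
Qed.

Lemma bkt_add a P j l : bkt a P j + bkt a P l = (j + l + bko a P)%:R.
Proof.
case: a; first by rewrite /bkt /bko /hh_t !natrD; field.
by case: P; rewrite /bkt /bko /dd_t /nn_t ?addn0 ?natrD // -!natr1; ring.
Qed.

Lemma bkt_sub a P j l : bkt a P j - bkt a P l = j%:R - l%:R.
Proof.
by case: a; [|case: P]; rewrite /bkt /hh_t /dd_t /nn_t -?natr1; ring.
Qed.

Lemma bk_mat (p : R -> R) al a P : sq p -> (forall m : nat, cosc p m%:R = al m / 4) ->
  mat (bkphi a P) p = bk al a P.
Proof.
move=> hp pal; apply/funext => j; apply/funext => l; rewrite /bkphi mat_trig // bkt_add bkt_sub.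
have -> : cosc p (j%:R - l%:R) = al (ddn j l) / 4.
  by have [->|->] := ddn_cases R j l; rewrite ?alN pal.
by rewrite pal /bk; case: P; rewrite /zz; field.
Qed.

Lemma adm_le (D : nat -> R) b (K K' : R) : K <= K' -> adm D b K -> adm D b K'.
Proof.
move=> KK [h1 h2 h3 [K0 h]]; split=> //; split=> [|k]; first exact: le_trans KK.
have [h4 h5] := h k; split=> //; apply: le_trans h5 _.
by rewrite ler_pXn2r // nnegrE // (le_trans K0).
Qed.

Definition cosseq al := l2 al /\ al 0%N = 0.

(** [p y] plays the part of [q (y / 2) / 4]: stretching the half period to the unit interval divides
    the operator by 4 and turns the coefficients into [al m / 4]. *)
Lemma half_function al : cosseq al -> exists p : R -> R, [/\ sq p,
  forall m : nat, cosc p m%:R = al m / 4 & itg (fun y => p y * p y) = dot al al / 8].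
Proof.
move=> [hal al0]; have sy := nn_system R.
have [||||] := @riesz_fischer R (trig (@nn_t R) (@nn_c R) (@zz R)) _ _ _ (fun k => r2 / 4 * al k).
- by move=> k; exact: C1_cont (sys_phi sy k).
- exact: sys_bphi sy.
- exact: sys_orth sy.
- exact: l2Z.
move=> p [hp pc pe _ _]; exists p; split=> //; last first.
  have h := l2Z (r2 / 4) hal; rewrite pe dotZl // [dot al _]dotC dotZl // mulrA mulrC; congr (_ * _).
  have -> : r2 / 4 * (r2 / 4) = (r2 * r2) / 16 by field.
  by rewrite r2K; field.
move=> m; have ip : ig (fun y => p y * csp m%:R y).
  exact: igM_cts (sq_ig hp) (cts_cts01 (@csp_cont R _)).
have r20 : r2 != 0 by rewrite gt_eqF // sqrtr_gt0.
have h : nn_c R m * cosc p m%:R = r2 / 4 * al m.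
  rewrite -(pc m) /cosc -itgZ //; apply: eq_itg => y _; rewrite /trig /zz mul0r addr0 /nn_t; ring.
move: h; rewrite /nn_c; case: eqP => [-> |_]; first by rewrite mul1r al0 mulr0 mul0r.
by move=> h; apply: (mulfI r20); rewrite h; ring.
Qed.

Lemma bk_adm al a P : cosseq al -> adm (bkD a P) (bk al a P) (nrm al).
Proof.
move=> hal; have [p [hp pal pe]] := half_function hal.
rewrite -(bk_mat a P hp pal); apply: adm_le (mat_adm (bk_system a P) hp).
have d0 := dot_ge0 hal.1.
rewrite /matK /nrm pe -(@ler_pXn2r _ 2) ?nnegrE ?mulr_ge0 ?sqrtr_ge0 // exprMn !sqr_sqrtr //; lra.
Qed.

Definition BE al a P : nat -> R := xget (fun=> 0) [set E | exists e, spec (bkD a P) (bk al a P) E e].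

Lemma BE_spec al a P : cosseq al -> exists e, spec (bkD a P) (bk al a P) (BE al a P) e.
Proof.
move=> hal; have [E [e S]] := spec_exists (bk_adm a P hal).
by apply: (@xgetPex _ (fun=> 0) [set E | exists e, spec (bkD a P) (bk al a P) E e]); exists E, e.
Qed.

(* The Dirichlet form domain is contained in the Neumann one (for [a = true], up to one constraint). *)
Lemma BE_order al a i : cosseq al -> BE al a false i <= BE al a true (i + a)%N.
Proof.
move=> hal; have [p [hp pal pe]] := half_function hal.
have [e0 S0] := BE_spec a false hal; have [e1 S1] := BE_spec a true hal.
move: S0 S1; rewrite -!(bk_mat _ _ hp pal) => S0 S1.
rewrite addnC; apply: (@compare _ _ _ _ _ _ _ _ _ (bk_system a true) (bk_system a false) p hp
  _ _ _ _ S1 S0 a i (fun=> 0) (fun=> 1)) => u0 u1 /=.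
case: a {S0 S1} => /=; last by [].
move=> _ /(_ ord0); rewrite mul0r mul1r add0r => ->; by split.
Qed.

(** The factor 4 undoes the scaling to the half period. *)
Definition sig al n := sgm 4 (BE al (odd n) false) (BE al (odd n) true) n.

Section Full.
Variables (q : R -> R) (al : nat -> R).
Hypotheses (hal : cosseq al) (hq : sq q).
Hypothesis qal : forall m : nat, cosc q (2 * m%:R) = al m.
Hypothesis qbe : forall m : nat, sinc q (2 * m%:R) = 0.

Let qals i j : cosc q (2 * (i%:R - j%:R)) = al (ddn i j).
Proof. by case: (ddn_cases R i j) => ->; rewrite ?mulrN ?alN qal. Qed.
Let qbes i j : sinc q (2 * (i%:R - j%:R)) = 0.
Proof. by case: (ddn_cases R i j) => ->; rewrite ?mulrN ?beN ?qbe ?oppr0. Qed.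

Lemma twb_parity a j l : [/\ twb q a j.*2 l.*2 = 4 * bk al a false j l,
  twb q a j.*2.+1 l.*2.+1 = 4 * bk al a true j l, twb q a j.*2 l.*2.+1 = 0 &
  twb q a j.*2.+1 l.*2 = 0].
Proof.
have dS i i' : ddn i.+1 i'.+1 = ddn i i' by rewrite /ddn !subSS.
rewrite !twbE // !twt_sub !twt_add !qals !qbes !qal !qbe /= !odd_double /=.
rewrite /bk /twa /twz /bkw /bko /nn_c /dd_s /twg.
have e0 : (j.*2 == 0%N) = (j == 0%N) by case: (j).
have e1 : (l.*2 == 0%N) = (l == 0%N) by case: (l).
case: a => /=; rewrite ?uphalf_double ?doubleK ?e0 ?e1 ?andbF ?dS ?addn0 ?addSn ?addnS ?addn0.
  by split; field.
by case: (j == 0%N); case: (l == 0%N); split; field.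
Qed.

Lemma twD_parity a j : @twD R a j.*2 = 4 * bkD a false j /\ @twD R a j.*2.+1 = 4 * bkD a true j.
Proof.
rewrite /twD /bkD !twtE /bkt /twg /=; case: a => /=; rewrite ?uphalf_double ?doubleK.
  by rewrite /hh_t; split; field.
by rewrite /nn_t /dd_t; split; ring.
Qed.

Variables (E : bool -> nat -> R) (e : bool -> nat -> nat -> R).
Hypothesis S : forall a, spec (@twD R a) (twb q a) (E a) (e a).

Lemma even_gap_le n : (0 < n)%N -> E (odd n) n - E (odd n) n.-1 <= `|sig al n|.
Proof.
move=> n0; have [e0 S0] := BE_spec (odd n) false hal; have [e1 S1] := BE_spec (odd n) true hal.
apply: (@gap_le_sgm R (@twD R (odd n)) (bkD (odd n) false) (bkD (odd n) true) (twb q (odd n))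
  (bk al (odd n) false) (bk al (odd n) true) _ _ _ 4 _ _ _ _ _ _
  (mat_adm (tw_system R (odd n)) hq) (bk_adm _ _ hal) (bk_adm _ _ hal) (S _) S0 S1 _ _ _ _ _ _ _ (odd n)) => //.
- by rewrite ler1n.
- by move=> j; case: (twD_parity (odd n) j).
- by move=> j; case: (twD_parity (odd n) j).
- by move=> j l; case: (twb_parity (odd n) j l).
- by move=> j l; case: (twb_parity (odd n) j l).
- by move=> j l; case: (twb_parity (odd n) j l).
- by move=> j l; case: (twb_parity (odd n) j l).
Qed.

Lemma even_gap_eq n : (0 < n)%N -> 0 <= sig al n -> E (odd n) n - E (odd n) n.-1 = sig al n.
Proof.
move=> n0; have [e0 S0] := BE_spec (odd n) false hal; have [e1 S1] := BE_spec (odd n) true hal.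
apply: (@gap_eq_sgm R (@twD R (odd n)) (bkD (odd n) false) (bkD (odd n) true) (twb q (odd n))
  (bk al (odd n) false) (bk al (odd n) true) _ _ _ 4 _ _ _ _ _ _
  (mat_adm (tw_system R (odd n)) hq) (bk_adm _ _ hal) (bk_adm _ _ hal) (S _) S0 S1 _ _ _ _ _ _ _ (odd n)) => //.
- by rewrite ler1n.
- by move=> j; case: (twD_parity (odd n) j).
- by move=> j; case: (twD_parity (odd n) j).
- by move=> j l; case: (twb_parity (odd n) j l).
- by move=> j l; case: (twb_parity (odd n) j l).
- by move=> j l; case: (twb_parity (odd n) j l).
- by move=> j l; case: (twb_parity (odd n) j l).
- by move=> i; exact: BE_order.
Qed.

End Full.

Lemma full_function al : cosseq al -> exists q : R -> R, [/\ L2T q,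
  forall m : nat, cosc q (2 * m%:R) = al m & forall m : nat, sinc q (2 * m%:R) = 0].
Proof.
move=> [hal al0]; have sy := per_system R.
pose x k := if odd k then 0 else r2 * al k./2.
have xl2 : l2 x.
  apply: asm_parity; last by apply: eq_asm (asm0 R) => k; rewrite /od /x /= odd_double mul0r.
  by apply: eq_asm (l2Z r2 hal) => k; rewrite /ev /x odd_double doubleK.
have [|||] := @riesz_fischer R (trig (@per_t R) (@per_c R) (@od_s R)) _ _ _ x xl2.
- by move=> k; exact: C1_cont (sys_phi sy k).
- exact: sys_bphi sy.
- exact: sys_orth sy.
move=> q [hq qc _ mq pq]; exists q.
have r20 : r2 != 0 by rewrite gt_eqF // sqrtr_gt0.
have ic t : ig (fun y => q y * csp t y) by exact: igM_cts (sq_ig hq) (cts_cts01 (@csp_cont R t)).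
have isn t : ig (fun y => q y * snp t y) by exact: igM_cts (sq_ig hq) (cts_cts01 (@snp_cont R t)).
have qc' k : @per_c R k * cosc q (@per_t R k) + @od_s R k * sinc q (@per_t R k) = x k.
  rewrite -(qc k) /cosc /sinc -!itgZ // -itgD; [|exact: igZ|exact: igZ].
  by apply: eq_itg => y _; rewrite /trig; ring.
have dt (m : nat) : m.*2%:R = 2 * m%:R :> R by rewrite -muln2 natrM mulrC.
split.
- split; first exact: mq.
  split; last first.
    case: hq => _ /integrableP[_]; apply: le_lt_trans; rewrite le_eqVlt; apply/orP; left; apply/eqP.
    by apply: eq_integral => y _; rewrite /= ger0_norm -expr2 ?sqr_ge0.
  apply: pq => k y; rewrite /trig.
  have [c1 s1] := csp_even R (uphalf k).
  by rewrite /per_t csp_shift snp_shift c1 s1; ring.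
- move=> m; have := qc' m.*2; rewrite /per_t /per_c /od_s /x uphalf_double odd_double doubleK mul0r addr0.
  rewrite double_eq0 dt; case: eqP => [->|_]; first by rewrite al0 !mulr0 mul1r.
  exact: mulfI.
- case=> [|m].
    by rewrite mulr0 /sinc (@eq_itg _ _ (fun=> 0)) ?itg_cst // => y _; rewrite /snp mulr0 mul0r sin0 mulr0.
  have e : uphalf m.*2.+1 = m.+1 by rewrite /= doubleK.
  have := qc' m.*2.+1; rewrite /per_t e dt /per_c /od_s /x /= odd_double /= mul0r add0r.
  by move=> /eqP; rewrite mulf_eq0 (negbTE r20) => /eqP.
Qed.

End Blocks.

Lemma cancel_aux (R : realType) (K p s : R) : p != 0 -> s != 0 ->
  K * (2 / (p * s)) * (p * s ^+ 2) = K * (2 * s).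
Proof. by move=> p0 s0; field; rewrite p0 s0. Qed.

(** * Asymptotics and weak continuity of the signed gaps *)

Section SimplePert.
Variable R : realType.
Variables (t0 : R) (b : nat -> nat -> R) (K : R) (E : nat -> R) (e : nat -> nat -> R).
Let D k : R := (pi * (t0 + k%:R)) ^+ 2.
Hypothesis t00 : 0 <= t0.
Hypothesis H : adm D b K.
Hypothesis S : spec D b E e.
Variable j : nat.
Let t := t0 + j%:R.
Hypothesis tj : 1 / 2 <= t.
Hypothesis Kt : 16 * K ^+ 2 <= t.

Let pi2 : 2 <= pi :> R. Proof. exact: pi_ge2. Qed.
Let pi4 : 4 <= pi ^+ 2 :> R. Proof. by have := pi2; nra. Qed.
Let K0 : 0 <= K. Proof. by case: H => _ _ _ []. Qed.
Let t1 : 0 < t. Proof. by apply: lt_le_trans tj. Qed.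

Let Dm i k : (i <= k)%N -> D i <= D k.
Proof.
move=> ik; rewrite /D ler_pXn2r ?nnegrE ?mulr_ge0 ?pi_ge0 ?addr_ge0 //.
by rewrite ler_wpM2l ?pi_ge0 // lerD2l ler_nat.
Qed.

Let inv_sq_shift n : \sum_(k < n) ((t + k%:R) ^+ 2)^-1 <= 3 / t.
Proof.
have h m : \sum_(k < m.+1) ((t + k%:R) ^+ 2)^-1 <= 3 / t - (t + m%:R)^-1.
  elim: m => [|m IH].
    rewrite big_ord1 !addr0 -exprVn; have u0 : 0 < t^-1 by rewrite invr_gt0.
    have : t^-1 <= 2 by rewrite invf_ple ?posrE //; have := tj; lra.
    by move: u0; move: t^-1 => u; nra.
  rewrite big_ord_recr /=; apply: le_trans (lerD IH (lexx _)) _.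
  have m0 : 0 <= m%:R :> R by [].
  have a0 : 0 < t + m%:R by rewrite ltr_pwDl.
  rewrite (_ : t + m.+1%:R = t + m%:R + 1); last by rewrite -natr1 addrA.
  move: (t + m%:R) a0 => a a0.
  rewrite -addrA lerD2l -subr_ge0.
  have -> : - (a + 1)^-1 - (- a^-1 + ((a + 1) ^+ 2)^-1) = (a * (a + 1) ^+ 2)^-1.
    by field; apply/andP; split; rewrite gt_eqF //; lra.
  by rewrite invr_ge0 mulr_ge0 ?sqr_ge0 // ltW.
case: n => [|n]; first by rewrite big_ord0 divr_ge0 // ltW.
by apply: le_trans (h n) _; rewrite gerBl invr_ge0 addr_ge0 // ltW.
Qed.

Let loc : `|E j - D j| <= pi ^+ 2 * t / 2.
Proof.
have st : Num.sqrt t ^+ 2 = t by rewrite sqr_sqrtr // ltW.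
have st0 : 0 < Num.sqrt t by rewrite sqrtr_gt0.
have Ks : 2 * K <= Num.sqrt t.
  rewrite -(@ler_pXn2r _ 2) ?nnegrE ?mulr_ge0 ?(ltW st0) // st exprMn -natrX.
  by apply: le_trans Kt; rewrite ler_wpM2r ?sqr_ge0 // ler_nat.
have c3 : Num.sqrt 3 <= 2 :> R.
  by rewrite -(@ler_pXn2r _ 2) ?nnegrE ?sqrtr_ge0 // sqr_sqrtr // -natrX ler_nat.
have key : K * (2 * Num.sqrt t) <= pi ^+ 2 * t / 2.
  by rewrite -{2}st; have := pi4; nra.
have up : E j <= D j + K * (2 * Num.sqrt t).
  apply: le_trans (eig_upper H S j Dm) _; rewrite lerD2l ler_wpM2l //.
  apply: (@le_trans _ _ (Num.sqrt (4 * t))).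
    rewrite ler_sqrt ?mulr_ge0 ?(ltW t1) // -natr1.
    have jt : j%:R <= t by rewrite /t lerDr.
    by have := tj; lra.
  by rewrite sqrtrM // (_ : 4 = 2 ^+ 2) ?sqrtr_sqr ?ger0_norm // -natrX.
have pp : 0 < pi :> R by exact: pi_gt0.
have sD : Num.sqrt (D j) = pi * t.
  by rewrite /D sqrtr_sqr ger0_norm // mulr_ge0 ?ltW.
pose T := 2 / (pi * Num.sqrt t) : R.
have T0 : 0 <= T by rewrite divr_ge0 // mulr_ge0 ?sqrtr_ge0 // ltW.
have TE : K * T * Num.sqrt (D j) = K * (2 * Num.sqrt t).
  rewrite sD /T; have h : K * (2 / (pi * Num.sqrt t)) * (pi * Num.sqrt t ^+ 2) = K * (2 * Num.sqrt t).
    exact: cancel_aux (lt0r_neq0 pp) (lt0r_neq0 st0).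
  by rewrite st in h.
have lo : D j - K * (2 * Num.sqrt t) <= E j.
  rewrite -TE; apply: (eig_lower H S Dm) => //.
  - by rewrite /D exprn_gt0 // mulr_gt0.
  - move=> n; apply: (@le_trans _ _ (pi ^- 2 * \sum_(k < n) ((t + k%:R) ^+ 2)^-1)).
      rewrite mulr_sumr; apply: ler_sum => k _.
      by rewrite /D exprMn invfM natrD addrA.
    have -> : T ^+ 2 = pi ^- 2 * (4 / t).
      by rewrite /T expr_div_n exprMn st -natrX invfM mulrCA.
    rewrite ler_wpM2l ?invr_ge0 ?sqr_ge0 //; apply: le_trans (inv_sq_shift n) _.
    by rewrite ler_wpM2r ?invr_ge0 ?(ltW t1) // ler_nat.
  rewrite sD /T mulrA ler_pdivrMr ?mulr_gt0 //.
  rewrite (_ : 2 * (pi * t) * (pi * Num.sqrt t) = 2 * pi ^+ 2 * t * Num.sqrt t); last by ring.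
  rewrite mulrC; apply: le_trans Ks _; rewrite ler_peMl ?(ltW st0) //.
  by have := pi4; have := tj; nra.
by rewrite ler_norml; apply/andP; split; lra.
Qed.

Let sum_dist n : \sum_(k < n | k != j :> nat) (((k%:R - j%:R) ^+ 2)^-1 : R) <= 8.
Proof.
have [i2 in2] := inv_l2 R.
have p m : 0 <= inv R m * inv R m by rewrite -expr2 sqr_ge0.
have h m : \sum_(k < m) inv R k * inv R k <= 4.
  apply: le_trans (psum_le_sm m i2 p) _; rewrite -[sm _]/(dot (inv R) (inv R)) -nrm_sqr //.
  by have := nrm_ge0 (inv R); nra.
have -> : (8 : R) = 2%:R * 4 by rewrite -natrM.
apply: le_trans (@sum_fiber_nat R (fun m => inv R m * inv R m) (fun k => ddn k j) 2 4 p h _ n).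
  rewrite big_mkcond; apply: ler_sum => k _; case: eqP => _; first exact: p.
  by rewrite /inv -invfM -expr2; have [->|->] := ddn_cases R k j; rewrite ?sqrrN.
by move=> d; exists [:: (j + d)%N; (j - d)%N]; split=> // k; rewrite /ddn !inE; lia.
Qed.

(** [|D k - D j|] is at least [pi^2 t |k - j|], and [loc] leaves half of it for [|E j - D k|]. The
    inverse squares sum to at most [(2 / t) ^+ 2], and [scalar_pert] gives the bound. *)
Lemma simple_pert : `|E j - D j - b j j| <= 4 * K ^+ 2 / t.
Proof.
pose g (k : nat) : R := pi ^+ 2 * t / 2 * `|k%:R - j%:R|.
have p0 : 0 < pi ^+ 2 * t / 2 by rewrite divr_gt0 // mulr_gt0 // exprn_gt0 // pi_gt0.
have G : forall n, \sum_(k < n | k != j :> nat) (g k ^+ 2)^-1 <= (2 / t) ^+ 2.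
  move=> n; apply: (@le_trans _ _ (((pi ^+ 2 * t / 2) ^+ 2)^-1 * 8)).
    apply: le_trans (ler_wpM2l _ (sum_dist n)); last by rewrite invr_ge0 sqr_ge0.
    rewrite mulr_sumr; apply: ler_sum => k _.
    by rewrite /g exprMn sqr_normr invfM.
  rewrite ler_pdivrMl ?exprn_gt0 //.
  have -> : (pi ^+ 2 * t / 2) ^+ 2 * (2 / t) ^+ 2 = (pi ^+ 2) ^+ 2 by field; rewrite gt_eqF.
  by have := pi4; nra.
have tt0 : 0 <= 2 / t by rewrite divr_ge0 // ltW.
rewrite (_ : 4 * K ^+ 2 / t = 2 * K ^+ 2 * Num.sqrt ((2 / t) ^+ 2)); last first.
  by rewrite sqrtr_sqr ger0_norm //; field; rewrite gt_eqF.
apply: (scalar_pert H S (g := g)) => // [k kj|]; last first.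
  rewrite expr_div_n mulrA ler_pdivrMr ?exprn_gt0 //; have := Kt; have := tj; nra.
split.
  by rewrite /g mulr_gt0 // normr_gt0 subr_eq0 eqr_nat.
have d : `|D k - D j| = pi ^+ 2 * `|k%:R - j%:R| * (t + (t0 + k%:R)).
  rewrite (_ : D k - D j = pi ^+ 2 * (k%:R - j%:R) * (t + (t0 + k%:R))); last by rewrite /D /t; ring.
  rewrite normrM [X in X * _]normrM (ger0_norm (sqr_ge0 _)) [`|t + _|]ger0_norm //.
  by rewrite addr_ge0 ?addr_ge0 // ltW.
have h1 : 1 <= `|k%:R - j%:R| :> R.
  have [h|h|h] := ltngtP k j; last by rewrite h eqxx in kj.
    by rewrite distrC -natrB ?(ltnW h) // ger0_norm // ler1n subn_gt0.
  by rewrite -natrB ?(ltnW h) // ger0_norm // ler1n subn_gt0.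
have h2 : `|D k - D j| <= `|E j - D k| + `|E j - D j|.
  have tri (u v z : R) : `|u - v| <= `|z - u| + `|z - v|.
    by rewrite (_ : u - v = (z - v) - (z - u)); [rewrite [leRHS]addrC ler_normB|ring].
  exact: tri.
have h3 : pi ^+ 2 * t * `|k%:R - j%:R| <= `|D k - D j|.
  rewrite d mulrAC ler_wpM2l //; last by rewrite lerDl addr_ge0.
  by rewrite mulr_ge0 // sqr_ge0.
rewrite /g; have := loc; have : pi ^+ 2 * t / 2 <= pi ^+ 2 * t / 2 * `|k%:R - j%:R| by rewrite ler_peMr // ltW.
lra.
Qed.

End SimplePert.

Section SigmaEstimates.
Variable R : realType.
Implicit Types (al : nat -> R).

Lemma l2_limit (U : set_system nat) (X : nat -> nat -> R) al (B : R) : UltraFilter U ->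
  (forall k, l2 (X k)) -> (forall k, nrm (X k) <= B) -> (forall m, (fun k => X k m) @ U --> al m) ->
  l2 al /\ nrm al <= B.
Proof.
move=> UU hX XB cX.
have B0 : 0 <= B by apply: le_trans (XB 0%N); exact: sqrtr_ge0.
have h n : \sum_(m < n) al m * al m <= B ^+ 2.
  have c : (fun k => \sum_(m < n) X k m * X k m) @ U --> \sum_(m < n) al m * al m.
    by apply: (@cvg_sum_ord R U _ n (fun k m => X k m * X k m) (fun m => al m * al m)) => m; exact: cvgM.
  rewrite -(cvg_lim (@Rhausdorff R) c); apply: limr_le; first exact: cvgP c.
  apply: nearW => k; apply: le_trans (psum_le_sm n (hX k) _) _.
    by move=> m; rewrite -expr2 sqr_ge0.
  by rewrite -[sm _]/(dot (X k) (X k)) -nrm_sqr // ler_pXn2r ?nnegrE ?sqrtr_ge0.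
have l : l2 al by apply: (asm_bound _ h) => m; rewrite -expr2 sqr_ge0.
split=> //; rewrite -(@ler_pXn2r _ 2) ?nnegrE ?sqrtr_ge0 // nrm_sqr //.
exact: sm_le_bound.
Qed.

(** An entry of [bk] involves two coefficients only, so coordinatewise convergence with bounded
    norms is what [weak_cont] asks for. *)
Lemma BE_cvg (U : set_system nat) (X : nat -> nat -> R) al (B : R) a P j : UltraFilter U ->
  (forall k, cosseq (X k)) -> cosseq al -> (forall k, nrm (X k) <= B) -> nrm al <= B ->
  (forall m, (fun k => X k m) @ U --> al m) -> (fun k => BE (X k) a P j) @ U --> BE al a P j.
Proof.
move=> UU hX hal XB alB cX.
have sy := bk_system R a P; have adl := adm_le alB (bk_adm a P hal).
have adX k := adm_le (XB k) (bk_adm a P (hX k)).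
have B0 : 0 <= B by case: adl => _ _ _ [].
apply/cvgrPdist_le => e0 e00.
have [D0 DV _ _] := adl.
have [L [eta [eta0 h]]] := weak_cont D0 DV (sys_Dmono sy) j B0 e00.
have [e S] := BE_spec a P hal.
have nr : \forall k \near U, forall i l : 'I_L, `|bk (X k) a P i l - bk al a P i l| <= eta.
  apply: filter_forall => i; apply: filter_forall => l.
  have : (fun k => bk (X k) a P i l) @ U --> bk al a P i l.
    rewrite /bk; apply: cvgM; first exact: cvg_cst.
    by case: P {sy adl adX D0 DV h S}; [apply: cvgB|apply: cvgD]; exact: cX.
  by move=> /cvgrPdist_le /(_ eta eta0); apply: filterS => k; rewrite distrC.
apply: filterS nr => k hk; have [e' S'] := BE_spec a P (hX k).
rewrite distrC; apply: (h _ _ _ _ _ _ adl (adX k) S S') => i l iL lL.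
exact: (hk (Ordinal iL) (Ordinal lL)).
Qed.

Lemma sig_cvg (U : set_system nat) (X : nat -> nat -> R) al (B : R) n : UltraFilter U ->
  (forall k, cosseq (X k)) -> cosseq al -> (forall k, nrm (X k) <= B) -> nrm al <= B ->
  (forall m, (fun k => X k m) @ U --> al m) -> (fun k => sig (X k) n) @ U --> sig al n.
Proof.
by move=> UU *; apply: cvgM; [exact: cvg_cst|apply: cvgB; apply: BE_cvg].
Qed.

(** Both block eigenvalues are near [(pi n / 2) ^ 2] and their diagonal entries are [al n / 4] and
    [- al n / 4]; four times the difference is [2 * al n]. The two errors of [8 |al|^2 / n] are also
    multiplied by 4. *)
Lemma sig_pert al n : cosseq al -> (0 < n)%N -> 32 * nrm al ^+ 2 <= n%:R ->
  `|sig al n - 2 * al n| <= 64 * nrm al ^+ 2 / n%:R.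
Proof.
move=> hal n0 Kn; pose jj (P : bool) := if P then n.-1./2 else n./2.
have n1 : 1 <= n%:R :> R by rewrite ler1n.
have est P : `|BE al (odd n) P (jj P) - (pi * (n%:R / 2)) ^+ 2 - (if P then - al n / 4 else al n / 4)|
    <= 8 * nrm al ^+ 2 / n%:R.
  have [a na] : exists a, a = odd n by exists (odd n).
  rewrite -na; pose t0 : R := bkt R a P 0.
  have bt k : bkt R a P k = t0 + k%:R.
    by rewrite /t0 /bkt; case: (a); case: (P); rewrite /hh_t /dd_t /nn_t -?natr1; ring.
  have t00 : 0 <= t0 by rewrite /t0 /bkt; case: (a); case: (P); rewrite /hh_t /dd_t /nn_t; lra.
  have ji : (jj P + jj P + bko a P = n)%N.
    by rewrite /jj /bko na; clear -n0; case: (P); case: ifP; lia.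
  have tn : t0 + (jj P)%:R = n%:R / 2.
    by rewrite -bt; have := bkt_add R a P (jj P) (jj P); rewrite ji; lra.
  have [e S] := BE_spec a P hal; have H := bk_adm a P hal.
  have eD : bkD R a P = fun k => (pi * (t0 + k%:R)) ^+ 2.
    by apply/funext => k; rewrite /bkD bt.
  rewrite eD in S H.
  have := @simple_pert R t0 (bk al a P) (nrm al) (BE al a P) e t00 H S (jj P); rewrite tn.
  have w2 : bkw R a P (jj P) * bkw R a P (jj P) = 2.
    have r2 : Num.sqrt 2 * Num.sqrt 2 = 2 :> R by rewrite -expr2 sqr_sqrtr.
    rewrite /bkw; case: ifP => [_ //|/norP[a0 P0]]; rewrite /nn_c /jj (negbTE P0).
    case: eqP => // n20; move: ji; rewrite /jj /bko (negbTE a0) (negbTE P0) n20; lia.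
  have dd0 : ddn (jj P) (jj P) = 0%N by rewrite /ddn subnn.
  rewrite (_ : bk al a P (jj P) (jj P) = if P then - al n / 4 else al n / 4); last first.
    by rewrite /bk w2 ji dd0 hal.2; case: (P); field.
  rewrite (_ : 4 * nrm al ^+ 2 / (n%:R / 2) = 8 * nrm al ^+ 2 / n%:R); last first.
    by field; rewrite gt_eqF // ltr0n.
  by apply; lra.
have := est true; have := est false; rewrite /sig /sgm /jj.
have e (c : R) : c * nrm al ^+ 2 / n%:R = c * (nrm al ^+ 2 / n%:R) by rewrite mulrA.
rewrite !e; move: (nrm al ^+ 2 / n%:R) => k; rewrite !ler_norml => /andP[? ?] /andP[? ?].
by apply/andP; split; lra.
Qed.

End SigmaEstimates.

(** * A priori bounds *)

Section TrigPoly.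
Variable R : realType.
Implicit Types (al : nat -> R) (x y : R).

Let itgc (i j : nat) : itg (csp (2 * (i%:R - j%:R)) : R -> R) = (i == j)%:R /\
  itg (snp (2 * (i%:R - j%:R)) : R -> R) = 0.
Proof.
have h (d : nat) : itg (csp (2 * d%:R) : R -> R) = (d == 0%N)%:R /\ itg (snp (2 * d%:R) : R -> R) = 0.
  case: d => [|d].
    split; [rewrite -[RHS](itg_cst 1)|rewrite -[RHS](itg_cst 0)]; apply: eq_itg => y _.
      by rewrite mulr0 csp0.
    by rewrite mulr0 snp0.
  by have := @itg_csp_even R d.+1 isT; rewrite -muln2 natrM mulrC.
have dd : (ddn i j == 0%N) = (i == j) by rewrite /ddn; lia.
have [h1 h2] := h (ddn i j); rewrite dd in h1.
have [->|->] := ddn_cases R i j; first by [].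
rewrite mulrN; split; first by rewrite -h1; apply: eq_itg => y _; rewrite cspN.
rewrite (@eq_itg _ _ (fun y => -1 * snp (2 * (ddn i j)%:R) y)); last by move=> y _; rewrite snpN mulN1r.
by rewrite itgZ ?h2 ?mulr0 //; apply: ig_cts; apply: cts_cts01; exact: snp_cont.
Qed.

Let igc t : ig (csp t : R -> R). Proof. by apply: ig_cts; apply: cts_cts01; exact: csp_cont. Qed.
Let igs t : ig (snp t : R -> R). Proof. by apply: ig_cts; apply: cts_cts01; exact: snp_cont. Qed.

Let prods (i j : nat) : (0 < i)%N ->
  [/\ itg (fun y => csp (2 * i%:R) y * csp (2 * j%:R) y) = 2^-1 * (i == j)%:R :> R,
      itg (fun y => snp (2 * i%:R) y * csp (2 * j%:R) y) = 0 :> R,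
      itg (fun y => csp (2 * i%:R) y * snp (2 * j%:R) y) = 0 :> R &
      itg (fun y => snp (2 * i%:R) y * snp (2 * j%:R) y) = 2^-1 * (i == j)%:R :> R].
Proof.
move=> i0; have [c1 s1] := itgc i j; have [c2 s2] := itgc (i + j) 0.
have ij : (i + j == 0)%N = false by lia.
rewrite ij subr0 in c2 s2.
have e1 : 2 * i%:R - 2 * j%:R = 2 * (i%:R - j%:R) :> R by ring.
have e2 : 2 * i%:R + 2 * j%:R = 2 * (i + j)%:R :> R by rewrite natrD; ring.
have lin (f : R -> R) (p r u v : R) : (forall y, f y = 2^-1 * (p * csp (2 * (i%:R - j%:R)) y +
    (r * csp (2 * (i + j)%:R) y + (u * snp (2 * (i%:R - j%:R)) y + v * snp (2 * (i + j)%:R) y)))) ->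
    itg f = 2^-1 * p * (i == j)%:R.
  move=> hf; rewrite (eq_itg (fun y _ => hf y)) itgZ; last by do 3?apply: igD; exact: igZ.
  rewrite itgD; [|exact: igZ|by do 2?apply: igD; exact: igZ].
  rewrite itgD; [|exact: igZ|by apply: igD; exact: igZ].
  rewrite itgD; [|exact: igZ|exact: igZ].
  by rewrite !itgZ // c1 c2 s1 s2 !mulr0 !addr0 mulrA.
split.
- by rewrite (lin _ 1 1 0 0) ?mulr1 // => y; rewrite -e1 -e2 cspB cspD; field.
- by rewrite (lin _ 0 0 1 1) ?mulr0 ?mul0r // => y; rewrite -e1 -e2 snpB snpD; field.
- by rewrite (lin _ 0 0 (-1) 1) ?mulr0 ?mul0r // => y; rewrite -e1 -e2 snpB snpD; field.
- by rewrite (lin _ 1 (-1) 0 0) ?mulr1 // => y; rewrite -e1 -e2 cspB cspD; field.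
Qed.

Variables (N : nat) (al : nat -> R).
Hypothesis al0 : al 0%N = 0.
Hypothesis alN0 : forall m, (N < m)%N -> al m = 0.

(** The even trigonometric polynomial with cosine coefficients [al], translated by [x]; the factor 2
    accounts for the mean square 1/2 of a cosine. *)
Definition tq x y : R := \sum_(m < N.+1) 2 * al m * csp (2 * m%:R) (y + x).

Let tqE x y : tq x y = \sum_(m < N.+1) ((2 * al m * csp (2 * m%:R) x) * csp (2 * m%:R) y +
  (- (2 * al m * snp (2 * m%:R) x)) * snp (2 * m%:R) y).
Proof. by apply: eq_bigr => m _; rewrite csp_shift; ring. Qed.

Let tq_term x (g : R -> R) : continuous g -> itg (fun y => tq x y * g y) =
  \sum_(m < N.+1) ((2 * al m * csp (2 * m%:R) x) * itg (fun y => csp (2 * m%:R) y * g y) +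
  (- (2 * al m * snp (2 * m%:R) x)) * itg (fun y => snp (2 * m%:R) y * g y)).
Proof.
move=> cg; have ic t : ig (fun y => csp t y * g y).
  by apply: ig_cts; apply: cts01M; apply: cts_cts01 => //; exact: csp_cont.
have isn t : ig (fun y => snp t y * g y).
  by apply: ig_cts; apply: cts01M; apply: cts_cts01 => //; exact: snp_cont.
rewrite (@eq_itg _ _ (fun y => \sum_(m < N.+1)
  ((2 * al m * csp (2 * m%:R) x) * (csp (2 * m%:R) y * g y) +
  (- (2 * al m * snp (2 * m%:R) x)) * (snp (2 * m%:R) y * g y)))); last first.
  by move=> y _; rewrite tqE mulr_suml; apply: eq_bigr => m _; ring.
rewrite itg_sum; last by move=> m; apply: igD; exact: igZ.
by apply: eq_bigr => m _; rewrite itgD ?itgZ //; exact: igZ.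
Qed.

Lemma tq_coef x (n : nat) : cosc (tq x) (2 * n%:R) = al n * csp (2 * n%:R) x /\
  sinc (tq x) (2 * n%:R) = - (al n * snp (2 * n%:R) x).
Proof.
have pick (F : nat -> R) : \sum_(m < N.+1) al m * F m * (m == n :> nat)%:R = al n * F n.
  have [nN|nN] := ltnP n N.+1.
    rewrite (bigD1 (Ordinal nN)) //= eqxx mulr1 big1 ?addr0 // => m.
    by rewrite -val_eqE /= => /negbTE ->; rewrite mulr0.
  rewrite (alN0 nN) mul0r big1 // => m _.
  by case: eqP => [mn|_]; [have := ltn_ord m; rewrite mn ltnNge nN|rewrite mulr0].
rewrite /cosc /sinc !tq_term; [|exact: snp_cont|exact: csp_cont].
split.
  rewrite -(pick (fun m => csp (2 * m%:R) x)); apply: eq_bigr => -[[|m] mN] _ /=.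
    by rewrite al0; ring.
  have [-> -> _ _] := prods n (ltn0Sn m); by field.
rewrite -mulrN -(pick (fun m => - snp (2 * m%:R) x)); apply: eq_bigr => -[[|m] mN] _ /=.
  by rewrite al0; ring.
by have [_ _ -> ->] := prods n (ltn0Sn m); field.
Qed.

Lemma tq_cont x : continuous (tq x).
Proof.
rewrite /tq; elim: N.+1 => [|m IH] y.
  by rewrite (_ : (fun y => _) = fun=> 0); [exact: cvg_cst|apply/funext => z; rewrite big_ord0].
rewrite (_ : (fun y => _) = fun y => (\sum_(k < m) 2 * al k * csp (2 * k%:R) (y + x)) +
    2 * al m * csp (2 * m%:R) (y + x)); last by apply/funext => z; rewrite big_ord_recr.
apply: cvgD; first exact: IH.
apply: cvgM; first exact: cvg_cst.
apply: (@continuous_comp _ _ _ (fun y => y + x) (csp (2 * m%:R))); last exact: csp_cont.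
by apply: cvgD; [exact: cvg_id|exact: cvg_cst].
Qed.

Lemma tq_sq x : sq (tq x). Proof. by apply: sq_cts; apply: cts_cts01; exact: tq_cont. Qed.

Lemma tq_norm x : itg (fun y => tq x y * tq x y) = 2 * dot al al.
Proof.
rewrite tq_term; last exact: tq_cont.
have com (f : R -> R) : itg (fun y => f y * tq x y) = itg (fun y => tq x y * f y).
  by apply: eq_itg => y _; rewrite mulrC.
rewrite /dot (@sm_fin _ _ N.+1); last by move=> k kN; rewrite (alN0 kN) mul0r.
rewrite mulr_sumr; apply: eq_bigr => m _; rewrite !com //.
have [] := tq_coef x m; rewrite /cosc /sinc => -> ->.
have e (z : R) : z = z * (csp (2 * m%:R) x ^+ 2 + snp (2 * m%:R) x ^+ 2) by rewrite csp_sqr mulr1.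
by rewrite [RHS]e; ring.
Qed.

Section Shift.
Variables (a : bool) (x : R).
(** The coefficients of the basis function [k] translated by [x], from the addition formulas. *)
Let cx k := twc R a k * csp (twt R a k) x + od_s R k * snp (twt R a k) x.
Let sx k := od_s R k * csp (twt R a k) x - twc R a k * snp (twt R a k) x.

Let sy := tw_system R a.

(** An original basis function combines translated ones of the same frequency, so a function
    orthogonal to the translated family is orthogonal to the original one, and completeness carries
    over. *)
Let unrot k y : twphi a k y = csp (twt R a k) x * trig (twt R a) cx sx k y -
    twe R a k * snp (twt R a k) x * trig (twt R a) cx sx (tws a k) y /\
  twpsi a k y = csp (twt R a k) x * trig' (twt R a) cx sx k y -
    twe R a k * snp (twt R a k) x * trig' (twt R a) cx sx (tws a k) y.
Proof.
have s2 := csp_sqr (twt R a k) x.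
rewrite /twphi /twpsi /trig /trig' /cx /sx twt_s.
have [-> ->] := twcs R a k; have [-> ->] := twcs R a (tws a k).
case z : (twz a k).
  have [a0 k0] := twz_a z; have e : tws a k = k by rewrite /tws z k0.
  have t0 : twt R a k = 0 by rewrite twtE (twg0 z) a0 mulr0 addr0.
  by rewrite e /twe z k0 /= -k0 t0 !csp0 !snp0; split; ring.
rewrite tws_odd ?z // /twe /twa z (negbTE (tws_z (negbT z))).
move: s2; set C := csp (twt R a k) x; set S := snp (twt R a k) x => s2.
have eq (w : R) : w = w * (C ^+ 2 + S ^+ 2) by rewrite s2 mulr1.
by case: (odd k) => /=; split; rewrite [LHS]eq; ring.
Qed.

Let perp (h : R -> R) (F G : nat -> R -> R) : cts01 h -> (forall k, continuous (F k)) ->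
  (forall k y, G k y = csp (twt R a k) x * F k y - twe R a k * snp (twt R a k) x * F (tws a k) y) ->
  (forall k, itg (fun y => h y * F k y) = 0) -> forall k, itg (fun y => h y * G k y) = 0.
Proof.
move=> ch cF e hF k.
have ih i : ig (fun y => h y * F i y) by apply: ig_cts; apply: cts01M => //; apply: cts_cts01.
rewrite (@eq_itg _ _ (fun y => csp (twt R a k) x * (h y * F k y) +
  (- (twe R a k * snp (twt R a k) x)) * (h y * F (tws a k) y))); last by move=> y _; rewrite e; ring.
by rewrite itgD ?itgZ ?hF ?mulr0 ?addr0 //; exact: igZ.
Qed.

Lemma shift_system : system (Twist (if a then -1 else 1)) (trig (twt R a) cx sx)
  (trig' (twt R a) cx sx) (twD R a).
Proof.
have per k : csp (twt R a k) 1 = (if a then -1 else 1) /\ snp (twt R a k) 1 = 0.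
  by rewrite /twt; case: (a); [exact: csp_odd|exact: csp_even].
apply: trig_system.
- exact: (sys_bc sy).
- move=> k; rewrite /twt; case: (a); rewrite /anti_t /per_t !ler_nat; [exact: half_bounds|exact: uphalf_bounds].
- move=> i k ik; rewrite !twtE lerD2r ler_wpM2l // ler_nat /twg.
  by case: (a); rewrite ?half_leq // uphalf_leq.
- move=> k; case z : (twz a k).
    have [a0 k0] := twz_a z; left.
    have t0 : twt R a k = 0 by rewrite twtE (twg0 z) a0 mulr0 addr0.
    have [e1 e2] := twcs R a k; split => //; rewrite /cx /sx e1 e2 t0 csp0 snp0 k0 /= /twa -k0 z.
    by split; ring.
  right; split.
    rewrite twtE; move: z; rewrite /twz /twg; case: (a) => /=; first by move=> _; rewrite ltr_wpDl.
    by move=> kn; rewrite addr0 mulr_gt0 // ltr0n; lia.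
  rewrite /cx /sx; have [-> ->] := twcs R a k; rewrite /twa z.
  have r2 : Num.sqrt 2 ^+ 2 = 2 :> R by rewrite sqr_sqrtr.
  have s2 := csp_sqr (twt R a k) x.
  transitivity (Num.sqrt 2 ^+ 2 * (csp (twt R a k) x ^+ 2 + snp (twt R a k) x ^+ 2)).
    by case: (odd k); ring.
  by rewrite r2 s2 mulr1.
- move=> k l kl tkl.
  have gkl : twg a k = twg a l.
    by move/eqP: tkl; rewrite !twtE (inj_eq (addIr _)) (inj_eq (mulfI _)) ?pnatr_eq0 // eqr_nat => /eqP.
  have zk : ~~ twz a k.
    apply/negP => /twz_a[a0 k0]; move: gkl kl; rewrite a0 k0 /twg.
    by case: (l).
  have zl : ~~ twz a l.
    apply/negP => /twz_a[a0 k0]; move: gkl kl; rewrite a0 k0 /twg.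
    by case: (k).
  have okl : odd k != odd l.
    by apply: contra kl => /eqP o; move: gkl; rewrite /twg; case: (a); lia.
  split.
    rewrite twtE; move: zk; rewrite /twz /twg; case: (a) => /=; first by move=> _; rewrite ltr_wpDl.
    by move=> kn; rewrite addr0 mulr_gt0 // ltr0n; lia.
  rewrite /cx /sx -tkl; have [-> ->] := twcs R a k; have [-> ->] := twcs R a l.
  by move: okl; case: (odd k); case: (odd l) => // _; ring.
- move=> k; have [c1 s1] := per k; rewrite /= /trig c1 s1 csp_x0 snp_x0; by case: ifP => _; ring.
- move=> k; have [c1 s1] := per k; rewrite /= /trig' c1 s1 csp_x0 snp_x0; by case: ifP => _; ring.
- move=> h ch hF; apply: (sys_compl sy ch); apply: (perp ch _ (fun k y => (unrot k y).1) hF) => k.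
  by rewrite (_ : trig _ _ _ k = fun y => cx k * csp (twt R a k) y + sx k * snp (twt R a k) y) //; exact: C1_cont (trig_C1 _ _ _).
- move=> h ch hF; apply: (sys_dual sy ch); apply: (perp ch _ (fun k y => (unrot k y).2) hF) => k.
  exact: (trig_C1 _ _ _).2.
- have [z|z] : a = false \/ a = true by case: (a); [right|left].
    right; exists 0%N; have t0 : twt R a 0 = 0 by rewrite /twt z /per_t.
    split; last by rewrite t0 mulr0 expr0n.
    by move=> y; rewrite /trig /cx /sx t0 !csp0 !snp0 /twc z /per_c /od_s /=; ring.
  left; exists (2^-1) => k; rewrite (C1_itg (trig_C1 (twt R a k) (cx k) (sx k))).
  by have [c1 s1] := per k; rewrite /trig c1 s1 csp_x0 snp_x0 z; field.
Qed.

Lemma shift_mat : mat (trig (twt R a) cx sx) (tq x) = twb (tq 0) a.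
Proof.
apply/funext => k; apply/funext => l; rewrite /twb /twphi !mat_trig ?twt_sub ?twt_add; [|exact: tq_sq|exact: tq_sq].
have co (i j : nat) y : cosc (tq y) (2 * (i%:R - j%:R)) = al (ddn i j) * csp (2 * (i%:R - j%:R)) y /\
    sinc (tq y) (2 * (i%:R - j%:R)) = - (al (ddn i j) * snp (2 * (i%:R - j%:R)) y).
  have [h1 h2] := tq_coef y (ddn i j).
  have [->|->] := ddn_cases R i j; first by [].
  by rewrite mulrN alN beN ?cspN ?snpN ?h1 ?h2; [split; ring|exact: tq_sq].
rewrite !(co _ _ _).1 !(co _ _ _).2 !(tq_coef _ _).1 !(tq_coef _ _).2 !csp_x0 !snp_x0.
rewrite -!twt_sub -!twt_add cspB snpB cspD snpD /cx /sx.
have s2 := csp_sqr (twt R a k) x; have s2' := csp_sqr (twt R a l) x.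
have eq (w : R) : w = w * (csp (twt R a k) x ^+ 2 + snp (twt R a k) x ^+ 2) *
  (csp (twt R a l) x ^+ 2 + snp (twt R a l) x ^+ 2) by rewrite s2 s2' !mulr1.
by rewrite [RHS]eq; ring.
Qed.

End Shift.

(** In the translated basis the translated potential has the matrix of the original one, by
    [shift_mat]. Two bases for the same boundary condition give the same eigenvalues: [compare] in
    both directions, with no constraint. *)
Lemma shift_eig a x E e E' e' j : spec (twD R a) (twb (tq 0) a) E e ->
  spec (twD R a) (twb (tq x) a) E' e' -> E' j = E j.
Proof.
move=> S S'; rewrite -(shift_mat a x) in S.
have h u : forall u1 : R, ess (Twist (if a then -1 else 1)) u u1 ->
  (forall s : 'I_0, (0 : R) * u + 0 * u1 = 0) -> ess (Twist (if a then -1 else 1)) u u1 by [].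
apply/eqP; rewrite eq_le; apply/andP; split.
  exact: (compare (shift_system a x) (tw_system R a) (tq_sq x) S S' j h).
exact: (compare (tw_system R a) (shift_system a x) (tq_sq x) S' S j h).
Qed.

Local Notation ddphi := (trig (dd_t R) (zz R) (dd_s R)).
Local Notation ddD := (fun k => (pi * dd_t R k) ^+ 2).

(** The Dirichlet form domain lies in the twisted one and is cut out by the single condition
    [u 0 = 0]. Since the twisted eigenvalues do not depend on the translation, neither do the
    intervals. *)
Lemma dd_interlace a x E e M m j : spec (twD R a) (twb (tq 0) a) E e ->
  spec ddD (mat ddphi (tq x)) M m -> E j <= M j <= E j.+1.
Proof.
move=> S SM; have [E' [e' S']] := spec_exists (mat_adm (tw_system R a) (tq_sq x)).
rewrite -!(shift_eig _ S S'); apply/andP; split.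
  apply: (@compare R _ _ _ _ _ _ _ _ (dd_system R) (tw_system R a) _ (tq_sq x) _ _ _ _ SM S' 0 j
    (fun=> 0) (fun=> 0)) => u0 u1 /= [] /(_ isT) -> /(_ isT) -> _.
  by rewrite mulr0.
apply: (@compare R _ _ _ _ _ _ _ _ (tw_system R a) (dd_system R) _ (tq_sq x) _ _ _ _ S' SM 1 j
    (fun=> 1) (fun=> 0)) => u0 u1 /= -> /(_ ord0).
by rewrite mul1r mul0r addr0 => ->; rewrite mulr0.
Qed.

End TrigPoly.

Lemma inv_sq_sum (R : realType) n : \sum_(l < n) (l.+1%:R)^-1 ^+ 2 <= 4 :> R.
Proof.
have [i2 in2] := inv_l2 R.
have i0 k : 0 <= inv R k * inv R k by rewrite -expr2 sqr_ge0.
have := psum_le_sm n.+1 i2 i0; rewrite big_ord_recl.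
have -> : \sum_(l < n) inv R (lift ord0 l) * inv R (lift ord0 l) = \sum_(l < n) (l.+1%:R)^-1 ^+ 2.
  by apply: eq_bigr => l _; rewrite lift0 -expr2.
have := i0 0%N; rewrite -[sm _]/(dot (inv R) (inv R)) -nrm_sqr //=.
by have := nrm_ge0 (inv R); nra.
Qed.

(** * Dirichlet traces and the low modes *)

Section DirichletTrace.
Variable R : realType.
Variables (b : nat -> nat -> R) (K : R) (E : nat -> R) (e : nat -> nat -> R).
Let D k : R := (pi * dd_t R k) ^+ 2.
Hypothesis H : adm D b K.
Hypothesis S : spec D b E e.
Variable M : nat.
Hypothesis M0 : (0 < M)%N.
Hypothesis KM : 16 * K ^+ 2 <= M%:R.

Let K0 : 0 <= K. Proof. by case: H => _ _ _ []. Qed.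
Let m : R := M%:R.
Let m1 : 1 <= m. Proof. by rewrite ler1n. Qed.
Let p4 : 4 <= pi ^+ 2 :> R. Proof. by have := pi_ge2 R; nra. Qed.
Let sm0 : 0 < Num.sqrt m. Proof. by rewrite sqrtr_gt0 (lt_le_trans _ m1). Qed.
Let sm2 : Num.sqrt m ^+ 2 = m. Proof. by rewrite sqr_sqrtr // (le_trans _ m1). Qed.

Let Ksm : K * Num.sqrt m <= pi ^+ 2 * m.
Proof.
have : 4 * K <= Num.sqrt m.
  rewrite -(@ler_pXn2r _ 2) ?nnegrE ?mulr_ge0 ?(ltW sm0) // sm2 exprMn -natrX; exact: KM.
by have := p4; have := sm2; have := sm0; have := K0; nra.
Qed.

(** The threshold for [kyfan_lower]: the last low diagonal entry, of index [M - 1] and value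
    [pi^2 M^2], plus [K * sqrt M]. *)
Let c := pi ^+ 2 * m ^+ 2 + K * Num.sqrt m.

Let Dc l : pi ^+ 2 * ((l.+1%:R) * (m + l.+1%:R)) <= D (M + l)%N - c.
Proof.
rewrite /D /dd_t /c -addnS natrD -/m; have := Ksm; set k := l.+1%:R : R.
have k1 : 1 <= k by rewrite ler1n.
move=> h; have : pi ^+ 2 * m <= pi ^+ 2 * (m * k) by rewrite ler_wpM2l ?sqr_ge0 // ler_peMr // (le_trans _ m1).
have -> : (pi * (m + k)) ^+ 2 = pi ^+ 2 * (m ^+ 2) + 2 * (pi ^+ 2 * (m * k)) + pi ^+ 2 * (k * k) by ring.
have -> : pi ^+ 2 * (k * (m + k)) = pi ^+ 2 * (m * k) + pi ^+ 2 * (k * k) by ring.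
lra.
Qed.

Let hT n : \sum_(l < n) (D (M + l)%N - c)^-1 <= (Num.sqrt m)^-1.
Proof.
have m0 : 0 < m by apply: lt_le_trans m1.
have ps l : 0 < m + l.+1%:R by rewrite addr_gt0 // ltr0n.
have pos l : 0 < l.+1%:R * (m + l.+1%:R) by rewrite mulr_gt0 // ltr0n.
have pp : 0 < pi ^+ 2 :> R by apply: lt_le_trans p4.
apply: (@le_trans _ _ (4^-1 * \sum_(l < n) (l.+1%:R)^-1 * (m + l.+1%:R)^-1)).
  rewrite mulr_sumr; apply: ler_sum => l _; rewrite -invfM -invfM.
  have q1 : 0 < 4 * (l.+1%:R * (m + l.+1%:R)) by rewrite mulr_gt0.
  have q2 : 4 * (l.+1%:R * (m + l.+1%:R)) <= D (M + l)%N - c.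
    by apply: le_trans (Dc l); rewrite ler_wpM2r // ltW.
  by rewrite lef_pV2 // posrE // (lt_le_trans q1).
rewrite ler_pdivrMl // -(@ler_pXn2r _ 2) ?nnegrE ?mulr_ge0 ?invr_ge0 ?(ltW sm0) //; last first.
  by apply: sumr_ge0 => l _; rewrite mulr_ge0 ?invr_ge0 // addr_ge0 // (le_trans _ m1).
apply: le_trans (@cs_fin R n (fun l => (l.+1%:R)^-1 * (m + l.+1%:R)^-1) (fun l => (l.+1%:R)^-1 ^+ 2)
  (fun l => (m + l.+1%:R)^-1 ^+ 2) _ _ _) _.
- by move=> l; rewrite sqr_ge0.
- by move=> l; rewrite sqr_ge0.
- by move=> l; rewrite exprMn.
have h1 := inv_sq_sum R n.
have h2 : \sum_(l < n) (m + l.+1%:R)^-1 ^+ 2 <= 4 / m.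
  have := @inv_sq_tail R M n M0 => /(ler_wpM2l (ler0n R 4)); apply: le_trans.
  rewrite mulr_sumr; apply: ler_sum => l _; rewrite exprMn invfM mulrA -natrX divff ?mul1r ?pnatr_eq0 //.
  rewrite exprVn lef_pV2 ?posrE ?exprn_gt0 ?addr_gt0 ?ltr0n ?addn_gt0 ?M0 // ?(lt_le_trans _ m1) //.
  by rewrite -natrD ler_pXn2r ?nnegrE // ler_nat leq_add2l leqnSn.
apply: le_trans (ler_pM _ _ h1 h2) _; do ?[by apply: sumr_ge0 => l _; rewrite sqr_ge0].
by rewrite exprMn exprVn sm2 mulrA -natrM -natrX.
Qed.

(** Ky Fan from both sides. Above, the first [M] basis vectors serve as trial vectors without error;
    below, [hT] gives [T = 1 / sqrt M]. *)
Lemma dd_trace : \sum_(k < M) (D k + b k k) - 4 * K ^+ 2 / Num.sqrt M%:R <= \sum_(k < M) E k /\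
  \sum_(k < M) E k <= \sum_(k < M) (D k + b k k).
Proof.
split.
  apply: (kyfan_lower H S (N := M) (c := c) (g := pi ^+ 2 * (m + 1)) (T := (Num.sqrt m)^-1)).
  - move=> k kM; rewrite /c lerD2r /D /dd_t exprMn ler_wpM2l ?sqr_ge0 //.
    by rewrite ler_pXn2r ?nnegrE // ler_nat.
  - by rewrite mulr_gt0 ?addr_gt0 // ?(lt_le_trans _ m1) // (lt_le_trans _ p4).
  - move=> l; apply: le_trans (Dc l); rewrite ler_wpM2l ?sqr_ge0 //.
    have : 1 <= l.+1%:R :> R by rewrite ler1n.
    by have := m1; nra.
  - exact: hT.
  - rewrite ler_pdivrMr //; apply: le_trans KM _; rewrite -/m.
    have s1 : 1 <= Num.sqrt m by rewrite -[leLHS]sqrtr1 ler_sqrt // (le_trans _ m1).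
    have h : m <= pi ^+ 2 * (m + 1) by have := p4; have := m1; nra.
    apply: le_trans h _; rewrite ler_peMr //.
    by rewrite mulr_ge0 ?sqr_ge0 // addr_ge0 // (le_trans _ m1).
apply: le_trans (kyfan_upper H S (f := fun i : 'I_M => delta R i) _ _) _.
- by move=> i; exact: h1_delta.
- by move=> i j; rewrite dot_delta.
apply: ler_sum => i _; rewrite QQ_delta; last exact: h1_delta.
by rewrite /bx dotC dot_delta /delta eqxx mulr1.
Qed.

End DirichletTrace.

Section LowModes.
Variable R : realType.
Variables (N : nat) (al : nat -> R).
Hypothesis hal : cosseq al.
Hypothesis alN0 : forall m, (N < m)%N -> al m = 0.
Variable M : nat.
Hypothesis M0 : (0 < M)%N.
Hypothesis alM : 128 * nrm al ^+ 2 <= M%:R.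
Let w := 32 * nrm al ^+ 2 / Num.sqrt M%:R + \sum_(k < M) `|sig al k.+1|.
Let P (x : R) := \sum_(k < M) al k.+1 * csp (2 * k.+1%:R) x.

(** The Dirichlet matrix of the translate by [y] has trace [- P y] up to a constant. For two
    translates the [k]-th Dirichlet eigenvalues lie in the same interval, whose length is at most
    [|sig|] by [even_gap_le]. The 32 is [4 * 8], because [K^2 = 8 |al|^2]. *)
Let Pw x x' : P x' <= P x + w.
Proof.
have al0 := hal.2.
have sqt y : sq (tq N al y) by exact: tq_sq.
have K2 y : matK (tq N al y) ^+ 2 = 8 * nrm al ^+ 2.
  have d0 := dot_ge0 hal.1; rewrite /matK (tq_norm al0 alN0) exprMn sqr_sqrtr ?mulr_ge0 //.
  by rewrite (nrm_sqr hal.1); ring.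
pose b y := mat (trig (dd_t R) (zz R) (dd_s R)) (tq N al y).
have bkk y k : b y k k = - (al k.+1 * csp (2 * k.+1%:R) y).
  rewrite /b mat_trig // subrr /dd_t /zz /dd_s.
  have [a0 _] := tq_coef al0 alN0 y 0; have [a1 _] := tq_coef al0 alN0 y k.+1.
  rewrite mulr0 al0 mul0r in a0.
  have e2 : k.+1%:R + k.+1%:R = 2 * k.+1%:R :> R by ring.
  rewrite e2 a0 a1.
  have r2 : Num.sqrt 2 * Num.sqrt 2 = 2 :> R by rewrite -expr2 sqr_sqrtr.
  by rewrite r2; field.
have ad y := mat_adm (dd_system R) (sqt y).
have [E1 [e1 S1]] := spec_exists (ad x); have [E2 [e2 S2]] := spec_exists (ad x').
have hS a := spec_exists (mat_adm (tw_system R a) (sqt 0)).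
pose E a := sval (cid (hS a)); pose e a := sval (cid (svalP (cid (hS a)))).
have S a : spec (twD R a) (twb (tq N al 0) a) (E a) (e a) := svalP (cid (svalP (cid (hS a)))).
have q0 m : cosc (tq N al 0) (2 * m%:R) = al m.
  by rewrite (tq_coef al0 alN0 0 m).1 csp_x0 mulr1.
have q1 m : sinc (tq N al 0) (2 * m%:R) = 0.
  by rewrite (tq_coef al0 alN0 0 m).2 snp_x0 mulr0 oppr0.
have gap k : E1 k - E2 k <= `|sig al k.+1|.
  apply: le_trans (even_gap_le hal (sqt 0) q0 q1 S (ltn0Sn k)).
  have /andP[_ h1] := dd_interlace al0 alN0 k (S (odd k.+1)) S1.
  have /andP[h2 _] := dd_interlace al0 alN0 k (S (odd k.+1)) S2.
  exact: lerB.
have KM y : 16 * matK (tq N al y) ^+ 2 <= M%:R by rewrite K2 mulrA -natrM.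
have [lo _] := dd_trace (ad x) S1 M0 (KM x); have [_ up] := dd_trace (ad x') S2 M0 (KM x').
have sumE y : \sum_(k < M) ((pi * dd_t R k) ^+ 2 + b y k k) = \sum_(k < M) (pi * dd_t R k) ^+ 2 - P y.
  by rewrite big_split /= /P -sumrN; congr (_ + _); apply: eq_bigr => k _; rewrite bkk.
have tot : \sum_(k < M) E1 k - \sum_(k < M) E2 k <= \sum_(k < M) `|sig al k.+1|.
  by rewrite -sumrB; apply: ler_sum => k _; exact: gap.
move: lo up; rewrite !sumE K2 (_ : 4 * (8 * nrm al ^+ 2) = 32 * nrm al ^+ 2); last by rewrite mulrA -natrM.
rewrite /w; lra.
Qed.

(** [P] has mean zero, so the bound [w] on its oscillation bounds [|P|] itself, and Parseval passes
    to the coefficients. *)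
Lemma low_modes : \sum_(k < M) al k.+1 ^+ 2 <= 2 * w ^+ 2.
Proof.
pose bl m := if (m <= M)%N then al m / 2 else 0.
have b0 : bl 0%N = 0 by rewrite /bl hal.2 mul0r.
have bN m : (M < m)%N -> bl m = 0 by rewrite /bl ltnNge => /negbTE ->.
have PE y : P y = tq M bl 0 y.
  rewrite /tq big_ord_recl b0 mulr0 mul0r add0r; apply: eq_bigr => k _.
  by rewrite lift0 /bl ltn_ord addr0; field.
have cP : continuous P by rewrite (_ : P = tq M bl 0); [exact: tq_cont|apply/funext].
have iP : ig P by apply: ig_cts; exact: cts_cts01.
have P0 : itg P = 0.
  have [h _] := tq_coef b0 bN 0 0; rewrite b0 mul0r in h; rewrite -[RHS]h.
  by apply: eq_itg => y _; rewrite mulr0 csp0 mulr1 PE.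
have up x : P x <= w.
  have := itg_le (ig_cts (@cts01C R (P x))) (igD iP (ig_cts (@cts01C R w))) (fun y _ => Pw y x).
  by rewrite itg_cst itgD ?itg_cst ?P0 ?add0r //; apply: ig_cts; exact: cts01C.
have lo x : - P x <= w.
  have := itg_le iP (ig_cts (@cts01C R (P x + w))) (fun y _ => Pw x y).
  by rewrite itg_cst P0; lra.
have PP : itg (fun y => P y * P y) <= w ^+ 2.
  rewrite -[leRHS]itg_cst; apply: itg_le.
  - by apply: ig_cts; apply: cts01M; exact: cts_cts01.
  - by apply: ig_cts; exact: cts01C.
  - by move=> y _; have := up y; have := lo y; nra.
have : itg (fun y => P y * P y) = 2 * dot bl bl.
  by rewrite -(tq_norm b0 bN 0); apply: eq_itg => y _; rewrite PE.
rewrite /dot (@sm_fin _ _ M.+1); last by move=> k kM; rewrite (bN _ kM) mul0r.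
rewrite big_ord_recl b0 mul0r add0r => e.
have -> : \sum_(k < M) al k.+1 ^+ 2 = 2 * itg (fun y => P y * P y).
  rewrite e mulrA mulr_sumr; apply: eq_bigr => k _; rewrite lift0 /bl ltn_ord; by field.
by rewrite ler_wpM2l.
Qed.

End LowModes.

(** * The a priori bound for prescribed gaps *)

Section APriori.
Variable R : realType.
Variable a : nat -> R.
Hypothesis a0 : forall k, 0 <= a k.
Hypothesis ha : l2 a.

Let c0 : 0 < 256 :> R. Proof. by rewrite ltr0n. Qed.
Let aa k : 0 <= a k * a k. Proof. by rewrite -expr2 sqr_ge0. Qed.

(** Partial sums of an l^2 sequence are o(sqrt m): a fixed head plus a tail handled by
    Cauchy-Schwarz. [ep] is such that [sqrt m * ep = n / 16] for [m = (256 * n) ^ 2]. *)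
Lemma psum_small : exists n : nat, [/\ (0 < n)%N, 4 * dot a a <= n%:R ^+ 2 &
  \sum_(k < (256 * n) ^ 2) a k <= n%:R / 8].
Proof.
pose ep : R := (256 * 16)^-1.
have e0 : 0 < ep ^+ 2 by rewrite exprn_gt0 // invr_gt0 (mulr_gt0 c0).
have [L hL] := tail_small ha e0; have {}hL := hL L (leqnn L).
pose C := \sum_(k < L) a k.
have C0 : 0 <= C by apply: sumr_ge0.
pose n := (Num.bound (16 * C) + Num.bound (2 * nrm a) + L).+1.
have n0 : (0 < n)%N by [].
have bd (x : R) : 0 <= x -> x <= (Num.bound x)%:R by move=> x0; rewrite ltW // archi_boundP.
have n1 : 16 * C <= n%:R.
  apply: le_trans (bd _ (mulr_ge0 _ C0)) _ => //; by rewrite ler_nat /n ltnW // ltnS -addnA leq_addr.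
have n2 : 2 * nrm a <= n%:R.
  by apply: le_trans (bd _ (mulr_ge0 _ (nrm_ge0 a))) _ => //; rewrite ler_nat /n ltnW // ltnS addnAC leq_addl.
exists n; split => //.
  have h : (2 * nrm a) ^+ 2 <= n%:R ^+ 2 by rewrite ler_pXn2r ?nnegrE ?mulr_ge0 ?nrm_ge0.
  by rewrite -(nrm_sqr ha) (_ : 4 * nrm a ^+ 2 = (2 * nrm a) ^+ 2); [exact: h|ring].
set m := ((256 * n) ^ 2)%N.
have Lm : (L <= m)%N.
  have : (L <= n)%N by rewrite /n ltnW // ltnS leq_addl.
  have n256 : (n <= 256 * n)%N by rewrite leq_pmull.
  have nm : (n <= m)%N by apply: leq_trans n256 _; rewrite /m -mulnn leq_pmulr // muln_gt0 n0.
  by move=> h; apply: leq_trans nm.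
pose T := \sum_(k < m - L) a (L + k)%N.
have sp r : \sum_(k < L + r) a k = C + \sum_(k < r) a (L + k)%N by rewrite big_split_ord.
have := sp (m - L)%N; rewrite (subnKC Lm) -/T => ->.
have T0 : 0 <= T by apply: sumr_ge0.
have TT : T ^+ 2 <= (m - L)%:R * ep ^+ 2.
  apply: le_trans (@cs_fin R (m - L) (fun k => a (L + k)%N) (fun=> 1)
    (fun k => a (L + k)%N * a (L + k)%N) _ _ _) _ => //.
    by move=> k; rewrite mul1r expr2.
  rewrite sumr_const card_ord -[1 *+ _]/((m - L)%:R) ler_wpM2l //; apply: le_trans hL.
  apply: le_trans (psum_le_sm _ (asm_tail L (asm_abs ha)) (fun k => normr_ge0 _)).
  by apply: ler_sum => k _; rewrite ler_norm.
have Tn : T <= n%:R / 16.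
  rewrite -(@ler_pXn2r _ 2) ?nnegrE ?divr_ge0 //; apply: le_trans TT _.
  apply: (@le_trans _ _ (m%:R * ep ^+ 2)); first by rewrite ler_wpM2r ?sqr_ge0 // ler_nat leq_subr.
  rewrite /m natrX natrM /ep.
  by rewrite le_eqVlt; apply/orP; left; apply/eqP; field.
rewrite (_ : n%:R / 8 = n%:R / 16 + n%:R / 16); last by field.
by apply: lerD Tn; rewrite ler_pdivlMr // mulrC.
Qed.

(** With [b = nrm al], the modes up to [M] carry at most [b^2 / 8]. The higher ones carry at most
    [b^2 / 8] from the prescribed values and [b^2 / 8] from the error of [sig_pert]. The total is
    below [b^2] unless [b = 0]. *)
Lemma apriori : exists n M : nat, [/\ (0 < n)%N, (0 < M)%N, 4 * dot a a <= n%:R ^+ 2 &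
  forall N (al : nat -> R), (M <= N)%N -> cosseq al -> (forall m, (N < m)%N -> al m = 0) ->
    nrm al <= n%:R -> (forall k, (k < N)%N -> sig al k.+1 = nrm al / n%:R * a k) -> nrm al = 0].
Proof.
have [n [n0 an An]] := psum_small; set M := ((256 * n) ^ 2)%N in An.
have M0 : (0 < M)%N by rewrite /M expn_gt0 muln_gt0 n0.
have Mn : M%:R = (256 * n%:R) ^+ 2 :> R by rewrite /M natrX natrM.
clearbody M.
exists n, M; split => // N al MN hal alN aln hs.
have b0 := nrm_ge0 al; set b := nrm al in b0 aln hs *.
have n1 : 0 < n%:R :> R by rewrite ltr0n.
have cn := mulr_gt0 c0 n1.
have b2n : b ^+ 2 <= n%:R ^+ 2 by rewrite ler_pXn2r ?nnegrE // ltW.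
have sM : Num.sqrt M%:R = 256 * n%:R :> R.
  by rewrite Mn sqrtr_sqr (ger0_norm (ltW cn)).
have lowM : 128 * nrm al ^+ 2 <= M%:R.
  rewrite -/b Mn; have -> : (256 * n%:R) ^+ 2 = 256 * (256 * n%:R ^+ 2) :> R by ring.
  by have := sqr_ge0 (n%:R : R); lra.
have low := low_modes hal alN M0 lowM; rewrite -/b sM in low.
have sumsig : \sum_(k < M) `|sig al k.+1| <= b / 8.
  apply: (@le_trans _ _ (b / n%:R * \sum_(k < M) a k)).
    rewrite mulr_sumr; apply: ler_sum => k _; rewrite hs ?(leq_trans _ MN) // ger0_norm //.
    by rewrite mulr_ge0 // divr_ge0 // ltW.
  apply: le_trans (ler_wpM2l _ An) _; first by rewrite divr_ge0 // ltW.
  by rewrite le_eqVlt; apply/orP; left; apply/eqP; field; rewrite gt_eqF.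
have w0 : 0 <= \sum_(k < M) `|sig al k.+1| by apply: sumr_ge0.
have bn : 32 * b ^+ 2 / (256 * n%:R) <= b / 8.
  rewrite (ler_pdivrMr _ _ cn) (_ : b / 8 * (256 * n%:R) = 32 * (b * n%:R)); last by field.
  by rewrite ler_wpM2l // expr2 ler_wpM2l.
have bn0 : 0 <= 32 * b ^+ 2 / (256 * n%:R) by rewrite divr_ge0 ?(ltW cn) // mulr_ge0 // sqr_ge0.
have low' : \sum_(k < M) al k.+1 ^+ 2 <= b ^+ 2 / 8.
  by apply: le_trans low _; move: (_ / (256 * _)) (\sum_(k < M) `|_|) bn bn0 sumsig w0 => u v; nra.
have high : \sum_(k < N - M) al (M + k).+1 ^+ 2 <= b ^+ 2 / 4.
  have t1 (k : nat) : (k < N - M)%N -> al (M + k).+1 ^+ 2 <= 2^-1 * (b / n%:R) ^+ 2 * (a (M + k)%N * a (M + k)%N) +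
      2 * (64 * b ^+ 2) ^+ 2 * ((2 * (M + k)%:R) ^+ 2)^-1.
    move=> kN; have pn : 32 * nrm al ^+ 2 <= (M + k).+1%:R.
      apply: le_trans (_ : M%:R <= _); last by rewrite ler_nat ltnW // ltnS leq_addr.
      by apply: le_trans lowM; rewrite ler_wpM2r ?sqr_ge0 // ler_nat.
    have := sig_pert hal (ltn0Sn (M + k)) pn; rewrite hs; last by rewrite -ltn_subRL.
    rewrite -/b => h.
    have Mk : 0 < (M + k)%:R :> R by rewrite ltr0n addn_gt0 M0.
    have h' : `|b / n%:R * a (M + k)%N - 2 * al (M + k).+1| <= 64 * b ^+ 2 / (M + k)%:R.
      apply: le_trans h _; rewrite ler_wpM2l //; first by rewrite mulr_ge0 // sqr_ge0.
      by rewrite lef_pV2 ?posrE // ler_nat leqnSn.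
    have e (u v : R) : 0 < u -> 2 * v ^+ 2 * ((2 * u) ^+ 2)^-1 = 2^-1 * (v / u) ^+ 2.
      by move=> u0; field; rewrite gt_eqF.
    rewrite (e _ _ Mk).
    have -> : 2^-1 * (b / n%:R) ^+ 2 * (a (M + k)%N * a (M + k)%N) = 2^-1 * (b / n%:R * a (M + k)%N) ^+ 2 by ring.
    move: (b / _ * _) (64 * _ / _) h' => u v; rewrite ler_norml => /andP[? ?].
    have v2 : (u - 2 * al (M + k).+1) ^+ 2 <= v ^+ 2 by nra.
    by have := sqr_ge0 (u - al (M + k).+1); have := sqr_ge0 (2 * al (M + k).+1 - 2 * u); nra.
  apply: le_trans (ler_sum _ (fun (k : 'I_(N - M)) _ => t1 k (ltn_ord k))) _.
  rewrite big_split /= -!mulr_sumr (_ : b ^+ 2 / 4 = b ^+ 2 / 8 + b ^+ 2 / 8); last by field.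
  apply: lerD.
    apply: (@le_trans _ _ (2^-1 * (b / n%:R) ^+ 2 * (n%:R ^+ 2 / 4))).
      rewrite ler_wpM2l ?mulr_ge0 ?sqr_ge0 //; apply: (@le_trans _ _ (dot a a)); last by lra.
      have := psum_le_sm (M + (N - M)) ha aa; apply: le_trans.
      by rewrite big_split_ord /= lerDr sumr_ge0.
    by rewrite le_eqVlt; apply/orP; left; apply/eqP; field; rewrite gt_eqF.
  apply: le_trans (ler_wpM2l _ (@inv_sq_tail R M (N - M) M0)) _; first by rewrite mulr_ge0 // sqr_ge0.
  rewrite Mn ler_pdivrMr ?exprn_gt0 //.
  have -> : 2 * (64 * b ^+ 2) ^+ 2 = 32 * 256 * (b ^+ 2 * b ^+ 2) by ring.
  have -> : b ^+ 2 / 8 * (256 * n%:R) ^+ 2 = 32 * 256 * (b ^+ 2 * n%:R ^+ 2) by field.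
  by rewrite ler_wpM2l ?(mulr_ge0 _ (ltW c0)) // ler_wpM2l // sqr_ge0.
have tot : b ^+ 2 = \sum_(k < M) al k.+1 ^+ 2 + \sum_(k < N - M) al (M + k).+1 ^+ 2.
  rewrite /b (nrm_sqr hal.1) /dot (@sm_fin _ _ N.+1); last by move=> k kN; rewrite (alN k kN) mul0r.
  rewrite big_ord_recl hal.2 mul0r add0r -[in LHS](subnKC MN) big_split_ord /=.
  by congr (_ + _); apply: eq_bigr => k _; rewrite lift0 -expr2.
have : b ^+ 2 = 0 by have := sqr_ge0 b; lra.
by move/eqP; rewrite sqrf_eq0 => /eqP.
Qed.

End APriori.

(** * Prescribing the gap lengths *)

Section Finite.
Variable R : realType.
Variables (a : nat -> R) (N : nat) (B : R).
Hypothesis ha : l2 a.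
Hypothesis N0 : (0 < N)%N.
Hypothesis B1 : 1 <= B.
Hypothesis aB : 4 * dot a a <= B ^+ 2.
Hypothesis apr : forall al : nat -> R, cosseq al -> (forall m, (N < m)%N -> al m = 0) ->
  nrm al <= B -> (forall k, (k < N)%N -> sig al k.+1 = nrm al / B * a k) -> nrm al = 0.

Definition ext (x : 'I_N -> R) (m : nat) : R :=
  if m is k.+1 then (if insub k is Some i then x i else 0) else 0.

Lemma extS x (i : 'I_N) : ext x i.+1 = x i. Proof. by rewrite /ext valK. Qed.

Lemma ext_out x m : (N < m)%N -> ext x m = 0.
Proof. by case: m => // m; rewrite ltnS => Nm; rewrite /ext insubN // -leqNgt. Qed.

Lemma ext_cosseq x : cosseq (ext x).
Proof. by split; [apply: (@l2_fin R (ext x) N.+1) => k; exact: ext_out|]. Qed.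

Lemma extZ t x : ext (fun i => t * x i) = fun m => t * ext x m.
Proof.
by apply/funext => -[|k]; rewrite /ext ?mulr0 //; case: insubP => [? _ _|_]; rewrite ?mulr0.
Qed.

Let rad x := nrm (ext x).

Let rad_sq x : rad x ^+ 2 = \sum_i x i ^+ 2.
Proof.
rewrite /rad (nrm_sqr (ext_cosseq x).1) /dot (@sm_fin _ _ N.+1); last by move=> k /ext_out ->; rewrite mul0r.
by rewrite big_ord_recl mul0r add0r; apply: eq_bigr => i _; rewrite lift0 extS expr2.
Qed.

Let rad_sq' x : nrm (ext x) ^+ 2 = \sum_i x i ^+ 2.
Proof. exact: rad_sq. Qed.

Let rad0 x : 0 <= rad x. Proof. exact: nrm_ge0. Qed.

(* The maximum, in a form whose continuity is immediate. *)
Let mx (u v : R) := (u + v + `|u - v|) / 2.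
Let mxl u v : v <= u -> mx u v = u.
Proof. by move=> h; rewrite /mx ger0_norm ?subr_ge0 //; field. Qed.
Let mxr u v : u <= v -> mx u v = v.
Proof. by move=> h; rewrite /mx ler0_norm ?subr_le0 //; field. Qed.
Let mx_cvg (U : set_system nat) (f g : nat -> R) u v : Filter U ->
  f @ U --> u -> g @ U --> v -> (fun k => mx (f k) (g k)) @ U --> mx u v.
Proof.
move=> FU hf hg; apply: cvgM; last exact: cvg_cst.
by apply: cvgD; [exact: cvgD|apply: cvg_norm; exact: cvgB].
Qed.

(** [d] is chosen so that [64 * d ^+ 2 = d / nu]: for a potential of norm [d], the error of
    [sig_pert] does not exceed the least size of the coordinate that is extremal on a face of the
    cube. *)
Let nu : R := N.+1%:R.
Let d : R := (64 * nu)^-1.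
Let nu2 : 2 <= nu. Proof. by rewrite /nu ler_nat. Qed.
Let d0 : 0 < d. Proof. by rewrite invr_gt0 mulr_gt0 // (lt_le_trans _ nu2). Qed.
Let dnu : 64 * d * nu = 1.
Proof. by rewrite mulrAC mulfV // gt_eqF // mulr_gt0 // (lt_le_trans _ nu2). Qed.
Let d1 : 128 * d <= 1. Proof. by have := dnu; have := nu2; have := d0; nra. Qed.

(* Inside the ball of radius [B] the map is [sig - a]; on the shell between the radii [B] and
   [2 B - d] both the potential and the target shrink proportionally; beyond, the potential has norm
   [d], where [sig] is nearly linear, and the target shrinks to zero. *)
Let sc r := 1 - mx 0 (1 - mx (2 * B - r) d / mx r B).
Let tt r := 1 - mx 0 (1 - mx (2 * B - r) 0 / B).
Let F (x : 'I_N -> R) (i : 'I_N) : R :=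
  sig (ext (fun i => sc (rad x) * x i)) i.+1 - tt (rad x) * a i.

Let sc_in r : r <= B -> sc r = 1 /\ tt r = 1.
Proof.
move=> rB; have b0 : 0 < B by apply: lt_le_trans B1.
have h1 : B <= 2 * B - r by lra.
have h2 : d <= 2 * B - r by have := d1; have := d0; have := B1; lra.
have h3 : 0 <= 2 * B - r by lra.
rewrite /sc /tt (mxr rB) (mxl h2) (mxl h3) mxl ?subr0 //.
by rewrite subr_le0 ler_pdivlMr // mul1r.
Qed.

Let sc_out r : B <= r -> sc r * r = mx (2 * B - r) d /\ tt r = mx (2 * B - r) 0 / B.
Proof.
move=> rB; have b0 : 0 < B by apply: lt_le_trans B1.
have r0 : 0 < r by apply: lt_le_trans rB.
have h1 : mx (2 * B - r) d <= r.
  have [h|h] := leP d (2 * B - r); first by rewrite mxl //; lra.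
  by rewrite mxr ?(ltW h) //; have := d1; have := d0; have := B1; lra.
have h2 : mx (2 * B - r) 0 <= B.
  have [h|h] := leP 0 (2 * B - r); first by rewrite mxl //; lra.
  by rewrite mxr ?(ltW h) // ltW.
have h3 : 0 <= 1 - mx (2 * B - r) d / r by rewrite subr_ge0 ler_pdivrMr // mul1r.
have h4 : 0 <= 1 - mx (2 * B - r) 0 / B by rewrite subr_ge0 ler_pdivrMr // mul1r.
rewrite /sc /tt (mxl rB) (mxr h3) (mxr h4).
by split; [rewrite opprB addrC subrK divfK // gt_eqF|rewrite opprB addrC subrK].
Qed.

Let sc_ge0 r : 0 <= r -> 0 <= sc r.
Proof.
move=> r0; have [h|h] := leP r B; first by rewrite (sc_in h).1.
have rp : 0 < r by apply: le_lt_trans h; apply: le_trans B1.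
have [e _] := sc_out (ltW h); rewrite -(pmulr_lge0 _ rp) e.
have [k|k] := leP d (2 * B - r); first by rewrite mxl // (le_trans (ltW d0)).
by rewrite mxr ?(ltW k) // ltW.
Qed.

Let sc_le r : 0 <= r -> sc r * r <= B.
Proof.
move=> r0; have [h|h] := leP r B; first by rewrite (sc_in h).1 mul1r.
have [e _] := sc_out (ltW h); rewrite e.
have [k|k] := leP d (2 * B - r); first by rewrite mxl //; lra.
by rewrite mxr ?(ltW k) //; have := d1; have := d0; have := B1; lra.
Qed.

Let al x := ext (fun i => sc (rad x) * x i).
Let nrm_al x : nrm (al x) = sc (rad x) * rad x.
Proof. by rewrite /al extZ (nrmZ _ (ext_cosseq x).1) ger0_norm // sc_ge0. Qed.

Let c : R := 2 * B.
Let c0 : 0 < c. Proof. by rewrite /c mulr_gt0 // (lt_le_trans _ B1). Qed.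

Let rad_cvg (U : set_system nat) (X : nat -> 'I_N -> R) x : Filter U ->
  (forall i, (fun k => X k i) @ U --> x i) -> (fun k => rad (X k)) @ U --> rad x.
Proof.
move=> FU cX; have e y : rad y = Num.sqrt (\sum_i y i ^+ 2) by rewrite -rad_sq sqrtr_sqr ger0_norm.
rewrite (_ : (fun k => rad (X k)) = fun k => Num.sqrt (\sum_i X k i ^+ 2)); last by apply/funext => k; rewrite e.
have ce y : \sum_i y i ^+ 2 = \sum_(k < N.+1) ext y k ^+ 2.
  by rewrite big_ord_recl expr0n add0r; apply: eq_bigr => i _; rewrite lift0 extS.
have cs : (fun k => \sum_i X k i ^+ 2) @ U --> \sum_i x i ^+ 2; last first.
  by rewrite e; exact: (cvg_comp _ _ cs (@sqrt_continuous R _)).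
rewrite (_ : (fun k => _) = fun k => \sum_(m < N.+1) ext (X k) m ^+ 2); last by apply/funext => k; rewrite ce.
rewrite ce; apply: (@cvg_sum_ord R U FU N.+1 (fun k m => ext (X k) m ^+ 2) (fun m => ext x m ^+ 2)) => m.
have : (fun k => ext (X k) m) @ U --> ext x m.
  case: m => [|m] /=; first exact: cvg_cst.
  by case: insubP => [i _ _|_]; [exact: cX|exact: cvg_cst].
by move=> h; rewrite expr2; under eq_fun do rewrite expr2; exact: cvgM.
Qed.

Let F_cvg (U : set_system nat) (X : nat -> 'I_N -> R) x : UltraFilter U ->
  (forall i, (fun k => X k i) @ U --> x i) -> forall i, (fun k => F (X k) i) @ U --> F x i.
Proof.
move=> UU cX i; have cr := rad_cvg _ cX.
have b0 : 0 < B by apply: lt_le_trans B1.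
have c1 (u : R) : (fun=> u) @ U --> u by exact: cvg_cst.
have mp r : 0 < mx r B.
  by have [h|h] := leP r B; [rewrite mxr|rewrite mxl ?(ltW h) // (lt_trans b0)].
have cs : (fun k => sc (rad (X k))) @ U --> sc (rad x).
  apply: cvgB; first exact: c1.
  apply: mx_cvg; first exact: c1.
  apply: cvgB; first exact: c1.
  apply: cvgM; first by apply: mx_cvg; [apply: cvgB|]; [exact: c1|exact: cr|exact: c1].
  apply: cvgV; first by rewrite gt_eqF.
  by apply: mx_cvg; [exact: cr|exact: c1].
have ct : (fun k => tt (rad (X k))) @ U --> tt (rad x).
  apply: cvgB; first exact: c1.
  apply: mx_cvg; first exact: c1.
  apply: cvgB; first exact: c1.
  apply: cvgM; last exact: c1.
  by apply: mx_cvg; [apply: cvgB|]; [exact: c1|exact: cr|exact: c1].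
rewrite /F; apply: cvgB; last by apply: cvgM.
apply: (@sig_cvg R U (fun k => al (X k)) (al x) B) => //.
- by move=> k; exact: ext_cosseq.
- exact: ext_cosseq.
- by move=> k; rewrite nrm_al sc_le.
- by rewrite nrm_al sc_le.
move=> [|m]; first exact: c1.
rewrite /al /ext; case: insubP => [l _ _|_]; last exact: c1.
by apply: cvgM; [exact: cs|exact: cX].
Qed.

Let coord_le x i : `|x i| <= rad x.
Proof. by have := nrm_coord i.+1 (ext_cosseq x).1; rewrite extS. Qed.

Let rad_le x (t : R) : 0 <= t -> (forall i, `|x i| <= t) -> rad x <= nu * t.
Proof.
move=> t0 h; rewrite -(@ler_pXn2r _ 2) ?nnegrE // ?mulr_ge0 ?(le_trans _ nu2) // rad_sq.
apply: (@le_trans _ _ (\sum_(i < N) t ^+ 2)).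
  by apply: ler_sum => i _; rewrite -(sqr_normr (x i)) ler_pXn2r ?nnegrE.
rewrite sumr_const card_ord -mulr_natl exprMn ler_wpM2r ?sqr_ge0 //.
apply: (@le_trans _ _ nu); first by rewrite /nu ler_nat.
by have := nu2; nra.
Qed.

Let far x : 2 * B <= rad x -> [/\ nrm (al x) = d, tt (rad x) = 0 &
  forall n, (0 < n)%N -> `|sig (al x) n - 2 * al x n| <= 64 * d ^+ 2].
Proof.
move=> h; have b0 : 0 < B by apply: lt_le_trans B1.
have Br : B <= rad x by lra.
have [e1 e2] := sc_out Br.
have n1 : nrm (al x) = d by rewrite nrm_al e1 mxr //; have := d0; lra.
split => //; first by rewrite e2 mxr ?mul0r //; lra.
move=> n n0; have nr : 1 <= n%:R :> R by rewrite ler1n.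
have d32 : 32 * nrm (al x) ^+ 2 <= n%:R by rewrite n1; have := d1; have := d0; nra.
apply: le_trans (sig_pert (ext_cosseq _) n0 d32) _; rewrite n1.
by rewrite ler_pdivrMr ?ltr0n // ler_peMr // mulr_ge0 // sqr_ge0.
Qed.

(** A zero of [F] in the ball is a solution. On the shell, as long as the norm of the potential is
    [2 * B - rad x >= d], the target is that norm over [B] times [a], which [apr] excludes; beyond,
    the near linearity of [sig] excludes zeros. *)
Lemma finite_solution : exists al : nat -> R, [/\ cosseq al, nrm al <= B &
  forall k, (k < N)%N -> sig al k.+1 = a k].
Proof.
have b0 : 0 < B by apply: lt_le_trans B1.
(* On a face the coordinate [sc (rad x) * c] is at least [d / nu = 64 * d ^+ 2], so twice it exceeds
   the error of [sig_pert] and [F] has the sign of [x i]. *)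
have bd x i : cube c x -> `|x i| = c -> [/\ 2 * B <= rad x, 0 < sc (rad x) & d <= nu * (sc (rad x) * c)].
  move=> cx xi; have h : 2 * B <= rad x by have := coord_le x i; rewrite xi.
  have rp : 0 < rad x by apply: lt_le_trans h; rewrite mulr_gt0.
  have [n1 _ _] := far h; rewrite nrm_al in n1.
  have sp : 0 < sc (rad x) by rewrite -(pmulr_lgt0 _ rp) n1.
  split => //; have := rad_le (ltW c0) cx => /(ler_wpM2l (ltW sp)); by rewrite n1 mulrCA.
have nu0 : 0 < nu by apply: lt_le_trans nu2.
have ed : nu * (64 * d ^+ 2) = d.
  by transitivity (64 * d * nu * d); [ring|rewrite dnu mul1r].
have [|U X x UU _ _ cX|x i cx xi|x i cx xi|x cx Fx] := @miranda R N c F.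
- exact: c0.
- exact: F_cvg.
- have xc : `|x i| = c by rewrite xi normrN gtr0_norm.
  have [h _ g] := bd x i cx xc; have [_ t0 hs] := far h.
  have := hs i.+1 (ltn0Sn i); rewrite /F t0 mul0r subr0 /al extS xi mulrN -/(al x).
  move: (sig _ _) (sc _ * c) g => u v g; rewrite ler_norml => /andP[_].
  by move=> /(ler_wpM2l (ltW nu0)); rewrite ed -(pmulr_rlt0 _ nu0); have := d0; lra.
- have xc : `|x i| = c by rewrite xi gtr0_norm.
  have [h _ g] := bd x i cx xc; have [_ t0 hs] := far h.
  have := hs i.+1 (ltn0Sn i); rewrite /F t0 mul0r subr0 /al extS xi -/(al x).
  move: (sig _ _) (sc _ * c) g => u v g; rewrite ler_norml => /andP[+ _].
  move=> /(ler_wpM2l (ltW nu0)); rewrite mulrN ed -(pmulr_rge0 _ nu0); have := d0; lra.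
have Fx' (i : 'I_N) : sig (al x) i.+1 = tt (rad x) * a i by apply/eqP; rewrite -subr_eq0 -[_ - _]/(F x i) Fx.
have [rB|Br] := leP (rad x) B.
  exists (al x); split; first exact: ext_cosseq.
    by rewrite nrm_al sc_le.
  by move=> k kN; have := Fx' (Ordinal kN); rewrite (sc_in rB).2 mul1r.
have [e1 e2] := sc_out (ltW Br).
have [k|k] := leP d (2 * B - rad x).
  have n1 : nrm (al x) = 2 * B - rad x by rewrite nrm_al e1 mxl.
  have t1 : tt (rad x) = nrm (al x) / B by rewrite e2 n1 mxl //; have := d0; lra.
  have := apr (al := al x) (ext_cosseq _) (ext_out _); rewrite n1 => h.
  have : 2 * B - rad x = 0.
    apply: h; first by lra.
    by move=> i iN; have := Fx' (Ordinal iN); rewrite t1 n1.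
  by have := d0; lra.
have n1 : nrm (al x) = d by rewrite nrm_al e1 mxr // ltW.
have t1 : 0 <= tt (rad x) <= d / B.
  rewrite e2; have [h|h] := leP 0 (2 * B - rad x).
    by rewrite mxl // divr_ge0 // ?ler_pM2r ?invr_gt0 // ?(ltW b0) //= ltW.
  by rewrite mxr ?(ltW h) // mul0r lexx divr_ge0 // ltW.
(* Here the potential has norm [d]. Summing the perturbation estimate over the coordinates, with
   [t <= d / B] and [4 * dot a a <= B ^+ 2], gives [d^2 <= d^2 / 8 + d^2 / 2]. *)
exfalso; set t := tt (rad x) in t1 Fx'; have /andP[t0 td] := t1.
have key (i : 'I_N) : al x i.+1 ^+ 2 <= 2^-1 * t ^+ 2 * (a i * a i) + 2^-1 * (64 * d ^+ 2) ^+ 2 * (i.+1%:R)^-1 ^+ 2.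
  have ir : 1 <= i.+1%:R :> R by rewrite ler1n.
  have d32 : 32 * nrm (al x) ^+ 2 <= i.+1%:R by rewrite n1; have := d1; have := d0; nra.
  have := sig_pert (ext_cosseq _) (ltn0Sn i) d32; rewrite -/(al x) n1 Fx'.
  have -> : 2^-1 * t ^+ 2 * (a i * a i) = 2^-1 * (t * a i) ^+ 2 by ring.
  rewrite -[X in _ <= _ + X]mulrA -exprMn.
  move: (t * a i) (64 * _ / _) (al x _) => u v z; rewrite ler_norml => /andP[? ?].
  have v2 : (u - 2 * z) ^+ 2 <= v ^+ 2 by nra.
  by have := sqr_ge0 (u - z); have := sqr_ge0 (2 * z - 2 * u); nra.
have tot : d ^+ 2 = \sum_(i < N) al x i.+1 ^+ 2.
  rewrite -n1 /al rad_sq'; apply: eq_bigr => i _; by rewrite extS.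
have : d ^+ 2 <= 2^-1 * t ^+ 2 * dot a a + 2^-1 * (64 * d ^+ 2) ^+ 2 * 4.
  rewrite {1}tot; apply: le_trans (ler_sum _ (fun i _ => key i)) _.
  rewrite big_split /= -!mulr_sumr; apply: lerD.
    apply: ler_wpM2l; first by rewrite mulr_ge0 ?sqr_ge0.
    by apply: (psum_le_sm N ha) => l; rewrite -expr2 sqr_ge0.
  by apply: ler_wpM2l; [rewrite mulr_ge0 ?sqr_ge0|exact: inv_sq_sum].
have h1 : t ^+ 2 * dot a a <= d ^+ 2 / 4.
  have tb : t * B <= d by rewrite -ler_pdivlMr.
  have tb2 : (t * B) ^+ 2 <= d ^+ 2 by rewrite ler_pXn2r ?nnegrE ?mulr_ge0 ?(ltW b0) ?(ltW d0).
  have := ler_wpM2l (sqr_ge0 t) aB; rewrite -exprMn; lra.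
have h2 : (64 * d ^+ 2) ^+ 2 <= d ^+ 2 / 4.
  rewrite (_ : d ^+ 2 / 4 = (d / 2) ^+ 2); last by field.
  rewrite ler_pXn2r ?nnegrE ?divr_ge0 ?(ltW d0) //; last by rewrite mulr_ge0 // sqr_ge0.
  by have := d1; have := d0; nra.
have fin (u z y : R) : u <= y / 4 -> z <= y / 4 -> 0 < y -> y <= 2^-1 * u + 2^-1 * z * 4 -> False by lra.
by rewrite -[2^-1 * t ^+ 2 * _]mulrA; exact: fin h1 h2 (exprn_gt0 2 d0).
Qed.

End Finite.

Lemma gap_surjective (R : realType) (a : nat -> R) : (forall k, 0 <= a k) -> l2 a ->
  exists q : R -> R, L2T q /\ gap q = a.
Proof.
move=> a0 ha; have [n [M [n0 M0 an apr]]] := apriori a0 ha.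
have B1 : 1 <= n%:R :> R by rewrite ler1n.
have sol j : exists al : nat -> R, [/\ cosseq al, nrm al <= n%:R &
    forall k, (k < M + j)%N -> sig al k.+1 = a k].
  apply: (finite_solution ha _ B1 an); first by rewrite addn_gt0 M0.
  by move=> al; apply: apr; exact: leq_addr.
have [X hX] := choice sol; have [U [UU Uoo]] := ultra_oo.
have cX j : cosseq (X j) by case: (hX j).
have nX j : nrm (X j) <= n%:R by case: (hX j).
have lim m : exists l : R, (fun j => X j m) @ U --> l.
  apply: (ultra_limit (C := n%:R)) => j; apply: le_trans (nX j).
  exact: nrm_coord (cX j).1.
have [al hal] := choice lim.
have [al2 aln] := l2_limit UU (fun j => (cX j).1) nX hal.
have cal : cosseq al.
  split => //; apply/esym; apply: (cvg_unique (@Rhausdorff R) _ (hal 0%N)).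
  by rewrite (_ : (fun j => X j 0%N) = fun=> 0); [exact: cvg_cst|apply/funext => j; exact: (cX j).2].
have sal k : sig al k.+1 = a k.
  have c := @sig_cvg R U X al n%:R k.+1 UU cX cal nX aln hal.
  apply: (cvg_unique (@Rhausdorff R) c); apply: cvg_near_cst.
  apply: Uoo; exists k.+1 => // j /= kj; have [_ _ ->] := hX j => //.
  by apply: leq_trans kj _; exact: leq_addl.
have [q [hq qal qbe]] := full_function cal; exists q; split => //.
have [E [e [S gE]]] := gap_gam hq; apply/funext => k; rewrite gE /gam.
by rewrite (even_gap_eq cal (L2T_sq hq) qal qbe S) ?sal.
Qed.

Theorem theorem2p1 (R : realType) (s : R) (w : nat -> R) :
  0 <= s ->
  (forall k, 0 < w k) ->
  (exists c1 c2 : R, 0 < c1 /\ 0 < c2 /\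
     forall k : nat, c1 * (k.+1%:R `^ s) <= w k /\ w k <= c2 * (k.+1%:R `^ (1 + s))) ->
  (@gap R) @` (Hw w) = hw_plus w /\
  (L2T (R:=R)) `&` (@gap R) @^-1` (hw_plus w) = Hw w.
Proof. exact: theorem_from_surjectivity (@gap_surjective R). Qed.
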